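(* Assume Hypothesis (H) below. Let $t_1,\dots,t_d\ge0$, $T=\sum_kt_k$, and let $(n_k,f^{(k)})_{k\ge1}$ be a sequence with $n_k\to\infty$, $f^{(k)}\in\mathcal K$, $\rho(f^{(k)})\to1$; write $n=n_k$, $\rho=\rho(f^{(k)})$ and evaluate all quantities at $f^{(k)}$. For a vector $m_n$ and number $\Psi$ specified below let $s_n=(e^{-t_1/m_{n,1}},\dots,e^{-t_d/m_{n,d}})'$ and $L_{n,j}(s,m)=E\big(s^{Y_n}\mid Z_{n+m}>\mathbf 0,\ N<\infty,\ Z_0=e_j\big)$. Then for every $j\in\{1,\dots,d\}$, $$\Big|\lim_{m\to\infty}L_{n,j}(s_n,m)-\Psi\Big|\to0\quad(k\to\infty)$$ in each of the cases: (1) $\rho\ne1$ for all $k$, $n|1-\rho|\to-\ln r$ with $r\in(0,1)$: $m_n=\frac{\rho_\mu^n-1+n(1-\rho_\mu)}{(1-\rho_\mu)^2}v$ and, with $z=\sqrt{1+\frac{4QT}{r-1-\ln r}}$, $w=\frac{z+1}{z-1}$, $\Psi=\Big(r^{1/2}\frac{r^{z/2}+wr^{-z/2}}{1+w}\Big)^{-2}$; (2) $\rho\ne1$ for all $k$, $n|1-\rho|\to0$: $m_n=\frac{n^2}{2}v$, $\Psi=(\cosh\sqrt{2QT})^{-2}$; (3) $\rho<1$ for all $k$, $n(1-\rho)\to\infty$: $m_n=\frac{n}{1-\rho}v$, $\Psi=e^{-2QT}$.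
   Context: Fix $d\ge1$, $X=\mathbb Z_{\ge0}^d$, $C=[0,1]^d$; $s^\alpha=\prod_is_i^{\alpha_i}$; vector inequalities and products $sw$ are componentwise; $\mathbf 1,\mathbf 0,e_k$ as usual. A $d$-type Galton–Watson process $(Z_n)$ in $X$ has offspring p.g.f. $f=(f_1,\dots,f_d)'$, $f_k(s)=\sum_{i\in X}p_k(i)s^i$; $Y_n=\sum_{l=0}^nZ_l$; $N=\min\{n:Z_n=\mathbf 0\}$ ($=\infty$ if no such $n$). $M(s)=(\partial f_k(s)/\partial s_l)_{k,l}$, $M=M(\mathbf 1)$, $b^k_{lm},c^k_{lmj}$ second and third partial derivatives of $f_k$ at $\mathbf 1$. For fixed $a,b,c>0$, $U\in\mathbb N$, $\mathcal K=\mathcal K(a,b,c,U)$ is the class of such $f$ with $[M^U]_{kl}\ge a$ for all $k,l$, $\sum b^k_{lm}\ge b$, $\sum c^k_{lmj}\le c$. $\rho$ is the Perron root of $M$, $u,v$ its right and left eigenvectors normalized by $\sum_ku_k=1$, $\sum_ku_kv_k=1$; $Q=\frac12\sum_kv_k\sum_{l,m}b^k_{lm}u_lu_m$; $\mu$ is the extinction probability vector and $\rho_\mu$ the Perron root of $M(\mu)$. Hypothesis (H): for $f\in\mathcal K$, $s\in C$ let $h_0(s)=\mathbf 0$, $h_n(s)=sf(h_{n-1}(s))$, $h^*(s)=\lim_nh_n(s)$ (the unique solution in $C$ of $h=sf(h)$), $v_{h^*}$ the left Perron eigenvector of $M(h^*(s))$ normalized with the right one $u_{h^*}$ by $\sum_ku_{h^*,k}=1$,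 $\sum_ku_{h^*,k}v_{h^*,k}=1$. (H): for every sequence $(n_k,f^{(k)},s^{(k)})$ with $n_k\to\infty$, $f^{(k)}\in\mathcal K$, $\rho(f^{(k)})\to1$, $s^{(k)}\in C$, $s^{(k)}\to\mathbf 1$, $v_{h^*}'(h^*(s^{(k)})-h_{n_k}(s^{(k)}))\to0$. *)

(* Defs.v *)
From mathcomp Require Import all_boot all_algebra.
From mathcomp Require Import all_classical all_reals all_analysis.
From mathcomp Require Import complex.
Import GRing.Theory Num.Theory.
Import numFieldNormedType.Exports.
Set Implicit Arguments. Unset Strict Implicit. Unset Printing Implicit Defensive.
Local Open Scope ring_scope.
Local Open Scope classical_set_scope.

Section GW.
Variables (R : realType) (d : nat).

Definition X := {ffun 'I_d -> nat}.
Definition unitv (j : 'I_d) : X := [ffun i => (i == j : nat)].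
Definition xzero : X := [ffun _ => 0%N].
Definition sub_x (x y : X) : X := [ffun i => (x i - y i)%N].
Definition vpow (s : 'cV[R]_d) (x : X) : R := \prod_(i < d) s i 0 ^+ x i.
Definition one_v : 'cV[R]_d := const_mx 1.
Definition inC (s : 'cV[R]_d) : Prop := forall i, 0 <= s i 0 <= 1.

Definition offspring := 'I_d -> X -> R.
Definition is_offspring (p : offspring) : Prop :=
  (forall k i, 0 <= p k i) /\
  (forall k, (\esum_(i in [set: X]) (p k i)%:E)%E = 1%E).

Definition pgf (p : offspring) (s : 'cV[R]_d) : 'cV[R]_d :=
  \col_k fine (\esum_(i in [set: X]) (p k i * vpow s i)%:E).

(* M(s) = (d f_k(s) / d s_l)_{k,l}  (termwise derivative of the power series) *)
Definition Mat (p : offspring) (s : 'cV[R]_d) : 'M[R]_d :=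
  \matrix_(k, l) fine (\esum_(i in [set: X])
                         (p k i * (i l)%:R * vpow s (sub_x i (unitv l)))%:E).
Definition Mmean (p : offspring) : 'M[R]_d := Mat p one_v.

(* second and third partial derivatives of f_k at 1 (factorial moments) *)
Definition bmom (p : offspring) (k l m : 'I_d) : \bar R :=
  \esum_(i in [set: X]) (p k i * (i l * (i m - (l == m)))%N%:R)%:E.
Definition cmom (p : offspring) (k l m j : 'I_d) : \bar R :=
  \esum_(i in [set: X])
     (p k i * (i l * (i m - (l == m)) * (i j - (l == j) - (m == j)))%N%:R)%:E.

Definition inK (a b c : R) (U : nat) (p : offspring) : Prop :=
  [/\ is_offspring p,
      (forall k l, a <= (Mmean p ^+ U) k l),
      (b%:E <= \sum_(k < d) \sum_(l < d) \sum_(m < d) bmom p k l m)%E &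
      (\sum_(k < d) \sum_(l < d) \sum_(m < d) \sum_(j < d) cmom p k l m j
         <= c%:E)%E].

Definition perron_root (A : 'M[R]_d) : R :=
  sup [set ComplexField.Normc.normc lam | lam in
        [set lam : R[i] | root (char_poly (map_mx (real_complex R) A)) lam]].
Definition perron_right (A : 'M[R]_d) : 'cV[R]_d :=
  xget 0 [set u : 'cV[R]_d | A *m u = perron_root A *: u /\
                              \sum_(k < d) u k 0 = 1].
Definition perron_left (A : 'M[R]_d) : 'cV[R]_d :=
  xget 0 [set v : 'cV[R]_d | v^T *m A = perron_root A *: v^T /\
                  \sum_(k < d) perron_right A k 0 * v k 0 = 1].

Definition rho (p : offspring) : R := perron_root (Mmean p).
Definition uvec (p : offspring) : 'cV[R]_d := perron_right (Mmean p).
Definition vvec (p : offspring) : 'cV[R]_d := perron_left (Mmean p).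
Definition Qc (p : offspring) : R :=
  2^-1 * \sum_(k < d) vvec p k 0 *
     \sum_(l < d) \sum_(m < d) fine (bmom p k l m) * uvec p l 0 * uvec p m 0.

Definition conv (q r : X -> \bar R) (y : X) : \bar R :=
  (\esum_(a in [set a : X | forall i, (a i <= y i)%N]) (q a * r (sub_x y a)))%E.
Definition delta0 (y : X) : \bar R := if y == xzero then 1%E else 0%E.
Definition cpow (q : X -> \bar R) (n : nat) : X -> \bar R := iter n (conv q) delta0.
(* kernel p x y = P(Z_{l+1} = y | Z_l = x): law of the sum of x_k i.i.d.
   offspring vectors with law p_k, k = 1..d, all independent *)
Definition kernel (p : offspring) (x : X) : X -> \bar R :=
  foldr (fun k acc => conv (cpow (fun y => (p k y)%:E) (x k)) acc) delta0
        (enum 'I_d).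
Definition step (p : offspring) (w : X -> R) (g : X -> \bar R) : X -> \bar R :=
  fun y => ((w y)%:E * \esum_(x in [set: X]) (g x * kernel p x y))%E.
Definition step1 (p : offspring) := step p (fun _ => 1).
(* y |-> E( s^{Y_n} ; Z_n = y | Z_0 = e_j ),  Y_n = Z_0 + ... + Z_n *)
Definition wlaw (p : offspring) (s : 'cV[R]_d) (j : 'I_d) (n : nat) : X -> \bar R :=
  iter n (step p (vpow s))
       (fun y => if y == unitv j then (vpow s y)%:E else 0%E).
Definition restrict_nonzero (g : X -> \bar R) : X -> \bar R :=
  fun y => if y == xzero then 0%E else g y.
(* E( s^{Y_n} ; Z_{n+m} <> 0, Z_{n+m+K} = 0 | Z_0 = e_j ) *)
Definition joint (p : offspring) (s : 'cV[R]_d) (j : 'I_d) (n m K : nat) : \bar R :=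
  iter K (step1 p) (restrict_nonzero (iter m (step1 p) (wlaw p s j n))) xzero.
(* E( s^{Y_n} ; Z_{n+m} <> 0, N < oo | Z_0 = e_j ): {N<oo} is the increasing
   union over K of {Z_{n+m+K} = 0} *)
Definition Ejoint (p : offspring) (s : 'cV[R]_d) (j : 'I_d) (n m : nat) : \bar R :=
  ereal_sup (range (joint p s j n m)).
Definition Lnj (p : offspring) (s : 'cV[R]_d) (j : 'I_d) (n m : nat) : R :=
  fine (Ejoint p s j n m) / fine (Ejoint p one_v j n m).

(* extinction probability vector mu_j = P(N < oo | Z_0 = e_j) *)
Definition mu (p : offspring) : 'cV[R]_d :=
  \col_j fine (ereal_sup (range (fun K => wlaw p one_v j K xzero))).
Definition rho_mu (p : offspring) : R := perron_root (Mat p (mu p)).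

Definition hn (p : offspring) (s : 'cV[R]_d) (n : nat) : 'cV[R]_d :=
  iter n (fun h => \col_k (s k 0 * pgf p h k 0)) 0.
Definition hstar (p : offspring) (s : 'cV[R]_d) : 'cV[R]_d :=
  \col_k (limn (fun n : nat => (hn p s n k 0 : R^o)) : R).

Definition HypH (a b c : R) (U : nat) : Prop :=
  forall (nk : nat -> nat) (f : nat -> offspring) (sk : nat -> 'cV[R]_d),
    (forall N, \forall k \near \oo, (N <= nk k)%N) ->
    (forall k, inK a b c U (f k)) ->
    (rho (f k) @[k --> \oo] --> (1 : R)) ->
    (forall k, inC (sk k)) ->
    (forall i, sk k i 0 @[k --> \oo] --> (1 : R)) ->
    (((perron_left (Mat (f k) (hstar (f k) (sk k))))^T
       *m (hstar (f k) (sk k) - hn (f k) (sk k) (nk k))) 0 0 @[k --> \oo] --> (0 : R)).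

Definition s_of (t m : 'cV[R]_d) : 'cV[R]_d := \col_i expR (- (t i 0 / m i 0)).

Definition limit_claim (t : 'cV[R]_d) (nk : nat -> nat) (f : nat -> offspring)
    (j : 'I_d) (mvec : nat -> 'cV[R]_d) (Psi : nat -> R) : Prop :=
  exists ell : nat -> R,
    (\forall k \near \oo,
       Lnj (f k) (s_of t (mvec k)) j (nk k) m @[m --> \oo] --> ell k) /\
    (`|ell k - Psi k| @[k --> \oo] --> (0 : R)).

End GW.

Definition cosh_ {R : realType} (x : R) : R := (expR x + expR (- x)) / 2.

(* Main.v *)
Require Import Defs.
From mathcomp Require Import all_boot all_order all_algebra.
From mathcomp Require Import all_classical all_reals all_analysis.
From mathcomp Require Import complex ring lra.
Import GRing.Theory Num.Theory Order.TTheory.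
Import numFieldNormedType.Exports.
Set Implicit Arguments. Unset Strict Implicit. Unset Printing Implicit Defensive.
Local Open Scope ring_scope.
Local Open Scope classical_set_scope.

(** With [H_0(s,x) = s x] and [H_(n+1) = s f(H_n)], the weight of [s^(Y_n)] on
    [{Z_(n+m) <> 0, N < oo}] is [H_n(s, mu) - H_n(s, f_m(0))].  As [m -> oo] the vector
    [mu - f_m(0)] tends to [0] in the direction of the right Perron vector [u'] of [M(mu)],
    so the limit of [L_(n,j)] is the ratio of the [j]-th entries of the derivatives
    [W_n] of [H_n(s, .)] and [H_n(1, .)] at [mu] in the direction [u'].

    Near criticality [D_i = 1 - H_i(s, mu)] and [W_i] align with the right Perron vector of
    [M(1)]: Doeblin's contraction makes the components killed by [v] summable.  What remains
    is scalar: [y_i = v' D_i] obeys [y_(i+1) = tau + rho y_i - Q y_i^2] with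
    [tau = v' (1 - s)], and [v' W_(i+1) = (rho - 2 Q y_i) v' W_i], up to small errors.
    Subtracting the fixed point [y_ext = v' (1 - mu)] gives the limit
    [prod_(i < n) (1 - 2 Q x_i / L)] with [x_i = y_i - y_ext] and
    [L = rho - 2 Q y_ext = 1 - |1 - rho| + O((1 - rho)^2)].

    In cases (1) and (2) the recursion for [x_i] is a discrete Riccati equation, close to
    [(phi ((i+1)/n) / phi (i/n) - 1) / Q] where [phi] solves a linear second order equation;
    the product telescopes to [phi(1)^-2].  In case (3) the quadratic term is negligible and
    summing the linear recursion gives [sum_i x_i ~ n tau / (1 - rho)]. *)

(** * Generating functions *)

(** The errors must be uniform in [f], although [Qc], [uvec] and [vvec] need not converge. Every
    estimate is therefore proved for one fixed offspring law with explicit constants, and limits in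
    [k] are taken only at the end. Differentiation never appears as a limit of quotients: power
    series with nonnegative coefficients are monotone and convex along increasing directions, so
    secants lie between the matrices [Mat] at the two end points, and Bonferroni inequalities turn
    the third moment bound into a cubic remainder at [1]. The fixed point is subtracted because
    numerator and denominator of the limit law both carry a damping factor [1 - 2 Q y_ext / rho] per
    step, whose power [n] need not tend to [1]; dividing it out replaces [rho] by [L]. For
    [rho > 1], [L] is about [2 - rho], which is why both sides of criticality lead to one
    recursion. *)

Lemma ge0_esumZl (R : realType) (T : choiceType) (D : set T) (x : \bar R)
    (a : T -> \bar R) : (0 <= x)%E -> (forall i, 0 <= a i)%E ->
  (x * (\esum_(i in D) a i) = \esum_(i in D) (x * a i))%E.
Proof.
move=> x0 a0.
(* The factor may be infinite, since laws take extended values: one positive term then makes both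
   sides infinite, and if all terms vanish both sides are [0]. *)
have [[i [Di ai]]|/forallNP noi] := pselect (exists i, D i /\ (0 < a i)%E); last first.
  have a00 i : D i -> a i = 0%E.
    move=> Di; apply/eqP; rewrite eq_le a0// andbT leNgt; apply/negP => ai.
    by apply: (noi i).
  by rewrite !esum1 ?mule0// => i Di; rewrite a00 ?mule0.
have le1 (g : T -> \bar R) j : D j -> (g j <= \esum_(i in D) g i)%E.
  move=> Dj; apply: esum_ge; exists [set j]; last by rewrite fsbig_set1.
  by split=> // k ->.
case: x x0 => [r| |//] r0.
- rewrite lee_fin in r0.
  rewrite /esum -ereal_supZl//; last first.
    by apply/set0P; exists 0%E; exists set0; [exact: fsets_set0|rewrite fsbig_set0].
  congr ereal_sup; apply/seteqP; split=> [_ [_ [F DF <-] <-]|_ [F DF <-]].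
    by exists F => //; rewrite ge0_mule_fsumr.
  by exists (\sum_(i \in F) a i)%E; [exists F|rewrite ge0_mule_fsumr].
- rewrite gt0_mulye; last exact: lt_le_trans ai (le1 _ _ Di).
  apply/esym/eqP; rewrite -leye_eq.
  apply: le_trans (le1 (fun i => +oo * a i)%E _ Di) => //.
  by rewrite gt0_mulye.
Qed.

Lemma ge0_esum_exchange (R : realType) (T1 T2 : choiceType)
    (a : T1 -> T2 -> \bar R) : (forall i j, 0 <= a i j)%E ->
  (\esum_(i in [set: T1]) \esum_(j in [set: T2]) a i j =
   \esum_(j in [set: T2]) \esum_(i in [set: T1]) a i j)%E.
Proof.
move=> a0; rewrite !esum_esum//.
rewrite (reindex_esum ([set: T2] `*`` (fun=> [set: T1])) _ (fun k => (k.2, k.1)))//.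
split=> //=; first by move=> [x1 x2] [y1 y2] _ _ /= [-> ->].
by move=> [x1 x2] _; exists (x2, x1).
Qed.

Section GeneratingFunction.
Variables (R : realType) (d : nat).
Implicit Types (s x : 'cV[R]_d) (q r g : X d -> \bar R) (y z : X d) (p : offspring R d).

Definition add_x y z : X d := [ffun i => (y i + z i)%N].
Definition hmul s x : 'cV[R]_d := \col_i (s i 0 * x i 0).
(** Laws are [\bar R]-valued because [wlaw] and [joint] are. Nonnegativity justifies all
    rearrangements, and finiteness is recovered afterwards from [pgf]. *)
Definition gen q x : \bar R := (\esum_(y in [set: X d]) q y * (vpow x y)%:E)%E.

Lemma vpow_ge0 x y : inC x -> 0 <= vpow x y.
Proof. by move=> xC; apply: prodr_ge0 => i _; rewrite exprn_ge0//; case/andP: (xC i). Qed.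

Lemma vpow_le1 x y : inC x -> vpow x y <= 1.
Proof.
move=> xC; apply: prodr_ile1 => i _; case/andP: (xC i) => x0 x1.
by rewrite exprn_ge0//= exprn_ile1.
Qed.

Lemma vpow_add x y z : vpow x (add_x y z) = vpow x y * vpow x z.
Proof. by rewrite /vpow -big_split; apply: eq_bigr => i _; rewrite ffunE exprD. Qed.

Lemma vpow_hmul s x y : vpow (hmul s x) y = vpow s y * vpow x y.
Proof. by rewrite /vpow -big_split; apply: eq_bigr => i _; rewrite mxE exprMn. Qed.

Lemma vpow_one y : vpow (one_v R d) y = 1.
Proof. by rewrite /vpow big1// => i _; rewrite mxE expr1n. Qed.

Lemma vpow_xzero x : vpow x (xzero d) = 1.
Proof. by rewrite /vpow big1// => i _; rewrite ffunE. Qed.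

Lemma vpow_unitv x j : vpow x (unitv j) = x j 0.
Proof.
rewrite /vpow (bigD1 j)//= ffunE eqxx expr1 big1 ?mulr1// => i /negPf ij.
by rewrite ffunE ij.
Qed.

Lemma vpow_0 y : vpow (0 : 'cV[R]_d) y = (y == xzero d)%:R.
Proof.
case: eqP => [->|/eqP yn0]; first by rewrite vpow_xzero.
have [i yi] : exists i, y i != 0%N.
  apply: contrapT => /forallNP h; case/negP: yn0; apply/eqP/ffunP => i.
  by rewrite ffunE; apply/eqP/negPn/negP/h.
by rewrite /vpow (bigD1 i)//= mxE expr0n (negPf yi) mul0r.
Qed.

Lemma inC_hmul s x : inC s -> inC x -> inC (hmul s x).
Proof.
move=> sC xC i; rewrite mxE; case/andP: (sC i) (xC i) => s0 s1 /andP[x0 x1].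
by rewrite mulr_ge0//= mulr_ile1.
Qed.

Lemma inC_one : inC (one_v R d).
Proof. by move=> i; rewrite mxE ler01 lexx. Qed.

Lemma inC0 : inC (0 : 'cV[R]_d).
Proof. by move=> i; rewrite mxE ler01 lexx. Qed.

Lemma hmul1 x : hmul (one_v R d) x = x.
Proof. by apply/matrixP => i k; rewrite !mxE ord1 mul1r. Qed.

Lemma conv_ge0 q r : (forall y, 0 <= q y)%E -> (forall y, 0 <= r y)%E ->
  forall y, (0 <= Defs.conv q r y)%E.
Proof. by move=> q0 r0 y; apply: esum_ge0 => a _; rewrite mule_ge0. Qed.

Lemma delta0_ge0 y : (0 <= delta0 R y)%E.
Proof. by rewrite /delta0; case: ifP. Qed.

Lemma cpow_ge0 q n : (forall y, 0 <= q y)%E -> forall y, (0 <= cpow q n y)%E.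
Proof.
move=> q0; elim: n => [|n IH] y; first exact: delta0_ge0.
exact: conv_ge0.
Qed.

Lemma gen_conv q r x : (forall y, 0 <= q y)%E -> (forall y, 0 <= r y)%E -> inC x ->
  gen (Defs.conv q r) x = (gen q x * gen r x)%E.
Proof.
move=> q0 r0 xC.
have X0 y : (0 <= (vpow x y)%:E)%E by rewrite lee_fin vpow_ge0.
pose le y : set (X d) := [set a | forall i, (a i <= y i)%N].
transitivity (\esum_(y in [set: X d]) \esum_(a in le y)
    (q a * r (sub_x y a) * (vpow x y)%:E))%E.
  apply: eq_esum => y _; rewrite /Defs.conv muleC ge0_esumZl//; last first.
    by move=> a; rewrite mule_ge0.
  by apply: eq_esum => a _; rewrite muleC.
rewrite esum_esum; last by move=> *; rewrite !mule_ge0.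
(* Cauchy product: a pair [(y, a)] with [a <= y] corresponds to the two summands [(a, y - a)]. *)
rewrite (reindex_esum ([set: X d] `*`` (fun=> [set: X d])) _
  (fun k => (add_x k.1 k.2, k.1))); last first.
  split=> /=.
  - by move=> [y z] _; split=> // i /=; rewrite ffunE leq_addr.
  - move=> [y z] [y' z'] _ _ /= [e yy']; subst y'; congr pair; apply/ffunP => i.
    by move/ffunP/(_ i): e; rewrite !ffunE => /addnI.
  - move=> [y a] [_ /= ay]; exists (a, sub_x y a) => //=.
    by congr pair; apply/ffunP => i; rewrite !ffunE subnKC.
transitivity (\esum_(a in [set: X d]) \esum_(b in [set: X d])
    (q a * (vpow x a)%:E) * (r b * (vpow x b)%:E))%E; last first.
  rewrite [RHS]muleC [X in _ = (_ * X)%E]/gen ge0_esumZl//.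
  - apply: eq_esum => a _; rewrite [RHS]muleC [X in _ = (_ * X)%E]/gen ge0_esumZl ?mule_ge0// => b.
    by rewrite mule_ge0.
  - by apply: esum_ge0 => a _; rewrite mule_ge0.
  - by move=> a; rewrite mule_ge0.
rewrite esum_esum; last by move=> *; rewrite !mule_ge0.
apply: eq_esum => -[a b] _ /=.
rewrite vpow_add EFinM (_ : sub_x _ _ = b); last first.
  by apply/ffunP => i; rewrite !ffunE addKn.
by rewrite muleACA.
Qed.

Lemma gen_delta0 x : gen (@delta0 R d) x = 1%E.
Proof.
rewrite /gen (eq_esum (b := fun y => if y \in [set xzero d] then 1%E else 0%E)).
  by rewrite -esum_mkcond esum_set1.
move=> y _; rewrite /delta0; case: eqP => [->|ne].
  by rewrite vpow_xzero mule1 mem_set.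
by rewrite mul0e memNset.
Qed.

Lemma gen_cpow q n x : (forall y, 0 <= q y)%E -> inC x ->
  gen (cpow q n) x = (gen q x ^+ n)%E.
Proof.
move=> q0 xC; elim: n => [|n IH]; first exact: gen_delta0.
by rewrite expeS -IH -gen_conv// => y; exact: cpow_ge0.
Qed.

Lemma offspring_summable p k (F : X d -> R) : is_offspring p ->
    (forall y, 0 <= F y <= 1) ->
  (\esum_(i in [set: X d]) (p k i * F i)%:E <= 1)%E.
Proof.
move=> [p0 p1] F01; rewrite -(p1 k); apply: le_esum => y _; rewrite lee_fin.
by have /andP[F0 F1] := F01 y; rewrite ler_piMr.
Qed.

Lemma gen_offspring p k x : is_offspring p -> inC x ->
  gen (fun y => (p k y)%:E) x = (pgf p x k 0)%:E.
Proof.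
move=> po xC; rewrite mxE fineK.
  by apply: eq_esum => y _; rewrite EFinM.
have le1 : (\esum_(i in [set: X d]) (p k i * vpow x i)%:E <= 1)%E.
  by apply: offspring_summable => // y; rewrite vpow_ge0// vpow_le1.
rewrite ge0_fin_numE; first exact: le_lt_trans le1 (ltry _).
apply: esum_ge0 => y _; rewrite lee_fin mulr_ge0 ?vpow_ge0//; exact: (po.1).
Qed.

Lemma inC_pgf p x : is_offspring p -> inC x -> inC (pgf p x).
Proof.
move=> po xC k; rewrite -2!lee_fin -gen_offspring//; apply/andP; split.
  apply: esum_ge0 => y _; rewrite mule_ge0// lee_fin ?vpow_ge0//; exact: (po.1).
rewrite /gen; under eq_esum do rewrite -EFinM.
by apply: offspring_summable => // y; rewrite vpow_ge0// vpow_le1.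
Qed.

Lemma kernel_ge0 p y : is_offspring p -> forall z, (0 <= Defs.kernel p y z)%E.
Proof.
move=> po; rewrite /Defs.kernel; elim: (enum _) => [|k l IH] z /=; first exact: delta0_ge0.
apply: conv_ge0 => // w; apply: cpow_ge0 => u; rewrite lee_fin; exact: po.1.
Qed.

Lemma gen_kernel p y x : is_offspring p -> inC x ->
  gen (Defs.kernel p y) x = (vpow (pgf p x) y)%:E.
Proof.
move=> po xC; rewrite /vpow -big_enum /= /Defs.kernel.
have foldr_ge0 l z : (0 <= foldr (fun k acc =>
    Defs.conv (cpow (fun y => (p k y)%:E) (y k)) acc) (@delta0 R d) l z)%E.
  elim: l z => [|k l IH] z /=; first exact: delta0_ge0.
  apply: conv_ge0 => // w; apply: cpow_ge0 => u; rewrite lee_fin; exact: po.1.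
elim: (enum _) => [|k l IH] /=; first by rewrite gen_delta0 big_nil.
have pk0 z : (0 <= (p k z)%:E)%E by rewrite lee_fin; exact: po.1.
rewrite gen_conv//; last by move=> z; exact: cpow_ge0.
by rewrite gen_cpow// gen_offspring// IH big_cons EFinM EFin_expe.
Qed.

Lemma step_ge0 p s g : is_offspring p -> inC s -> (forall y, 0 <= g y)%E ->
  forall y, (0 <= step p (vpow s) g y)%E.
Proof.
move=> po sC g0 y; rewrite mule_ge0 ?lee_fin ?vpow_ge0//.
by apply: esum_ge0 => z _; rewrite mule_ge0// kernel_ge0.
Qed.

(** Given [Z_l = z] the next generation has generating function [f(x)^z], and the weight [s^y] turns
    the argument [x] into [s x]; exchanging the two sums gives a composition. *)
Lemma gen_step p s g x : is_offspring p -> inC s -> inC x -> (forall y, 0 <= g y)%E ->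
  gen (step p (vpow s) g) x = gen g (pgf p (hmul s x)).
Proof.
move=> po sC xC g0.
have sxC := inC_hmul sC xC.
transitivity (\esum_(y in [set: X d]) \esum_(z in [set: X d])
   (g z * (Defs.kernel p z y * (vpow (hmul s x) y)%:E)))%E.
  apply: eq_esum => y _; rewrite /step muleAC -EFinM -vpow_hmul ge0_esumZl.
  - by apply: eq_esum => z _; rewrite muleC muleA.
  - by rewrite lee_fin vpow_ge0.
  - by move=> z; rewrite mule_ge0// kernel_ge0.
rewrite ge0_esum_exchange; last first.
  by move=> y z; rewrite !mule_ge0// ?kernel_ge0// lee_fin vpow_ge0.
apply: eq_esum => z _; rewrite -gen_kernel// -ge0_esumZl//.
by move=> y; rewrite mule_ge0// ?kernel_ge0// lee_fin vpow_ge0.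
Qed.

Lemma step1E p : step1 p = step p (vpow (one_v R d)).
Proof. by rewrite /step1; congr step; apply/funext => y; rewrite vpow_one. Qed.

Lemma iter_step1_ge0 p g m : is_offspring p -> (forall y, 0 <= g y)%E ->
  forall y, (0 <= iter m (step1 p) g y)%E.
Proof.
move=> po g0; elim: m => [//|m IH] y /=; rewrite {1}step1E.
by apply: step_ge0 => //; exact: inC_one.
Qed.

Lemma inC_iter_pgf p x m : is_offspring p -> inC x -> inC (iter m (pgf p) x).
Proof. by move=> po xC; elim: m => //= m IH; exact: inC_pgf. Qed.

Lemma gen_iter_step1 p g x m : is_offspring p -> inC x -> (forall y, 0 <= g y)%E ->
  gen (iter m (step1 p) g) x = gen g (iter m (pgf p) x).
Proof.
move=> po + g0; elim: m x => [//|m IH] x xC; rewrite [in RHS]iterSr -IH; last exact: inC_pgf.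
have iter0 := iter_step1_ge0 m po g0.
by rewrite iterS {1}step1E gen_step ?hmul1//; exact: inC_one.
Qed.

Lemma gen_at0 g : (forall y, 0 <= g y)%E -> gen g 0 = g (xzero d).
Proof.
move=> g0.
rewrite /gen (eq_esum (b := fun y => if y \in [set xzero d] then g y else 0%E)).
  by rewrite -esum_mkcond esum_set1.
move=> y _; rewrite vpow_0; case: eqP => [->|ne].
  by rewrite mule1 mem_set.
by rewrite mule0 memNset.
Qed.

Lemma gen_restrict_nonzero g x : (forall y, 0 <= g y)%E -> inC x ->
  gen g x = (gen (restrict_nonzero g) x + gen g 0)%E.
Proof.
move=> g0 xC; rewrite /gen -esumD.
- apply: eq_esum => y _; rewrite /restrict_nonzero vpow_0; case: eqP => [->|_].
    by rewrite vpow_xzero mul0e add0e.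
  by rewrite mule0 adde0.
- move=> y _; rewrite mule_ge0 ?lee_fin ?vpow_ge0// /restrict_nonzero.
  by case: ifP.
- by move=> y _; rewrite mule_ge0// lee_fin vpow_ge0//; exact: inC0.
Qed.

(* [Hit p s n x] is the column of [E(s^{Y_n} x^{Z_n} | Z_0 = e_j)]. *)
Definition Hit p s n x : 'cV[R]_d := iter n (fun h => hmul s (pgf p h)) (hmul s x).

Lemma inC_Hit p s n x : is_offspring p -> inC s -> inC x -> inC (Hit p s n x).
Proof.
move=> po sC xC; elim: n => [|n IH]; first exact: inC_hmul.
by apply: inC_hmul => //; exact: inC_pgf.
Qed.

Lemma wlaw_ge0 p s j n : is_offspring p -> inC s -> forall y, (0 <= wlaw p s j n y)%E.
Proof.
move=> po sC; elim: n => [|n IH] y; last exact: step_ge0.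
by rewrite /wlaw /=; case: eqP => // _; rewrite lee_fin vpow_ge0.
Qed.

Lemma gen_wlaw p s j n x : is_offspring p -> inC s -> inC x ->
  gen (wlaw p s j n) x = (Hit p s n x j 0)%:E.
Proof.
move=> po sC; elim: n x => [|n IH] x xC.
  rewrite /gen (eq_esum (b := fun y => if y \in [set unitv j] then (vpow s y * vpow x y)%:E else 0%E)).
    by rewrite -esum_mkcond esum_set1 ?lee_fin ?mulr_ge0 ?vpow_ge0// !vpow_unitv mxE.
  move=> y _; rewrite /wlaw /=; case: eqP => [->|ne].
    by rewrite mem_set.
  by rewrite mul0e memNset.
rewrite /wlaw iterS -/(wlaw p s j n) gen_step//; last exact: wlaw_ge0.
by rewrite IH ?/Hit ?iterSr//; apply: inC_pgf => //; exact: inC_hmul.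
Qed.

(** The event [{Z_(n+m) <> 0, Z_(n+m+K) = 0}] is extinction by time [n+m+K] without extinction by
    time [n+m]. Evaluation at [0] reads off the mass of the zero state, and unweighted steps replace
    the argument by iterates of [f]. *)
Lemma jointE p s j n m K : is_offspring p -> inC s ->
  joint p s j n m K =
  (Hit p s n (iter m (pgf p) (iter K (pgf p) 0)) j 0
   - Hit p s n (iter m (pgf p) 0) j 0)%:E.
Proof.
move=> po sC; rewrite /joint.
have w0 := wlaw_ge0 j n po sC.
have r0 y : (0 <= restrict_nonzero (iter m (step1 p) (wlaw p s j n)) y)%E.
  by rewrite /restrict_nonzero; case: ifP => // _; exact: iter_step1_ge0.
rewrite -gen_at0; last by move=> y; exact: iter_step1_ge0.
have C0 := inC0.
rewrite gen_iter_step1//.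
have KC := inC_iter_pgf K po C0.
have := gen_restrict_nonzero (iter_step1_ge0 m po w0) KC.
rewrite !gen_iter_step1// !gen_wlaw//; try exact: inC_iter_pgf.
(* The other two terms of the equation are finite, so the remaining one cannot be infinite. *)
case: (gen _ _) => [r [e]| |] //=.
by congr EFin; rewrite e; ring.
Qed.

Lemma wlaw_one_xzero p j K : is_offspring p ->
  wlaw p (one_v R d) j K (xzero d) = (iter K (pgf p) 0 j 0)%:E.
Proof.
move=> po; rewrite -gen_at0; last by apply: wlaw_ge0 => //; exact: inC_one.
rewrite gen_wlaw ?/Hit ?hmul1//; [|exact: inC_one|exact: inC0].
by rewrite (eq_iter (f' := pgf p))// => h; rewrite hmul1.
Qed.

End GeneratingFunction.

(** * Factorial moments and Taylor bounds *)

Section Monomials.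
Variables (R : realType) (d : nat).
Implicit Types (x q : 'cV[R]_d) (y : X d) (a l m : 'I_d).

Definition deg y : nat := \sum_i y i.

(** Adding one individual multiplies a monomial by one coordinate, so inequalities between monomials
    can be proved by adding individuals one at a time. *)
Lemma X_ind (P : X d -> Prop) : P (xzero d) ->
  (forall y a, P y -> P (add_x y (unitv a))) -> forall y, P y.
Proof.
move=> P0 PS y; have [n] := ubnP (deg y); elim: n y => // n IH y.
rewrite ltnS => dyn.
have [->//|/eqP yn0] := pselect (y = xzero d).
have [i yi] : exists i, (0 < y i)%N.
  apply: contrapT => /forallNP h; case/negP: yn0; apply/eqP/ffunP => i.
  by rewrite ffunE; apply/eqP; rewrite -leqn0 leqNgt; apply/negP/h.
have -> : y = add_x (sub_x y (unitv i)) (unitv i).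
  apply/ffunP => k; rewrite !ffunE subnK//; case: eqP => // ->//.
apply: PS; apply: IH; apply: leq_trans dyn.
rewrite /deg (bigD1 i)//= [in ltnRHS](bigD1 i)//= ffunE ffunE eqxx subn1.
rewrite -addSn prednK// leq_add2l leq_sum// => k _.
by rewrite !ffunE leq_subr.
Qed.

Lemma deg_sub y l : (0 < y l)%N -> deg (sub_x y (unitv l)) = (deg y).-1.
Proof.
move=> yl; rewrite /deg (bigD1 l)//= [in RHS](bigD1 l)//= !ffunE eqxx subn1.
rewrite -[in RHS](prednK yl) addSn /=; congr addn; apply: eq_bigr => k /negPf kl.
by rewrite !ffunE kl subn0.
Qed.

Lemma deg_add y a : deg (add_x y (unitv a)) = (deg y).+1.
Proof.
rewrite /deg (bigD1 a)//= [in RHS](bigD1 a)//= !ffunE eqxx addn1 addSn.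
by congr (_ + _).+1%N; apply: eq_bigr => k /negPf ka; rewrite !ffunE ka addn0.
Qed.

(** [y m - (l == m)] is the coordinate [m] of [y - e_l]; where the subtraction truncates, the factor
    [y l] is [0]. Each summation over the last index leaves a degree, so the bound on the sum of the
    [c^k_(lmj)] is a bound on third factorial moments of the total offspring. *)
Lemma sum_fact2 y l :
  (\sum_m y l * (y m - (l == m)) = y l * (deg y).-1)%N.
Proof.
rewrite -big_distrr /=; have [->|yl] := posnP (y l); first by rewrite !mul0n.
rewrite -(deg_sub yl); congr muln; apply: eq_bigr => m _.
by rewrite !ffunE eq_sym.
Qed.

Lemma sum_fact3 y l m :
  (\sum_j y l * (y m - (l == m)) * (y j - (l == j) - (m == j))
   = y l * (y m - (l == m)) * (deg y).-2)%N.
Proof.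
rewrite -big_distrr /=; have [->|yl] := posnP (y l * (y m - (l == m)))%N.
  by rewrite !mul0n.
have [yl0 ym0] : (0 < y l)%N /\ (0 < sub_x y (unitv l) m)%N.
  by move: yl; rewrite muln_gt0 !ffunE [m == l]eq_sym => /andP[].
rewrite -(deg_sub yl0) -(deg_sub ym0); congr muln; apply: eq_bigr => j _.
by rewrite !ffunE ![j == _]eq_sym.
Qed.

Lemma sum_fact2_all y :
  (\sum_l \sum_m y l * (y m - (l == m)) = deg y * (deg y).-1)%N.
Proof.
rewrite (eq_bigr (fun l => y l * (deg y).-1)%N); last by move=> l _; exact: sum_fact2.
by rewrite -big_distrl.
Qed.

Lemma sum_fact3_all y :
  (\sum_l \sum_m \sum_j y l * (y m - (l == m)) * (y j - (l == j) - (m == j))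
   = deg y * (deg y).-1 * (deg y).-2)%N.
Proof.
rewrite -sum_fact2_all big_distrl; apply: eq_bigr => l _ /=.
by rewrite big_distrl; apply: eq_bigr => m _ /=; exact: sum_fact3.
Qed.

Lemma vpow_add_unitv x y a : vpow x (add_x y (unitv a)) = vpow x y * x a 0.
Proof. by rewrite vpow_add vpow_unitv. Qed.

Lemma vpow_mono x x' y : inC x -> inC x' -> (forall i, x i 0 <= x' i 0) ->
  vpow x y <= vpow x' y.
Proof.
move=> xC xC' xx'; apply: ler_prod => i _; case/andP: (xC i) => x0 _.
by rewrite exprn_ge0//= lerXn2r ?nnegrE//; exact: le_trans (xx' i).
Qed.

(** The partial derivative of [x^y] in [x_l]. For [y l = 0] the truncated exponent is harmless, the
    factor in front being [0]. *)
Definition dmon y l x : R := (y l)%:R * vpow x (sub_x y (unitv l)).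

Lemma dmon_add y a l x :
  dmon (add_x y (unitv a)) l x = x a 0 * dmon y l x + (a == l)%:R * vpow x y.
Proof.
rewrite /dmon ffunE natrD mulrDl ffunE eq_sym; congr (_ + _).
- have [->|yl] := posnP (y l); first by rewrite !mul0r mulr0.
  rewrite mulrCA -[x a 0 * _]mulrC -vpow_add_unitv; congr (_ * vpow x _).
  apply/ffunP => i; rewrite !ffunE addnBAC//.
  by case: eqP => // ->.
- case: eqP => [->|_]; last by rewrite !mul0r.
  rewrite !mul1r; congr vpow; apply/ffunP => i; rewrite !ffunE addnK//.
Qed.

Lemma sum_dmon_add y a x (q : 'cV[R]_d) :
  \sum_l dmon (add_x y (unitv a)) l x * q l 0 =
  x a 0 * (\sum_l dmon y l x * q l 0) + vpow x y * q a 0.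
Proof.
under eq_bigr do rewrite dmon_add mulrDl.
rewrite big_split /= mulr_sumr; congr (_ + _); first by apply: eq_bigr => l _; rewrite mulrA.
rewrite (bigD1 a)//= eqxx mul1r big1 ?addr0// => l /negPf la.
by rewrite eq_sym la !mul0r.
Qed.

Lemma dmon_xzero l x : dmon (xzero d) l x = 0.
Proof. by rewrite /dmon ffunE mul0r. Qed.

(** Convexity of monomials along increasing directions of the cube: the product rule [sum_dmon_add]
    carries both slope bounds through multiplication by one coordinate. *)
Lemma monomial_slope x x' y : inC x -> inC x' -> (forall i, x i 0 <= x' i 0) ->
  \sum_l dmon y l x * (x' l 0 - x l 0) <= vpow x' y - vpow x y
     <= \sum_l dmon y l x' * (x' l 0 - x l 0).
Proof.
move=> xC xC' xx'; elim/X_ind: y => [|y a IH].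
  by rewrite !vpow_xzero subrr !big1 ?lexx// => l _; rewrite dmon_xzero mul0r.
have sub (z : 'cV[R]_d) : \sum_l dmon (add_x y (unitv a)) l z * (x' l 0 - x l 0) =
    z a 0 * (\sum_l dmon y l z * (x' l 0 - x l 0)) + vpow z y * (x' a 0 - x a 0).
  have := sum_dmon_add y a z (x' - x).
  under eq_bigr do rewrite !mxE.
  by move=> ->; rewrite !mxE; under eq_bigr do rewrite !mxE.
rewrite !sub !vpow_add_unitv.
case/andP: IH => IH1 IH2.
have /andP[xa0 xa1] := xC a; have /andP[xa'0 xa'1] := xC' a.
have v0 := vpow_ge0 y xC; have vm := vpow_mono y xC xC' xx'; have xa := xx' a.
apply/andP; split; nra.
Qed.

(** [e1] and [e2] are the elementary symmetric functions of degree one and two of the list in which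
    [q_l] is repeated [y_l] times. *)
Definition e1 y q : R := \sum_l (y l)%:R * q l 0.
Definition e2 y q : R := 2^-1 * (e1 y q ^+ 2 - \sum_l (y l)%:R * q l 0 ^+ 2).

Lemma e1_add y a q : e1 (add_x y (unitv a)) q = e1 y q + q a 0.
Proof.
rewrite /e1 (bigD1 a)//= [in RHS](bigD1 a)//= !ffunE eqxx natrD /=.
rewrite (eq_bigr (fun l => (y l)%:R * q l 0)); last first.
  by move=> l /negPf la; rewrite !ffunE la addn0.
by ring.
Qed.

Lemma e2_add y a q : e2 (add_x y (unitv a)) q = e2 y q + q a 0 * e1 y q.
Proof.
rewrite /e2 e1_add (bigD1 a)//= [X in _ = _ * (_ - X) + _](bigD1 a)//= !ffunE eqxx natrD /=.
rewrite (eq_bigr (fun l => (y l)%:R * q l 0 ^+ 2)); last first.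
  by move=> l /negPf la; rewrite !ffunE la addn0.
by field.
Qed.

Lemma e1_bound y q (z : R) : (forall i, 0 <= q i 0 <= z) -> 0 <= e1 y q <= (deg y)%:R * z.
Proof.
move=> qz; apply/andP; split.
  by apply: sumr_ge0 => l _; rewrite mulr_ge0//; case/andP: (qz l).
rewrite /deg natr_sum mulr_suml; apply: ler_sum => l _.
by rewrite ler_wpM2l//; case/andP: (qz l).
Qed.

Lemma e2_bound y q (z : R) : (forall i, 0 <= q i 0 <= z) ->
  0 <= e2 y q <= 2^-1 * ((deg y)%:R * ((deg y)%:R - 1)) * z ^+ 2.
Proof.
move=> qz; elim/X_ind: y => [|y a IH].
  rewrite /e2 /e1 /deg !big1 ?(mul0r, expr0n)//=; try by move=> *; rewrite ffunE// mul0r.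
  by rewrite subr0 !mulr0 mul0r lexx.
rewrite e2_add deg_add; have /andP[e0 ez] := e1_bound y qz.
case/andP: IH => IH1 IH2; have /andP[q0 q1] := qz a.
have h0 : 0 <= q a 0 * e1 y q by exact: mulr_ge0.
have h1 : q a 0 * e1 y q <= z * ((deg y)%:R * z) by exact: ler_pM.
rewrite -[(deg y).+1%:R]natr1; apply/andP; split; first by rewrite addr_ge0.
apply: le_trans (lerD IH2 h1) _.
by rewrite le_eqVlt; apply/orP; left; apply/eqP; field.
Qed.

(* Bonferroni: [vpow (1 - q) y] is the probability that none of [deg y]
   independent events occurs, [e1] and [e2] being the first two sums. *)
Lemma bonferroni y q (z : R) : (forall i, 0 <= q i 0 <= z) -> z <= 1 ->
  let P := vpow (one_v R d - q) y in
  [/\ 1 - e1 y q <= P, P <= 1 - e1 y q + e2 y q &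
     1 - e1 y q + e2 y q - 6^-1 * ((deg y)%:R * ((deg y)%:R - 1) * ((deg y)%:R - 2)) * z ^+ 3 <= P].
Proof.
move=> qz z1 /=; elim/X_ind: y => [|y a [IH1 IH2 IH3]].
  rewrite vpow_xzero /e2 /e1 /deg !big1 ?(mul0r, expr0n)//=; try by move=> *; rewrite ffunE// mul0r.
  by rewrite !(subr0, mulr0, mul0r, addr0).
rewrite vpow_add_unitv e1_add e2_add deg_add -[(deg y).+1%:R]natr1 !mxE.
have /andP[e10 e1z] := e1_bound y qz; have /andP[e20 e2z] := e2_bound y qz.
have /andP[q0 q1] := qz a.
set P := vpow _ _ in IH1 IH2 IH3 *; set E1 := e1 y q in IH1 IH2 IH3 e10 e1z e2z *.
set E2 := e2 y q in IH2 IH3 e20 e2z *; set n := (deg y)%:R in IH1 IH2 IH3 e1z e2z *.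
set t := q a 0 in q0 q1 *.
have t1 : t <= 1 by exact: le_trans q1 z1.
have P1 : P <= 1.
  by apply: vpow_le1 => i; rewrite !mxE; have /andP[? ?] := qz i; lra.
have h3 : t * P <= t by rewrite ler_piMr.
have h4 : 0 <= t * (P - (1 - E1)) by rewrite mulr_ge0// subr_ge0.
split; [lra|lra|].
have h1 : t * E2 <= z * (2^-1 * (n * (n - 1)) * z ^+ 2) by apply: ler_pM.
have h2 : P * t <= (1 - E1 + E2) * t by apply: ler_wpM2r.
have -> : 6^-1 * ((n + 1) * (n + 1 - 1) * (n + 1 - 2)) * z ^+ 3 =
  6^-1 * (n * (n - 1) * (n - 2)) * z ^+ 3 + z * (2^-1 * (n * (n - 1)) * z ^+ 2) by field.
lra.
Qed.

End Monomials.

(** * Expectations under an offspring law and Taylor bounds for its generating function *)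

Section Expectation.
Variables (R : realType) (d : nat) (p : offspring R d) (c : R).
Hypothesis po : is_offspring p.
Hypothesis pc : (\sum_(k < d) \sum_(l < d) \sum_(m < d) \sum_(j < d) cmom p k l m j
         <= c%:E)%E.
Implicit Types (x q : 'cV[R]_d) (y : X d) (k l m : 'I_d) (g h : X d -> R).

(** The summand [2] makes the weight dominate [1], [deg] and [deg (deg - 1)] also for degree at most
    [2], where the third factorial vanishes. Its mean is at most [c + 2], which thereby bounds all
    lower moments. *)
Definition wgt y : R := (deg y * (deg y).-1 * (deg y).-2)%:R + 2.
Definition dom g := exists K, forall y, `|g y| <= K * wgt y.
Definition Epos k g : R := fine (\esum_(y in [set: X d]) (p k y * g y)%:E).
(** Positive and negative parts are summed separately, because [esum] is the right notion for
    nonnegative families only; [dom] makes both parts finite. *)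
Definition Ex k g : R :=
  Epos k (fun y => Num.max (g y) 0) - Epos k (fun y => Num.max (- g y) 0).

Let p0 k y : 0 <= p k y. Proof. exact: po.1. Qed.

Lemma esum_third_moment k :
  (\esum_(y in [set: X d]) (p k y * (deg y * (deg y).-1 * (deg y).-2)%:R)%:E <= c%:E)%E.
Proof.
apply: le_trans pc.
have c0 k' l m j : (0 <= cmom p k' l m j)%E.
  by apply: esum_ge0 => y _; rewrite lee_fin mulr_ge0.
rewrite (bigD1 k)//=.
apply: le_trans (_ : (\sum_(l < d) \sum_(m < d) \sum_(j < d) cmom p k l m j <= _)%E); last first.
  by rewrite leeDl// !sume_ge0// => ? _; rewrite !sume_ge0// => ? _; rewrite !sume_ge0// => ? _; rewrite !sume_ge0.
rewrite le_eqVlt; apply/orP; left; apply/eqP.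
transitivity (\esum_(y in [set: X d]) \sum_(l < d) \sum_(m < d) \sum_(j < d)
  (p k y * (y l * (y m - (l == m)) * (y j - (l == j) - (m == j)))%N%:R)%:E)%E.
  apply: eq_esum => y _; rewrite -sum_fact3_all natr_sum mulr_sumr -sumEFin.
  apply: eq_bigr => l _; rewrite natr_sum mulr_sumr -sumEFin.
  apply: eq_bigr => m _; rewrite natr_sum mulr_sumr -sumEFin.
  by apply: eq_bigr => j _.
have t0 y l m j : (0 <= (p k y * (y l * (y m - (l == m)) * (y j - (l == j) - (m == j)))%N%:R)%:E)%E.
  by rewrite lee_fin mulr_ge0.
rewrite esum_sum; last by move=> *; rewrite !sume_ge0// => ? _; rewrite !sume_ge0.
apply: eq_bigr => l _; rewrite esum_sum; last by move=> *; rewrite !sume_ge0.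
by apply: eq_bigr => m _; rewrite esum_sum.
Qed.

Lemma wgt_ge2 y : 2 <= wgt y. Proof. by rewrite lerDr. Qed.

Lemma esum_wgt k : (\esum_(y in [set: X d]) (p k y * wgt y)%:E <= (c + 2)%:E)%E.
Proof.
under eq_esum do rewrite mulrDr EFinD.
rewrite esumD; [|by move=> y _; rewrite lee_fin mulr_ge0..].
rewrite EFinD; apply: leeD; first exact: esum_third_moment.
under eq_esum do rewrite mulrC EFinM.
by rewrite -ge0_esumZl// ?po.2 ?mule1// => y; rewrite lee_fin.
Qed.

Lemma EposE k g : (forall y, 0 <= g y) -> dom g ->
  (\esum_(y in [set: X d]) (p k y * g y)%:E = (Epos k g)%:E)%E.
Proof.
move=> g0 [K gK]; rewrite /Epos fineK// ge0_fin_numE; last first.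
  by apply: esum_ge0 => y _; rewrite lee_fin mulr_ge0.
have K0 : 0 <= `|K| by [].
apply: le_lt_trans (_ : (`|K|%:E * (c + 2)%:E < +oo)%E); last by rewrite -EFinM ltry.
apply: le_trans (lee_wpmul2l _ (esum_wgt k)); rewrite ?lee_fin//.
rewrite ge0_esumZl ?lee_fin//; last first.
  by move=> y; rewrite lee_fin mulr_ge0// (le_trans _ (wgt_ge2 y)).
apply: le_esum => y _; rewrite -EFinM lee_fin mulrCA ler_wpM2l//.
have := gK y; rewrite ger0_norm// => /le_trans; apply.
by rewrite ler_wpM2r ?ler_norm// (le_trans _ (wgt_ge2 y)).
Qed.

Lemma EposD k g h : (forall y, 0 <= g y) -> (forall y, 0 <= h y) -> dom g -> dom h ->
  dom (fun y => g y + h y) -> Epos k (fun y => g y + h y) = Epos k g + Epos k h.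
Proof.
move=> g0 h0 dg dh dgh; apply: EFin_inj; rewrite EFinD -!EposE//; last first.
  by move=> y; rewrite addr_ge0.
by rewrite -esumD => [|y _|y _]; rewrite ?lee_fin ?mulr_ge0//; apply: eq_esum => y _; rewrite mulrDr EFinD.
Qed.

Lemma domD g h : dom g -> dom h -> dom (fun y => g y + h y).
Proof.
move=> [K gK] [L hL]; exists (K + L) => y; rewrite mulrDl.
exact: le_trans (ler_normD _ _) (lerD (gK y) (hL y)).
Qed.

Lemma dom_le g h : dom h -> (forall y, `|g y| <= `|h y|) -> dom g.
Proof. by move=> [K hK] gh; exists K => y; exact: le_trans (gh y) (hK y). Qed.

Lemma domZ (a : R) g : dom g -> dom (fun y => a * g y).
Proof.
move=> [K gK]; exists (`|a| * K) => y; rewrite normrM -mulrA.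
by rewrite ler_wpM2l.
Qed.

Lemma domN g : dom g -> dom (fun y => - g y).
Proof. by move=> dg; apply: dom_le dg _ => y; rewrite normrN. Qed.

Lemma dom_pos g : dom g -> dom (fun y => Num.max (g y) 0).
Proof.
move=> dg; apply: dom_le dg _ => y.
by case: (leP (g y) 0) => h; rewrite ?normr0.
Qed.

Lemma dom_wgt : dom wgt.
Proof. by exists 1 => y; rewrite mul1r ger0_norm// (le_trans _ (wgt_ge2 y)). Qed.

(** The mean does not depend on how a function is written as a difference of nonnegative ones;
    linearity follows from this. *)
Lemma Ex_split k g h : (forall y, 0 <= g y) -> (forall y, 0 <= h y) -> dom g -> dom h ->
  Ex k (fun y => g y - h y) = Epos k g - Epos k h.
Proof.
move=> g0 h0 dg dh; apply/eqP; rewrite /Ex subr_eq addrAC eq_sym subr_eq; apply/eqP.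
have dgh : dom (fun y => g y - h y) by apply: domD => //; exact: domN.
have pos0 (F : X d -> R) y : 0 <= Num.max (F y) 0 by rewrite le_max lexx orbT.
have d1 : dom (fun y => Num.max (g y - h y) 0) by exact: dom_pos.
have d2 : dom (fun y => Num.max (- (g y - h y)) 0) by apply: dom_pos; exact: domN.
have p1 := pos0 (fun y => g y - h y); have p2 := pos0 (fun y => - (g y - h y)).
rewrite -(EposD k g0 p2 dg d2 (domD dg d2)) -(EposD k p1 h0 d1 dh (domD d1 dh)).
congr (Epos k _); apply/funext => y.
by case: (leP (g y - h y) 0) => h1; case: (leP (- (g y - h y)) 0) => h2; lra.
Qed.

Lemma Ex_ge0E k g : (forall y, 0 <= g y) -> dom g -> Ex k g = Epos k g.
Proof.
move=> g0 dg.
have d0 : dom (fun=> 0 : R) by apply: dom_le dg _ => y; rewrite normr0.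
have := Ex_split k g0 (fun=> lexx 0) dg d0.
under eq_fun do rewrite subr0.
move=> ->; rewrite [X in _ - X](_ : _ = 0) ?subr0//.
by apply: EFin_inj; rewrite -EposE//; apply: esum1 => y _; rewrite mulr0.
Qed.

Lemma ExE k g : (forall y, 0 <= g y) -> dom g ->
  (\esum_(y in [set: X d]) (p k y * g y)%:E = (Ex k g)%:E)%E.
Proof. by move=> g0 dg; rewrite Ex_ge0E// EposE. Qed.

Lemma Ex_ge0 k g : (forall y, 0 <= g y) -> dom g -> 0 <= Ex k g.
Proof.
move=> g0 dg; rewrite -lee_fin -ExE//.
by apply: esum_ge0 => y _; rewrite lee_fin mulr_ge0.
Qed.

Let pos0 g y : 0 <= Num.max (g y) 0. Proof. by rewrite le_max lexx orbT. Qed.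

Lemma ExD k g h : dom g -> dom h -> Ex k (fun y => g y + h y) = Ex k g + Ex k h.
Proof.
move=> dg dh.
have dg1 := dom_pos dg; have dg2 := dom_pos (domN dg).
have dh1 := dom_pos dh; have dh2 := dom_pos (domN dh).
have -> : (fun y => g y + h y) = (fun y => (Num.max (g y) 0 + Num.max (h y) 0)
                             - (Num.max (- g y) 0 + Num.max (- h y) 0)).
  apply/funext => y.
  by case: (leP (g y) 0) => ?; case: (leP (h y) 0) => ?;
     case: (leP (- g y) 0) => ?; case: (leP (- h y) 0) => ?; lra.
have gp := pos0 g; have hp := pos0 h.
have gn := pos0 (fun y => - g y); have hn := pos0 (fun y => - h y).
rewrite Ex_split; try (by apply: domD); try (by move=> y; rewrite addr_ge0).
rewrite EposD//; last exact: domD.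
rewrite EposD//; last exact: domD.
by rewrite /Ex; ring.
Qed.

Lemma max_split (a : R) : a = Num.max a 0 - Num.max (- a) 0.
Proof. by case: (leP a 0) => ?; case: (leP (- a) 0) => ?; lra. Qed.

Lemma ExZ k (a : R) g : dom g -> Ex k (fun y => a * g y) = a * Ex k g.
Proof.
have posZ b F : 0 <= b -> (forall y, 0 <= F y) -> dom F ->
    Epos k (fun y => b * F y) = b * Epos k F.
  move=> b0 F0 dF; apply: EFin_inj; rewrite EFinM -!EposE//.
  - rewrite ge0_esumZl ?lee_fin//; last by move=> y; rewrite lee_fin mulr_ge0.
    by apply: eq_esum => y _; rewrite -EFinM mulrCA.
  - by move=> y; rewrite mulr_ge0.
  - exact: domZ.
move=> dg.
have dg1 := dom_pos dg; have dg2 := dom_pos (domN dg).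
have gp := pos0 g; have gn := pos0 (fun y => - g y).
have [a0|a0] := leP 0 a.
  have -> : (fun y => a * g y) = (fun y => a * Num.max (g y) 0 - a * Num.max (- g y) 0).
    by apply/funext => y; rewrite -mulrBr -max_split.
  rewrite Ex_split; try (by move=> y; rewrite mulr_ge0); try exact: domZ.
  by rewrite !posZ// /Ex mulrBr.
have na0 : 0 <= - a by lra.
have -> : (fun y => a * g y) = (fun y => (- a) * Num.max (- g y) 0 - (- a) * Num.max (g y) 0).
  by apply/funext => y; rewrite -mulrBr -opprB -max_split mulrNN.
rewrite Ex_split; try (by move=> y; rewrite mulr_ge0); try exact: domZ.
by rewrite !posZ// /Ex; ring.
Qed.

Lemma ExB k g h : dom g -> dom h -> Ex k (fun y => g y - h y) = Ex k g - Ex k h.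
Proof.
move=> dg dh; rewrite -[- Ex k h]mulN1r -ExZ// -ExD//; last exact: domZ.
by congr (Ex k _); apply/funext => y; rewrite mulN1r.
Qed.

Lemma dom0 : dom (fun=> 0).
Proof. by exists 0 => y; rewrite normr0 mul0r. Qed.

Lemma dom_sum (I : Type) (r : seq I) (G : I -> X d -> R) : (forall i, dom (G i)) ->
  dom (fun y => \sum_(i <- r) G i y).
Proof.
move=> dG; elim: r => [|i r IH].
  by rewrite (_ : (fun y => _) = (fun=> 0)); [exact: dom0|apply/funext => y; rewrite big_nil].
rewrite (_ : (fun y => _) = (fun y => G i y + \sum_(i <- r) G i y)); first exact: domD.
by apply/funext => y; rewrite big_cons.
Qed.

Lemma Ex0 k : Ex k (fun=> 0) = 0.
Proof.
have := ExZ k 0 dom_wgt; rewrite mul0r; apply: etrans.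
by congr (Ex k _); apply/funext => y; rewrite mul0r.
Qed.

Lemma Ex_sum k (I : Type) (r : seq I) (G : I -> X d -> R) : (forall i, dom (G i)) ->
  Ex k (fun y => \sum_(i <- r) G i y) = \sum_(i <- r) Ex k (G i).
Proof.
move=> dG; elim: r => [|i r IH].
  rewrite big_nil; apply: etrans (Ex0 k).
  by congr (Ex k _); apply/funext => y; rewrite big_nil.
rewrite big_cons -IH -ExD//; last exact: dom_sum.
by congr (Ex k _); apply/funext => y; rewrite big_cons.
Qed.

Lemma Ex_le k g h : dom g -> dom h -> (forall y, g y <= h y) -> Ex k g <= Ex k h.
Proof.
move=> dg dh gh; rewrite -subr_ge0 -ExB//; apply: Ex_ge0 => [y|].
  by rewrite subr_ge0.
by apply: domD => //; exact: domN.
Qed.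

Lemma Ex_wgt k : Ex k wgt <= c + 2.
Proof.
rewrite -lee_fin -ExE ?esum_wgt//; last exact: dom_wgt.
by move=> y; rewrite (le_trans _ (wgt_ge2 y)).
Qed.

Lemma dom_third : dom (fun y => (deg y * (deg y).-1 * (deg y).-2)%:R).
Proof.
apply: dom_le dom_wgt _ => y.
rewrite !ger0_norm ?lerDl//; last by rewrite (le_trans _ (wgt_ge2 y)).
Qed.

Lemma Ex_third k : Ex k (fun y => (deg y * (deg y).-1 * (deg y).-2)%:R) <= c.
Proof. by rewrite -lee_fin -ExE ?esum_third_moment//; exact: dom_third. Qed.

Lemma dom_bound g : (forall y, `|g y| <= wgt y) -> dom g.
Proof. by move=> gw; exists 1 => y; rewrite mul1r. Qed.

Lemma dom_vpow x : inC x -> dom (vpow x).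
Proof.
move=> xC; apply: dom_bound => y; rewrite ger0_norm ?vpow_ge0//.
by rewrite (le_trans (vpow_le1 _ xC))// (le_trans _ (wgt_ge2 y))// ler1n.
Qed.

Lemma deg_wgt y : (deg y)%:R <= wgt y.
Proof.
rewrite /wgt -natrD ler_nat; case: (deg y) => [//|[//|[//|n]]] /=.
by rewrite -mulnA; apply: leq_trans (leq_addr _ _); rewrite leq_pmulr// muln_gt0.
Qed.

Lemma deg2_wgt y : (deg y * (deg y).-1)%:R <= wgt y.
Proof.
rewrite /wgt -natrD ler_nat; case: (deg y) => [//|[//|[//|n]]] /=.
by apply: leq_trans (leq_addr _ _); rewrite leq_pmulr.
Qed.

Lemma le_deg y l : (y l <= deg y)%N.
Proof. by rewrite /deg (bigD1 l)//= leq_addr. Qed.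

Lemma dmon_bound y l x : inC x -> 0 <= dmon y l x <= (y l)%:R.
Proof.
move=> xC; rewrite /dmon mulr_ge0 ?vpow_ge0//=.
by rewrite ler_piMr// vpow_le1.
Qed.

Lemma dom_dmon l x : inC x -> dom (fun y => dmon y l x).
Proof.
move=> xC; apply: dom_bound => y; have /andP[h0 h1] := dmon_bound y l xC.
rewrite ger0_norm// (le_trans h1)// (le_trans _ (deg_wgt y))// ler_nat.
exact: le_deg.
Qed.

Definition fct2 l m y : R := (y l * (y m - (l == m)))%:R.

Lemma fct2_le y l m : fct2 l m y <= (deg y * (deg y).-1)%:R.
Proof.
rewrite /fct2 ler_nat -sum_fact2_all (bigD1 l)//= (bigD1 m)//=.
by rewrite -addnA leq_addr.
Qed.

Lemma dom_fct2 l m : dom (fct2 l m).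
Proof.
apply: dom_bound => y; rewrite ger0_norm//.
exact: le_trans (fct2_le _ _ _) (deg2_wgt _).
Qed.

Lemma pgfE x k : inC x -> pgf p x k 0 = Ex k (vpow x).
Proof.
move=> xC; rewrite mxE ExE//; last exact: dom_vpow.
by move=> y; exact: vpow_ge0.
Qed.

Lemma MatE x k l : inC x -> Mat p x k l = Ex k (fun y => dmon y l x).
Proof.
move=> xC; rewrite mxE; under eq_esum do rewrite -mulrA.
rewrite ExE//; last exact: dom_dmon.
by move=> y; case/andP: (dmon_bound y l xC).
Qed.

Definition bm k l m : R := fine (bmom p k l m).

Lemma bmomE k l m : bmom p k l m = (bm k l m)%:E.
Proof. by rewrite /bm /bmom ExE//; exact: dom_fct2. Qed.

Lemma bmE k l m : bm k l m = Ex k (fct2 l m).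
Proof. by rewrite /bm /bmom ExE//; exact: dom_fct2. Qed.

Lemma bm_ge0 k l m : 0 <= bm k l m.
Proof. by rewrite bmE; apply: Ex_ge0 => //; exact: dom_fct2. Qed.

Lemma sum_bm k : \sum_l \sum_m bm k l m <= c + 2.
Proof.
have dm l : dom (fun y => \sum_m fct2 l m y) by apply: dom_sum => m; exact: dom_fct2.
rewrite (eq_bigr (fun l => Ex k (fun y => \sum_m fct2 l m y))); last first.
  move=> l _; rewrite Ex_sum; last by move=> m; exact: dom_fct2.
  by apply: eq_bigr => m _; rewrite bmE.
rewrite -Ex_sum//; apply: le_trans (Ex_wgt k); apply: Ex_le.
- exact: dom_sum.
- exact: dom_wgt.
move=> y; rewrite (le_trans _ (deg2_wgt y))// -sum_fact2_all natr_sum.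
by apply: ler_sum => l _; rewrite natr_sum.
Qed.

Lemma bm_le k l m : bm k l m <= c + 2.
Proof.
apply: le_trans (sum_bm k); rewrite (bigD1 l)//= (bigD1 m)//= -addrA lerDl.
rewrite addr_ge0// sumr_ge0// => i _; first exact: bm_ge0.
by rewrite sumr_ge0// => j _; exact: bm_ge0.
Qed.

Let C1 := @inC_one R d.

Lemma Mat_ge0 x k l : inC x -> 0 <= Mat p x k l.
Proof.
move=> xC; rewrite MatE//; apply: Ex_ge0; last exact: dom_dmon.
by move=> y; case/andP: (dmon_bound y l xC).
Qed.

Lemma dmon_mono y l x x' : inC x -> inC x' -> (forall i, x i 0 <= x' i 0) ->
  dmon y l x <= dmon y l x'.
Proof. by move=> xC xC' xx'; rewrite /dmon ler_wpM2l// vpow_mono. Qed.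

Lemma Mat_mono x x' k l : inC x -> inC x' -> (forall i, x i 0 <= x' i 0) ->
  Mat p x k l <= Mat p x' k l.
Proof.
move=> xC xC' xx'; rewrite !MatE//; apply: Ex_le; try exact: dom_dmon.
by move=> y; exact: dmon_mono.
Qed.

Lemma Mat_le x k l : inC x -> Mat p x k l <= c + 2.
Proof.
move=> xC; rewrite MatE//; apply: le_trans (Ex_wgt k); apply: Ex_le.
- exact: dom_dmon.
- exact: dom_wgt.
move=> y; have /andP[_ h1] := dmon_bound y l xC.
by rewrite (le_trans h1)// (le_trans _ (deg_wgt y))// ler_nat le_deg.
Qed.

Lemma pgf_one : pgf p (one_v R d) = one_v R d.
Proof.
apply/matrixP => k i; rewrite ord1 [RHS]mxE pgfE//; apply: EFin_inj.
rewrite -ExE; [|by move=> y; rewrite vpow_ge0|exact: dom_vpow].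
by under eq_esum do rewrite vpow_one mulr1; exact: po.2.
Qed.

Lemma pgf_slope x x' k : inC x -> inC x' -> (forall i, x i 0 <= x' i 0) ->
  \sum_l Mat p x k l * (x' l 0 - x l 0) <= pgf p x' k 0 - pgf p x k 0
     <= \sum_l Mat p x' k l * (x' l 0 - x l 0).
Proof.
move=> xC xC' xx'.
have dd (z : 'cV[R]_d) l : inC z -> dom (fun y => dmon y l z * (x' l 0 - x l 0)).
  move=> zC; rewrite (_ : (fun y => _) = (fun y => (x' l 0 - x l 0) * dmon y l z)).
    by apply: domZ; exact: dom_dmon.
  by apply/funext => y; rewrite mulrC.
have e (z : 'cV[R]_d) : inC z -> \sum_l Mat p z k l * (x' l 0 - x l 0) =
    Ex k (fun y => \sum_l dmon y l z * (x' l 0 - x l 0)).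
  move=> zC; rewrite Ex_sum; last by move=> l; exact: dd.
  apply: eq_bigr => l _; rewrite MatE// mulrC -ExZ; last exact: dom_dmon.
  by congr (Ex k _); apply/funext => y; rewrite mulrC.
rewrite !e// !pgfE// -ExB; try exact: dom_vpow.
have dv : dom (fun y => vpow x' y - vpow x y).
  by apply: domD; [|apply: domN]; exact: dom_vpow.
by apply/andP; split; (apply: Ex_le => //;
  [by apply: dom_sum => l; exact: dd
  |by move=> y; case/andP: (monomial_slope y xC xC' xx')]) || (apply: Ex_le => //;
  [by apply: dom_sum => l; exact: dd
  |by move=> y; case/andP: (monomial_slope y xC xC' xx')]).
Qed.

Lemma sum_bmE k l q : \sum_m bm k l m * q m 0 = Ex k (fun y => \sum_m fct2 l m y * q m 0).
Proof.
rewrite Ex_sum; last first.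
  move=> m; rewrite (_ : (fun y => _) = (fun y => q m 0 * fct2 l m y)).
    by apply: domZ; exact: dom_fct2.
  by apply/funext => y; rewrite mulrC.
apply: eq_bigr => m _; rewrite bmE mulrC -ExZ; last exact: dom_fct2.
by congr (Ex k _); apply/funext => y; rewrite mulrC.
Qed.

Lemma dom_sum_fct2 l q : dom (fun y => \sum_m fct2 l m y * q m 0).
Proof.
apply: dom_sum => m; rewrite (_ : (fun y => _) = (fun y => q m 0 * fct2 l m y)).
  by apply: domZ; exact: dom_fct2.
by apply/funext => y; rewrite mulrC.
Qed.

Lemma fct2_e1 l y q : \sum_m fct2 l m y * q m 0 = (y l)%:R * e1 (sub_x y (unitv l)) q.
Proof.
rewrite mulr_sumr; apply: eq_bigr => m _.
by rewrite /fct2 natrM !ffunE mulrA [m == l]eq_sym.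
Qed.

Lemma Mat_slope x x' k l : inC x -> inC x' -> (forall i, x i 0 <= x' i 0) ->
  Mat p x' k l - Mat p x k l <= \sum_m bm k l m * (x' m 0 - x m 0).
Proof.
move=> xC xC' xx'; rewrite !MatE// -ExB; try exact: dom_dmon.
rewrite (eq_bigr (fun m => bm k l m * (x' - x) m 0)); last by move=> m _; rewrite !mxE.
rewrite sum_bmE; apply: Ex_le.
- by apply: domD; [|apply: domN]; exact: dom_dmon.
- exact: dom_sum_fct2.
move=> y; rewrite /dmon -mulrBr fct2_e1 ler_wpM2l//.
have /andP[_ /le_trans] := monomial_slope (sub_x y (unitv l)) xC xC' xx'; apply.
apply: ler_sum => m _; rewrite !mxE ler_wpM2r ?subr_ge0//.
by case/andP: (dmon_bound (sub_x y (unitv l)) m xC').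
Qed.

Lemma inC_one_sub q (z : R) : (forall i, 0 <= q i 0 <= z) -> z <= 1 -> inC (one_v R d - q).
Proof. by move=> qz z1 i; rewrite !mxE; have /andP[? ?] := qz i; lra. Qed.

(** The derivative [dmon y l] at [1 - q] is [y_l] times the monomial of [y - e_l], to which the
    upper Bonferroni bound applies. Its [e2] term costs at most half the third factorial of the
    degree times [z^2]; the factor one half is given away. *)
Lemma Mat_taylor q z k l : (forall i, 0 <= q i 0 <= z) -> z <= 1 ->
  \sum_m bm k l m * q m 0 - c * z ^+ 2 <= Mmean p k l - Mat p (one_v R d - q) k l.
Proof.
move=> qz z1; have qC := inC_one_sub qz z1.
rewrite /Mmean !MatE// -ExB; try exact: dom_dmon.
rewrite sum_bmE lerBlDr.
apply: le_trans (_ : Ex k (fun y => (dmon y l (one_v R d) - dmon y l (one_v R d - q)) +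
  z ^+ 2 * (deg y * (deg y).-1 * (deg y).-2)%:R) <= _); last first.
  rewrite ExD.
  - by rewrite lerD2l ExZ; [rewrite mulrC ler_wpM2r ?sqr_ge0 ?Ex_third|exact: dom_third].
  - by apply: domD; [|apply: domN]; exact: dom_dmon.
  - by apply: domZ; exact: dom_third.
apply: Ex_le.
- exact: dom_sum_fct2.
- apply: domD; last by apply: domZ; exact: dom_third.
  by apply: domD; [|apply: domN]; exact: dom_dmon.
move=> y; rewrite fct2_e1 /dmon -mulrBr vpow_one.
have [->|yl] := posnP (y l); first by rewrite !mul0r add0r mulr_ge0 ?sqr_ge0.
set j := sub_x y _; have [_ hb _] := bonferroni j qz z1.
have /andP[_ he] := e2_bound j qz.
apply: le_trans (_ : (y l)%:R * (1 - vpow (one_v R d - q) j + e2 j q) <= _).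
  by rewrite ler_wpM2l//; lra.
rewrite mulrDr lerD2l.
have dj : deg j = (deg y).-1 by rewrite /j deg_sub.
have n1 : ((deg j)%:R : R) * ((deg j)%:R - 1) = ((deg y).-1 * (deg y).-2)%:R.
  rewrite dj; case: (deg y) => [|[|n]] /=; rewrite ?mul0n ?mul0r//.
  by rewrite natrM -[n.+1%:R]natr1 addrK.
apply: le_trans (ler_wpM2l _ he) _ => //; rewrite n1.
rewrite -mulnA [(deg y * _)%:R]natrM.
have h1 : ((y l)%:R : R) <= (deg y)%:R by rewrite ler_nat le_deg.
have h2 : 0 <= ((deg y).-1 * (deg y).-2)%:R :> R by [].
have h3 : 0 <= z ^+ 2 by exact: sqr_ge0.
have h4 : 0 <= (y l)%:R :> R by [].
have h5 : 0 <= z ^+ 2 * ((deg y).-1 * (deg y).-2)%:R by rewrite mulr_ge0.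
have h6 := ler_wpM2r h5 h1.
have h7 : 0 <= (y l)%:R * (z ^+ 2 * ((deg y).-1 * (deg y).-2)%:R) by rewrite mulr_ge0.
have -> : z ^+ 2 * ((deg y)%:R * ((deg y).-1 * (deg y).-2)%:R) = (deg y)%:R * (z ^+ 2 * ((deg y).-1 * (deg y).-2)%:R) by ring.
have -> : (y l)%:R * (2^-1 * ((deg y).-1 * (deg y).-2)%:R * z ^+ 2) =
  2^-1 * ((y l)%:R * (z ^+ 2 * ((deg y).-1 * (deg y).-2)%:R)) by ring.
lra.
Qed.

Lemma e2_fct2 y q : e2 y q = 2^-1 * \sum_l (\sum_m fct2 l m y * q m 0) * q l 0.
Proof.
rewrite /e2; congr (_ * _).
under [RHS]eq_bigr do rewrite fct2_e1.
rewrite expr2 {1}/e1 mulr_suml -sumrB; apply: eq_bigr => l _.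
have [->|yl] := posnP (y l); first by rewrite !mul0r subr0.
have -> : e1 (sub_x y (unitv l)) q = e1 y q - q l 0.
  rewrite /e1 (bigD1 l)//= [in RHS](bigD1 l)//= !ffunE eqxx natrB//=.
  rewrite (eq_bigr (fun m => (y m)%:R * q m 0)); last first.
    by move=> m /negPf ml; rewrite !ffunE ml subn0.
  by ring.
by rewrite -/(e1 y q); ring.
Qed.

Definition bquad k q : R := 2^-1 * \sum_l (\sum_m bm k l m * q m 0) * q l 0.

(** Bonferroni inequalities under the mean: stopping after two terms bounds from above, and the
    third term costs at most [c z^3], its coefficient [1/6] being dropped. *)
Lemma pgf_taylor q z k : (forall i, 0 <= q i 0 <= z) -> z <= 1 ->
  bquad k q - c * z ^+ 3 <=
    pgf p (one_v R d - q) k 0 - 1 + \sum_l Mmean p k l * q l 0 <= bquad k q.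
Proof.
move=> qz z1; have qC := inC_one_sub qz z1.
have dB : dom (fun y => e2 y q).
  rewrite (_ : (fun y => _) = (fun y => 2^-1 * \sum_l (\sum_m fct2 l m y * q m 0) * q l 0)).
    apply: domZ; apply: dom_sum => l.
    rewrite (_ : (fun y => _) = (fun y => q l 0 * (\sum_m fct2 l m y * q m 0))).
      by apply: domZ; exact: dom_sum_fct2.
    by apply/funext => y; rewrite mulrC.
  by apply/funext => y; exact: e2_fct2.
have -> : bquad k q = Ex k (fun y => e2 y q).
  rewrite (_ : (fun y => e2 y q) = (fun y => 2^-1 * \sum_l (\sum_m fct2 l m y * q m 0) * q l 0)); last first.
    by apply/funext => y; exact: e2_fct2.
  have dl l : dom (fun y => (\sum_m fct2 l m y * q m 0) * q l 0).
    rewrite (_ : (fun y => _) = (fun y => q l 0 * (\sum_m fct2 l m y * q m 0))).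
      by apply: domZ; exact: dom_sum_fct2.
    by apply/funext => y; rewrite mulrC.
  rewrite ExZ; last exact: dom_sum.
  rewrite Ex_sum//; congr (_ * _); apply: eq_bigr => l _; rewrite sum_bmE mulrC -ExZ; last exact: dom_sum_fct2.
  by congr (Ex k _); apply/funext => y; rewrite mulrC.
have de1 : dom (fun y => e1 y q).
  apply: dom_sum => l; rewrite (_ : (fun y => _) = (fun y => q l 0 * (dmon y l (one_v R d)))).
    by apply: domZ; exact: dom_dmon.
  by apply/funext => y; rewrite /dmon vpow_one mulr1 mulrC.
have -> : \sum_l Mmean p k l * q l 0 = Ex k (fun y => e1 y q).
  rewrite /e1 Ex_sum; last first.
    move=> l; rewrite (_ : (fun y => _) = (fun y => q l 0 * (dmon y l (one_v R d)))).
      by apply: domZ; exact: dom_dmon.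
    by apply/funext => y; rewrite /dmon vpow_one mulr1 mulrC.
  apply: eq_bigr => l _; rewrite /Mmean MatE// mulrC -ExZ; last exact: dom_dmon.
  by congr (Ex k _); apply/funext => y; rewrite /dmon vpow_one mulr1 mulrC.
have E1 : 1 = Ex k (vpow (one_v R d)) by rewrite -pgfE// pgf_one mxE.
have dv := dom_vpow qC; have dv1 := dom_vpow C1.
have -> : pgf p (one_v R d - q) k 0 - 1 =
    Ex k (fun y => vpow (one_v R d - q) y - vpow (one_v R d) y).
  by rewrite ExB// -E1 pgfE.
have dvv : dom (fun y => vpow (one_v R d - q) y - vpow (one_v R d) y).
  by apply: domD => //; exact: domN.
rewrite -ExD//.
have dP : dom (fun y => vpow (one_v R d - q) y - vpow (one_v R d) y + e1 y q).
  by apply: domD => //; apply: domD => //; exact: domN.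
apply/andP; split; last first.
  by apply: Ex_le => // y; rewrite vpow_one; have [_ h _] := bonferroni y qz z1; lra.
rewrite lerBlDr.
apply: le_trans (_ : Ex k (fun y => (vpow (one_v R d - q) y - vpow (one_v R d) y + e1 y q) +
  z ^+ 3 * (deg y * (deg y).-1 * (deg y).-2)%:R) <= _).
  apply: Ex_le => //.
    by apply: domD => //; apply: domZ; exact: dom_third.
  move=> y; rewrite vpow_one; have [_ _ h] := bonferroni y qz z1.
  have e : (deg y * (deg y).-1 * (deg y).-2)%:R = (deg y)%:R * ((deg y)%:R - 1) * ((deg y)%:R - 2) :> R.
    case: (deg y) => [|[|n]] /=; rewrite ?(mul0n, mul0r, muln0, subrr, mulr0)//.
    by rewrite !natrM -![n.+2%:R]natr1 -![n.+1%:R]natr1; ring.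
  rewrite -e in h.
  have z0 : 0 <= z ^+ 3.
    by have /andP[q0 q1] := qz k; rewrite exprn_ge0// (le_trans q0 q1).
  have t0 : 0 <= z ^+ 3 * (deg y * (deg y).-1 * (deg y).-2)%:R by rewrite mulr_ge0.
  have : 6^-1 * (deg y * (deg y).-1 * (deg y).-2)%:R * z ^+ 3 =
     6^-1 * (z ^+ 3 * (deg y * (deg y).-1 * (deg y).-2)%:R) by ring.
  lra.
rewrite ExD//; last by apply: domZ; exact: dom_third.
rewrite lerD2l ExZ; last exact: dom_third.
rewrite mulrC ler_wpM2r ?Ex_third//.
by have /andP[q0 q1] := qz k; rewrite exprn_ge0// (le_trans q0 q1).
Qed.

End Expectation.

(** * Perron theory of primitive matrices *)

Section Perron.
Variables (R : realType) (d : nat).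
Implicit Types (A : 'M[R]_d) (u v x : 'cV[R]_d) (lam : R).

Definition dotp v x : R := \sum_i v i 0 * x i 0.
(** With the left Perron vector as weight, [A] has norm at most [lam], so iteration loses no
    constant, and on nonnegative vectors the norm is the linear form [v' x]. *)
Definition wnorm v x : R := \sum_i v i 0 * `|x i 0|.

Lemma mulmx_cE A x i : (A *m x) i 0 = \sum_j A i j * x j 0.
Proof. by rewrite mxE. Qed.

Lemma mulmx_exprS A n x : A ^+ n.+1 *m x = A *m (A ^+ n *m x).
Proof. by rewrite exprS mulmxA. Qed.

Lemma mulmx_exprSr A n x : A ^+ n.+1 *m x = A ^+ n *m (A *m x).
Proof. by rewrite exprSr mulmxA. Qed.

Lemma eigen_expr A lam x n : A *m x = lam *: x -> A ^+ n *m x = lam ^+ n *: x.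
Proof.
move=> e; elim: n => [|n IH]; first by rewrite !expr0 mul1mx scale1r.
by rewrite mulmx_exprS IH -scalemxAr e scalerA exprSr.
Qed.

Lemma pos_mulmx_gt0 A x : (forall i j, 0 < A i j) -> (forall i, 0 <= x i 0) ->
  x != 0 -> forall i, 0 < (A *m x) i 0.
Proof.
move=> A0 x0 xn0 i; rewrite mulmx_cE.
have [j xj] : exists j, 0 < x j 0.
  apply: contrapT => /forallNP h; case/negP: xn0; apply/eqP/matrixP => j k.
  by rewrite ord1 mxE; apply/eqP; rewrite eq_le x0 andbT leNgt; apply/negP/h.
rewrite (bigD1 j)//= ltr_wpDr ?mulr_gt0//.
by apply: sumr_ge0 => k _; rewrite mulr_ge0// ltW.
Qed.

Lemma finite_lower_bound (I : finType) (F G : I -> R) :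
  (forall i, 0 < F i) -> (forall i, 0 < G i) ->
  exists2 e, 0 < e & forall i, e * F i <= G i.
Proof.
move=> F0 G0; exists (1 + \sum_i F i / G i)^-1.
  by rewrite invr_gt0 ltr_pwDl// sumr_ge0// => i _; rewrite divr_ge0// ltW.
move=> i; rewrite mulrC ler_pdivrMr; last first.
  by rewrite ltr_pwDl// sumr_ge0// => j _; rewrite divr_ge0// ltW.
rewrite -ler_pdivrMl// mulrC (bigD1 i)//= addrCA lerDl addr_ge0// sumr_ge0// => j _.
by rewrite divr_ge0// ltW.
Qed.

Lemma closed_preimage_continuous (T : topologicalType) (g : T -> R) (D : set R) :
  continuous g -> closed D -> closed (g @^-1` D).
Proof. by move=> cg; apply: preimage_closed => x _; exact: cg. Qed.

(* The pair [(lam, x)] is coded as a single row so that the compactness of boxes in ['rV]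
   applies; at a maximum of [lam] subject to [A x >= lam x], the defect [A x - lam x]
   vanishes, for otherwise [A ^+ U] turns it into a strictly positive vector. *)
Lemma perron_vector_exists A U : (0 < d)%N -> (0 < U)%N -> (forall i j, 0 <= A i j) ->
  (forall i j, 0 < (A ^+ U) i j) ->
  exists lam u, [/\ 0 < lam, (forall i, 0 < u i 0), A *m u = lam *: u & \sum_i u i 0 = 1].
Proof.
move=> d0 U0 A0 AU0.
have AUx x : (forall i, 0 <= x i 0) -> x != 0 -> forall i, 0 < (A ^+ U *m x) i 0.
  exact: pos_mulmx_gt0.
(* Admissible pairs lie in a box: [x_i <= 1], and summing [lam x_i <= (A x)_i] gives [lam <= L]. The
   single bound [1 + L] serves every coordinate. *)
pose L := \sum_i \sum_j A i j.
pose cl (z : 'rV[R]_d.+1) : R := z ord0 ord0.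
pose cx (z : 'rV[R]_d.+1) : 'cV[R]_d := \col_i z ord0 (lift ord0 i).
pose S := [set z : 'rV[R]_d.+1 | (forall i, 0 <= z ord0 i <= 1 + L)
   /\ (\sum_i cx z i 0 = 1 /\ forall i, 0 <= (A *m cx z) i 0 - cl z * cx z i 0)].
have coordc i : continuous (fun z : 'rV[R]_d.+1 => z ord0 i) by exact: coord_continuous.
have sumc (F : 'I_d -> 'rV[R]_d.+1 -> R) : (forall i, continuous (F i)) ->
    continuous (fun z => \sum_i F i z).
  by move=> cF; apply: continuous_big => //; exact: add_continuous.
have cS : compact S.
  have cB : compact [set z : 'rV[R]_d.+1 | forall i, `[0, 1 + L]%classic (z ord0 i)].
    by apply: (@rV_compact _ _ (fun=> `[0, 1 + L]%classic)) => i; exact: segment_compact.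
  apply: (subclosed_compact _ cB); last first.
    by move=> z [h _] i /=; rewrite in_itv/=; exact: h.
  have -> : S = \bigcap_(i in [set: 'I_d.+1]) ((fun z : 'rV[R]_d.+1 => z ord0 i) @^-1` `[0, 1 + L]%classic)
     `&` (((fun z => \sum_i cx z i 0) @^-1` [set x | x = 1]) `&`
     \bigcap_(i in [set: 'I_d]) ((fun z => (A *m cx z) i 0 - cl z * cx z i 0) @^-1` [set x | 0 <= x])).
    apply/seteqP; split=> z [h1 [h2 h3]]; split => //.
    - by move=> i _ /=; rewrite in_itv/=; exact: h1.
    - by split=> // i _; exact: h3.
    - by move=> i; have := h1 i I; rewrite /= in_itv.
    - by split=> // i; exact: h3.
  apply: closedI.
    by apply: closed_bigI => i _; apply: closed_preimage_continuous => //; exact: itv_closed.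
  apply: closedI.
    apply: closed_preimage_continuous; last exact: closed_eq.
    apply: sumc => i; rewrite (_ : (fun z => _) = (fun z : 'rV[R]_d.+1 => z ord0 (lift ord0 i)))//.
    by apply/funext => z; rewrite mxE.
  apply: closed_bigI => i _; apply: closed_preimage_continuous; last exact: closed_ge.
  rewrite (_ : (fun z => _) = (fun z : 'rV[R]_d.+1 => \sum_j A i j * z ord0 (lift ord0 j)
     - z ord0 ord0 * z ord0 (lift ord0 i))); last first.
    by apply/funext => z; rewrite !mxE /cl; congr (_ - _); apply: eq_bigr => j _; rewrite mxE.
  have cs : continuous (fun z : 'rV[R]_d.+1 => \sum_j A i j * z ord0 (lift ord0 j)).
    apply: sumc => j z.
    have cj : {for z, continuous (fun z : 'rV[R]_d.+1 => z ord0 (lift ord0 j))} by exact: coordc.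
    by apply: (continuous_comp cj); exact: mulrl_continuous.
  move=> z.
  have c1 : {for z, continuous (fun z : 'rV[R]_d.+1 => \sum_j A i j * z ord0 (lift ord0 j))} by exact: cs.
  have c0 : {for z, continuous (fun z : 'rV[R]_d.+1 => z ord0 ord0)} by exact: coordc.
  have ci : {for z, continuous (fun z : 'rV[R]_d.+1 => z ord0 (lift ord0 i))} by exact: coordc.
  exact: (continuousB c1 (continuousM c0 ci)).
have L0 : 0 <= L by apply: sumr_ge0 => i _; apply: sumr_ge0 => j _.
have mkS lam x : 0 <= lam -> (forall i, 0 <= x i 0) -> \sum_i x i 0 = 1 ->
    (forall i, lam * x i 0 <= (A *m x) i 0) ->
    exists2 z, S z & cl z = lam /\ cx z = x.
  move=> l0 x0 x1 Ax.
  pose z : 'rV[R]_d.+1 := \row_i (if unlift ord0 i is Some k then x k 0 else lam).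
  have clz : cl z = lam by rewrite /cl mxE unlift_none.
  have cxz : cx z = x by apply/matrixP => i k; rewrite !mxE liftK ord1.
  have xle i : x i 0 <= 1.
    by rewrite -x1 (bigD1 i)//= lerDl sumr_ge0.
  exists z => //; split; [|split].
  - move=> i; rewrite mxE; case: unliftP => [k|] _.
      by rewrite x0 (le_trans (xle k))// lerDl.
    have e : lam = \sum_i lam * x i 0 by rewrite -mulr_sumr x1 mulr1.
    rewrite l0 /= e.
    apply: le_trans (_ : L <= _); last by rewrite lerDr.
    apply: ler_sum => k _; apply: le_trans (Ax k) _; rewrite mulmx_cE.
    by apply: ler_sum => j _; rewrite ler_piMr.
  - by rewrite cxz.
  - by move=> i; rewrite clz cxz subr_ge0.
have [z0 Sz0 _] : exists2 z, S z & cl z = 0 /\ cx z = \col_i (d%:R)^-1.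
  apply: mkS => //.
  - by move=> i; rewrite mxE invr_ge0.
  - under eq_bigr do rewrite mxE.
    by rewrite sumr_const card_ord -[LHS]mulr_natr mulVf// pnatr_eq0 -lt0n.
  - move=> i; rewrite mul0r mulmx_cE sumr_ge0// => j _.
    by rewrite mulr_ge0// mxE invr_ge0.
have [z /set_mem Sz maxz] := compact_EVT_max (ex_intro _ z0 Sz0) cS
   (continuous_subspaceT (coordc ord0)).
have {}maxz y : S y -> cl y <= cl z by move=> Sy; apply: maxz; exact: mem_set.
case: (Sz) => bz [x1 Ax].
set x := cx z in x1 Ax; set lam := cl z in Ax maxz.
have x0 i : 0 <= x i 0 by rewrite mxE; case/andP: (bz (lift ord0 i)).
have lam0 : 0 <= lam by case/andP: (bz ord0).
have xn0 : x != 0.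
  apply/eqP => xe; move: x1; rewrite xe big1; last by move=> i _; rewrite mxE.
  by move/eqP; rewrite eq_sym oner_eq0.
have e : A *m x = lam *: x.
  apply/eqP; rewrite -subr_eq0; apply/negPn/negP => yn0.
  set y := A *m x - lam *: x in yn0.
  have y0 i : 0 <= y i 0 by have := Ax i; rewrite /y !mxE.
  have By := AUx _ y0 yn0; have Bx := AUx _ x0 xn0.
  have [eps eps0 epsle] := finite_lower_bound Bx By.
  have sB : 0 < \sum_i (A ^+ U *m x) i 0.
    rewrite (bigD1 (Ordinal d0))//= ltr_wpDr// sumr_ge0// => i _; exact: ltW.
  (* The competitor that would beat the maximum: [A (A^U x) = A^U y + lam A^U x >= (lam + eps) A^U
     x], because [A^U y >= eps A^U x]. *)
  pose x' := (\sum_i (A ^+ U *m x) i 0)^-1 *: (A ^+ U *m x).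
  have [] := mkS (lam + eps) x'.
  - by rewrite addr_ge0// ltW.
  - by move=> i; rewrite mxE mulr_ge0 ?invr_ge0 ?ltW.
  - under eq_bigr do rewrite mxE.
    by rewrite -mulr_sumr mulVf// gt_eqF.
  - move=> i; have h := epsle i; rewrite /x' -scalemxAr.
    have -> : A *m (A ^+ U *m x) = A ^+ U *m y + lam *: (A ^+ U *m x).
      rewrite -mulmx_exprS mulmx_exprSr scalemxAr -mulmxDr; congr (_ *m _).
      by rewrite /y subrK.
    move: h; move: (A ^+ U *m x) (A ^+ U *m y) sB => X1 X2 sB h.
    have scE (e : R) (w : 'cV[R]_d) : (e *: w) i 0 = e * w i 0 by rewrite mxE.
    have adE (w w' : 'cV[R]_d) : (w + w') i 0 = w i 0 + w' i 0 by rewrite mxE.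
    rewrite !scE adE scE mulrCA ler_wpM2l ?invr_ge0 ?(ltW sB)//.
    by rewrite mulrDl addrC lerD2r.
  - move=> w Sw [clw _]; have := maxz _ Sw; rewrite clw.
    by rewrite gerDl leNgt eps0.
have lamU i : 0 < lam ^+ U * x i 0.
  by have := AUx _ x0 xn0 i; rewrite (eigen_expr _ e) mxE.
have x00 i : 0 < x i 0.
  by rewrite lt_neqAle x0 andbT; apply/negP => /eqP h; have := lamU i; rewrite -h mulr0 ltxx.
exists lam, x; split=> //.
rewrite lt_neqAle lam0 andbT; apply/negP => /eqP h.
by have := lamU (Ordinal d0); rewrite -h expr0n eqn0Ngt U0 /= mul0r ltxx.
Qed.

(** Positivity is part of the data, so that estimates run without any spectral argument.
    [perron_rootE], [perron_rightE] and [perron_leftE] identify such a triple with the quantities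
    defined through [sup] and [xget]. *)
Record perron A lam u v : Prop := Perron {
  perron_lam_gt0 : 0 < lam;
  perron_u_gt0 : forall i, 0 < u i 0;
  perron_v_gt0 : forall i, 0 < v i 0;
  perron_eigen_r : A *m u = lam *: u;
  perron_eigen_l : forall j, \sum_i v i 0 * A i j = lam * v j 0;
  perron_sum : \sum_i u i 0 = 1;
  perron_dot : dotp v u = 1 }.

Lemma trmx_expr A n : (A ^+ n)^T = A^T ^+ n.
Proof.
elim: n => [|n IH]; first by rewrite !expr0 trmx1.
by rewrite exprS trmx_mul IH exprSr.
Qed.

(** The existence result is applied to [A] and to its transpose. The two eigenvalues agree: evaluate
    [v' A u] in both ways and divide by [v' u > 0]. *)
Lemma perron_exists A U : (0 < d)%N -> (0 < U)%N -> (forall i j, 0 <= A i j) ->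
  (forall i j, 0 < (A ^+ U) i j) -> exists lam u v, perron A lam u v.
Proof.
move=> d0 U0 A0 AU0.
have [lam [u [l0 u0 Au u1]]] := perron_vector_exists d0 U0 A0 AU0.
have [lam' [v [l0' v0 Av v1]]] : exists lam u, [/\ 0 < lam, (forall i, 0 < u i 0),
    A^T *m u = lam *: u & \sum_i u i 0 = 1].
  apply: (@perron_vector_exists _ U) => //.
  - by move=> i j; rewrite mxE.
  - by move=> i j; rewrite -trmx_expr mxE.
have vA j : \sum_i v i 0 * A i j = lam' * v j 0.
  have := congr1 (fun M : 'cV_d => M j 0) Av; rewrite !mxE => <-.
  by apply: eq_bigr => i _; rewrite mxE mulrC.
have vu0 : 0 < dotp v u.
  rewrite /dotp (bigD1 (Ordinal d0))//= ltr_pwDl ?mulr_gt0// sumr_ge0// => i _.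
  by rewrite mulr_ge0// ltW.
have ll : lam' = lam.
  have : \sum_i v i 0 * (A *m u) i 0 = lam' * dotp v u.
    under eq_bigr do rewrite mulmx_cE mulr_sumr.
    rewrite exchange_big /= /dotp mulr_sumr; apply: eq_bigr => j _.
    by rewrite mulrA -vA mulr_suml; apply: eq_bigr => i _; rewrite mulrA.
  rewrite Au; under eq_bigr do rewrite mxE mulrCA.
  by rewrite -mulr_sumr -/(dotp v u) => /mulIf -> //; rewrite gt_eqF.
rewrite {}ll in vA.
exists lam, u, ((dotp v u)^-1 *: v); split=> //.
- by move=> i; rewrite mxE mulr_gt0// invr_gt0.
- move=> j; rewrite mxE mulrCA -vA mulr_sumr.
  by apply: eq_bigr => i _; rewrite mxE mulrA.
- rewrite /dotp; under eq_bigr do rewrite mxE -mulrA.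
  by rewrite -mulr_sumr mulVf// gt_eqF.
Qed.

Section PerronTheory.
Variables (A : 'M[R]_d) (lam : R) (u v : 'cV[R]_d).
Hypothesis P : perron A lam u v.
Hypothesis A0 : forall i j, 0 <= A i j.

Lemma dotp_mulmx x : dotp v (A *m x) = lam * dotp v x.
Proof.
rewrite /dotp; under eq_bigr do rewrite mulmx_cE mulr_sumr.
rewrite exchange_big /= mulr_sumr; apply: eq_bigr => j _.
by rewrite mulrA -(perron_eigen_l P) mulr_suml; apply: eq_bigr => i _; rewrite mulrA.
Qed.

Lemma dotpD x y : dotp v (x + y) = dotp v x + dotp v y.
Proof. by rewrite /dotp -big_split; apply: eq_bigr => i _; rewrite mxE mulrDr. Qed.

Lemma dotpZ (r : R) x : dotp v (r *: x) = r * dotp v x.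
Proof. by rewrite /dotp mulr_sumr; apply: eq_bigr => i _; rewrite mxE mulrCA. Qed.

Lemma dotpN x : dotp v (- x) = - dotp v x.
Proof. by rewrite -scaleN1r dotpZ mulN1r. Qed.

Lemma dotpB x y : dotp v (x - y) = dotp v x - dotp v y.
Proof. by rewrite dotpD dotpN. Qed.

Let v0 i : 0 <= v i 0. Proof. exact: ltW (perron_v_gt0 P i). Qed.

Lemma wnorm_ge0 x : 0 <= wnorm v x.
Proof. by apply: sumr_ge0 => i _; rewrite mulr_ge0. Qed.

Lemma wnorm_eq0 x : wnorm v x = 0 -> x = 0.
Proof.
move=> /eqP; rewrite psumr_eq0; last by move=> i _; rewrite mulr_ge0.
move=> /allP h; apply/matrixP => i j; rewrite ord1 mxE.
have := h i (mem_index_enum _); rewrite /= mulf_eq0 (gt_eqF (perron_v_gt0 P i)) /= normr_eq0.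
by move/eqP.
Qed.

Lemma wnorm_pos x : (forall i, 0 <= x i 0) -> wnorm v x = dotp v x.
Proof. by move=> x0; apply: eq_bigr => i _; rewrite ger0_norm. Qed.

Lemma wnormD x y : wnorm v (x + y) <= wnorm v x + wnorm v y.
Proof.
rewrite /wnorm -big_split; apply: ler_sum => i _ /=; rewrite -mulrDr mxE.
by rewrite ler_wpM2l// ler_normD.
Qed.

Lemma wnormZ (r : R) x : wnorm v (r *: x) = `|r| * wnorm v x.
Proof. by rewrite /wnorm mulr_sumr; apply: eq_bigr => i _; rewrite mxE normrM mulrCA. Qed.

Lemma wnormN x : wnorm v (- x) = wnorm v x.
Proof. by rewrite -scaleN1r wnormZ normrN1 mul1r. Qed.

Lemma dotp_le_wnorm x : `|dotp v x| <= wnorm v x.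
Proof.
apply: le_trans (ler_norm_sum _ _ _) _; apply: ler_sum => i _.
by rewrite normrM ger0_norm.
Qed.

Lemma wnorm_mulmx x : wnorm v (A *m x) <= lam * wnorm v x.
Proof.
apply: le_trans (_ : \sum_i v i 0 * \sum_j A i j * `|x j 0| <= _).
  apply: ler_sum => i _; rewrite ler_wpM2l// mulmx_cE.
  apply: le_trans (ler_norm_sum _ _ _) _; apply: ler_sum => j _.
  by rewrite normrM ger0_norm.
under eq_bigr do rewrite mulr_sumr.
rewrite exchange_big /= /wnorm mulr_sumr; apply: ler_sum => j _.
rewrite mulrA -(perron_eigen_l P) mulr_suml; apply: ler_sum => i _.
by rewrite mulrA.
Qed.

Lemma wnorm_u : wnorm v u = 1.
Proof. by rewrite wnorm_pos ?(perron_dot P)// => i; exact: ltW (perron_u_gt0 P i). Qed.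

Definition orth x : 'cV[R]_d := x - dotp v x *: u.

Lemma orth_dotp x : dotp v (orth x) = 0.
Proof. by rewrite dotpB dotpZ (perron_dot P) mulr1 subrr. Qed.

Lemma orthE x : x = dotp v x *: u + orth x.
Proof. by rewrite addrC subrK. Qed.

Lemma orthD x y : orth (x + y) = orth x + orth y.
Proof. by rewrite /orth dotpD scalerDl opprD addrACA. Qed.

Lemma orthZ (r : R) x : orth (r *: x) = r *: orth x.
Proof. by rewrite /orth dotpZ scalerBr scalerA. Qed.

Lemma orth_mulmx x : orth (A *m x) = A *m orth x.
Proof.
by rewrite /orth dotp_mulmx mulmxBr -scalemxAr (perron_eigen_r P) scalerA mulrC.
Qed.

Lemma wnorm_orth x : wnorm v (orth x) <= 2 * wnorm v x.
Proof.
apply: le_trans (wnormD _ _) _; rewrite wnormN wnormZ wnorm_u mulr1.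
have := dotp_le_wnorm x; lra.
Qed.

Section Contraction.
Variables (U : nat) (a : R).
Hypothesis a0 : 0 < a.
Hypothesis AU : forall i j, a <= (A ^+ U) i j.

(** Entries of [A^U] at least [a] bound [u] and [v] from below and [v] from above in terms of [a]
    and [lam^U] alone. This is the source of uniformity over the class. *)
Lemma perron_u_ge i : a <= lam ^+ U * u i 0.
Proof.
have := congr1 (fun M : 'cV_d => M i 0) (eigen_expr U (perron_eigen_r P)).
rewrite mulmx_cE mxE => <-.
rewrite -[a]mulr1 -(perron_sum P) mulr_sumr; apply: ler_sum => j _.
by rewrite ler_wpM2r// ltW// (perron_u_gt0 P).
Qed.

Lemma perron_u_le1 i : u i 0 <= 1.
Proof.
by rewrite -(perron_sum P) (bigD1 i)//= lerDl sumr_ge0// => j _; exact: ltW (perron_u_gt0 P j).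
Qed.

Lemma perron_left_expr n j : \sum_i v i 0 * (A ^+ n) i j = lam ^+ n * v j 0.
Proof.
elim: n j => [|n IH] j.
  rewrite !expr0 (bigD1 j)//= mxE eqxx big1 ?addr0 ?mulr1 ?mul1r// => i /negPf ij.
  by rewrite mxE ij mulr0.
rewrite exprS; under eq_bigr do rewrite mxE mulr_sumr.
rewrite exchange_big /= exprS -mulrA -IH mulr_sumr; apply: eq_bigr => k _.
by rewrite mulrA -(perron_eigen_l P) mulr_suml; apply: eq_bigr => i _; rewrite mulrA.
Qed.

Lemma perron_v_sum : 1 <= \sum_i v i 0.
Proof.
rewrite -(perron_dot P); apply: ler_sum => i _; rewrite ler_piMr//.
exact: perron_u_le1.
Qed.

Lemma perron_v_ge j : a <= lam ^+ U * v j 0.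
Proof.
rewrite -perron_left_expr; apply: le_trans (_ : a * \sum_i v i 0 <= _).
  by rewrite ler_peMr ?perron_v_sum// ltW.
by rewrite mulr_sumr; apply: ler_sum => i _; rewrite mulrC ler_wpM2l.
Qed.

Lemma perron_v_le j : a * v j 0 <= lam ^+ U.
Proof.
have := perron_u_ge j; have lU : 0 < lam ^+ U by rewrite exprn_gt0// (perron_lam_gt0 P).
have : v j 0 * u j 0 <= 1.
  rewrite -(perron_dot P) /dotp (bigD1 j)//= lerDl sumr_ge0// => i _.
  by rewrite mulr_ge0// ltW// (perron_u_gt0 P).
move=> h1 h2.
have h3 := ler_wpM2r (v0 j) h2.
apply: le_trans h3 _; rewrite -mulrA ler_piMr// ?(ltW lU)//.
by rewrite mulrC.
Qed.

(* Doeblin: [A ^+ U] dominates [g u v'] entrywise, and [u v'] kills vectors with [v' x = 0]. *)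
Lemma wnorm_contract (g : R) x : (forall i j, g * (u i 0 * v j 0) <= a) ->
  dotp v x = 0 -> wnorm v (A ^+ U *m x) <= (lam ^+ U - g) * wnorm v x.
Proof.
move=> ga vx.
apply: le_trans (_ : \sum_i v i 0 * \sum_j ((A ^+ U) i j - g * (u i 0 * v j 0)) * `|x j 0| <= _).
  apply: ler_sum => i _; rewrite ler_wpM2l// mulmx_cE.
  have -> : \sum_j (A ^+ U) i j * x j 0 =
     \sum_j ((A ^+ U) i j - g * (u i 0 * v j 0)) * x j 0.
    transitivity (\sum_j (A ^+ U) i j * x j 0 - g * u i 0 * dotp v x).
      by rewrite vx mulr0 subr0.
    rewrite /dotp mulr_sumr -sumrB; apply: eq_bigr => j _; ring.
  apply: le_trans (ler_norm_sum _ _ _) _; apply: ler_sum => j _.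
  by rewrite normrM ger0_norm// subr_ge0 (le_trans (ga i j)).
have -> : \sum_i v i 0 * \sum_j ((A ^+ U) i j - g * (u i 0 * v j 0)) * `|x j 0| =
   \sum_j (\sum_i v i 0 * (A ^+ U) i j - g * v j 0 * \sum_i v i 0 * u i 0) * `|x j 0|.
  under eq_bigr do rewrite mulr_sumr.
  rewrite exchange_big; apply: eq_bigr => j _ /=.
  rewrite mulr_sumr -sumrB mulr_suml; apply: eq_bigr => i _; ring.
have vu : \sum_i v i 0 * u i 0 = 1 := perron_dot P.
rewrite vu /wnorm mulr_sumr; apply: ler_sum => j _; rewrite mulr1.
by rewrite perron_left_expr -mulrBl mulrA.
Qed.

(** By [u_i <= 1] and [v_j <= lam^U / a], the constant [a^2 / lam^U] is admissible in the Doeblin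
    bound. *)
Lemma contract_gap i j : a ^+ 2 / lam ^+ U * (u i 0 * v j 0) <= a.
Proof.
have lU : 0 < lam ^+ U by rewrite exprn_gt0// (perron_lam_gt0 P).
rewrite mulrAC ler_pdivrMr//.
have h1 := perron_u_le1 i; have h2 := perron_v_le j.
have u0 := ltW (perron_u_gt0 P i).
rewrite expr2 -mulrA ler_wpM2l ?(ltW a0)//.
apply: le_trans h2; rewrite mulrCA mulrC ler_piMr// mulr_ge0// ltW//.
Qed.

(** The part of an eigenvector killed by [v] is again an eigenvector for [lam], whereas [A^U]
    multiplies its norm by less than [lam^U]; so it vanishes. *)
Lemma perron_unique x : A *m x = lam *: x -> x = dotp v x *: u.
Proof.
move=> Ax; have ga := contract_gap; set g := a ^+ 2 / lam ^+ U in ga.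
have g0 : 0 < g by rewrite divr_gt0 ?exprn_gt0// (perron_lam_gt0 P).
have vy := orth_dotp x.
have Ay : A *m orth x = lam *: orth x by rewrite -orth_mulmx Ax orthZ.
have := wnorm_contract ga vy; rewrite (eigen_expr U Ay) wnormZ.
rewrite ger0_norm; last by rewrite exprn_ge0// ltW// (perron_lam_gt0 P).
rewrite mulrBl lerBrDr gerDl => h.
have : wnorm v (orth x) = 0.
  apply/eqP; rewrite eq_le wnorm_ge0 andbT.
  by rewrite -(pmulr_rle0 _ g0).
by move/wnorm_eq0/eqP; rewrite subr_eq0 => /eqP.
Qed.

End Contraction.

(** If [w] is a complex left eigenvector for [l], then [|l| |w_j| <= sum_i |w_i| A_ij]; pairing with
    [u > 0] yields [|l| <= lam]. The vector [v] shows that [lam] itself is an eigenvalue. *)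
Lemma perron_rootE : perron_root A = lam.
Proof.
have lr : [set ComplexField.Normc.normc l | l in
   [set l : R[i] | root (char_poly (map_mx (real_complex R) A)) l]] lam.
  exists (lam%:C)%C; last by rewrite /= expr0n/= addr0 sqrtr_sqr ger0_norm// ltW// (perron_lam_gt0 P).
  rewrite /= -eigenvalue_root_char; apply/eigenvalueP.
  exists (map_mx (real_complex R) v^T).
    rewrite -map_mxM -map_mxZ; congr map_mx; apply/matrixP => i j.
    by rewrite ord1 !mxE -(perron_eigen_l P); apply: eq_bigr => k _; rewrite mxE.
  rewrite map_mx_eq0; apply/eqP => /matrixP e.
  have := perron_sum P; rewrite big1; last first.
    move=> i _; have := perron_v_gt0 P i.
    by have := e 0 i; rewrite !mxE => ->; rewrite ltxx.
  by move/eqP; rewrite eq_sym oner_eq0.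
have ub : ubound [set ComplexField.Normc.normc l | l in
   [set l : R[i] | root (char_poly (map_mx (real_complex R) A)) l]] lam.
  move=> _ [l /= + <-]; rewrite -eigenvalue_root_char => /eigenvalueP[w wA wn0].
  pose nw j := ComplexField.Normc.normc (w 0 j).
  have nw0 j : 0 <= nw j by rewrite /nw; case: (w 0 j) => ? ?; exact: sqrtr_ge0.
  have hj j : ComplexField.Normc.normc l * nw j <= \sum_i nw i * A i j.
    rewrite -ComplexField.Normc.normcM.
    have := congr1 (fun M : 'rV_d => M 0 j) wA; rewrite !mxE => <-.
    elim/big_ind2: _ => [|x1 x2 y1 y2 h1 h2|i _].
    - by rewrite ComplexField.Normc.normc0.
    - by apply: le_trans (le_normcD _ _) _; exact: lerD.
    - rewrite ComplexField.Normc.normcM [map_mx _ _ _ _]mxE ler_wpM2l//; first exact: nw0.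
      rewrite (_ : ComplexField.Normc.normc (A i j)%:C%C = A i j)//.
      by rewrite /ComplexField.Normc.normc /= expr0n/= addr0 sqrtr_sqr ger0_norm.
  have s0 : 0 < \sum_j nw j * u j 0.
    have [j wj] : exists j, w 0 j != 0.
      apply: contrapT => /forallNP h; case/negP: wn0; apply/eqP/matrixP => i j.
      by rewrite ord1 [RHS]mxE; apply/eqP/negPn/negP/h.
    rewrite (bigD1 j)//= ltr_pwDl//.
      rewrite mulr_gt0 ?(perron_u_gt0 P)// lt_neqAle nw0 andbT; apply/negP => /eqP.
      by move/esym/ComplexField.Normc.eq0_normc => e; rewrite e eqxx in wj.
    by rewrite sumr_ge0// => k _; rewrite mulr_ge0// ltW// (perron_u_gt0 P).
  rewrite -(ler_pM2r s0) mulr_sumr.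
  apply: le_trans (_ : \sum_j (\sum_i nw i * A i j) * u j 0 <= _).
    by apply: ler_sum => j _; rewrite mulrA ler_wpM2r// ltW// (perron_u_gt0 P).
  rewrite le_eqVlt; apply/orP; left; apply/eqP.
  under eq_bigr do rewrite mulr_suml.
  rewrite exchange_big /= mulr_sumr; apply: eq_bigr => i _.
  have := congr1 (fun M : 'cV_d => M i 0) (perron_eigen_r P).
  rewrite mulmx_cE mxE mulrCA => <-; rewrite mulr_sumr.
  by apply: eq_bigr => j _; rewrite mulrA.
apply/eqP; rewrite eq_le; apply/andP; split.
  by apply: ge_sup => //; exists lam.
by apply: ub_le_sup => //; exists lam.
Qed.

End PerronTheory.

Lemma perron_rightE A lam u v U (a : R) : perron A lam u v -> 0 < a ->
  (forall i j, a <= (A ^+ U) i j) -> (forall i j, 0 <= A i j) -> perron_right A = u.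
Proof.
move=> P a0 AU A0; apply: xget_unique => /=.
  by rewrite (perron_rootE P A0); split; [exact: perron_eigen_r P|exact: perron_sum P].
move=> x [Ax x1]; rewrite (perron_rootE P A0) in Ax.
have := perron_unique P a0 AU Ax => e.
have : dotp v x = 1.
  by move: x1; rewrite {1}e; under eq_bigr do rewrite mxE; rewrite -mulr_sumr (perron_sum P) mulr1.
by move=> e1; rewrite e e1 scale1r.
Qed.

Lemma perron_leftE A lam u v U (a : R) : perron A lam u v -> 0 < a ->
  (forall i j, a <= (A ^+ U) i j) -> (forall i j, 0 <= A i j) -> perron_left A = v.
Proof.
move=> P a0 AU A0; have rE := perron_rightE P a0 AU A0.
have lE := perron_rootE P A0.
apply: xget_unique => /=.
  rewrite rE lE; split.
    apply/matrixP => i j; rewrite ord1 !mxE -(perron_eigen_l P).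
    by apply: eq_bigr => k _; rewrite mxE.
  by rewrite -(perron_dot P); apply: eq_bigr => i _; rewrite mulrC.
move=> x []; rewrite rE lE => xA x1.
have vs : 0 < \sum_i v i 0 by apply: lt_le_trans (perron_v_sum P).
(* Uniqueness of the left vector is uniqueness of the right vector of the transpose. The factor
   [sum v] moves the normalisation from one vector to the other. *)
have P' : perron A^T lam ((\sum_i v i 0)^-1 *: v) ((\sum_i v i 0) *: u).
  split.
  - exact: perron_lam_gt0 P.
  - by move=> i; rewrite mxE mulr_gt0 ?invr_gt0// (perron_v_gt0 P).
  - by move=> i; rewrite mxE mulr_gt0// (perron_u_gt0 P).
  - rewrite -scalemxAr scalerA [lam * _]mulrC -scalerA; congr (_ *: _); apply/matrixP => i j.
    rewrite ord1 mulmx_cE mxE -(perron_eigen_l P); apply: eq_bigr => k _.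
    by rewrite mxE mulrC.
  - move=> j; have := congr1 (fun M : 'cV_d => M j 0) (perron_eigen_r P).
    rewrite mulmx_cE !mxE mulrCA => <-; rewrite mulr_sumr; apply: eq_bigr => i _.
    by rewrite !mxE; ring.
  - under eq_bigr do rewrite mxE.
    by rewrite -mulr_sumr mulVf// gt_eqF.
  - rewrite -[RHS](perron_dot P) /dotp; apply: eq_bigr => i _; rewrite !mxE.
    by field; rewrite gt_eqF.
have Ax : A^T *m x = lam *: x.
  apply/matrixP => i j; rewrite ord1 mulmx_cE.
  have := congr1 (fun M : 'rV_d => M 0 i) xA; rewrite !mxE => <-.
  by apply: eq_bigr => k _; rewrite !mxE mulrC.
have AU' i j : a <= (A^T ^+ U) i j by rewrite -trmx_expr mxE.
have A0' i j : 0 <= A^T i j by rewrite mxE.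
have := perron_unique P' a0 AU' Ax; rewrite scalerA.
have -> : dotp ((\sum_i v i 0) *: u) x = \sum_i v i 0.
  rewrite -[RHS]mulr1 -x1 /dotp mulr_sumr; apply: eq_bigr => i _; rewrite !mxE; ring.
by rewrite mulfV ?scale1r// gt_eqF.
Qed.

End Perron.

(** * One step of the recursion *)

Section OneStep.
Variables (R : realType) (d : nat) (p : offspring R d) (c : R).
Hypothesis po : is_offspring p.
Hypothesis pc : (\sum_(k < d) \sum_(l < d) \sum_(m < d) \sum_(j < d) cmom p k l m j
         <= c%:E)%E.
Variables (lam : R) (u v : 'cV[R]_d) (c0 V : R).
Hypothesis P : perron (Mmean p) lam u v.
Hypothesis c00 : 0 < c0.
Hypothesis vc0 : forall i, c0 <= v i 0.
Hypothesis vV : forall i, v i 0 <= V.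
Hypothesis c_ge0 : 0 <= c.
Implicit Types (x z q s : 'cV[R]_d).

Definition bform x z : R := \sum_k v k 0 * \sum_l \sum_m bm p k l m * x l 0 * z m 0.
Definition Qv : R := 2^-1 * bform u u.
(** It comes from [v_k <= V], [bm <= c + 2] and [sum_l |x_l| <= wnorm v x / c0]. The lock makes the
    constant an atom for the arithmetic tactics; [C3] and [KM] are built alike. *)
Definition Cb : R := locked (V * d%:R * (c + 2) / c0 ^+ 2).

Definition C3 : R := locked (V * d%:R * c / c0 ^+ 3).

Let v0 i : 0 <= v i 0. Proof. exact: ltW (perron_v_gt0 P i). Qed.
Let C1 := @inC_one R d.

Lemma Mmean_ge0 k l : 0 <= Mmean p k l.
Proof. exact: (Mat_ge0 po pc k l C1). Qed.

Lemma V_ge0 (i : 'I_d) : 0 <= V. Proof. exact: le_trans (v0 i) (vV i). Qed.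

Lemma coord_le_wnorm x i : `|x i 0| <= wnorm v x / c0.
Proof.
rewrite ler_pdivlMr// mulrC; apply: le_trans (_ : v i 0 * `|x i 0| <= _).
  by rewrite ler_wpM2r.
by rewrite /wnorm (bigD1 i)//= lerDl sumr_ge0// => j _; rewrite mulr_ge0.
Qed.

Lemma sum_coord_le_wnorm x : \sum_i `|x i 0| <= wnorm v x / c0.
Proof.
rewrite ler_pdivlMr// mulr_suml; apply: ler_sum => i _.
by rewrite mulrC ler_wpM2r.
Qed.

Lemma bform_bound x z : `|bform x z| <= Cb * (wnorm v x * wnorm v z).
Proof.
have nx := sum_coord_le_wnorm x; have nz := sum_coord_le_wnorm z.
have sx0 : 0 <= \sum_i `|x i 0| by exact: sumr_ge0.
have sz0 : 0 <= \sum_i `|z i 0| by exact: sumr_ge0.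
have c20 : 0 <= c + 2 by rewrite addr_ge0.
apply: le_trans (_ : \sum_(k < d) V * ((c + 2) * ((\sum_i `|x i 0|) * (\sum_i `|z i 0|))) <= _).
  apply: le_trans (ler_norm_sum _ _ _) _; apply: ler_sum => k _.
  rewrite normrM ger0_norm//; apply: ler_pM => //.
  apply: le_trans (ler_norm_sum _ _ _) _.
  rewrite mulr_suml mulr_sumr; apply: ler_sum => l _.
  apply: le_trans (ler_norm_sum _ _ _) _.
  rewrite mulr_sumr mulr_sumr; apply: ler_sum => m _.
  rewrite !normrM (ger0_norm (bm_ge0 po pc k l m)) -mulrA.
  by rewrite ler_wpM2r ?mulr_ge0// (bm_le po pc).
rewrite sumr_const card_ord -[leLHS]mulr_natr /Cb -lock.
have h : (\sum_i `|x i 0|) * (\sum_i `|z i 0|) <= wnorm v x * wnorm v z / c0 ^+ 2.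
  by apply: le_trans (ler_pM _ _ nx nz) _ => //; rewrite expr2 invfM mulrACA.
have V0 : 0 <= V * d%:R.
  rewrite mulr_natr -[X in V *+ X]card_ord -sumr_const sumr_ge0// => i _.
  exact: V_ge0 i.
have -> : V * d%:R * (c + 2) / c0 ^+ 2 * (wnorm v x * wnorm v z) =
   V * d%:R * (c + 2) * (wnorm v x * wnorm v z / c0 ^+ 2) by ring.
have -> : V * ((c + 2) * ((\sum_i `|x i 0|) * (\sum_i `|z i 0|))) * d%:R =
   V * d%:R * (c + 2) * ((\sum_i `|x i 0|) * (\sum_i `|z i 0|)) by ring.
by rewrite ler_wpM2l// mulr_ge0.
Qed.

Lemma bformDl x x' z : bform (x + x') z = bform x z + bform x' z.
Proof.
rewrite /bform -big_split; apply: eq_bigr => k _ /=; rewrite -mulrDr; congr (_ * _).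
rewrite -big_split; apply: eq_bigr => l _ /=; rewrite -big_split; apply: eq_bigr => m _ /=.
by rewrite mxE; ring.
Qed.

Lemma bformDr x z z' : bform x (z + z') = bform x z + bform x z'.
Proof.
rewrite /bform -big_split; apply: eq_bigr => k _ /=; rewrite -mulrDr; congr (_ * _).
rewrite -big_split; apply: eq_bigr => l _ /=; rewrite -big_split; apply: eq_bigr => m _ /=.
by rewrite mxE; ring.
Qed.

Lemma bformZl (r : R) x z : bform (r *: x) z = r * bform x z.
Proof.
rewrite /bform mulr_sumr; apply: eq_bigr => k _ /=; rewrite mulrCA; congr (_ * _).
rewrite mulr_sumr; apply: eq_bigr => l _ /=; rewrite mulr_sumr; apply: eq_bigr => m _ /=.
by rewrite mxE; ring.
Qed.

Lemma bformZr (r : R) x z : bform x (r *: z) = r * bform x z.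
Proof.
rewrite /bform mulr_sumr; apply: eq_bigr => k _ /=; rewrite mulrCA; congr (_ * _).
rewrite mulr_sumr; apply: eq_bigr => l _ /=; rewrite mulr_sumr; apply: eq_bigr => m _ /=.
by rewrite mxE; ring.
Qed.

Lemma bform_ge0 x z : (forall i, 0 <= x i 0) -> (forall i, 0 <= z i 0) -> 0 <= bform x z.
Proof.
move=> x0 z0; apply: sumr_ge0 => k _; rewrite mulr_ge0//.
by apply: sumr_ge0 => l _; apply: sumr_ge0 => m _; rewrite !mulr_ge0// (bm_ge0 po pc).
Qed.

Local Notation ort := (orth u v).

(** To leading order only the components along [u] count. Replacing the arguments by their
    projections costs the norms of the parts killed by [v], and those are summable along the
    orbit. *)
Lemma bform_orth x z :
  `|bform x z - 2 * Qv * (dotp v x * dotp v z)| <=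
  Cb * (wnorm v (ort x) * wnorm v z + wnorm v x * wnorm v (ort z)).
Proof.
have e : bform x z = dotp v x * dotp v z * bform u u + dotp v x * bform u (ort z)
   + bform (ort x) z.
  rewrite {1}(orthE u v x) bformDl bformZl; congr (_ + _).
  by rewrite {1}(orthE u v z) bformDr bformZr; ring.
have -> : bform x z - 2 * Qv * (dotp v x * dotp v z) =
    dotp v x * bform u (ort z) + bform (ort x) z.
  by rewrite e /Qv; field.
have h1 := bform_bound (ort x) z; have h2 := bform_bound u (ort z).
rewrite (wnorm_u P) mul1r in h2.
have h3 := dotp_le_wnorm P x.
have h4 : `|dotp v x * bform u (ort z)| <= wnorm v x * (Cb * wnorm v (ort z)).
  by rewrite normrM; apply: ler_pM.
apply: le_trans (ler_normD _ _) _.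
rewrite mulrDr [leRHS]addrC; apply: lerD => //.
by apply: le_trans h4 _; rewrite mulrCA.
Qed.

Definition KM : R := locked (d%:R * (c + 2) / c0).

(** The map [h -> s f(h)] seen from [1]: it carries [1 - H_i] to [1 - H_(i+1)]. *)
Definition dstep s q : 'cV[R]_d := one_v R d - hmul s (pgf p (one_v R d - q)).

Section Step.
Variables (s q : 'cV[R]_d).
Hypothesis sC : inC s.
Hypothesis q0 : forall i, 0 <= q i 0.
Let y := dotp v q.
Let tau := dotp v (one_v R d - s).
Hypothesis yc0 : y / c0 <= 1.

Let wq : wnorm v q = y. Proof. exact: wnorm_pos. Qed.

Let qz i : 0 <= q i 0 <= y / c0.
Proof.
by rewrite q0/=; have := coord_le_wnorm q i; rewrite wq ger0_norm.
Qed.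

Let qC : inC (one_v R d - q). Proof. exact: inC_one_sub qz yc0. Qed.
Let y0 : 0 <= y. Proof. by apply: sumr_ge0 => i _; rewrite mulr_ge0. Qed.
Let yc00 : 0 <= y / c0. Proof. by rewrite divr_ge0// ltW. Qed.

Let s1 i : 0 <= (one_v R d - s) i 0 <= 1.
Proof. by rewrite !mxE; have /andP[? ?] := sC i; lra. Qed.

Let tau0 : 0 <= tau.
Proof. by apply: sumr_ge0 => i _; rewrite mulr_ge0//; case/andP: (s1 i). Qed.

Let beta k := \sum_l Mmean p k l * q l 0 - (1 - pgf p (one_v R d - q) k 0).

Lemma bquadE k : bquad p k q = 2^-1 * \sum_l \sum_m bm p k l m * q l 0 * q m 0.
Proof.
rewrite /bquad; congr (_ * _); apply: eq_bigr => l _; rewrite mulr_suml.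
by apply: eq_bigr => m _; rewrite mulrAC.
Qed.

Let beta_bounds k : bquad p k q - c * (y / c0) ^+ 3 <= beta k <= bquad p k q.
Proof.
have := pgf_taylor po pc k qz yc0.
by rewrite (_ : beta k = pgf p (one_v R d - q) k 0 - 1 + \sum_l Mmean p k l * q l 0)// /beta; ring.
Qed.

Let beta_ge0 k : 0 <= beta k.
Proof.
have := pgf_slope po pc k qC C1; rewrite (pgf_one po pc).
have h i : (one_v R d - q) i 0 <= one_v R d i 0.
  by rewrite !mxE; have := q0 i; lra.
move=> /(_ h) /andP[_]; rewrite [one_v R d k 0]mxE /beta.
rewrite (eq_bigr (fun l => Mmean p k l * q l 0)); last first.
  by move=> l _; rewrite !mxE opprB addrCA subrr addr0.
by move=> ?; lra.
Qed.

Let Mq_le k : \sum_l Mmean p k l * q l 0 <= KM * y.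
Proof.
apply: le_trans (_ : \sum_l (c + 2) * q l 0 <= _).
  by apply: ler_sum => l _; rewrite ler_wpM2r// (Mat_le po pc).
rewrite -mulr_sumr /KM -lock; have := sum_coord_le_wnorm q; rewrite wq.
rewrite (eq_bigr (fun l => q l 0)); last by move=> i _; rewrite ger0_norm.
move=> h; apply: le_trans (ler_wpM2l _ h) _; first by rewrite addr_ge0.
have d1 : 1 <= d%:R :> R by rewrite ler1n (leq_ltn_trans _ (ltn_ord k)).
have h2 : 0 <= (c + 2) * (y / c0) by rewrite mulr_ge0// addr_ge0.
have -> : d%:R * (c + 2) / c0 * y = d%:R * ((c + 2) * (y / c0)) by ring.
by rewrite ler_peMl.
Qed.

Let sum_beta : \sum_k v k 0 * bquad p k q = 2^-1 * bform q q.
Proof.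
by rewrite /bform mulr_sumr; apply: eq_bigr => k _; rewrite bquadE mulrCA.
Qed.

Let eps k := (one_v R d - s) k 0 * (1 - pgf p (one_v R d - q) k 0).

(** From [1 - s f = (1 - f) + (1 - s) - (1 - s) (1 - f)]: [beta] is the loss of [1 - f] against its
    linear part and [eps] is the cross term. *)
Let dstepE k : dstep s q k 0 = (Mmean p *m q) k 0 + ((one_v R d - s) k 0 - beta k - eps k).
Proof.
rewrite /dstep /eps /beta mulmx_cE !mxE; ring.
Qed.

Let eps_bounds k : 0 <= eps k <= (one_v R d - s) k 0.
Proof.
have /andP[f0 f1] := inC_pgf po qC k; have /andP[s0 s1'] := s1 k.
rewrite /eps mulr_ge0 ?subr_ge0//= ler_piMr//; lra.
Qed.

Let eps_le k : eps k <= (one_v R d - s) k 0 * (KM * y).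
Proof.
have /andP[s0 s1'] := s1 k; rewrite /eps ler_wpM2l//.
have := beta_ge0 k; have := Mq_le k; rewrite /beta; lra.
Qed.

Lemma dstep_error : wnorm v (dstep s q - Mmean p *m q) <= tau + 2^-1 * Cb * y ^+ 2.
Proof.
have hb : 2^-1 * bform q q <= 2^-1 * Cb * y ^+ 2.
  have := bform_bound q q; rewrite wq ger0_norm ?bform_ge0// -mulrA -expr2 => h.
  by rewrite ler_wpM2l.
apply: le_trans (_ : tau + 2^-1 * bform q q <= _); last by rewrite lerD2l.
rewrite -sum_beta /tau /dotp -big_split /wnorm; apply: ler_sum => k _ /=.
rewrite -mulrDr ler_wpM2l//.
have -> : (dstep s q - Mmean p *m q) k 0 = (one_v R d - s) k 0 - beta k - eps k.
  by rewrite [LHS]mxE [(- (_ *m _)) k 0]mxE dstepE; ring.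
have := beta_ge0 k; have /andP[_ b1] := beta_bounds k.
have /andP[e0 e1'] := eps_bounds k.
move=> b0; rewrite ler_norml; apply/andP; split; lra.
Qed.

(** The three error terms come from the misalignment of [q] with [u], from the cubic Taylor
    remainder and from the cross term [eps]. *)
Lemma dstep_dotp : `|dotp v (dstep s q) - (tau + lam * y - Qv * y ^+ 2)| <=
  Cb * (y * wnorm v (ort q)) + C3 * y ^+ 3 + KM * (tau * y).
Proof.
rewrite /C3 -lock.
have -> : dotp v (dstep s q) = lam * y + tau - \sum_k v k 0 * beta k - \sum_k v k 0 * eps k.
  rewrite -(dotp_mulmx P) /dotp /tau /dotp -big_split -!sumrB /=.
  by apply: eq_bigr => k _; rewrite dstepE; ring.
have se0 : 0 <= \sum_k v k 0 * eps k.
  by apply: sumr_ge0 => k _; rewrite mulr_ge0//; case/andP: (eps_bounds k).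
have se1 : \sum_k v k 0 * eps k <= KM * (tau * y).
  rewrite /tau /dotp mulr_suml mulr_sumr; apply: ler_sum => k _.
  by rewrite [leRHS](_ : _ = v k 0 * ((one_v R d - s) k 0 * (KM * y))); [rewrite ler_wpM2l|ring].
have sb1 : \sum_k v k 0 * beta k <= 2^-1 * bform q q.
  by rewrite -sum_beta; apply: ler_sum => k _; rewrite ler_wpM2l//; case/andP: (beta_bounds k).
have sb2 : 2^-1 * bform q q - V * d%:R * c / c0 ^+ 3 * y ^+ 3 <= \sum_k v k 0 * beta k.
  rewrite -sum_beta; apply: le_trans (_ : \sum_k v k 0 * (bquad p k q - c * (y / c0) ^+ 3) <= _); last first.
    by apply: ler_sum => k _; rewrite ler_wpM2l//; case/andP: (beta_bounds k).
  have -> : \sum_k v k 0 * (bquad p k q - c * (y / c0) ^+ 3) =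
      \sum_k v k 0 * bquad p k q - (\sum_k v k 0) * (c * (y / c0) ^+ 3).
    move: (c * (y / c0) ^+ 3) => C.
    by rewrite mulr_suml -sumrB; apply: eq_bigr => k _; rewrite mulrBr.
  rewrite lerD2l lerN2.
  have vs : \sum_i v i 0 <= V * d%:R.
    apply: le_trans (_ : \sum_(i < d) V <= _); first exact: ler_sum.
    by rewrite sumr_const card_ord mulr_natr.
  have h : 0 <= c * (y / c0) ^+ 3 by rewrite mulr_ge0// exprn_ge0.
  apply: le_trans (ler_wpM2r h vs) _.
  by rewrite expr_div_n [leRHS](_ : _ = V * d%:R * (c * (y ^+ 3 / c0 ^+ 3)))//; ring.
have hQ := bform_orth q q; rewrite wq -/y in hQ.
have hQ' : `|2^-1 * bform q q - Qv * y ^+ 2| <= Cb * (y * wnorm v (ort q)).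
  have -> : 2^-1 * bform q q - Qv * y ^+ 2 = 2^-1 * (bform q q - 2 * Qv * (y * y)) by field.
  rewrite normrM ger0_norm//.
  have -> : Cb * (y * wnorm v (ort q)) = 2^-1 * (Cb * (wnorm v (ort q) * y + y * wnorm v (ort q))) by field.
  by rewrite ler_wpM2l.
rewrite ler_norml in hQ'; case/andP: hQ' => hQ1 hQ2.
rewrite ler_norml; apply/andP; split; lra.
Qed.

Variable w : 'cV[R]_d.
Hypothesis w0 : forall i, 0 <= w i 0.
Let om := dotp v w.
Let ww : wnorm v w = om. Proof. exact: wnorm_pos. Qed.

(** The differential of [dstep s] at [q] in the direction [w]. *)
Definition wstep s q w : 'cV[R]_d := hmul s (Mat p (one_v R d - q) *m w).

Let del k := ((Mmean p - Mat p (one_v R d - q)) *m w) k 0.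
Let zet k := (one_v R d - s) k 0 * (Mat p (one_v R d - q) *m w) k 0.

Lemma wstep_ge0 i : 0 <= wstep s q w i 0.
Proof.
rewrite mxE mulr_ge0//; first by case/andP: (sC i).
by rewrite mulmx_cE sumr_ge0// => j _; rewrite mulr_ge0// (Mat_ge0 po pc).
Qed.

Let wstepE k : wstep s q w k 0 = (Mmean p *m w) k 0 - del k - zet k.
Proof.
rewrite /wstep /del /zet mulmxBl [hmul _ _ k 0]mxE.
rewrite [(Mmean p *m w - _) k 0]mxE [(- (_ *m _)) k 0]mxE.
rewrite [(one_v R d - s) k 0]mxE [one_v R d k 0]mxE [(- s) k 0]mxE; ring.
Qed.

Let le1q i : (one_v R d - q) i 0 <= one_v R d i 0.
Proof. by rewrite !mxE; have := q0 i; lra. Qed.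

Let delE k : del k = \sum_l (Mmean p k l - Mat p (one_v R d - q) k l) * w l 0.
Proof. by rewrite /del mulmx_cE; apply: eq_bigr => l _; rewrite !mxE. Qed.

Let del_ge0 k : 0 <= del k.
Proof.
rewrite delE sumr_ge0// => l _; rewrite mulr_ge0// subr_ge0.
exact: (Mat_mono po pc).
Qed.

Let del_sum : bform w q - V * d%:R * c / c0 ^+ 3 * (y ^+ 2 * om) <= \sum_k v k 0 * del k <= bform w q.
Proof.
have e k : \sum_l \sum_m bm p k l m * w l 0 * q m 0 = \sum_l (\sum_m bm p k l m * q m 0) * w l 0.
  apply: eq_bigr => l _; rewrite mulr_suml; apply: eq_bigr => m _; ring.
apply/andP; split; last first.
  apply: ler_sum => k _; rewrite ler_wpM2l// e delE; apply: ler_sum => l _.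
  rewrite ler_wpM2r//; apply: le_trans (Mat_slope po pc k l qC C1 le1q) _.
  by apply: ler_sum => m _; rewrite !mxE opprB addrCA subrr addr0.
apply: le_trans (_ : \sum_k v k 0 * \sum_l (\sum_m bm p k l m * q m 0 - c * (y / c0) ^+ 2) * w l 0 <= _); last first.
  apply: ler_sum => k _; rewrite ler_wpM2l// delE; apply: ler_sum => l _.
  by rewrite ler_wpM2r// (Mat_taylor po pc k l qz yc0).
have -> : \sum_k v k 0 * (\sum_l (\sum_m bm p k l m * q m 0 - c * (y / c0) ^+ 2) * w l 0) =
   bform w q - (\sum_k v k 0) * (c * (y / c0) ^+ 2 * \sum_l w l 0).
  move: (c * (y / c0) ^+ 2) => C.
  rewrite /bform mulr_suml -sumrB; apply: eq_bigr => k _.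
  rewrite e -mulrBr; congr (_ * _); rewrite mulr_sumr -sumrB; apply: eq_bigr => l _; ring.
rewrite lerD2l lerN2.
have vs : \sum_i v i 0 <= V * d%:R.
  apply: le_trans (_ : \sum_(i < d) V <= _); first exact: ler_sum.
  by rewrite sumr_const card_ord mulr_natr.
have ws := sum_coord_le_wnorm w; rewrite ww in ws.
rewrite (eq_bigr (fun l => w l 0)) in ws; last by move=> i _; rewrite ger0_norm.
have ws0 : 0 <= \sum_l w l 0 by exact: sumr_ge0.
have h : 0 <= c * (y / c0) ^+ 2 by rewrite mulr_ge0// exprn_ge0.
apply: le_trans (ler_pM _ _ vs (ler_wpM2l h ws)) _.
- exact: sumr_ge0.
- by rewrite mulr_ge0.
by rewrite expr_div_n le_eqVlt; apply/orP; left; apply/eqP; field; rewrite gt_eqF.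
Qed.

Let zet_sum : 0 <= \sum_k v k 0 * zet k <= KM * (tau * om).
Proof.
have h0 k : 0 <= zet k.
  rewrite mulr_ge0//; first by case/andP: (s1 k).
  by rewrite mulmx_cE sumr_ge0// => l _; rewrite mulr_ge0// (Mat_ge0 po pc).
rewrite sumr_ge0 => [|k _]; last by rewrite mulr_ge0.
rewrite /tau /dotp mulr_suml mulr_sumr; apply: ler_sum => k _.
have -> : KM * (v k 0 * (one_v R d - s) k 0 * om) = v k 0 * ((one_v R d - s) k 0 * (KM * om)) by ring.
rewrite ler_wpM2l// /zet ler_wpM2l//; first by case/andP: (s1 k).
rewrite mulmx_cE; apply: le_trans (_ : \sum_l (c + 2) * w l 0 <= _).
  by apply: ler_sum => l _; rewrite ler_wpM2r// (Mat_le po pc).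
have ws := sum_coord_le_wnorm w; rewrite ww in ws.
rewrite (eq_bigr (fun l => w l 0)) in ws; last by move=> i _; rewrite ger0_norm.
rewrite -mulr_sumr; apply: le_trans (ler_wpM2l _ ws) _; first by rewrite addr_ge0.
have d1 : 1 <= d%:R :> R by rewrite ler1n (leq_ltn_trans _ (ltn_ord k)).
have om0 : 0 <= om by apply: sumr_ge0 => i _; rewrite mulr_ge0.
have h2 : 0 <= (c + 2) * (om / c0) by rewrite mulr_ge0 ?addr_ge0// divr_ge0// ltW.
have -> : KM * om = d%:R * ((c + 2) * (om / c0)) by rewrite /KM -lock; ring.
by rewrite ler_peMl.
Qed.

Lemma wstep_error : wnorm v (wstep s q w - Mmean p *m w) <= (Cb * y + KM * tau) * om.
Proof.
have h0 k : 0 <= zet k.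
  rewrite mulr_ge0//; first by case/andP: (s1 k).
  by rewrite mulmx_cE sumr_ge0// => l _; rewrite mulr_ge0// (Mat_ge0 po pc).
have -> : wnorm v (wstep s q w - Mmean p *m w) = \sum_k v k 0 * del k + \sum_k v k 0 * zet k.
  rewrite /wnorm -big_split; apply: eq_bigr => k _ /=.
  rewrite [X in `|X|]mxE [(- (_ *m _)) k 0]mxE wstepE.
  have -> : (Mmean p *m w) k 0 - del k - zet k - (Mmean p *m w) k 0 = - (del k + zet k) by ring.
  by rewrite normrN ger0_norm ?addr_ge0// mulrDr.
have /andP[_ h1] := del_sum; have /andP[_ h2] := zet_sum.
have h3 := bform_bound w q; rewrite ww wq ger0_norm ?bform_ge0// in h3.
have : Cb * (om * y) = Cb * y * om by ring.
have : KM * (tau * om) = KM * tau * om by ring.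
lra.
Qed.

Lemma wstep_dotp : `|dotp v (wstep s q w) - (lam - 2 * Qv * y) * om| <=
  Cb * (wnorm v (ort w) * y + om * wnorm v (ort q))
    + C3 * (y ^+ 2 * om) + KM * (tau * om).
Proof.
rewrite /C3 -lock.
have -> : dotp v (wstep s q w) = lam * om - \sum_k v k 0 * del k - \sum_k v k 0 * zet k.
  rewrite -(dotp_mulmx P) /dotp -!sumrB /=.
  by apply: eq_bigr => k _; rewrite wstepE; ring.
have /andP[h0 h1] := del_sum; have /andP[h2 h3] := zet_sum.
have := bform_orth w q; rewrite ww wq -/y -/om ler_norml => /andP[h4 h5].
rewrite ler_norml; apply/andP; split; lra.
Qed.

Lemma wstep_dotp_le : dotp v (wstep s q w) <= lam * om.
Proof.
have -> : dotp v (wstep s q w) = lam * om - \sum_k v k 0 * del k - \sum_k v k 0 * zet k.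
  rewrite -(dotp_mulmx P) /dotp -!sumrB /=.
  by apply: eq_bigr => k _; rewrite wstepE; ring.
have /andP[h2 h3] := zet_sum.
have : 0 <= \sum_k v k 0 * del k by apply: sumr_ge0 => k _; rewrite mulr_ge0.
lra.
Qed.

End Step.
End OneStep.

(** * Contraction and the scalar recursions *)

(** Inside a block of [U] steps the norm may grow by powers of two, and [1 / h] sums the geometric
    series of block contractions. *)
Definition CU (R : realType) (U : nat) (h : R) : R := locked (U%:R * 2 ^+ U.+1 / h).

Section ContractionSequences.
Variables (R : realType) (d : nat) (A : 'M[R]_d) (lam : R) (u v : 'cV[R]_d).
Hypothesis P : perron A lam u v.
Hypothesis A0 : forall i j, 0 <= A i j.
Variables (U : nat) (h sg : R).
Hypothesis U0 : (0 < U)%N.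
Hypothesis h01 : 0 < h <= 1.
Hypothesis sg0 : 0 <= sg.
Hypothesis sgl : sg * lam <= 2.
Hypothesis ctr : forall x, dotp v x = 0 ->
  sg ^+ U * wnorm v (A ^+ U *m x) <= (1 - h) * wnorm v x.
Variables (x : nat -> 'cV[R]_d) (n : nat) (e : R).
Hypothesis e0 : 0 <= e.
Hypothesis xe : forall i, (i < n)%N -> wnorm v (x i.+1 - sg *: (A *m x i)) <= e.

Let r i := wnorm v (orth u v (x i)).

Let lam0 : 0 <= lam. Proof. exact: ltW (perron_lam_gt0 P). Qed.

Let r0 i : 0 <= r i. Proof. exact: wnorm_ge0 P _. Qed.

(** The factor [sg] is [1] for the orbit and [lam^-1] for its normalised differential. The
    coefficient solves [k_(m+1) = 2 k_m + 2]: the multiplier is the bound on [sg lam], the increment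
    is the factor lost by [wnorm_orth]. *)
Lemma orth_drift i m : (i + m <= n)%N ->
  wnorm v (orth u v (x (i + m)%N) - sg ^+ m *: (A ^+ m *m orth u v (x i))) <= (2 ^+ m.+1 - 2) * e.
Proof.
elim: m => [|m IH] im.
  rewrite addn0 !expr0 mul1mx scale1r subrr expr1 subrr mul0r.
  by rewrite /wnorm big1// => k _; rewrite mxE normr0 mulr0.
have im' : (i + m <= n)%N by rewrite (leq_trans _ im)// addnS.
have := IH im'; set X := x (i + m)%N; set Z := A ^+ m *m _ => hIH.
rewrite addnS.
have -> : orth u v (x (i + m).+1) - sg ^+ m.+1 *: (A ^+ m.+1 *m orth u v (x i)) =
   orth u v (x (i + m).+1 - sg *: (A *m X)) + sg *: (A *m (orth u v X - sg ^+ m *: Z)).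
  have -> : orth u v (x (i + m).+1 - sg *: (A *m X)) = orth u v (x (i + m).+1) - sg *: (A *m orth u v X).
    by rewrite orthD -scaleN1r orthZ orthZ (orth_mulmx P) scaleN1r.
  have alg (a b z : 'cV[R]_d) : a - sg ^+ m.+1 *: (A *m z) =
      a - sg *: (A *m b) + sg *: (A *m (b - sg ^+ m *: z)).
    by rewrite mulmxBr scalerBr -scalemxAr scalerA -exprS addrA subrK.
  by rewrite mulmx_exprS -alg.
apply: le_trans (wnormD P _ _) _; rewrite wnormZ ger0_norm//.
have h1 := wnorm_orth P (x (i + m).+1 - sg *: (A *m X)).
have h2 : wnorm v (x (i + m).+1 - sg *: (A *m X)) <= e by apply: xe; rewrite -addnS.
have h3 := wnorm_mulmx P A0 (orth u v X - sg ^+ m *: Z).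
have h4 : sg * wnorm v (A *m (orth u v X - sg ^+ m *: Z)) <= 2 * ((2 ^+ m.+1 - 2) * e).
  apply: le_trans (ler_wpM2l sg0 h3) _; rewrite [leLHS]mulrA.
  by apply: ler_pM; rewrite ?mulr_ge0 ?(wnorm_ge0 P).
rewrite [2 ^+ m.+2]exprS; lra.
Qed.

Lemma orth_growth i m : (i + m <= n)%N -> r (i + m)%N <= 2 ^+ m * r i + 2 ^+ m.+1 * e.
Proof.
move=> im; have := orth_drift im; set Z := A ^+ m *m _ => hd.
have e1 : orth u v (x (i + m)%N) = (orth u v (x (i + m)%N) - sg ^+ m *: Z) + sg ^+ m *: Z.
  by rewrite subrK.
rewrite {1}/r {}e1; apply: le_trans (wnormD P _ _) _.
have hZ : wnorm v (sg ^+ m *: Z) <= 2 ^+ m * r i.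
  rewrite /Z; elim: (m) => [|k IH]; first by rewrite !expr0 mul1mx scale1r mul1r.
  rewrite mulmx_exprS exprS -scalerA scalemxAr wnormZ ger0_norm//.
  apply: le_trans (ler_wpM2l sg0 (wnorm_mulmx P A0 _)) _; rewrite [leLHS]mulrA exprS -[leRHS]mulrA.
  by apply: ler_pM; rewrite ?mulr_ge0 ?(wnorm_ge0 P).
rewrite mulrBl in hd; have := e0; lra.
Qed.

Lemma orth_contract i : (i + U <= n)%N -> r (i + U)%N <= (1 - h) * r i + 2 ^+ U.+1 * e.
Proof.
move=> im; have := orth_drift im; set Z := A ^+ U *m _ => hd.
have e1 : orth u v (x (i + U)%N) = (orth u v (x (i + U)%N) - sg ^+ U *: Z) + sg ^+ U *: Z.
  by rewrite subrK.
rewrite {1}/r {}e1; apply: le_trans (wnormD P _ _) _.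
have := ctr (orth_dotp P (x i)); rewrite -/Z -/(r i) => hZ.
rewrite mulrBl in hd; rewrite wnormZ ger0_norm ?exprn_ge0//; have := e0; lra.
Qed.

Lemma orth_contract_iter q m : (q * U + m <= n)%N ->
  r (q * U + m)%N <= (1 - h) ^+ q * r m + 2 ^+ U.+1 / h * e.
Proof.
case/andP: h01 => h0 h1.
have hq : 0 <= 2 ^+ U.+1 / h * e by rewrite mulr_ge0 ?divr_ge0 ?exprn_ge0 ?(ltW h0).
elim: q => [|q IH] qn.
  by rewrite mul0n add0n expr0 mul1r lerDl.
have e1 : (q.+1 * U + m = (q * U + m) + U)%N by rewrite mulSn -addnA addnC.
rewrite e1 in qn *.
have qn' : (q * U + m <= n)%N by rewrite (leq_trans _ qn)// leq_addr.
have := orth_contract qn; have := IH qn'.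
set t := r (q * U + m)%N => hIH ho.
have : (1 - h) * t <= (1 - h) * ((1 - h) ^+ q * r m + 2 ^+ U.+1 / h * e).
  by rewrite ler_wpM2l// subr_ge0.
have -> : (1 - h) * ((1 - h) ^+ q * r m + 2 ^+ U.+1 / h * e) =
   (1 - h) ^+ q.+1 * r m + 2 ^+ U.+1 / h * e - 2 ^+ U.+1 * e.
  by rewrite [(1 - h) ^+ q.+1]exprS; field; rewrite gt_eqF.
lra.
Qed.

(** Division with remainder: [n %% U] steps with bounded growth, then [n %/ U] block
    contractions. *)
Lemma orth_pointwise : r n <= 2 ^+ U * (1 - h) ^+ (n %/ U) * r 0%N + 2 ^+ U.+2 / h * e.
Proof.
case/andP: h01 => h0 h1.
have nU : (n %/ U * U + n %% U <= n)%N by rewrite -divn_eq.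
have := orth_contract_iter nU; rewrite -divn_eq => hn.
have m0 : (0 + n %% U <= n)%N by rewrite add0n leq_mod.
have := orth_growth m0; rewrite add0n => hm.
have mU : (n %% U <= U)%N by rewrite ltnW// ltn_mod.
have p1 : 2 ^+ (n %% U) <= 2 ^+ U :> R by rewrite ler_weXn2l// ler1n.
have p2 : 2 ^+ (n %% U).+1 <= 2 ^+ U.+1 :> R by rewrite ler_weXn2l// ler1n.
have hh0 : 0 <= (1 - h) ^+ (n %/ U) by rewrite exprn_ge0// subr_ge0.
have hh1 : (1 - h) ^+ (n %/ U) <= 1 by rewrite exprn_ile1 ?subr_ge0// lerBlDr lerDl ltW.
have k0 := r0 0%N.
have h2 : (1 - h) ^+ (n %/ U) * r (n %% U)%N <= (1 - h) ^+ (n %/ U) * (2 ^+ U * r 0%N) + 2 ^+ U.+1 * e.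
  apply: le_trans (ler_wpM2l hh0 hm) _; rewrite mulrDr; apply: lerD.
    by rewrite ler_wpM2l// ler_wpM2r.
  apply: le_trans (_ : 1 * (2 ^+ (n %% U).+1 * e) <= _).
    by rewrite ler_wpM2r// mulr_ge0// exprn_ge0.
  by rewrite mul1r ler_wpM2r.
have h3 : 2 ^+ U.+1 * e <= 2 ^+ U.+1 / h * e.
  rewrite ler_wpM2r// ler_peMr ?exprn_ge0// -invr1 lef_pV2 ?posrE//.
have -> : 2 ^+ U.+2 / h * e = 2 * (2 ^+ U.+1 / h * e) by rewrite [2 ^+ U.+2]exprS; ring.
have -> : 2 ^+ U * (1 - h) ^+ (n %/ U) * r 0%N = (1 - h) ^+ (n %/ U) * (2 ^+ U * r 0%N) by ring.
lra.
Qed.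

(** Contracting every term after the first [U] bounds the sum [S] by the first block plus
    [(1 - h) S + n 2^(U+1) e]; this is solved for [S]. *)
Lemma orth_sum : \sum_(0 <= i < n) r i <= CU U h * (r 0%N + (n%:R + 1) * e).
Proof.
rewrite /CU -lock.
case/andP: h01 => h0 h1; have k0 := r0 0%N.
have pU : 0 <= 2 ^+ U :> R by exact: exprn_ge0.
have first_sum m : (m <= U)%N -> (m <= n)%N ->
    \sum_(0 <= i < m) r i <= U%:R * (2 ^+ U * r 0%N + 2 ^+ U.+1 * e).
  move=> mU mn.
  apply: le_trans (_ : \sum_(0 <= i < m) (2 ^+ U * r 0%N + 2 ^+ U.+1 * e) <= _).
    rewrite big_nat [leRHS]big_nat; apply: ler_sum => i /andP[_ im].
    have i0 : (0 + i <= n)%N by rewrite add0n ltnW// (leq_trans im).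
    apply: le_trans (orth_growth i0) _; have iU := leq_trans im mU.
    have q1 : 2 ^+ i <= 2 ^+ U :> R by rewrite ler_weXn2l ?ler1n// ltnW.
    have q2 : 2 ^+ i.+1 <= 2 ^+ U.+1 :> R by rewrite ler_weXn2l ?ler1n// ltnS ltnW.
    by apply: lerD; rewrite ler_wpM2r.
  rewrite sumr_const_nat subn0 -[leLHS]mulr_natl ler_wpM2r ?ler_nat//.
  by rewrite addr_ge0// mulr_ge0// exprn_ge0.
have e2 : 2 ^+ U.+1 = 2 * 2 ^+ U :> R by rewrite exprS.
have U1 : 1 <= U%:R :> R by rewrite ler1n.
have hV : 1 <= h^-1 by rewrite -invr1 lef_pV2 ?posrE.
have ne0 : 0 <= (n%:R + 1) * e by rewrite mulr_ge0// addr_ge0.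
have [nU|Un] := leqP n U.
  apply: le_trans (first_sum n nU (leqnn n)) _.
  rewrite -[leRHS]mulrA -[leRHS]mulrA ler_wpM2l//.
  have h5 : 0 <= 2 ^+ U.+1 * (r 0%N + (n%:R + 1) * e).
    by rewrite mulr_ge0 ?exprn_ge0// addr_ge0.
  rewrite mulrCA; apply: le_trans (_ : 1 * (2 ^+ U.+1 * (r 0%N + (n%:R + 1) * e)) <= _); last first.
    by rewrite ler_wpM2r.
  rewrite mul1r mulrDr; apply: lerD; first by rewrite e2; nra.
  by rewrite ler_wpM2l ?exprn_ge0// ler_peMl// lerDr.
have [m nE] : exists m, n = (m + U)%N by exists (n - U)%N; rewrite subnK// ltnW.
have S1 := first_sum U (leqnn _) (ltnW Un).
have split1 : \sum_(0 <= i < n) r i = \sum_(0 <= i < U) r i + \sum_(0 <= i < m) r (i + U)%N.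
  rewrite (@big_cat_nat _ _ _ U)//=; last exact: ltnW.
  by congr (_ + _); rewrite -{1}[U]add0n big_addn nE addnK.
have S2 : \sum_(0 <= i < m) r (i + U)%N <= (1 - h) * \sum_(0 <= i < n) r i + n%:R * (2 ^+ U.+1 * e).
  apply: le_trans (_ : \sum_(0 <= i < m) ((1 - h) * r i + 2 ^+ U.+1 * e) <= _).
    rewrite big_nat [leRHS]big_nat; apply: ler_sum => i /andP[_ im].
    by apply: orth_contract; rewrite nE leq_add2r ltnW.
  rewrite big_split /= -mulr_sumr sumr_const_nat subn0 -[_ *+ m]mulr_natl; apply: lerD.
    rewrite ler_wpM2l ?subr_ge0// (@big_cat_nat _ _ _ m 0%N n)//= ?lerDl ?sumr_ge0//.
    by rewrite nE leq_addr.
  by rewrite ler_wpM2r ?mulr_ge0 ?exprn_ge0// ler_nat nE leq_addr.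
rewrite mulrAC ler_pdivlMr// mulrC.
set S := \sum_(0 <= i < n) r i in split1 S2 *.
have : h * S <= U%:R * (2 ^+ U * r 0%N + 2 ^+ U.+1 * e) + n%:R * (2 ^+ U.+1 * e) by lra.
move=> /le_trans; apply.
have -> : U%:R * 2 ^+ U.+1 * (r 0%N + (n%:R + 1) * e) =
   U%:R * (2 ^+ U.+1 * r 0%N + 2 ^+ U.+1 * e) + U%:R * (n%:R * (2 ^+ U.+1 * e)) by ring.
apply: lerD.
  by rewrite ler_wpM2l// lerD2r ler_wpM2r// e2; lra.
by rewrite ler_peMl// mulr_ge0// mulr_ge0// exprn_ge0.
Qed.

End ContractionSequences.

(** Factors in [[0, 1]] do not amplify earlier errors, so the one-step errors simply add. *)
Lemma product_recursion (R : realType) (w a err : nat -> R) n :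
  (forall i, (i < n)%N -> 0 <= a i <= 1) ->
  (forall i, (i < n)%N -> `|w i.+1 - a i * w i| <= err i) ->
  `|w n - w 0%N * \prod_(0 <= i < n) a i| <= \sum_(0 <= i < n) err i.
Proof.
elim: n => [|n IH] an wn; first by rewrite !big_geq// mulr1 subrr normr0.
rewrite !big_nat_recr//=.
have IH' := IH (fun i ni => an i (ltnW ni)) (fun i ni => wn i (ltnW ni)).
have /andP[a0 a1] := an n (ltnSn n).
have -> : w n.+1 - w 0%N * (\prod_(0 <= i < n) a i * a n) =
  a n * (w n - w 0%N * \prod_(0 <= i < n) a i) + (w n.+1 - a n * w n) by ring.
apply: le_trans (ler_normD _ _) _; apply: lerD; last exact: wn.
by rewrite normrM ger0_norm//; apply: le_trans IH'; rewrite ler_piMl.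
Qed.

(** * Alignment of the orbit and of its differential with the Perron direction *)

Section Process.
Variables (R : realType) (d : nat) (p : offspring R d) (c : R).
Hypothesis po : is_offspring p.
Hypothesis pc : (\sum_(k < d) \sum_(l < d) \sum_(m < d) \sum_(j < d) cmom p k l m j
         <= c%:E)%E.
Variables (lam : R) (u v : 'cV[R]_d) (c0 V : R).
Hypothesis P : perron (Mmean p) lam u v.
Hypothesis c00 : 0 < c0.
Hypothesis vc0 : forall i, c0 <= v i 0.
Hypothesis vV : forall i, v i 0 <= V.
Hypothesis c_ge0 : 0 <= c.
Hypothesis V0 : 0 <= V.
Variables (U : nat) (h K : R).
Hypothesis U0 : (0 < U)%N.
Hypothesis h01 : 0 < h <= 1.
Hypothesis K1 : 0 <= K.
Hypothesis lam_half : 2^-1 <= lam.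
Hypothesis lam2 : lam <= 2.
Hypothesis ctr1 : forall x, dotp v x = 0 ->
  wnorm v (Mmean p ^+ U *m x) <= (1 - h) * wnorm v x.
Hypothesis ctr2 : forall x, dotp v x = 0 ->
  lam^-1 ^+ U * wnorm v (Mmean p ^+ U *m x) <= (1 - h) * wnorm v x.

Local Notation Cb' := (Cb d c c0 V).
Local Notation KM' := (KM d c c0).
Local Notation C3' := (C3 d c c0 V).
Local Notation CU' := (CU U h).

(** This constant and the next four are those delivered by [orth_sum] and [orth_pointwise]: [K]
    enters through [n Y <= K], the factors two through [wnorm_orth], [n + 1 <= 2 n] and
    [lam^-1 <= 2]. They see the law only through the bounds assumed on it. *)
Definition CR : R := CU' * (2 + Cb' * K).
Definition Cy : R := Cb' * CR + C3' * K + KM'.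
Definition CS : R := CU' * (2 + 4 * (Cb' * K + KM')).
Definition Cw : R := 2 * (Cb' * CS + Cb' * CR + C3' * K + KM').
Definition Cp : R := 2 ^+ U.+1 + 2 ^+ U.+2 / h * (2 * (Cb' + KM')).

Let h0 : 0 < h. Proof. by case/andP: h01. Qed.
Let Cb0 : 0 <= Cb'. Proof. by rewrite /Cb -lock divr_ge0 ?exprn_ge0 ?(ltW c00)// !mulr_ge0// addr_ge0. Qed.
Let KM0 : 0 <= KM'. Proof. by rewrite /KM -lock divr_ge0 ?(ltW c00)// mulr_ge0// addr_ge0. Qed.
Let C30 : 0 <= C3'. Proof. by rewrite /C3 -lock divr_ge0 ?exprn_ge0 ?(ltW c00)// !mulr_ge0. Qed.
Let CU0 : 0 <= CU'. Proof. by rewrite /CU -lock divr_ge0 ?(ltW h0)// mulr_ge0// exprn_ge0. Qed.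
Let CR0 : 0 <= CR. Proof. by rewrite mulr_ge0// addr_ge0// mulr_ge0. Qed.
Let CS0 : 0 <= CS. Proof. by rewrite mulr_ge0// addr_ge0// mulr_ge0// addr_ge0// mulr_ge0. Qed.

Variables (s : 'cV[R]_d) (n : nat) (Y : R) (D : nat -> 'cV[R]_d).
Hypothesis sC : inC s.
Hypothesis n0 : (0 < n)%N.
Hypothesis D0 : forall i k, 0 <= D i k 0.
Hypothesis DS : forall i, (i < n)%N -> D i.+1 = dstep p s (D i).
Hypothesis DY : forall i, (i <= n)%N -> dotp v (D i) <= Y.
Hypothesis Yc0 : Y / c0 <= 1.
Hypothesis nY : n%:R * Y <= K.
Let tau := dotp v (one_v R d - s).
Hypothesis nt : n%:R * tau <= 1.
Let y i := dotp v (D i).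
Let eta := Y + n%:R * tau.
Let r i := wnorm v (orth u v (D i)).

Let v0 i : 0 <= v i 0. Proof. exact: ltW (perron_v_gt0 P i). Qed.
Let y0 i : 0 <= y i. Proof. by apply: sumr_ge0 => k _; rewrite mulr_ge0. Qed.
Let Y0 : 0 <= Y. Proof. exact: le_trans (y0 0%N) (DY (leq0n n)). Qed.
Let tau0 : 0 <= tau.
Proof.
apply: sumr_ge0 => i _; rewrite mulr_ge0// !mxE.
by have /andP[? ?] := sC i; lra.
Qed.
Let n1 : 1 <= n%:R :> R. Proof. by rewrite ler1n. Qed.
Let yc i : (i <= n)%N -> y i / c0 <= 1.
Proof. by move=> ni; apply: le_trans Yc0; rewrite ler_pM2r ?invr_gt0// DY. Qed.
Let r0 i : 0 <= r i. Proof. exact: wnorm_ge0 P _. Qed.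
Let lam0 : 0 < lam := perron_lam_gt0 P.
Let lamV : lam^-1 <= 2.
Proof. by rewrite -[leRHS]invrK lef_pV2 ?posrE// invr_gt0. Qed.
Let A0 := Mmean_ge0 po pc.
Let Ynn : n%:R * Y ^+ 2 <= K * Y.
Proof. by rewrite expr2 mulrA ler_wpM2r. Qed.
Let eta0 : 0 <= eta. Proof. by rewrite /eta addr_ge0// mulr_ge0. Qed.
Let ntau0 : 0 <= n%:R * tau. Proof. by rewrite mulr_ge0. Qed.

(** One step errs by at most [tau + Cb Y^2 / 2]. As [n Y^2 <= K Y], the sum over [n] steps is of
    order [eta = Y + n tau], a small quantity in every regime. *)
Lemma sum_orth_D : \sum_(0 <= i < n) r i <= CR * eta.
Proof.
have e0 : 0 <= tau + 2^-1 * Cb' * Y ^+ 2 by rewrite addr_ge0// !mulr_ge0 ?exprn_ge0//.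
have sgl : 1 * lam <= 2 by rewrite mul1r.
have ctr x : dotp v x = 0 -> 1 ^+ U * wnorm v (Mmean p ^+ U *m x) <= (1 - h) * wnorm v x.
  by rewrite expr1n mul1r; exact: ctr1.
have xe i : (i < n)%N -> wnorm v (D i.+1 - 1 *: (Mmean p *m D i)) <= tau + 2^-1 * Cb' * Y ^+ 2.
  move=> ni; rewrite scale1r DS//.
  apply: le_trans (dstep_error po pc P c00 vc0 vV c_ge0 sC (D0 i) (yc (ltnW ni))) _.
  have yi0 := y0 i; have yY := DY (ltnW ni); rewrite -/(y i) in yY *.
  by rewrite lerD2l ler_wpM2l ?mulr_ge0// lerXn2r ?nnegrE.
have := orth_sum P A0 U0 h01 ler01 sgl ctr e0 xe.
move=> /le_trans; apply; rewrite /CR -[leRHS]mulrA ler_wpM2l//.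
have hr : r 0%N <= 2 * Y.
  apply: le_trans (wnorm_orth P _) _; rewrite ler_wpM2l// wnorm_pos//.
  exact: DY.
have h2 : (n%:R + 1) * (tau + 2^-1 * Cb' * Y ^+ 2) <= 2 * (n%:R * tau) + Cb' * (K * Y).
  apply: le_trans (_ : (2 * n%:R) * (tau + 2^-1 * Cb' * Y ^+ 2) <= _).
    by rewrite ler_wpM2r//; have := n1; lra.
  have -> : 2 * n%:R * (tau + 2^-1 * Cb' * Y ^+ 2) = 2 * (n%:R * tau) + Cb' * (n%:R * Y ^+ 2) by field.
  by rewrite lerD2l ler_wpM2l.
have : 0 <= Cb' * K * (n%:R * tau) by rewrite !mulr_ge0.
rewrite -/(r 0%N) /eta; lra.
Qed.

(** Misalignment enters multiplied by [y_i <= Y], which gains a factor [Y] over [eta]. The gain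
    matters because the Riccati comparison multiplies this error by [n], and only [n Y] is
    bounded. *)
Lemma dotp_recursion : \sum_(0 <= i < n)
  `|y i.+1 - (tau + lam * y i - Qv p u v * y i ^+ 2)| <= Cy * (Y * eta).
Proof.
apply: le_trans (_ : \sum_(0 <= i < n) (Cb' * Y * r i + (C3' * Y ^+ 3 + KM' * (tau * Y))) <= _).
  rewrite big_nat [leRHS]big_nat; apply: ler_sum => i /andP[_ ni].
  rewrite {1}/y DS//.
  have h1 := dstep_dotp po pc P c00 vc0 vV c_ge0 sC (D0 i) (yc (ltnW ni)).
  rewrite -/(y i) -/(r i) in h1; apply: le_trans h1 _.
  have yY := DY (ltnW ni); have yi0 := y0 i; rewrite -/(y i) in yY.
  rewrite -[leLHS]addrA; apply: lerD.
    by rewrite -[leRHS]mulrA ler_wpM2l// ler_wpM2r// r0.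
  apply: lerD; first by rewrite ler_wpM2l// lerXn2r ?nnegrE//.
  by rewrite ler_wpM2l// ler_wpM2l.
rewrite big_split /= -mulr_sumr sumr_const_nat subn0 -[_ *+ n]mulr_natl.
have h1 : Cb' * Y * \sum_(0 <= i < n) r i <= Cb' * Y * (CR * eta).
  by rewrite ler_wpM2l ?mulr_ge0// sum_orth_D.
have h2 : n%:R * (C3' * Y ^+ 3 + KM' * (tau * Y)) <= C3' * (K * Y * Y) + KM' * (n%:R * tau * Y).
  have -> : n%:R * (C3' * Y ^+ 3 + KM' * (tau * Y)) = C3' * (n%:R * Y ^+ 2 * Y) + KM' * (n%:R * tau * Y) by ring.
  by rewrite lerD2r ler_wpM2l// ler_wpM2r.
have h3 : 0 <= C3' * K * Y * (n%:R * tau) by rewrite !mulr_ge0.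
have h4 : 0 <= KM' * Y * Y by rewrite !mulr_ge0.
rewrite /Cy /eta in h1 *; lra.
Qed.

Variable W : nat -> 'cV[R]_d.
Hypothesis W0 : forall k, 0 <= W 0%N k 0.
Hypothesis WS : forall i, (i < n)%N -> W i.+1 = wstep p s (D i) (W i).
Let om i := dotp v (W i).
(** Division by [lam^i] makes [v' X_i] nonincreasing, so that all errors stay proportional to
    [om 0]. *)
Let X i := lam^-1 ^+ i *: W i.
Let q i := wnorm v (orth u v (X i)).

Let Wge0 i k : (i <= n)%N -> 0 <= W i k 0.
Proof.
elim: i k => [|i IH] k ni; first exact: W0.
rewrite WS//; apply: (wstep_ge0 po pc P c00 vc0 sC (D0 i) (yc (ltnW ni))) => // l.
exact: IH (ltnW ni).
Qed.

Let om0 : 0 <= om 0%N. Proof. by apply: sumr_ge0 => k _; rewrite mulr_ge0. Qed.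
Let omi0 i : (i <= n)%N -> 0 <= om i.
Proof. by move=> ni; apply: sumr_ge0 => k _; rewrite mulr_ge0// Wge0. Qed.

Let omn i : (i <= n)%N -> lam^-1 ^+ i * om i <= om 0%N.
Proof.
elim: i => [|i IH] ni; first by rewrite expr0 mul1r.
apply: le_trans (IH (ltnW ni)); rewrite exprSr -mulrA ler_wpM2l ?exprn_ge0 ?invr_ge0 ?(ltW lam0)//.
rewrite ler_pdivrMl// {1}/om WS//.
apply: (wstep_dotp_le po pc P c00 vc0 c_ge0 sC (D0 i) (yc (ltnW ni))) => k.
exact: Wge0 (ltnW ni).
Qed.

Let lamVn i : 0 <= lam^-1 ^+ i. Proof. by rewrite exprn_ge0// invr_ge0 ltW. Qed.

Let eW := 2 * (Cb' * Y + KM' * tau) * om 0%N.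
Let eW0 : 0 <= eW. Proof. by rewrite !mulr_ge0// addr_ge0// mulr_ge0. Qed.

Let X_error i : (i < n)%N -> wnorm v (X i.+1 - lam^-1 *: (Mmean p *m X i)) <= eW.
Proof.
move=> ni; rewrite /X -scalemxAr scalerA -exprS -scalerBr wnormZ ger0_norm//.
have h1 := wstep_error po pc P c00 vc0 vV c_ge0 sC (D0 i) (yc (ltnW ni)) (fun k => Wge0 k (ltnW ni)).
rewrite WS//; apply: le_trans (ler_wpM2l (lamVn i.+1) h1) _.
rewrite exprS -mulrA mulrCA; rewrite mulrCA.
have yY := DY (ltnW ni).
have h2 : Cb' * dotp v (D i) + KM' * tau <= Cb' * Y + KM' * tau by rewrite lerD2r ler_wpM2l.
have h3 : 0 <= Cb' * dotp v (D i) + KM' * tau by rewrite addr_ge0// mulr_ge0//; exact: y0.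
have h4 := omn (ltnW ni).
have h5 : 0 <= lam^-1 by rewrite invr_ge0 ltW.
have h6 : 0 <= lam^-1 ^+ i * om i by rewrite mulr_ge0// omi0// ltnW.
rewrite /eW -mulrA; apply: ler_pM => //.
  by rewrite mulr_ge0// mulr_ge0// omi0// ltnW.
by rewrite mulrCA; apply: ler_pM.
Qed.

Let q0_le : q 0%N <= 2 * om 0%N.
Proof.
rewrite /q /X expr0 scale1r; apply: le_trans (wnorm_orth P _) _.
by rewrite ler_wpM2l// wnorm_pos.
Qed.

Let q0 i : 0 <= q i. Proof. exact: wnorm_ge0 P _. Qed.
Let sgl : lam^-1 * lam <= 2. Proof. by rewrite mulVf ?gt_eqF// ler1n. Qed.
Let lamV0 : 0 <= lam^-1. Proof. by rewrite invr_ge0 ltW. Qed.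

Let neW : n%:R * eW <= 2 * (Cb' * K + KM') * om 0%N.
Proof.
have -> : n%:R * eW = 2 * (Cb' * (n%:R * Y) + KM' * (n%:R * tau)) * om 0%N by rewrite /eW; ring.
rewrite ler_wpM2r// ler_wpM2l// lerD ?ler_wpM2l//.
by rewrite -[leRHS]mulr1 ler_wpM2l.
Qed.

Lemma sum_orth_W : \sum_(0 <= i < n) q i <= CS * om 0%N.
Proof.
have := orth_sum P A0 U0 h01 lamV0 sgl ctr2 eW0 X_error.
move=> /le_trans; apply; rewrite /CS -[leRHS]mulrA ler_wpM2l//.
have h1 := q0_le; have h2 := neW.
have : eW <= n%:R * eW by rewrite ler_peMl.
rewrite -/(q 0%N); lra.
Qed.

Lemma orth_W_end : q n <= Cp * ((1 - h) ^+ (n %/ U) + eta) * om 0%N.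
Proof.
apply: le_trans (orth_pointwise P A0 U0 h01 lamV0 sgl ctr2 eW0 X_error) _.
rewrite -/(q 0%N).
have k0 : 0 <= (1 - h) ^+ (n %/ U) by rewrite exprn_ge0// subr_ge0; case/andP: h01.
set ka := (1 - h) ^+ _ in k0 *.
have p1 : 0 <= 2 ^+ U :> R by exact: exprn_ge0.
have p2 : 0 <= 2 ^+ U.+2 / h by rewrite divr_ge0 ?exprn_ge0// ltW.
have h1 : 2 ^+ U * ka * q 0%N <= 2 ^+ U * ka * (2 * om 0%N).
  by rewrite ler_wpM2l// mulr_ge0.
have tn : tau <= n%:R * tau by rewrite ler_peMl.
have h2 : 2 ^+ U.+2 / h * eW <= 2 ^+ U.+2 / h * (2 * (Cb' + KM') * eta * om 0%N).
  rewrite ler_wpM2l// /eW ler_wpM2r// -!mulrA ler_wpM2l// /eta.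
  have : 0 <= Cb' * (n%:R * tau) by rewrite mulr_ge0.
  have : 0 <= KM' * Y by rewrite mulr_ge0.
  have : KM' * tau <= KM' * (n%:R * tau) by rewrite ler_wpM2l.
  lra.
have h3 : 0 <= 2 ^+ U * 2 * eta * om 0%N by rewrite !mulr_ge0.
have h4 : 0 <= 2 ^+ U.+2 / h * (2 * (Cb' + KM')) * ka * om 0%N by do 3!(apply: mulr_ge0 => //); rewrite mulr_ge0// addr_ge0.
have -> : Cp * (ka + eta) * om 0%N = 2 ^+ U * ka * (2 * om 0%N) + 2 ^+ U * 2 * eta * om 0%N
  + 2 ^+ U.+2 / h * (2 * (Cb' + KM')) * ka * om 0%N + 2 ^+ U.+2 / h * (2 * (Cb' + KM') * eta * om 0%N).
  by rewrite /Cp [2 ^+ U.+1]exprS; ring.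
lra.
Qed.

Hypothesis QY : 4 * Qv p u v * Y <= 1.

Let Q0 : 0 <= Qv p u v.
Proof.
rewrite /Qv mulr_ge0//; apply: (bform_ge0 po pc P) => k; exact: ltW (perron_u_gt0 P k).
Qed.

Lemma factor_bounds i : (i <= n)%N -> 0 <= 1 - 2 * Qv p u v * y i / lam <= 1.
Proof.
move=> ni; have yY := DY ni.
have h1 : 0 <= 2 * Qv p u v * y i / lam by rewrite divr_ge0 ?(ltW lam0)// mulr_ge0// mulr_ge0.
have h2 : 2 * Qv p u v * y i / lam <= 2 * Qv p u v * Y * 2.
  apply: ler_pM => //; first by rewrite mulr_ge0// mulr_ge0.
  by rewrite ler_wpM2l// mulr_ge0.
have : 2 * Qv p u v * Y * 2 = 4 * Qv p u v * Y by ring.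
have := QY; lra.
Qed.

(** Used for two orbits: the one of [mu] under [s], and the constant orbit [1 - mu] under [s = 1].
    Their quotient is the limit law. *)
Lemma omega_product :
  `|lam^-1 ^+ n * om n - om 0%N * \prod_(0 <= i < n) (1 - 2 * Qv p u v * y i / lam)|
    <= Cw * eta * om 0%N.
Proof.
pose err i := 2 * (Cb' * Y * q i + (Cb' * r i + (C3' * Y ^+ 2 + KM' * tau)) * om 0%N).
have hP := @product_recursion R (fun i => lam^-1 ^+ i * om i)
  (fun i => 1 - 2 * Qv p u v * y i / lam) err n.
rewrite /= expr0 mul1r in hP; apply: le_trans (hP _ _) _.
- by move=> i ni; apply: factor_bounds; exact: ltnW.
- move=> i ni; rewrite {1}/om WS//.
  have h1 := wstep_dotp po pc P c00 vc0 vV c_ge0 sC (D0 i) (yc (ltnW ni)) (fun k => Wge0 k (ltnW ni)).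
  rewrite -/(y i) -/(om i) -/(r i) in h1.
  have -> : lam^-1 ^+ i.+1 * dotp v (wstep p s (D i) (W i)) -
      (1 - 2 * Qv p u v * y i / lam) * (lam^-1 ^+ i * om i) =
      lam^-1 ^+ i.+1 * (dotp v (wstep p s (D i) (W i)) - (lam - 2 * Qv p u v * y i) * om i).
    by rewrite exprS; field; rewrite gt_eqF.
  rewrite normrM ger0_norm//; apply: le_trans (ler_wpM2l (lamVn i.+1) h1) _.
  have qE : lam^-1 ^+ i * wnorm v (orth u v (W i)) = q i.
    by rewrite /q /X orthZ wnormZ ger0_norm.
  have h4 := omn (ltnW ni); have yY := DY (ltnW ni); rewrite -/(y i) in yY.
  rewrite exprS -[leLHS]mulrA /err; apply: ler_pM => //.
    rewrite mulr_ge0//; exact: le_trans (normr_ge0 _) h1.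
  have -> : lam^-1 ^+ i * (Cb' * (wnorm v (orth u v (W i)) * y i + om i * r i) +
      C3' * (y i ^+ 2 * om i) + KM' * (tau * om i)) =
    Cb' * y i * q i + (Cb' * r i + (C3' * y i ^+ 2 + KM' * tau)) * (lam^-1 ^+ i * om i).
    by rewrite -qE; ring.
  have y2 : y i ^+ 2 <= Y ^+ 2 by rewrite lerXn2r ?nnegrE.
  apply: lerD; first by rewrite ler_wpM2r// ler_wpM2l.
  apply: ler_pM => //.
  + by rewrite !addr_ge0// ?mulr_ge0 ?exprn_ge0.
  + by rewrite mulr_ge0// omi0// ltnW.
  + by rewrite lerD2l lerD2r ler_wpM2l.
- rewrite /err -mulr_sumr big_split /= -mulr_sumr -mulr_suml big_split /= -mulr_sumr.
  rewrite sumr_const_nat subn0 -[_ *+ n]mulr_natl.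
  have h1 := sum_orth_W; have h2 := sum_orth_D.
  have h3 : Cb' * Y * \sum_(0 <= i < n) q i <= Cb' * Y * (CS * om 0%N).
    by rewrite ler_wpM2l// mulr_ge0.
  have h4 : Cb' * \sum_(0 <= i < n) r i <= Cb' * (CR * eta) by rewrite ler_wpM2l.
  have h5 : n%:R * (C3' * Y ^+ 2 + KM' * tau) <= C3' * (K * Y) + KM' * (n%:R * tau).
    have -> : n%:R * (C3' * Y ^+ 2 + KM' * tau) = C3' * (n%:R * Y ^+ 2) + KM' * (n%:R * tau) by ring.
    by rewrite lerD2r ler_wpM2l.
  have h6 : C3' * (K * Y) + KM' * (n%:R * tau) <= (C3' * K + KM') * eta.
    have : 0 <= C3' * K * (n%:R * tau) by rewrite !mulr_ge0.
    have : 0 <= KM' * Y by rewrite mulr_ge0.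
    rewrite /eta; lra.
  have h7 : Cb' * Y * CS <= Cb' * CS * eta.
    have : 0 <= Cb' * CS * (n%:R * tau) by rewrite mulr_ge0// mulr_ge0.
    rewrite /eta; lra.
  have h8 : (Cb' * \sum_(0 <= i < n) r i + n%:R * (C3' * Y ^+ 2 + KM' * tau)) * om 0%N
     <= (Cb' * CR + C3' * K + KM') * eta * om 0%N.
    by rewrite ler_wpM2r//; have := n1; lra.
  have h9 : Cb' * Y * (CS * om 0%N) <= Cb' * CS * eta * om 0%N.
    by rewrite mulrA ler_wpM2r.
  have -> : Cw * eta * om 0%N = 2 * (Cb' * CS * eta * om 0%N + (Cb' * CR + C3' * K + KM') * eta * om 0%N).
    by rewrite /Cw; ring.
  rewrite ler_wpM2l//; lra.
Qed.

End Process.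

(** * The limit in m *)

Lemma cvg_sumr (R : realType) (I : Type) (r : seq I) (F : I -> nat -> R) (l : I -> R) :
  (forall i, F i k @[k --> \oo] --> l i) ->
  \sum_(i <- r) F i k @[k --> \oo] --> \sum_(i <- r) l i.
Proof.
move=> Fl; elim: r => [|i r IH].
  by under eq_fun do rewrite big_nil; rewrite big_nil; exact: cvg_cst.
under eq_fun do rewrite big_cons; rewrite big_cons.
exact: (cvgD (Fl i) IH).
Qed.

Lemma cvg_mulmx (R : realType) (d : nat) (A : nat -> 'M[R]_d) (B : 'M[R]_d)
    (x : nat -> 'cV[R]_d) (y : 'cV[R]_d) :
  (forall i j, A k i j @[k --> \oo] --> B i j) ->
  (forall i, x k i 0 @[k --> \oo] --> y i 0) ->
  forall i, (A k *m x k) i 0 @[k --> \oo] --> (B *m y) i 0.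
Proof.
move=> AB xy i; under eq_fun do rewrite mulmx_cE; rewrite mulmx_cE.
by apply: cvg_sumr => j; exact: (cvgM (AB i j) (xy j)).
Qed.

Lemma expr_ge_scaled (R : realType) (d : nat) (A B : 'M[R]_d) (k : R) n :
  0 <= k -> (forall i j, 0 <= A i j) -> (forall i j, k * A i j <= B i j) ->
  forall i j, k ^+ n * (A ^+ n) i j <= (B ^+ n) i j.
Proof.
move=> k0 A0 kAB.
have An0 m i j : 0 <= (A ^+ m) i j.
  elim: m i j => [|m IH] i j; first by rewrite expr0 mxE.
  by rewrite exprS mxE sumr_ge0// => l _; rewrite mulr_ge0.
elim: n => [|n IH] i j; first by rewrite !expr0 mul1r.
rewrite !exprS !mxE mulr_sumr; apply: ler_sum => l _.
have -> : k * k ^+ n * (A i l * (A ^+ n) l j) = (k * A i l) * (k ^+ n * (A ^+ n) l j) by ring.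
by apply: ler_pM => //; rewrite ?mulr_ge0 ?exprn_ge0.
Qed.

(** Contraction for a single matrix, with a constant that may depend on it. It serves for [M(mu)] in
    the limit over [m], which is taken for a fixed law. *)
Lemma perron_contraction (R : realType) (d : nat) (A : 'M[R]_d) lam u v U (a : R) :
  perron A lam u v -> 0 < a -> (forall i j, a <= (A ^+ U) i j) ->
  exists2 h, 0 < h <= 1 & forall x, dotp v x = 0 ->
    lam^-1 ^+ U * wnorm v (A ^+ U *m x) <= (1 - h) * wnorm v x.
Proof.
move=> P a0 AU; have ga := contract_gap P a0 AU; set g := a ^+ 2 / lam ^+ U in ga.
have lU : 0 < lam ^+ U by rewrite exprn_gt0// (perron_lam_gt0 P).
have g0 : 0 < g by rewrite divr_gt0// exprn_gt0.
exists (Num.min 1 (g / lam ^+ U)).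
  by rewrite lt_min ltr01 divr_gt0//= ge_min lexx.
move=> x vx; have h1 := wnorm_contract P AU ga vx.
have N0 := wnorm_ge0 P x.
rewrite exprVn; apply: le_trans (_ : (lam ^+ U)^-1 * ((lam ^+ U - g) * wnorm v x) <= _).
  by rewrite ler_wpM2l// invr_ge0 ltW.
rewrite mulrA ler_wpM2r// mulrBr mulVf ?gt_eqF// lerD2l lerN2 [_^-1 * g]mulrC.
by rewrite ge_min lexx orbT.
Qed.

(** * Extinction probabilities and the limit over [m] for a fixed offspring law *)

Section Extinction.
Variables (R : realType) (d : nat) (p : offspring R d) (c : R).
Hypothesis po : is_offspring p.
Hypothesis pc : (\sum_(k < d) \sum_(l < d) \sum_(m < d) \sum_(j < d) cmom p k l m j
         <= c%:E)%E.
Implicit Types (x s w : 'cV[R]_d).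

Definition vle x x' := forall i : 'I_d, x i 0 <= x' i 0.

Lemma pgf_mono x x' : inC x -> inC x' -> vle x x' -> vle (pgf p x) (pgf p x').
Proof.
move=> xC xC' xx' k; have /andP[h _] := pgf_slope po pc k xC xC' xx'.
rewrite -subr_ge0; apply: le_trans h; apply: sumr_ge0 => l _.
by rewrite mulr_ge0 ?subr_ge0// (Mat_ge0 po pc).
Qed.

Definition fit K : 'cV[R]_d := iter K (pgf p) 0.

Lemma fit_inC K : inC (fit K).
Proof. by apply: inC_iter_pgf => //; exact: inC0. Qed.

Lemma fitS_le K : vle (fit K) (fit K.+1).
Proof.
elim: K => [|K IH] i; first by rewrite [fit 0]/= mxE; case/andP: (fit_inC 1 i).
exact: (pgf_mono (fit_inC K) (fit_inC K.+1) IH i).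
Qed.

Lemma fit_le m n : (m <= n)%N -> vle (fit m) (fit n).
Proof.
move=> /subnKC <-; elim: (n - m)%N => [|k IH] i; first by rewrite addn0.
by rewrite addnS; apply: le_trans (IH i) _; exact: fitS_le.
Qed.

Lemma muE j : mu p j 0 = sup (range (fun K => fit K j 0)).
Proof.
have e : range (fun K => wlaw p (one_v R d) j K (xzero d)) =
    [set x%:E | x in range (fun K => fit K j 0)].
  apply/seteqP; split=> [_ [K _ <-]|_ [_ [K _ <-] <-]].
    by exists (fit K j 0); [exists K|rewrite wlaw_one_xzero].
  by exists K => //; rewrite wlaw_one_xzero.
rewrite mxE e ereal_sup_EFin//; last by exists (fit 0 j 0); exists 0%N.
by exists 1 => _ [K _ <-]; case/andP: (fit_inC K j).
Qed.

Lemma fit_ubound j : has_ubound (range (fun K => fit K j 0)).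
Proof. by exists 1 => _ [K _ <-]; case/andP: (fit_inC K j). Qed.

Lemma fit_cvg j : fit K j 0 @[K --> \oo] --> mu p j 0.
Proof.
rewrite muE; apply: nondecreasing_cvgn; last exact: fit_ubound.
by move=> m n mn; exact: fit_le.
Qed.

Lemma fit_le_mu K : vle (fit K) (mu p).
Proof.
by move=> j; rewrite muE; apply: ub_le_sup; [exact: fit_ubound|exists K].
Qed.

Lemma mu_inC : inC (mu p).
Proof.
move=> j; apply/andP; split.
  by apply: le_trans (fit_le_mu 0 j); rewrite [fit 0]/= mxE.
rewrite muE; apply: ge_sup; first by exists (fit 0 j 0); exists 0%N.
by move=> _ [K _ <-]; case/andP: (fit_inC K j).
Qed.

Section FromBelow.
Variables (x : nat -> 'cV[R]_d) (x0 : 'cV[R]_d).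
Hypothesis xC : forall m, inC (x m).
Hypothesis x0C : inC x0.
Hypothesis xle : forall m, vle (x m) x0.
Hypothesis xcv : forall i, x m i 0 @[m --> \oo] --> x0 i 0.

Let lin_cvg (B : 'I_d -> R) : \sum_l B l * (x0 l 0 - x m l 0) @[m --> \oo] --> (0 : R).
Proof.
rewrite [X in _ --> X](_ : _ = \sum_l B l * (x0 l 0 - x0 l 0)); last first.
  by rewrite big1// => l _; rewrite subrr mulr0.
apply: cvg_sumr => l; apply: cvgM; first exact: cvg_cst.
by apply: cvgB => //; exact: cvg_cst.
Qed.

(** The iterates [f_K(0)] increase to [mu], so continuity from below suffices; the slope bounds
    provide it with a linear modulus. *)
Lemma squeeze_below (g : nat -> R) (g0 : R) (B : 'I_d -> R) :
  (forall m, 0 <= g0 - g m <= \sum_l B l * (x0 l 0 - x m l 0)) -> g m @[m --> \oo] --> g0.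
Proof.
move=> gB; have h : g0 - g m @[m --> \oo] --> (0 : R).
  by apply: squeeze_cvgr (cvg_cst 0) (lin_cvg B); apply: nearW => m; exact: gB.
have : g0 - (g0 - g m) @[m --> \oo] --> g0 - 0 by apply: cvgB => //; exact: cvg_cst.
by rewrite subr0; under eq_fun do rewrite opprB addrC subrK.
Qed.

Lemma pgf_cvg k : pgf p (x m) k 0 @[m --> \oo] --> pgf p x0 k 0.
Proof.
apply: (squeeze_below (B := fun l => Mat p x0 k l)) => m.
have /andP[_ h] := pgf_slope po pc k (xC m) x0C (xle m).
apply/andP; split; last exact: h.
by rewrite subr_ge0; exact: (pgf_mono (xC m) x0C (xle m) k).
Qed.

Lemma Mat_cvg k l : Mat p (x m) k l @[m --> \oo] --> Mat p x0 k l.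
Proof.
apply: (squeeze_below (B := fun i => bm p k l i)) => m.
apply/andP; split; first by rewrite subr_ge0; exact: (Mat_mono po pc k l (xC m) x0C (xle m)).
exact: (Mat_slope po pc k l (xC m) x0C (xle m)).
Qed.

End FromBelow.

Lemma mu_fix : pgf p (mu p) = mu p.
Proof.
apply/matrixP => k j; rewrite ord1.
have h : pgf p (fit K) k 0 @[K --> \oo] --> pgf p (mu p) k 0.
  by apply: pgf_cvg; [exact: fit_inC|exact: mu_inC|exact: fit_le_mu|exact: fit_cvg].
have h' : fit K.+1 k 0 @[K --> \oo] --> mu p k 0.
  by have := @fit_cvg k; rewrite -(cvg_shiftn 1); under eq_fun do rewrite addn1.
exact: (cvg_unique _ h h').
Qed.

Section Hitting.
Variable s : 'cV[R]_d.
Hypothesis sC : inC s.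
Local Notation H n x := (Hit p s n x).

Let s0 i : 0 <= s i 0. Proof. by case/andP: (sC i). Qed.

Lemma hmul_mono x x' : vle x x' -> vle (hmul s x) (hmul s x').
Proof. by move=> xx' i; rewrite !mxE ler_wpM2l. Qed.

Lemma Hit_mono n x x' : inC x -> inC x' -> vle x x' -> vle (H n x) (H n x').
Proof.
move=> xC xC' xx'; elim: n => [|n IH]; first exact: hmul_mono.
by apply: hmul_mono; apply: pgf_mono => //; exact: inC_Hit.
Qed.

Lemma Hit_cvg n (x : nat -> 'cV[R]_d) x0 : (forall m, inC (x m)) -> inC x0 ->
  (forall m, vle (x m) x0) -> (forall i, x m i 0 @[m --> \oo] --> x0 i 0) ->
  forall i, H n (x m) i 0 @[m --> \oo] --> H n x0 i 0.
Proof.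
move=> xC x0C xle xcv; elim: n => [|n IH] i.
  rewrite /Hit /= mxE; under eq_fun do rewrite mxE.
  by apply: cvgM => //; exact: cvg_cst.
rewrite /Hit iterS -/(Hit _ _ _ _) mxE; under eq_fun do rewrite iterS -/(Hit _ _ _ _) mxE.
apply: cvgM; first exact: cvg_cst.
apply: pgf_cvg => //; [by move=> m; exact: inC_Hit|exact: inC_Hit|].
by move=> m; exact: Hit_mono.
Qed.

(** The supremum over [K] is a limit, because [f_(m+K)(0)] increases to [mu] and [H_n] is monotone
    and continuous from below. *)
Lemma EjointE j n m :
  Ejoint p s j n m = (H n (mu p) j 0 - H n (fit m) j 0)%:E.
Proof.
pose G K := H n (fit (m + K)) j 0.
have -> : Ejoint p s j n m = ereal_sup [set x%:E | x in range (fun K => G K - H n (fit m) j 0)].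
  congr ereal_sup; apply/seteqP; split=> [_ [K _ <-]|_ [_ [K _ <-] <-]].
    by exists (G K - H n (fit m) j 0); [exists K|rewrite jointE// /G /fit iterD].
  by exists K => //; rewrite jointE// /G /fit iterD.
have Gle K : G K <= 1 by case/andP: (inC_Hit n po sC (fit_inC (m + K)) j).
have ub : has_ubound (range (fun K => G K - H n (fit m) j 0)).
  by exists (1 - H n (fit m) j 0) => _ [K _ <-]; rewrite lerD2r.
rewrite ereal_sup_EFin//; last by exists (G 0%N - H n (fit m) j 0); exists 0%N.
congr EFin.
have mono : {homo (fun K => G K - H n (fit m) j 0) : i k / (i <= k)%N >-> i <= k}.
  move=> i k ik; rewrite lerD2r; apply: Hit_mono; try exact: fit_inC.
  by apply: fit_le; rewrite leq_add2l.
have h1 := nondecreasing_cvgn mono ub.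
have h2 : G K - H n (fit m) j 0 @[K --> \oo] --> H n (mu p) j 0 - H n (fit m) j 0.
  apply: cvgB; last exact: cvg_cst.
  apply: Hit_cvg => [K|||i]; [exact: fit_inC|exact: mu_inC|by move=> K; exact: fit_le_mu|].
  by have := @fit_cvg i; rewrite -(cvg_shiftn m); under eq_fun do rewrite addnC.
exact: (cvg_unique _ h1 h2).
Qed.

(* The derivative of [Hit p s n] at [x] in the direction [w]. *)
Fixpoint Jit x w n : 'cV[R]_d :=
  if n is n'.+1 then hmul s (Mat p (H n' x) *m Jit x w n') else hmul s w.

Lemma mulmx_vle (A B : 'M[R]_d) x y : (forall i j, 0 <= A i j) -> (forall i j, A i j <= B i j) ->
  (forall i, 0 <= x i 0) -> vle x y -> vle (A *m x) (B *m y).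
Proof.
move=> A0 AB x0 xy i; rewrite !mulmx_cE; apply: ler_sum => j _; exact: ler_pM.
Qed.

Lemma mulmx_vge0 (A : 'M[R]_d) x : (forall i j, 0 <= A i j) -> (forall i, 0 <= x i 0) ->
  forall i, 0 <= (A *m x) i 0.
Proof. by move=> A0 x0 i; rewrite mulmx_cE sumr_ge0// => j _; rewrite mulr_ge0. Qed.

Lemma hmul_ge0 x : (forall i, 0 <= x i 0) -> forall i, 0 <= hmul s x i 0.
Proof. by move=> x0 i; rewrite mxE mulr_ge0. Qed.

Lemma Jit_ge0 x w n : inC x -> (forall i, 0 <= w i 0) -> forall i, 0 <= Jit x w n i 0.
Proof.
move=> xC w0; elim: n => [|n IH]; first exact: hmul_ge0.
apply: hmul_ge0; apply: mulmx_vge0 => // i j; apply: (Mat_ge0 po pc); exact: inC_Hit.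
Qed.

Lemma Jit_scale x (r : R) w n : Jit x (r *: w) n = r *: Jit x w n.
Proof.
have hs (y : 'cV[R]_d) : hmul s (r *: y) = r *: hmul s y.
  by apply/matrixP => i j; rewrite !mxE mulrCA.
by elim: n => [|n IH] /=; rewrite ?IH -?scalemxAr hs.
Qed.

(** Convexity propagated through the composition: increments lie between the directional derivatives
    at the two end points. This replaces a differentiability argument for [H_n]. *)
Lemma Hit_slope n x x' : inC x -> inC x' -> vle x x' ->
  vle (Jit x (x' - x) n) (H n x' - H n x) /\ vle (H n x' - H n x) (Jit x' (x' - x) n).
Proof.
move=> xC xC' xx'.
have hB (y z : 'cV[R]_d) : hmul s y - hmul s z = hmul s (y - z).
  by apply/matrixP => i j; rewrite !mxE mulrBr.
have dx i : 0 <= (x' - x) i 0 by rewrite !mxE subr_ge0.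
elim: n => [|n [IH1 IH2]].
  by rewrite /Hit /= hB; split=> i.
have HC := inC_Hit n po sC xC; have HC' := inC_Hit n po sC xC'.
have Hm := Hit_mono n xC xC' xx'.
have Hd i : 0 <= (H n x' - H n x) i 0 by rewrite !mxE subr_ge0.
have sl k := pgf_slope po pc k HC HC' Hm.
have M0 i j := Mat_ge0 po pc i j HC; have M0' i j := Mat_ge0 po pc i j HC'.
rewrite /Hit !iterS -/(Hit p s n x) -/(Hit p s n x') hB; split; apply: hmul_mono => k /=.
  apply: le_trans (_ : (Mat p (H n x) *m (H n x' - H n x)) k 0 <= _).
    by apply: mulmx_vle => //; exact: Jit_ge0.
  have /andP[h _] := sl k; rewrite mulmx_cE [leRHS]mxE [(- pgf _ _) k 0]mxE.
  by apply: le_trans h; rewrite le_eqVlt; apply/orP; left; apply/eqP; apply: eq_bigr => l _; rewrite !mxE.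
apply: le_trans (_ : (Mat p (H n x') *m (H n x' - H n x)) k 0 <= _); last first.
  by apply: mulmx_vle.
have /andP[_ h] := sl k; rewrite mulmx_cE [leLHS]mxE [(- pgf _ _) k 0]mxE.
by apply: le_trans h _; rewrite le_eqVlt; apply/orP; left; apply/eqP; apply: eq_bigr => l _; rewrite !mxE.
Qed.

Lemma Jit_cvg n (x w : nat -> 'cV[R]_d) x0 w0 : (forall m, inC (x m)) -> inC x0 ->
  (forall m, vle (x m) x0) -> (forall i, x m i 0 @[m --> \oo] --> x0 i 0) ->
  (forall i, w m i 0 @[m --> \oo] --> w0 i 0) ->
  forall i, Jit (x m) (w m) n i 0 @[m --> \oo] --> Jit x0 w0 n i 0.
Proof.
move=> xC x0C xle xcv wcv; elim: n => [|n IH] i /=.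
  rewrite mxE; under eq_fun do rewrite mxE.
  by apply: cvgM => //; exact: cvg_cst.
rewrite mxE; under eq_fun do rewrite mxE.
apply: cvgM; first exact: cvg_cst.
apply: cvg_mulmx => // k l; apply: Mat_cvg.
- by move=> m; exact: inC_Hit.
- exact: inC_Hit.
- by move=> m; exact: Hit_mono.
- exact: Hit_cvg.
Qed.

End Hitting.

Hypothesis mu0 : forall i, 0 < mu p i 0.

Lemma esum_eq0_term (g : X d -> R) k : (forall y, 0 <= g y) ->
  (\esum_(y in [set: X d]) (p k y * g y)%:E = 0)%E -> forall y, p k y * g y = 0.
Proof.
move=> g0 e y; apply/eqP; rewrite eq_le; apply/andP; split; last first.
  by rewrite mulr_ge0//; exact: po.1.
have h : ((p k y * g y)%:E <= 0)%E.
  by rewrite -e; apply: esum_ge; exists [set y]; [split|rewrite fsbig_set1].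
by rewrite -lee_fin.
Qed.

Lemma vpow_gt0 x y : (forall i, 0 < x i 0) -> 0 < vpow x y.
Proof. by move=> x0; apply: prodr_gt0 => i _; rewrite exprn_gt0. Qed.

Lemma sub_x_unitv (y : X d) l : (0 < y l)%N -> y = add_x (sub_x y (unitv l)) (unitv l).
Proof. by move=> yl; apply/ffunP => k; rewrite !ffunE subnK//; case: eqP => // ->. Qed.

(** Equality would mean that no [y] charged by [p k] contains the type [l], since a monomial
    containing it is strictly smaller at [x] than at [mu > 0]. Then the entry of [M(mu)] would
    vanish. *)
Lemma pgf_strict x k l : inC x -> (forall i, x i 0 < mu p i 0) -> Mat p (mu p) k l != 0 ->
  pgf p x k 0 < pgf p (mu p) k 0.
Proof.
move=> xC xmu Mkl; have xle i := ltW (xmu i).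
have muC := mu_inC.
rewrite lt_neqAle pgf_mono// andbT; apply/negP => /eqP e.
have vm y : 0 <= vpow (mu p) y - vpow x y by rewrite subr_ge0 vpow_mono.
have dv : dom (fun y => vpow (mu p) y - vpow x y).
  by apply: domD; [|apply: domN]; exact: dom_vpow.
have e0 : (\esum_(y in [set: X d]) (p k y * (vpow (mu p) y - vpow x y))%:E = 0)%E.
  rewrite (ExE po pc)// (ExB po pc); try exact: dom_vpow.
  by rewrite -!(pgfE po pc)// e subrr.
case/negP: Mkl; rewrite (MatE po pc)//; apply/eqP/EFin_inj.
rewrite -(ExE po pc); [|by move=> y; case/andP: (dmon_bound y l muC)|exact: dom_dmon].
apply: esum1 => y _; congr EFin.
have := esum_eq0_term vm e0 y => /eqP; rewrite mulf_eq0 => /orP[/eqP ->|]; first by rewrite mul0r.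
rewrite /dmon; have [->|yl] := posnP (y l); first by rewrite mul0r mulr0.
rewrite (sub_x_unitv yl) !vpow_add_unitv => h; exfalso; move: h; apply/negP; rewrite gt_eqF// subr_gt0.
apply: le_lt_trans (_ : vpow (mu p) (sub_x y (unitv l)) * x l 0 < _).
  by rewrite ler_wpM2r ?vpow_mono//; case/andP: (xC l).
by rewrite ltr_pM2l ?vpow_gt0.
Qed.

(** For [mu > 0] the terms of the two series differ by positive factors, so the entries vanish
    together and primitivity passes from [M(1)] to [M(mu)]. *)
Lemma Mat_mu_pattern k l : Mat p (mu p) k l = 0 -> Mmean p k l = 0.
Proof.
have muC := mu_inC; have C1 := @inC_one R d.
rewrite /Mmean !(MatE po pc)// => e.
have e0 : (\esum_(y in [set: X d]) (p k y * dmon y l (mu p))%:E = 0)%E.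
  by rewrite (ExE po pc) ?e//; [by move=> y; case/andP: (dmon_bound y l muC)|exact: dom_dmon].
apply: EFin_inj; rewrite -(ExE po pc); [|by move=> y; case/andP: (dmon_bound y l C1)|exact: dom_dmon].
apply: esum1 => y _; congr EFin.
have g0 z : 0 <= dmon z l (mu p) by case/andP: (dmon_bound z l muC).
have := esum_eq0_term g0 e0 y => /eqP; rewrite mulf_eq0 => /orP[/eqP ->|]; first by rewrite mul0r.
rewrite /dmon mulf_eq0 [X in _ || X]gt_eqF ?vpow_gt0// orbF => /eqP ->.
by rewrite mul0r mulr0.
Qed.

Lemma Mat_mu_primitive U : (forall i j, 0 < (Mmean p ^+ U) i j) ->
  forall i j, 0 < (Mat p (mu p) ^+ U) i j.
Proof.
move=> MU.
have M0 k l := Mat_ge0 po pc k l (@inC_one R d); have A0 k l := Mat_ge0 po pc k l mu_inC.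
(* [finite_lower_bound] compares positive families; adding the indicator of the common zero set
   makes both families positive. *)
pose F (kl : 'I_d * 'I_d) := Mmean p kl.1 kl.2 + (Mat p (mu p) kl.1 kl.2 == 0)%:R.
pose G (kl : 'I_d * 'I_d) := Mat p (mu p) kl.1 kl.2 + (Mat p (mu p) kl.1 kl.2 == 0)%:R.
have G0 kl : 0 < G kl.
  rewrite /G; case: eqP => [->|/eqP h]; first by rewrite add0r ltr01.
  by rewrite addr0 lt_neqAle eq_sym h A0.
have F0 kl : 0 < F kl.
  rewrite /F; case: eqP => [h|/eqP h]; first by rewrite (Mat_mu_pattern h) add0r ltr01.
  rewrite addr0 lt_neqAle M0 andbT eq_sym; apply: contra h => /eqP h.
  have hle : Mat p (mu p) kl.1 kl.2 <= Mmean p kl.1 kl.2.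
    apply: (Mat_mono po pc _ _ mu_inC (@inC_one R d)) => i.
    by rewrite [one_v R d i 0]mxE; case/andP: (mu_inC i).
  by rewrite eq_le A0 andbT -h.
have [e e0 eFG] := finite_lower_bound F0 G0.
have kM k l : e * Mmean p k l <= Mat p (mu p) k l.
  have := eFG (k, l); rewrite /F /G /=; case: eqP => [h _|_]; last by rewrite !addr0.
  by rewrite (Mat_mu_pattern h) mulr0.
move=> i j; apply: lt_le_trans (expr_ge_scaled U (ltW e0) M0 kM i j).
by rewrite mulr_gt0// exprn_gt0.
Qed.

Variables (lam : R) (u v : 'cV[R]_d) (U : nat).
Hypothesis U0 : (0 < U)%N.
Hypothesis P : perron (Mat p (mu p)) lam u v.
Hypothesis AU : forall i j, 0 < (Mat p (mu p) ^+ U) i j.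
Local Notation A := (Mat p (mu p)).

Let A0 k l : 0 <= A k l. Proof. exact: (Mat_ge0 po pc k l mu_inC). Qed.
Let lam0 : 0 < lam := perron_lam_gt0 P.
Let v0 i : 0 <= v i 0. Proof. exact: ltW (perron_v_gt0 P i). Qed.

Definition qm m : 'cV[R]_d := mu p - fit m.

(** Strictness propagates because no row of [M(mu)] is zero: otherwise the eigenvalue equation would
    contradict [lam u > 0]. *)
Lemma fit_lt_mu m i : fit m i 0 < mu p i 0.
Proof.
elim: m i => [|m IH] i; first by rewrite [fit 0]/= mxE.
have fixi : pgf p (mu p) i 0 = mu p i 0 by rewrite mu_fix.
rewrite -fixi.
have [l Al] : exists l, A i l != 0.
  apply: contrapT => /forallNP h.
  have := congr1 (fun M : 'cV_d => M i 0) (perron_eigen_r P).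
  rewrite mulmx_cE mxE big1; last by move=> l _; have /negP/negPn/eqP -> := h l; rewrite mul0r.
  by move=> /esym/eqP; rewrite gt_eqF// mulr_gt0// (perron_u_gt0 P).
exact: pgf_strict (fit_inC m) IH Al.
Qed.

Lemma qmE m i : qm m i 0 = mu p i 0 - fit m i 0.
Proof. by rewrite /qm [LHS]mxE [X in _ + X]mxE. Qed.

Lemma qm_gt0 m i : 0 < qm m i 0.
Proof. by rewrite qmE subr_gt0 fit_lt_mu. Qed.

Let qm_ge0 m i : 0 <= qm m i 0. Proof. exact: ltW (qm_gt0 m i). Qed.

Lemma qm_cvg i : qm m i 0 @[m --> \oo] --> (0 : R).
Proof.
rewrite -[X in _ --> X](subrr (mu p i 0)); under eq_fun do rewrite qmE.
by apply: cvgB; [exact: cvg_cst|exact: fit_cvg].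
Qed.

Let ym m := dotp v (qm m).

Let ym_gt0 m : 0 < ym m.
Proof.
have [i _|no] := pickP 'I_d; last first.
  by have := perron_sum P; rewrite big1 => [/eqP|i]; rewrite ?[0 == _]eq_sym ?oner_eq0// => _; have := no i.
rewrite /ym /dotp (bigD1 i)//= ltr_pwDl ?mulr_gt0 ?(perron_v_gt0 P) ?qm_gt0//.
by apply: sumr_ge0 => k _; rewrite mulr_ge0.
Qed.

Let ym_cvg : ym m @[m --> \oo] --> (0 : R).
Proof.
rewrite [X in _ --> X](_ : _ = \sum_i v i 0 * 0); last by rewrite big1// => i _; rewrite mulr0.
by apply: cvg_sumr => i; apply: cvgM; [exact: cvg_cst|exact: qm_cvg].
Qed.

Let ym_le m n : (m <= n)%N -> ym n <= ym m.
Proof.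
move=> mn; apply: ler_sum => i _; rewrite ler_wpM2l// !qmE lerD2l lerN2.
exact: fit_le.
Qed.

Let qmS m i : 0 <= (A *m qm m - qm m.+1) i 0 /\
  (A *m qm m - qm m.+1) i 0 <= (c + 2) * (\sum_l qm m l 0) ^+ 2.
Proof.
have e : (A *m qm m - qm m.+1) i 0 =
    \sum_l A i l * (mu p l 0 - fit m l 0) - (pgf p (mu p) i 0 - pgf p (fit m) i 0).
  rewrite [LHS]mxE mulmx_cE [(- qm _) i 0]mxE qmE mu_fix; congr (_ - _).
  by apply: eq_bigr => l _; rewrite qmE.
have /andP[h1 h2] := pgf_slope po pc i (fit_inC m) mu_inC (fit_le_mu m).
rewrite {}e subr_ge0; split=> //.
apply: le_trans (_ : \sum_l (A i l - Mat p (fit m) i l) * qm m l 0 <= _).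
  rewrite lerBlDr -lerBlDl; apply: le_trans h1.
  rewrite -sumrB; apply: ler_sum => l _; rewrite qmE le_eqVlt; apply/orP; left; apply/eqP; ring.
rewrite expr2 mulrA mulr_sumr; apply: ler_sum => l _; rewrite ler_wpM2r//.
apply: le_trans (Mat_slope po pc i l (fit_inC m) mu_inC (fit_le_mu m)) _.
rewrite mulr_sumr; apply: ler_sum => k _; rewrite -qmE ler_wpM2r//.
exact: (bm_le po pc).
Qed.

Let defect : exists2 C, 0 <= C & forall m, wnorm v (qm m.+1 - A *m qm m) <= C * ym m ^+ 2.
Proof.
have F1 (i : 'I_d) : 0 < (1 : R) by [].
have [e e0 ev] := finite_lower_bound F1 (perron_v_gt0 P).
exists (\sum_i v i 0 * (`|c + 2| / e ^+ 2)).
  by apply: sumr_ge0 => i _; rewrite mulr_ge0// divr_ge0// exprn_ge0// ltW.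
move=> m; rewrite mulr_suml; apply: ler_sum => i _.
have [h1 h2] := qmS m i.
rewrite -mulrA ler_wpM2l// -opprB [X in `|X|]mxE normrN ger0_norm//.
apply: le_trans h2 _.
have sq : 0 <= \sum_l qm m l 0 by exact: sumr_ge0.
have sy : \sum_l qm m l 0 <= ym m / e.
  rewrite ler_pdivlMr// mulr_suml; apply: ler_sum => l _.
  by rewrite mulrC ler_wpM2r// -[e]mulr1.
apply: le_trans (_ : `|c + 2| * (\sum_l qm m l 0) ^+ 2 <= _).
  by rewrite ler_wpM2r ?exprn_ge0// ler_norm.
rewrite -mulrA ler_wpM2l// mulrC -expr_div_n lerXn2r// nnegrE//.
by rewrite divr_ge0// ltW.
Qed.

(** Start at a late time [m] and follow [N U] steps, with [N] depending on [eps] only. Contraction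
    makes the misaligned part small against [y_m], and the quadratic errors over this window of
    fixed length are negligible because [y_m -> 0]. No rate of decay of [y_m] enters. *)
Lemma qm_direction_error (eps : R) : 0 < eps ->
  \forall m \near \oo, wnorm v (orth u v (qm m)) <= eps * ym m.
Proof.
move=> eps0; have [C C0 defC] := defect.
have [a a0 aA] : exists2 a, 0 < a & forall i j, a <= (A ^+ U) i j.
  have [e e0 eh] := finite_lower_bound (fun kl : 'I_d * 'I_d => ltr01) (fun kl : 'I_d * 'I_d => AU kl.1 kl.2).
  by exists e => // i j; have := eh (i, j); rewrite mulr1.
have [h h01 ctr] := perron_contraction P a0 aA.
have h0 : 0 < h by case/andP: h01.
have lV : 0 < lam^-1 by rewrite invr_gt0.
have k1 : `|1 - h| < 1.
  by case/andP: h01 => _ ?; rewrite ger0_norm ?subr_ge0// ltrBlDr ltrDl.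
have [N Nk] : exists N, 2 ^+ U.+1 * (1 - h) ^+ N <= eps / 4.
  have cv := cvg_geometric (2 ^+ U.+1) k1.
  have e4 : 0 < eps / 4 by rewrite divr_gt0.
  have [N _ hN] := (cvgrPdist_le _ _).1 cv _ e4.
  exists N; have := hN N (leqnn N); rewrite sub0r normrN /geometric /=.
  exact: le_trans (ler_norm _).
pose n := (N * U)%N.
pose C1 := 2 ^+ U.+2 / h * (lam^-1 * C); pose C2 := n%:R * (lam^-1 * C).
have C10 : 0 <= C1 by rewrite mulr_ge0 ?divr_ge0 ?exprn_ge0 ?(ltW h0)// mulr_ge0// ltW.
have C20 : 0 <= C2 by rewrite mulr_ge0// mulr_ge0// ltW.
have bound m : lam^-1 ^+ n * wnorm v (orth u v (qm (m + n))) <= eps / 2 * ym m + C1 * ym m ^+ 2 /\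
   ym m - C2 * ym m ^+ 2 <= lam^-1 ^+ n * ym (m + n)%N.
  have y0 := ltW (ym_gt0 m).
  pose X i := lam^-1 ^+ i *: qm (m + i).
  have yl i : lam^-1 ^+ i * ym (m + i)%N <= ym m.
    elim: i => [|i IH]; first by rewrite addn0 mul1r.
    apply: le_trans IH; rewrite exprSr -mulrA ler_wpM2l ?exprn_ge0 ?(ltW lV)//.
    rewrite ler_pdivrMl// addnS -(dotp_mulmx P); apply: ler_sum => k _; rewrite ler_wpM2l//.
    have [+ _] := qmS (m + i) k.
    by rewrite [X in 0 <= X]mxE [(- qm _) k 0]mxE subr_ge0.
  have df i : lam^-1 ^+ i.+1 * wnorm v (qm (m + i).+1 - A *m qm (m + i)%N) <= lam^-1 * C * ym m ^+ 2.
    apply: le_trans (ler_wpM2l _ (defC (m + i)%N)) _; first by rewrite exprn_ge0// ltW.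
    have y1 := ym_le (leq_addr i m); have := yl i.
    have -> : lam^-1 ^+ i.+1 * (C * ym (m + i)%N ^+ 2) =
       lam^-1 * C * (lam^-1 ^+ i * ym (m + i)%N * ym (m + i)%N) by rewrite exprS; ring.
    move=> y2; rewrite ler_wpM2l ?mulr_ge0 ?(ltW lV)// expr2.
    apply: ler_pM => //; last exact: ltW.
    by rewrite mulr_ge0 ?exprn_ge0 ?(ltW lV) ?(ltW (ym_gt0 _)).
  have Xe i : (i < n)%N -> wnorm v (X i.+1 - lam^-1 *: (A *m X i)) <= lam^-1 * C * ym m ^+ 2.
    move=> _; rewrite /X -scalemxAr scalerA -exprS -scalerBr wnormZ ger0_norm; last first.
      by rewrite exprn_ge0// ltW.
    by rewrite addnS; exact: df.
  have e0 : 0 <= lam^-1 * C * ym m ^+ 2 by rewrite mulr_ge0 ?exprn_ge0// mulr_ge0// ltW.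
  have sgl : lam^-1 * lam <= 2 by rewrite mulVf ?gt_eqF// ler1n.
  split.
    have := orth_pointwise P A0 U0 h01 (ltW lV) sgl ctr e0 Xe.
    rewrite mulnK// /X expr0 scale1r addn0 orthZ wnormZ ger0_norm ?exprn_ge0 ?(ltW lV)//.
    move=> /le_trans; apply; apply: lerD; last by rewrite /C1 !mulrA.
    have hq : wnorm v (orth u v (qm m)) <= 2 * ym m.
      by apply: le_trans (wnorm_orth P _) _; rewrite wnorm_pos.
    apply: le_trans (_ : 2 ^+ U * (1 - h) ^+ N * (2 * ym m) <= _).
      by rewrite ler_wpM2l// mulr_ge0 ?exprn_ge0// subr_ge0; case/andP: h01.
    have -> : 2 ^+ U * (1 - h) ^+ N * (2 * ym m) = 2 ^+ U.+1 * (1 - h) ^+ N * ym m by rewrite exprS; ring.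
    by rewrite ler_wpM2r//; have := eps0; lra.
  suff H i : (i <= n)%N -> ym m - i%:R * (lam^-1 * C) * ym m ^+ 2 <= lam^-1 ^+ i * ym (m + i)%N.
    exact: H.
  elim: i => [_|i IH ni]; first by rewrite addn0 !mul0r subr0 expr0 mul1r.
  have IH' := IH (ltnW ni).
  have h1 : lam * ym (m + i)%N - wnorm v (qm (m + i).+1 - A *m qm (m + i)%N) <= ym (m + i).+1.
    have := dotp_le_wnorm P (qm (m + i).+1 - A *m qm (m + i)%N).
    rewrite dotpB (dotp_mulmx P) ler_norml => /andP[h1 _].
    by rewrite /ym; lra.
  have h2 := df i; rewrite addnS.
  have h3 : 0 <= lam^-1 ^+ i.+1 by rewrite exprn_ge0// ltW.
  have h4 := ler_wpM2l h3 h1; rewrite mulrBr in h4.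
  have h5 : lam^-1 ^+ i.+1 * (lam * ym (m + i)%N) = lam^-1 ^+ i * ym (m + i)%N.
    by rewrite exprSr mulrA; field; rewrite gt_eqF.
  rewrite h5 in h4; rewrite -natr1; lra.
(* With these tolerances the bound for the misaligned part and [eps] times the lower bound for the
   size meet at [3 eps y_m / 4]. *)
have near1 : \forall m \near \oo, C1 * ym m <= eps / 4 /\ C2 * ym m <= 4^-1.
  have small (B e : R) : 0 <= B -> 0 < e -> \forall m \near \oo, B * ym m <= e.
    move=> B0 e0.
    have e1 : 0 < e / (B + 1) by rewrite divr_gt0// ltr_wpDl.
    have /cvgrPdist_le/(_ _ e1) := @ym_cvg; apply: filterS => m.
    rewrite sub0r normrN ger0_norm ?(ltW (ym_gt0 m))// ler_pdivlMr ?ltr_wpDl// => hm.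
    by apply: le_trans hm; rewrite mulrDr mulr1 mulrC lerDl ltW.
  have e4 : 0 < eps / 4 by rewrite divr_gt0.
  have q4 : 0 < (4^-1 : R) by rewrite invr_gt0.
  by have := small C2 _ C20 q4; have := small C1 _ C10 e4; apply: filterS2 => m.
have [m0 _ hm0] := near1.
exists (m0 + n)%N => // k /= kn.
have kE : k = ((k - n) + n)%N by rewrite subnK// (leq_trans _ kn)// leq_addl.
have m0k : (m0 <= k - n)%N by rewrite -(leq_add2r n) -kE.
have [s1 s2] := hm0 _ m0k; rewrite kE; move: (k - n)%N s1 s2 => m s1 s2.
have [b1 b2] := bound m; have y0 := ym_gt0 m.
have ln : 0 < lam^-1 ^+ n by rewrite exprn_gt0.
rewrite -(ler_pM2l ln).
have e1 : C1 * ym m ^+ 2 <= eps / 4 * ym m by rewrite expr2 [leLHS]mulrA ler_wpM2r// ltW.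
have e2 : C2 * ym m ^+ 2 <= 4^-1 * ym m by rewrite expr2 [leLHS]mulrA ler_wpM2r// ltW.
apply: le_trans b1 _.
rewrite [leRHS]mulrCA; apply: le_trans _ (ler_wpM2l (ltW eps0) b2).
have : eps * (C2 * ym m ^+ 2) <= eps * (4^-1 * ym m) by rewrite ler_wpM2l// ltW.
lra.
Qed.

Lemma qm_direction i : (ym m)^-1 * qm m i 0 @[m --> \oo] --> u i 0.
Proof.
apply/cvgrPdist_le => eps eps0.
have vi := perron_v_gt0 P i.
have e1 : 0 < eps * v i 0 by rewrite mulr_gt0.
have := qm_direction_error e1; apply: filterS => m hm.
have y0 := ym_gt0 m.
have -> : u i 0 - (ym m)^-1 * qm m i 0 = - ((ym m)^-1 * orth u v (qm m) i 0).
  have -> : orth u v (qm m) i 0 = qm m i 0 - ym m * u i 0.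
    by rewrite [LHS]mxE [X in _ + X]mxE [X in - X]mxE.
  by field; rewrite gt_eqF.
rewrite normrN normrM ger0_norm ?invr_ge0 ?(ltW y0)// ler_pdivrMl//.
rewrite -(ler_pM2l vi); apply: le_trans (_ : wnorm v (orth u v (qm m)) <= _).
  by rewrite /wnorm (bigD1 i)//= lerDl sumr_ge0// => j _; rewrite mulr_ge0.
by apply: le_trans hm _; rewrite le_eqVlt; apply/orP; left; apply/eqP; ring.
Qed.

(** By [Hit_slope] the quotient lies between [Jit] at [f_m(0)] and [Jit] at [mu], both in the
    direction [q_m / y_m]; the two bounds have the same limit. *)
Lemma Hit_increment_cvg s n j : inC s ->
  (ym m)^-1 * (Hit p s n (mu p) j 0 - Hit p s n (fit m) j 0) @[m --> \oo] -->
    Jit s (mu p) u n j 0.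
Proof.
move=> sC.
have hd i : ((ym m)^-1 *: qm m) i 0 @[m --> \oo] --> u i 0.
  by under eq_fun do rewrite mxE; exact: qm_direction.
apply: (@squeeze_cvgr _ _ _ _ (fun m => Jit s (fit m) ((ym m)^-1 *: qm m) n j 0)
    (fun m => Jit s (mu p) ((ym m)^-1 *: qm m) n j 0)).
- apply: nearW => m; rewrite !Jit_scale.
  have [h1 h2] := Hit_slope sC n (fit_inC m) mu_inC (fit_le_mu m).
  have y0 : 0 <= (ym m)^-1 by rewrite invr_ge0 ltW.
  have h1j := h1 j; have h2j := h2 j; rewrite [X in _ <= X]mxE [X in _ <= _ + X]mxE in h1j.
  rewrite [X in X <= _]mxE [X in _ + X <= _]mxE in h2j.
  rewrite [X in X <= _]mxE [X in _ <= _ <= X]mxE.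
  by rewrite !ler_wpM2l.
- by apply: Jit_cvg => //; [exact: fit_inC|exact: mu_inC|exact: fit_le_mu|exact: fit_cvg].
- apply: Jit_cvg => //; [by move=> m; exact: mu_inC|exact: mu_inC|by move=> m i|by move=> i; exact: cvg_cst].
Qed.

Lemma Hit_one_mu n : Hit p (one_v R d) n (mu p) = mu p.
Proof.
elim: n => [|n IH]; first by rewrite /Hit /= hmul1.
by rewrite /Hit iterS -/(Hit _ _ _ _) IH hmul1 mu_fix.
Qed.

Lemma Jit_one_mu n : Jit (one_v R d) (mu p) u n = lam ^+ n *: u.
Proof.
elim: n => [|n IH] /=; first by rewrite hmul1 scale1r.
by rewrite Hit_one_mu IH hmul1 -scalemxAr (perron_eigen_r P) scalerA exprSr.
Qed.

(** The normalisation [y_m] cancels in the ratio. For [s = 1] the point [mu] is fixed and [u] is an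
    eigenvector of the differential, so the denominator is explicit. *)
Lemma Lnj_cvg s j n : inC s ->
  Lnj p s j n m @[m --> \oo] --> Jit s (mu p) u n j 0 / (lam ^+ n * u j 0).
Proof.
move=> sC; have C1 := @inC_one R d.
have h1 := @Hit_increment_cvg s n j sC; have h2 := @Hit_increment_cvg (one_v R d) n j C1.
rewrite Jit_one_mu [X in _ --> X]mxE in h2.
have d0 : lam ^+ n * u j 0 != 0.
  by rewrite mulf_neq0 ?expf_neq0 ?gt_eqF// (perron_u_gt0 P).
have E : (fun m => Lnj p s j n m) = (fun m =>
    ((ym m)^-1 * (Hit p s n (mu p) j 0 - Hit p s n (fit m) j 0)) *
    ((ym m)^-1 * (Hit p (one_v R d) n (mu p) j 0 - Hit p (one_v R d) n (fit m) j 0))^-1).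
  apply/funext => m; have y0 := ym_gt0 m.
  by rewrite /Lnj !EjointE//= invfM invrK mulrACA mulVf ?mul1r// gt_eqF.
rewrite E; exact: (cvgM h1 (cvgV d0 h2)).
Qed.

End Extinction.

(** * The extinction probability near criticality *)

Lemma coordB (R : realType) (d : nat) (x y : 'cV[R]_d) i : (x - y) i 0 = x i 0 - y i 0.
Proof. by rewrite [LHS]mxE [X in _ + X]mxE. Qed.

Lemma coordZ (R : realType) (d : nat) (r : R) (x : 'cV[R]_d) i : (r *: x) i 0 = r * x i 0.
Proof. by rewrite mxE. Qed.

Lemma coord1 (R : realType) (d : nat) i : one_v R d i 0 = 1.
Proof. by rewrite mxE. Qed.

Section NearCritical.
Variables (R : realType) (d : nat) (p : offspring R d) (c : R).
Hypothesis po : is_offspring p.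
Hypothesis pc : (\sum_(k < d) \sum_(l < d) \sum_(m < d) \sum_(j < d) cmom p k l m j
         <= c%:E)%E.
Variables (lam : R) (u v : 'cV[R]_d) (c0 V : R).
Hypothesis P : perron (Mmean p) lam u v.
Hypothesis c00 : 0 < c0.
Hypothesis vc0 : forall i, c0 <= v i 0.
Hypothesis vV : forall i, v i 0 <= V.
Hypothesis c_ge0 : 0 <= c.
Hypothesis V0 : 0 <= V.
Variables (U : nat) (h : R).
Hypothesis U0 : (0 < U)%N.
Hypothesis h01 : 0 < h <= 1.
Hypothesis lam2 : lam <= 2.
Hypothesis ctr1 : forall x, dotp v x = 0 ->
  wnorm v (Mmean p ^+ U *m x) <= (1 - h) * wnorm v x.

Local Notation Cb := (Cb d c c0 V).
Local Notation C3 := (C3 d c c0 V).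
Local Notation one := (one_v R d).

Definition kap : R := locked (2 ^+ U.+1 / h).

Let h0 : 0 < h. Proof. by case/andP: h01. Qed.
Let v0 i : 0 <= v i 0. Proof. exact: ltW (perron_v_gt0 P i). Qed.
Let Cb0 : 0 <= Cb.
Proof. by rewrite /Cb -lock divr_ge0 ?exprn_ge0 ?(ltW c00)// !mulr_ge0// addr_ge0. Qed.
Let C30 : 0 <= C3.
Proof. by rewrite /C3 -lock divr_ge0 ?exprn_ge0 ?(ltW c00)// !mulr_ge0. Qed.
Let kap0 : 0 <= kap.
Proof. by rewrite /kap -lock divr_ge0 ?exprn_ge0 ?(ltW h0). Qed.
Let A0 := Mmean_ge0 po pc.
Let C1 := @inC_one R d.
Let muC := mu_inC po.

(** The constant sequence [x] satisfies the recursion up to [e]; one block of [U] steps then reads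
    [h r <= 2^(U+1) e], whence [kap]. *)
Lemma orth_almost_eigen x (e : R) : 0 <= e ->
  wnorm v (x - Mmean p *m x) <= e -> wnorm v (orth u v x) <= kap * e.
Proof.
move=> e0 xe.
have sgl : 1 * lam <= 2 by rewrite mul1r.
have ctr z : dotp v z = 0 -> 1 ^+ U * wnorm v (Mmean p ^+ U *m z) <= (1 - h) * wnorm v z.
  by rewrite expr1n mul1r; exact: ctr1.
have Xe i : (i < U)%N -> wnorm v ((fun=> x) i.+1 - 1 *: (Mmean p *m (fun=> x) i)) <= e.
  by rewrite scale1r.
have := orth_contract P A0 ler01 sgl ctr e0 Xe (i := 0%N); rewrite add0n => /(_ (leqnn _)).
have -> : kap * e = 2 ^+ U.+1 * e / h by rewrite /kap -lock; ring.
rewrite ler_pdivlMr// => hh; lra.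
Qed.

Definition qext : 'cV[R]_d := one - mu p.
Definition yext : R := dotp v qext.

Let mu_le i : mu p i 0 <= one i 0.
Proof. by rewrite [one i 0]mxE; case/andP: (muC i). Qed.

Lemma qextE i : qext i 0 = 1 - mu p i 0.
Proof. by rewrite /qext [LHS]mxE [X in _ + X]mxE [one i 0]mxE. Qed.

Lemma qext_ge0 i : 0 <= qext i 0.
Proof. by rewrite qextE subr_ge0; case/andP: (muC i). Qed.

Lemma one_sub_qext : one - qext = mu p.
Proof. by rewrite /qext opprB addrC subrK. Qed.

Lemma dstep_qext : dstep p one qext = qext.
Proof. by rewrite /dstep hmul1 one_sub_qext (mu_fix po pc). Qed.

Lemma yext_ge0 : 0 <= yext.
Proof. by apply: sumr_ge0 => i _; rewrite mulr_ge0// qext_ge0. Qed.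

Lemma qext_sub i : qext i 0 <= (Mmean p *m qext) i 0.
Proof.
have /andP[_] := pgf_slope po pc i muC C1 mu_le.
rewrite (pgf_one po pc) (mu_fix po pc) [one i 0]mxE qextE => /le_trans; apply.
rewrite mulmx_cE; apply: ler_sum => l _.
by rewrite qextE [one l 0]mxE.
Qed.

Lemma yext0 : yext = 0 -> mu p = one.
Proof.
move=> y0; have : wnorm v qext = 0 by rewrite wnorm_pos//; exact: qext_ge0.
by move/(wnorm_eq0 P) => e; rewrite -one_sub_qext e subr0.
Qed.

(** Pairing [1 - mu <= M (1 - mu)] with [v] gives [y_ext <= lam y_ext]. *)
Lemma subcritical_mu : lam < 1 -> mu p = one.
Proof.
move=> l1; apply: yext0; apply/eqP; rewrite eq_le yext_ge0 andbT.
have h1 : yext <= lam * yext.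
  rewrite -(dotp_mulmx P); apply: ler_sum => i _; rewrite ler_wpM2l//.
  exact: qext_sub.
by rewrite -(pmulr_rle0 _ (_ : 0 < 1 - lam)) ?subr_gt0//; lra.
Qed.

Hypothesis lam1 : 1 <= lam.
Let lam10 : 0 <= lam - 1. Proof. by rewrite subr_ge0. Qed.

Lemma qext_defect : wnorm v (qext - Mmean p *m qext) = (lam - 1) * yext.
Proof.
rewrite -(wnormN v) opprB wnorm_pos; last first.
  by move=> i; rewrite [X in _ <= X]mxE [X in _ + X]mxE subr_ge0 qext_sub.
by rewrite dotpB (dotp_mulmx P) -/yext; ring.
Qed.

Lemma qext_orth : wnorm v (orth u v qext) <= kap * ((lam - 1) * yext).
Proof.
by apply: orth_almost_eigen; rewrite ?qext_defect// mulr_ge0// yext_ge0.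
Qed.

Let tau_one : dotp v (one - one) = 0.
Proof. by rewrite subrr /dotp big1// => i _; rewrite mxE mulr0. Qed.

Variable Qm : R.
Hypothesis Qm0 : 0 < Qm.
Hypothesis QmQ : Qm <= Qv p u v.

(** The range in which the quadratic term governs: the first bound keeps the coordinates of [q]
    below one half, the second lets [Qm / 4] absorb the cubic remainder. *)
Definition zst : R := locked (Num.min (c0 / 2) (Qm / (4 * (C3 + 1)))).

Lemma zst_gt0 : 0 < zst.
Proof.
rewrite /zst -lock lt_min !divr_gt0// mulr_gt0// ltr_wpDl//.
Qed.

Lemma zst_le : zst <= c0 / 2.
Proof. by rewrite /zst -lock ge_min lexx. Qed.

Lemma zst_C3 y : 0 <= y -> y <= zst -> C3 * y <= Qm / 4.
Proof.
move=> y0 yz; have C31 : 0 < 4 * (C3 + 1) by rewrite mulr_gt0// ltr_wpDl.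
have : y <= Qm / (4 * (C3 + 1)).
  by apply: le_trans yz _; rewrite /zst -lock ge_min lexx orbT.
rewrite ler_pdivlMr//; have := C30; lra.
Qed.

Hypothesis small1 : Cb * kap * (lam - 1) <= Qm / 2.
Hypothesis small2 : (lam - 1) * (V * d%:R) < zst ^+ 2 * (Qm / 4).

Lemma yext_le_Vd : yext <= V * d%:R.
Proof.
apply: le_trans (_ : \sum_(i < d) V <= _); last by rewrite sumr_const card_ord mulr_natr.
apply: ler_sum => i _; rewrite -[leRHS]mulr1; apply: ler_pM => //; first exact: qext_ge0.
by rewrite qextE lerBlDr lerDl; case/andP: (muC i).
Qed.

(* By concavity of [q |-> 1 - f (1 - q)] the defect at [qext] dominates that at [th *: qext]. *)
Lemma defect_scaled (th : R) : 0 <= th <= 1 -> th * yext <= zst ->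
  (th * yext) ^+ 2 * (Qm / 4) <= (lam - 1) * yext.
Proof.
move=> /andP[th0 th1] thz.
set y := th * yext in thz *.
have y0 : 0 <= y by rewrite mulr_ge0// yext_ge0.
have qe0 := qext_ge0.
have x0 i : 0 <= (th *: qext) i 0 by rewrite mxE mulr_ge0.
have dx : dotp v (th *: qext) = y by rewrite dotpZ.
have yc : dotp v (th *: qext) / c0 <= 1.
  rewrite dx ler_pdivrMr// mul1r (le_trans thz)// (le_trans zst_le)//.
  by rewrite ler_pdivrMr// ler_peMr ?(ltW c00)// ler1n.
have h1 := dstep_dotp po pc P c00 vc0 vV c_ge0 C1 x0 yc.
rewrite dx tau_one add0r mul0r mulr0 addr0 orthZ wnormZ (ger0_norm th0) in h1.
have h2 : th * wnorm v (orth u v qext) <= kap * (lam - 1) * y.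
  have -> : kap * (lam - 1) * y = th * (kap * ((lam - 1) * yext)) by rewrite /y; ring.
  by rewrite ler_wpM2l// qext_orth.
(* Of the coefficient [Qm], one half absorbs the misalignment by [small1] and one quarter the cubic
   remainder; a quarter is left. *)
have h3 : y ^+ 2 * (Qm / 4) <= lam * y - dotp v (dstep p one (th *: qext)).
  move: h1; rewrite ler_norml => /andP[_ h1].
  have e1 : Cb * (y * (th * wnorm v (orth u v qext))) <= Qm / 2 * y ^+ 2.
    apply: le_trans (_ : Cb * (y * (kap * (lam - 1) * y)) <= _).
      by rewrite ler_wpM2l// ler_wpM2l.
    have -> : Cb * (y * (kap * (lam - 1) * y)) = Cb * kap * (lam - 1) * y ^+ 2 by ring.
    by rewrite ler_wpM2r// exprn_ge0.
  have e2 : C3 * y ^+ 3 <= Qm / 4 * y ^+ 2.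
    have -> : C3 * y ^+ 3 = C3 * y * y ^+ 2 by ring.
    by rewrite ler_wpM2r ?exprn_ge0// zst_C3.
  have e3 : Qm * y ^+ 2 <= Qv p u v * y ^+ 2 by rewrite ler_wpM2r ?exprn_ge0.
  lra.
apply: le_trans h3 _.
have xle : vle (one - qext) (one - th *: qext).
  by move=> i; rewrite (coordB one qext) (coordB one (th *: _)) coordZ lerD2l lerN2 ler_piMl.
have xC : inC (one - th *: qext).
  move=> i; have q0 := qe0 i; rewrite coordB coordZ coord1.
  have q1 : qext i 0 <= 1 by rewrite qextE lerBlDr lerDl; case/andP: (muC i).
  have : th * qext i 0 <= 1 by rewrite mulr_ile1.
  have : 0 <= th * qext i 0 by rewrite mulr_ge0.
  by move=> ? ?; apply/andP; split; lra.
have qC : inC (one - qext) by rewrite one_sub_qext.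
have le1 i : (one - th *: qext) i 0 <= one i 0.
  by rewrite coord1; case/andP: (xC i).
have dec i : (Mmean p *m (th *: qext)) i 0 - dstep p one (th *: qext) i 0 <=
   (Mmean p *m qext) i 0 - qext i 0.
  have /andP[_ sl] := pgf_slope po pc i qC xC xle.
  have sl' : pgf p (one - th *: qext) i 0 - pgf p (one - qext) i 0 <= (1 - th) * (Mmean p *m qext) i 0.
    apply: le_trans sl _; rewrite mulmx_cE mulr_sumr; apply: ler_sum => l _.
    have -> : (one - th *: qext) l 0 - (one - qext) l 0 = (1 - th) * qext l 0.
      by rewrite (coordB one qext) (coordB one (th *: _)) coordZ; ring.
    rewrite mulrCA ler_wpM2l ?subr_ge0// ler_wpM2r//.
    exact: (Mat_mono po pc i l xC C1 le1).
  rewrite -scalemxAr coordZ.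
  have -> : dstep p one (th *: qext) i 0 = 1 - pgf p (one - th *: qext) i 0.
    by rewrite /dstep hmul1 (coordB one) coord1.
  have e2 : qext i 0 = 1 - pgf p (one - qext) i 0.
    by rewrite one_sub_qext (mu_fix po pc) qextE.
  rewrite [X in _ <= _ - X]e2; lra.
have <- : dotp v (Mmean p *m (th *: qext)) = lam * y by rewrite (dotp_mulmx P) dx.
rewrite -dotpB; have -> : (lam - 1) * yext = dotp v (Mmean p *m qext - qext).
  by rewrite dotpB (dotp_mulmx P) -/yext; ring.
apply: ler_sum => i _; rewrite ler_wpM2l//.
by rewrite (coordB (_ *m _) qext) (coordB (_ *m _) (dstep _ _ _)).
Qed.

(** Otherwise shrink [qext] to size exactly [zst]. The quadratic lower bound for its defect then
    contradicts the trivial bound [y_ext <= V d] and [small2]. *)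
Lemma yext_le_zst : yext <= zst.
Proof.
rewrite leNgt; apply/negP => yz.
have y0 : 0 < yext := lt_trans zst_gt0 yz.
have e : zst / yext * yext = zst by rewrite divfK// gt_eqF.
have th01 : 0 <= zst / yext <= 1.
  by rewrite divr_ge0 ?(ltW zst_gt0) ?(ltW y0)//= ler_pdivrMr// mul1r ltW.
have := defect_scaled th01; rewrite e => /(_ (lexx _)) hd.
have := ler_wpM2l lam10 yext_le_Vd.
by move: small2; lra.
Qed.

Lemma yext_le : yext <= 4 / Qm * (lam - 1).
Proof.
have := @defect_scaled 1; rewrite mul1r ler01 lexx => /(_ isT yext_le_zst) hd.
have [->|yn0] := eqVneq yext 0; first by rewrite mulr_ge0// divr_ge0// ltW.
have y0 : 0 < yext by rewrite lt_neqAle eq_sym yn0 yext_ge0.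
rewrite mulrAC ler_pdivlMr// -(ler_pM2r y0).
have : yext ^+ 2 * (Qm / 4) = yext * Qm * yext / 4 by field.
lra.
Qed.

Lemma yext_c0 : yext / c0 <= 1.
Proof.
rewrite ler_pdivrMr// mul1r (le_trans yext_le_zst)// (le_trans zst_le)//.
by rewrite ler_pdivrMr// ler_peMr ?(ltW c00)// ler1n.
Qed.

Lemma mu_gt0 i : 0 < mu p i 0.
Proof.
have := coord_le_wnorm P c00 vc0 qext i.
rewrite ger0_norm ?qext_ge0// wnorm_pos; last exact: qext_ge0.
rewrite -/yext qextE => h1.
have : yext / c0 <= 2^-1.
  rewrite ler_pdivrMr// mulrC; exact: le_trans yext_le_zst zst_le.
lra.
Qed.

(** The fixed point equation divided by [y_ext]. It says that [Q y_ext] equals [lam - 1] to second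
    order. *)
Lemma yext_relation : yext != 0 ->
  `|Qv p u v * yext - (lam - 1)| <= Cb * kap * (lam - 1) * yext + C3 * yext ^+ 2.
Proof.
move=> yn0; have y0 : 0 < yext by rewrite lt_neqAle eq_sym yn0 yext_ge0.
have := dstep_dotp po pc P c00 vc0 vV c_ge0 C1 qext_ge0 yext_c0.
rewrite dstep_qext tau_one -/yext add0r mul0r mulr0 addr0.
have -> : yext - (lam * yext - Qv p u v * yext ^+ 2) = (Qv p u v * yext - (lam - 1)) * yext by ring.
rewrite normrM (ger0_norm (ltW y0)) => h1; rewrite -(ler_pM2r y0).
apply: le_trans h1 _.
have : Cb * (yext * wnorm v (orth u v qext)) <= Cb * (yext * (kap * ((lam - 1) * yext))).
  by rewrite ler_wpM2l// ler_wpM2l ?(ltW y0)// qext_orth.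
have : Cb * (yext * (kap * ((lam - 1) * yext))) = Cb * kap * (lam - 1) * yext * yext by ring.
have : C3 * yext ^+ 2 * yext = C3 * yext ^+ 3 by ring.
lra.
Qed.

(** If [mu = 1], then [1 - f_m(0)] tends to [0]. But once it is small the gain [lam - 1] beats the
    quadratic loss, so [v' (1 - f_m(0))] is nondecreasing from then on and stays away from [0]. *)
Lemma supercritical_yext : (0 < d)%N -> (forall i j, 0 < (Mmean p ^+ U) i j) ->
  1 < lam -> yext != 0.
Proof.
move=> d0 AU l1; apply/eqP => y0; have mu1 := yext0 y0.
have mu0 i : 0 < mu p i 0 by exact: mu_gt0.
have P' : perron (Mat p (mu p)) lam u v by rewrite mu1.
have qg := qm_gt0 po pc mu0 P'.
have qc i : qm p m i 0 @[m --> \oo] --> (0 : R) by apply: (qm_cvg po pc).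
pose ym m := dotp v (qm p m).
have yg m : 0 < ym m.
  rewrite /ym /dotp (bigD1 (Ordinal d0))//= ltr_pwDl ?mulr_gt0 ?(perron_v_gt0 P)//.
  by apply: sumr_ge0 => k _; rewrite mulr_ge0// ltW.
have ycv : ym m @[m --> \oo] --> (0 : R).
  rewrite [X in _ --> X](_ : _ = \sum_i v i 0 * 0); last by rewrite big1// => i _; rewrite mulr0.
  by apply: cvg_sumr => i; apply: cvgM; [exact: cvg_cst|exact: qc].
have qS m : dstep p one (qm p m) = qm p m.+1.
  have e : one - qm p m = fit p m by rewrite /qm mu1 opprB addrC subrK.
  by rewrite /dstep hmul1 e /qm mu1.
pose e := Num.min c0 ((lam - 1) / (2^-1 * Cb + 1)).
have e0 : 0 < e.
  by rewrite /e lt_min c00 divr_gt0 ?subr_gt0// ltr_wpDl// mulr_ge0.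
have /cvgrPdist_le/(_ _ e0) [N _ hN] := ycv.
have ye m : (N <= m)%N -> ym m <= e.
  by move=> /hN; rewrite sub0r normrN ger0_norm// ltW.
have inc m : (N <= m)%N -> ym m <= ym m.+1.
  move=> Nm; have yme := ye m Nm.
  have yc : dotp v (qm p m) / c0 <= 1.
    by rewrite ler_pdivrMr// mul1r (le_trans yme)// /e ge_min lexx.
  have h1 := dstep_error po pc P c00 vc0 vV c_ge0 C1 (fun i => ltW (qg m i)) yc.
  rewrite tau_one add0r qS -/(ym m) in h1.
  have := le_trans (dotp_le_wnorm P _) h1.
  rewrite dotpB (dotp_mulmx P) -/(ym _) -/(ym _) ler_norml => /andP[h2 _].
  have h3 : ym m <= (lam - 1) / (2^-1 * Cb + 1).
    by apply: le_trans yme _; rewrite /e ge_min lexx orbT.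
  rewrite ler_pdivlMr in h3; last by rewrite ltr_wpDl// mulr_ge0.
  have h4 : 2^-1 * Cb * ym m ^+ 2 <= (lam - 1) * ym m.
    rewrite expr2 mulrA; apply: ler_wpM2r; first exact: ltW.
    have := yg m; lra.
  lra.
have up m : ym N <= ym (N + m)%N.
  elim: m => [|m IH]; first by rewrite addn0.
  by rewrite addnS (le_trans IH)// inc// leq_addr.
have yN2 : 0 < ym N / 2 by rewrite divr_gt0.
have /cvgrPdist_le/(_ _ yN2) [N' _ hN'] := ycv.
have := hN' (N + N')%N (leq_addl _ _); rewrite /= sub0r normrN ger0_norm ?(ltW (yg _))//.
have := up N'; have := yg N; lra.
Qed.

(** * The Perron root of the mean matrix at the extinction vector *)

Section RhoMu.
Variables (lam' : R) (u' v' : 'cV[R]_d).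
Hypothesis P' : perron (Mat p (mu p)) lam' u' v'.

Let w0 i : 0 <= u' i 0. Proof. exact: ltW (perron_u_gt0 P' i). Qed.
Let om := dotp v u'.

Let om0 : 0 < om.
Proof.
rewrite lt_neqAle; apply/andP; split; last by apply: sumr_ge0 => i _; rewrite mulr_ge0.
apply/eqP => /esym e; have : wnorm v u' = 0 by rewrite wnorm_pos.
move/(wnorm_eq0 P) => u0; have := perron_sum P'; rewrite u0 big1; last by move=> i _; rewrite mxE.
by move/eqP; rewrite eq_sym oner_eq0.
Qed.

Let wE : wstep p one qext u' = lam' *: u'.
Proof. by rewrite /wstep hmul1 one_sub_qext (perron_eigen_r P'). Qed.

(** The right Perron vector of [M(mu)] is an exact eigenvector of [wstep]. A bootstrap: the
    first-order error gives [|lam' - lam| <= Cb y_ext], so [u'] is nearly fixed by [M(1)] and hence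
    nearly aligned with [u]; the second-order expansion then applies. *)
Lemma rho_mu_estimate :
  `|lam' - (lam - 2 * Qv p u v * yext)| <=
    Cb * (kap * (lam - 1 + 2 * Cb * yext) * yext + kap * ((lam - 1) * yext)) + C3 * yext ^+ 2.
Proof.
have y0 := yext_ge0.
have h1 := wstep_error po pc P c00 vc0 vV c_ge0 C1 qext_ge0 yext_c0 w0.
rewrite wE tau_one mulr0 addr0 -/om -/yext in h1.
have hl : `|(lam' - lam) * om| <= Cb * yext * om.
  apply: le_trans h1; apply: le_trans (dotp_le_wnorm P _).
  by rewrite dotpB dotpZ (dotp_mulmx P) -/om mulrBl.
have hl' : `|lam' - lam| <= Cb * yext.
  by move: hl; rewrite normrM (ger0_norm (ltW om0)) ler_pM2r.
have hu : wnorm v (u' - Mmean p *m u') <= (lam - 1 + 2 * Cb * yext) * om.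
  have -> : u' - Mmean p *m u' = (1 - lam') *: u' + (lam' *: u' - Mmean p *m u').
    by rewrite scalerBl scale1r addrA subrK.
  apply: le_trans (wnormD P _ _) _; rewrite wnormZ (wnorm_pos v w0) -/om.
  have : `|1 - lam'| <= lam - 1 + Cb * yext.
    have -> : 1 - lam' = - (lam - 1) - (lam' - lam) by ring.
    by apply: le_trans (ler_normB _ _) _; rewrite normrN (ger0_norm lam10) lerD2l.
  by move=> /(ler_wpM2r (ltW om0)); lra.
have e0 : 0 <= (lam - 1 + 2 * Cb * yext) * om.
  by rewrite mulr_ge0 ?(ltW om0)// addr_ge0// mulr_ge0// mulr_ge0.
have hS := orth_almost_eigen e0 hu.
have h2 := wstep_dotp po pc P c00 vc0 vV c_ge0 C1 qext_ge0 yext_c0 w0.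
rewrite wE tau_one mul0r mulr0 addr0 dotpZ -/om -/yext -mulrBl normrM (ger0_norm (ltW om0)) in h2.
rewrite -(ler_pM2r om0); apply: le_trans h2 _.
have hS' := ler_wpM2r y0 hS; have hR := ler_wpM2l (ltW om0) qext_orth.
have : Cb * (wnorm v (orth u v u') * yext + om * wnorm v (orth u v qext)) <=
   Cb * (kap * ((lam - 1 + 2 * Cb * yext) * om) * yext + om * (kap * ((lam - 1) * yext))).
  by rewrite ler_wpM2l// lerD.
have : Cb * (kap * ((lam - 1 + 2 * Cb * yext) * om) * yext + om * (kap * ((lam - 1) * yext))) =
   Cb * (kap * (lam - 1 + 2 * Cb * yext) * yext + kap * ((lam - 1) * yext)) * om by ring.
have : C3 * (yext ^+ 2 * om) = C3 * yext ^+ 2 * om by ring.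
lra.
Qed.

End RhoMu.
End NearCritical.

(** * Riccati comparison *)

Section RealEstimates.
Variable R : realType.

Lemma expR_second_order (h : R) : `|h| <= 2^-1 -> 0 <= expR h - 1 - h <= 2 * h ^+ 2.
Proof.
rewrite ler_norml => /andP[h1 h2].
have e1 := expR_ge1Dx h; have e2 := expR_ge1Dx (- h).
have e3 : expR h * expR (- h) = 1 by rewrite -expRD subrr expR0.
have e0 := expR_gt0 h.
apply/andP; split; first lra.
have : expR h * (1 - h) <= 1 by rewrite -[X in _ <= X]e3 ler_wpM2l ?(ltW e0).
move=> e4; nra.
Qed.

Lemma expR_le_lin (h : R) : 0 <= h <= 2^-1 -> expR (- (2 * h)) <= 1 - h.
Proof.
move=> /andP[h1 h2]; have e1 := expR_ge1Dx (2 * h).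
have e3 : expR (2 * h) * expR (- (2 * h)) = 1 by rewrite -expRD subrr expR0.
have e0 := expR_gt0 (- (2 * h)).
have : (1 + 2 * h) * expR (- (2 * h)) <= 1 by rewrite -[X in _ <= X]e3 ler_wpM2r ?(ltW e0).
have : 1 <= (1 + 2 * h) * (1 - h) by nra.
move=> a1 a2; have : (1 + 2 * h) * expR (- (2 * h)) <= (1 + 2 * h) * (1 - h) by lra.
by rewrite ler_pM2l//; lra.
Qed.

Lemma expRN_lipschitz (a b : R) : 0 <= a -> 0 <= b -> `|expR (- a) - expR (- b)| <= `|a - b|.
Proof.
wlog ab : a b / a <= b => [hw a0 b0|a0 b0].
  have [ab|ba] := leP a b; first exact: hw.
  by rewrite distrC [leRHS]distrC; apply: hw => //; exact: ltW.
have e : expR (- b) = expR (- a) * expR (- (b - a)) by rewrite -expRD; congr expR; ring.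
have ea : expR (- a) <= 1 by rewrite -expR0 ler_expR oppr_le0.
have ep := expR_gt0 (- a); have h1 := expR_ge1Dx (- (b - a)).
have h2 : expR (- (b - a)) <= 1 by rewrite -expR0 ler_expR oppr_le0 subr_ge0.
rewrite distrC ler0_norm; last by rewrite subr_le0 ler_expR lerN2.
rewrite [`|a - b|]distrC ger0_norm ?subr_ge0// e.
have : 0 <= expR (- a) * (1 - expR (- (b - a))) by rewrite mulr_ge0 ?(ltW ep)// subr_ge0.
have : expR (- a) * (1 - expR (- (b - a))) <= 1 * (b - a).
  by apply: ler_pM => //; rewrite ?subr_ge0 ?(ltW ep)//; lra.
lra.
Qed.

Lemma prod_diff (a b : nat -> R) n :
  (forall i, (i < n)%N -> 0 <= a i <= 1) -> (forall i, (i < n)%N -> 0 <= b i <= 1) ->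
  `|\prod_(0 <= i < n) a i - \prod_(0 <= i < n) b i| <= \sum_(0 <= i < n) `|a i - b i|.
Proof.
elim: n => [|n IH] an bn; first by rewrite !big_geq// subrr normr0.
rewrite !big_nat_recr//=.
have IH' := IH (fun i ni => an i (ltnW ni)) (fun i ni => bn i (ltnW ni)).
have pb : 0 <= \prod_(0 <= i < n) b i <= 1.
  rewrite big_nat prodr_ge0 => [|i /andP[_ ni]]; last by case/andP: (bn i (ltnW ni)).
  by apply: prodr_ile1 => i /andP[_ ni]; exact: bn (ltnW ni).
have /andP[a0 a1] := an n (ltnSn n).
set Pa := \prod_(_ <= i < n) a i in IH' *; set Pb := \prod_(_ <= i < n) b i in IH' pb *.
have -> : Pa * a n - Pb * b n = (Pa - Pb) * a n + Pb * (a n - b n) by ring.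
apply: le_trans (ler_normD _ _) _; rewrite !normrM; case/andP: pb => pb0 pb1.
apply: lerD; last by rewrite (ger0_norm pb0) ler_piMl.
by apply: le_trans IH'; rewrite (ger0_norm a0) ler_piMr.
Qed.

Lemma prod_expV2 (F : nat -> R) n :
  \prod_(0 <= i < n) F i ^- 2 = (\prod_(0 <= i < n) F i) ^- 2.
Proof.
elim: n => [|n IH]; first by rewrite !big_geq// expr1n invr1.
by rewrite !big_nat_recr//= IH exprMn [RHS]invfM.
Qed.

Section Riccati.
Variables (p q al th Q B : R) (n : nat).
Hypothesis B1 : 1 <= B.
Hypothesis p0 : 0 < p.
Hypothesis pB : p <= B.
Hypothesis qp : q = p + al.
Hypothesis qB : q <= B.
Hypothesis al0 : 0 <= al.
Hypothesis Q0 : 0 < Q.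
Hypothesis QB : Q <= B.
Hypothesis QV : Q^-1 <= B.
Hypothesis th0 : 0 <= th.
Hypothesis thB : th <= B.
Hypothesis pq : p * q = Q * th.
Hypothesis nB : 4 * B ^+ 3 <= n%:R.

(** Solution of [phi'' + al phi' = Q th phi] with [phi(0) = 1] and [phi'(0) = 0]; the characteristic
    roots are [p] and [-q]. Then [phi' / (Q phi)] solves the Riccati equation
    [x' = th - al x - Q x^2] from [x = 0]. *)
Definition phi (t : R) : R := (q * expR (p * t) + p * expR (- (q * t))) / (p + q).

Let n0 : 0 < n%:R :> R.
Proof. by apply: lt_le_trans nB; rewrite mulr_gt0// exprn_gt0// (lt_le_trans ltr01 B1). Qed.
Let B0 : 0 < B. Proof. exact: lt_le_trans ltr01 B1. Qed.
Let q0 : 0 < q. Proof. by rewrite qp ltr_wpDr. Qed.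
Let alB : al <= B. Proof. by apply: le_trans qB; rewrite qp lerDr ltW. Qed.
Let x := expR (p / n%:R).
Let z := expR (- (q / n%:R)).
Let Ac := q / (p + q).
Let Bc := p / (p + q).
(** [ph i] is [phi (i / n)]. The discrete logarithmic derivative [xs] is scaled so that
    [1 + Q xs i = ph (i+1) / ph i], which makes products telescope. *)
Let ph i := Ac * x ^+ i + Bc * z ^+ i.
Let xs i := (ph i.+1 - ph i) / (Q * ph i).

Let BleB3 : B <= B ^+ 3.
Proof. by rewrite -[leLHS]expr1 ler_weXn2l. Qed.

Let pn : 0 < p / n%:R <= 2^-1.
Proof.
rewrite divr_gt0//= ler_pdivrMr//; have := B1; have := pB; have := nB; have := BleB3; lra.
Qed.
Let qn : 0 < q / n%:R <= 2^-1.
Proof.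
rewrite divr_gt0//= ler_pdivrMr//; have := B1; have := qB; have := nB; have := BleB3; lra.
Qed.

Let xE : p / n%:R <= x - 1 <= p / n%:R + 2 * (p / n%:R) ^+ 2.
Proof.
case/andP: pn => h1 h2.
have /expR_second_order/andP[] : `|p / n%:R| <= 2^-1 by rewrite ger0_norm// ltW.
rewrite -/x => a1 a2; apply/andP; split; lra.
Qed.

Let zE : - (q / n%:R) <= z - 1 <= - (q / n%:R) + 2 * (q / n%:R) ^+ 2.
Proof.
case/andP: qn => h1 h2.
have /expR_second_order/andP[] : `|- (q / n%:R)| <= 2^-1 by rewrite normrN ger0_norm// ltW.
rewrite -/z sqrrN => a1 a2; apply/andP; split; lra.
Qed.

Let pq0 : 0 < p + q. Proof. exact: addr_gt0. Qed.
Let Ac0 : 0 < Ac. Proof. exact: divr_gt0. Qed.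
Let Bc0 : 0 < Bc. Proof. exact: divr_gt0. Qed.
Let ABc : Ac + Bc = 1. Proof. by rewrite /Ac /Bc -mulrDl addrC divff// gt_eqF. Qed.
Let x1 : 1 <= x.
Proof. by case/andP: xE => h _; case/andP: pn => h1 _; lra. Qed.
Let z01 : 0 < z <= 1.
Proof. by rewrite expR_gt0 -expR0 ler_expR oppr_le0 ltW//; case/andP: qn. Qed.

Let phS i : ph i.+1 - ph i = Ac * (x - 1) * x ^+ i - Bc * (1 - z) * z ^+ i.
Proof. by rewrite /ph !exprS; ring. Qed.

Let ph_incr i : ph i <= ph i.+1.
Proof.
rewrite -subr_ge0 phS.
have xi : 1 <= x ^+ i by exact: exprn_ege1.
have zi : z ^+ i <= 1 by have /andP[? ?] := z01; rewrite exprn_ile1// ltW.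
have zi0 : 0 <= z ^+ i by rewrite exprn_ge0// ltW//; case/andP: z01.
have h1 : Bc * (1 - z) <= Ac * (x - 1).
  apply: le_trans (_ : Bc * (q / n%:R) <= _).
    by rewrite ler_wpM2l ?(ltW Bc0)//; case/andP: zE => ? _; lra.
  apply: le_trans (_ : Ac * (p / n%:R) <= _).
    by rewrite le_eqVlt; apply/orP; left; apply/eqP; rewrite /Ac /Bc; ring.
  by rewrite ler_wpM2l ?(ltW Ac0)//; case/andP: xE.
have h2 : 0 <= Bc * (1 - z) by rewrite mulr_ge0 ?(ltW Bc0)// subr_ge0; case/andP: z01.
have h3 : Bc * (1 - z) * z ^+ i <= Bc * (1 - z) by rewrite ler_piMr.
have h4 : Ac * (x - 1) <= Ac * (x - 1) * x ^+ i by rewrite ler_peMr// (le_trans h2).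
lra.
Qed.

Let ph0 : ph 0 = 1. Proof. by rewrite /ph !expr0 !mulr1. Qed.
Let ph_ge1 i : 1 <= ph i.
Proof. by elim: i => [|i IH]; [rewrite ph0|exact: le_trans IH (ph_incr i)]. Qed.
Let ph_gt0 i : 0 < ph i. Proof. exact: lt_le_trans ltr01 (ph_ge1 i). Qed.

Let xs_ge0 i : 0 <= xs i.
Proof. by rewrite divr_ge0 ?subr_ge0// mulr_ge0 ?ltW. Qed.

Let xs_def i : (1 + Q * xs i) * ph i = ph i.+1.
Proof. by rewrite /xs; field; rewrite !gt_eqF. Qed.

(** The order is [n^-2] instead of [n^-1] because [Ac p = Bc q], that is [phi'(0) = 0]. *)
Let xs0 : xs 0 <= 2 * B ^+ 3 / n%:R ^+ 2 * 2.
Proof.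
rewrite /xs phS ph0 !expr0 !mulr1.
have h1 : Ac * (x - 1) - Bc * (1 - z) <= Ac * (2 * (p / n%:R) ^+ 2) + Bc * (2 * (q / n%:R) ^+ 2).
  have e : Ac * (p / n%:R) = Bc * (q / n%:R) by rewrite /Ac /Bc; ring.
  case/andP: xE => _ h1; case/andP: zE => h3 h2.
  have := ler_wpM2l (ltW Ac0) h1; have := ler_wpM2l (ltW Bc0) h2.
  lra.
have n2 : 0 < n%:R ^+ 2 :> R by rewrite exprn_gt0.
have h2 (r : R) : 0 < r -> r <= B -> 2 * (r / n%:R) ^+ 2 <= 2 * B ^+ 2 / n%:R ^+ 2.
  move=> r0 rB; rewrite expr_div_n mulrA ler_wpM2r ?invr_ge0 ?(ltW n2)//.
  by rewrite ler_wpM2l// lerXn2r ?nnegrE ?(ltW r0) ?(ltW B0).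
have h3 : Ac * (x - 1) - Bc * (1 - z) <= 2 * B ^+ 2 / n%:R ^+ 2.
  apply: le_trans h1 _.
  have := ler_wpM2l (ltW Ac0) (h2 p p0 pB); have := ler_wpM2l (ltW Bc0) (h2 q q0 qB).
  have : 2 * B ^+ 2 / n%:R ^+ 2 = Ac * (2 * B ^+ 2 / n%:R ^+ 2) + Bc * (2 * B ^+ 2 / n%:R ^+ 2).
    by rewrite -mulrDl ABc mul1r.
  lra.
have h4 : 0 <= 2 * B ^+ 2 / n%:R ^+ 2 by rewrite divr_ge0 ?(ltW n2)// mulr_ge0// exprn_ge0// ltW.
apply: le_trans (_ : 2 * B ^+ 2 / n%:R ^+ 2 * B <= _).
  by apply: ler_pM => //; [rewrite -{1}[Ac]mulr1 -{1}[Bc]mulr1; have := ph_incr 0; rewrite -subr_ge0 phS !expr0 !mulr1|rewrite invr_ge0 ltW].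
have -> : 2 * B ^+ 3 / n%:R ^+ 2 * 2 = 2 * (2 * B ^+ 2 / n%:R ^+ 2 * B) by rewrite exprS; ring.
have : 0 <= 2 * B ^+ 2 / n%:R ^+ 2 * B by rewrite mulr_ge0// ltW.
lra.
Qed.

Let xs_le i : xs i <= 2 * B ^+ 2 / n%:R.
Proof.
rewrite /xs invfM mulrA ler_pdivrMr//.
have zi0 : 0 <= z ^+ i by rewrite exprn_ge0// ltW//; case/andP: z01.
have xi0 : 0 <= x ^+ i by rewrite exprn_ge0// (le_trans ler01).
have h1 : ph i.+1 - ph i <= Ac * (x - 1) * x ^+ i.
  have h : 0 <= Bc * (1 - z) * z ^+ i.
    by rewrite mulr_ge0// mulr_ge0 ?(ltW Bc0)// subr_ge0; case/andP: z01.
  by rewrite phS lerBlDr lerDl.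
have h2 : x - 1 <= 2 * B / n%:R.
  case/andP: xE => _ h; case/andP: pn => k1 k2.
  have k3 : 2 * (p / n%:R) ^+ 2 <= p / n%:R.
    by rewrite expr2 mulrA ler_piMl ?(ltW k1)//; lra.
  apply: le_trans (_ : 2 * (p / n%:R) <= _); first lra.
  by rewrite -[leRHS]mulrA ler_wpM2l// ler_wpM2r ?invr_ge0 ?(ltW n0).
have h3 : Ac * x ^+ i <= ph i by rewrite lerDl mulr_ge0 ?(ltW Bc0).
have h4 : 0 <= Ac * x ^+ i by rewrite mulr_ge0 ?(ltW Ac0).
apply: le_trans (_ : (Ac * x ^+ i) * (x - 1) / Q <= _).
  by rewrite ler_wpM2r ?invr_ge0 ?(ltW Q0)// -mulrA [x ^+ i * _]mulrC mulrA.
have x10 : 0 <= x - 1 by rewrite subr_ge0.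
have -> : 2 * B ^+ 2 / n%:R * ph i = ph i * (2 * B / n%:R) * B by rewrite expr2; ring.
apply: ler_pM => //; [by rewrite mulr_ge0|by rewrite invr_ge0 ltW|].
exact: ler_pM.
Qed.

Let ph_rec i : `|(ph i.+2 - ph i.+1) - (1 - al / n%:R) * (ph i.+1 - ph i) - Q * th / n%:R ^+ 2 * ph i|
  <= 8 * B ^+ 3 / n%:R ^+ 3 * ph i.
Proof.
(* The polynomial [X^2 + (al / n) X - Q th / n^2] has the roots [p / n] and [- q / n]. Its values at
   [x - 1] and [z - 1] therefore factor, with one factor of order [n^-2]. *)
pose ex := (x - 1 - p / n%:R) * (x - 1 + p / n%:R + al / n%:R).
pose ez := (z - 1 + q / n%:R) * (z - 1 - q / n%:R + al / n%:R).
have -> : (ph i.+2 - ph i.+1) - (1 - al / n%:R) * (ph i.+1 - ph i) - Q * th / n%:R ^+ 2 * ph i =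
   Ac * x ^+ i * ex + Bc * z ^+ i * ez.
  rewrite -pq /ph /ex /ez qp !exprS; field; rewrite gt_eqF//.
have zi0 : 0 <= z ^+ i by rewrite exprn_ge0// ltW//; case/andP: z01.
have xi0 : 0 <= x ^+ i by rewrite exprn_ge0// (le_trans ler01).
have nV : 0 < n%:R^-1 :> R by rewrite invr_gt0.
have hp : p / n%:R <= B / n%:R by rewrite ler_wpM2r// ltW.
have hq : q / n%:R <= B / n%:R by rewrite ler_wpM2r// ltW.
have ha : al / n%:R <= B / n%:R by rewrite ler_wpM2r// ltW.
have ha0 : 0 <= al / n%:R by rewrite mulr_ge0// ltW.
set b := B / n%:R in hp hq ha.
have b0 : 0 < b by rewrite divr_gt0.
have e8 : 8 * B ^+ 3 / n%:R ^+ 3 = 8 * b ^+ 3 by rewrite /b; field; rewrite gt_eqF.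
rewrite e8; case/andP: pn => p1 p2; case/andP: qn => q1 q2.
case/andP: xE => xE1 xE2; case/andP: zE => zE1 zE2.
have p2b : (p / n%:R) ^+ 2 <= b ^+ 2 by apply: lerXn2r; rewrite ?nnegrE//; apply: ltW.
have q2b : (q / n%:R) ^+ 2 <= b ^+ 2 by apply: lerXn2r; rewrite ?nnegrE//; apply: ltW.
have k3 : 2 * (p / n%:R) ^+ 2 <= p / n%:R by rewrite expr2 mulrA ler_piMl ?(ltW p1)//; lra.
have hex : `|ex| <= 8 * b ^+ 3.
  rewrite /ex normrM; apply: le_trans (_ : (2 * b ^+ 2) * (4 * b) <= _); last first.
    by rewrite le_eqVlt; apply/orP; left; apply/eqP; ring.
  apply: ler_pM => //; rewrite ger0_norm; lra.
have hez : `|ez| <= 8 * b ^+ 3.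
  rewrite /ez normrM; apply: le_trans (_ : (2 * b ^+ 2) * (4 * b) <= _); last first.
    by rewrite le_eqVlt; apply/orP; left; apply/eqP; ring.
  apply: ler_pM => //; first by rewrite ger0_norm; lra.
  case/andP: z01 => _ z1; rewrite ler_norml; apply/andP; split; lra.
apply: le_trans (ler_normD _ _) _.
have ax0 : 0 <= Ac * x ^+ i := mulr_ge0 (ltW Ac0) xi0.
have bz0 : 0 <= Bc * z ^+ i := mulr_ge0 (ltW Bc0) zi0.
rewrite (normrM (Ac * x ^+ i)) (normrM (Bc * z ^+ i)) (ger0_norm ax0) (ger0_norm bz0).
by rewrite /ph mulrDr; apply: lerD; rewrite mulrC ler_wpM2r.
Qed.

Let nV0 : 0 < n%:R^-1 :> R. Proof. by rewrite invr_gt0. Qed.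
Let nV1 : n%:R^-1 <= 1 :> R.
Proof.
rewrite invf_le1//; apply: le_trans nB; apply: le_trans (_ : 4 * 1 <= _); first by rewrite mulr1 ler1n.
by rewrite ler_wpM2l// exprn_ege1.
Qed.

(** Up to [n^-3], [xs] obeys an implicit recursion containing [Q xs(i+1) xs(i)]. As values are of
    order [n^-1] and consecutive ones differ by order [n^-2], replacing this product by [Q xs(i)^2]
    again costs order [n^-3]. *)
Let xs_rec i : `|xs i.+1 - ((1 - al / n%:R) * xs i - Q * xs i ^+ 2 + th / n%:R ^+ 2)|
  <= 38 * B ^+ 8 * n%:R^-1 ^+ 3.
Proof.
have h := ph_rec i; have g0 := ph_gt0 i; have g1 := ph_gt0 i.+1.
have d0 : ph i.+1 - ph i = Q * xs i * ph i by rewrite -xs_def; ring.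
have d1 : ph i.+2 - ph i.+1 = Q * xs i.+1 * ((1 + Q * xs i) * ph i) by rewrite xs_def -[ph i.+2]xs_def; ring.
rewrite d0 d1 in h.
have {}h : `|xs i.+1 * (1 + Q * xs i) - (1 - al / n%:R) * xs i - th / n%:R ^+ 2| <= 8 * B ^+ 4 * n%:R^-1 ^+ 3.
  have e : Q * xs i.+1 * ((1 + Q * xs i) * ph i) - (1 - al / n%:R) * (Q * xs i * ph i) - Q * th / n%:R ^+ 2 * ph i =
     (xs i.+1 * (1 + Q * xs i) - (1 - al / n%:R) * xs i - th / n%:R ^+ 2) * (Q * ph i) by ring.
  rewrite e normrM (ger0_norm (mulr_ge0 (ltW Q0) (ltW g0))) mulrA ler_pM2r// in h.
  rewrite -ler_pdivlMr// in h; apply: le_trans h _.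
  have -> : 8 * B ^+ 4 * n%:R^-1 ^+ 3 = 8 * B ^+ 3 / n%:R ^+ 3 * B by rewrite exprVn [B ^+ 4]exprS; ring.
  by rewrite ler_wpM2l// divr_ge0 ?exprn_ge0 ?(ltW n0)// mulr_ge0// exprn_ge0// ltW.
set w := n%:R^-1 in h *.
have s0 := xs_ge0 i; have s1 := xs_ge0 i.+1.
have b0 : xs i <= 2 * B ^+ 2 * w by exact: xs_le.
have b1 : xs i.+1 <= 2 * B ^+ 2 * w by exact: xs_le.
have thw : th / n%:R ^+ 2 = th * w ^+ 2 by rewrite /w exprVn.
rewrite thw in h *.
have w0 : 0 < w := nV0; have w1 : w <= 1 := nV1.
have w2 : 0 <= w ^+ 2 by rewrite exprn_ge0// ltW.
have alxs : 0 <= al * w * xs i <= 2 * B ^+ 3 * w ^+ 2.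
  rewrite mulr_ge0//= ?mulr_ge0 ?(ltW w0)//.
  have -> : 2 * B ^+ 3 * w ^+ 2 = B * w * (2 * B ^+ 2 * w) by ring.
  apply: ler_pM => //; first by rewrite mulr_ge0// ltW.
  by rewrite ler_wpM2r// ltW.
have thb : 0 <= th * w ^+ 2 <= B * w ^+ 2 by rewrite mulr_ge0//= ler_wpM2r.
have qxx : 0 <= Q * (xs i.+1 * xs i) <= 4 * B ^+ 5 * w ^+ 2.
  rewrite mulr_ge0 ?(ltW Q0) ?(mulr_ge0 s1 s0)//=.
  have -> : 4 * B ^+ 5 * w ^+ 2 = B * ((2 * B ^+ 2 * w) * (2 * B ^+ 2 * w)) by ring.
  apply: ler_pM => //; [exact: ltW|exact: mulr_ge0|exact: ler_pM].
have w3 : B ^+ 4 * w ^+ 3 <= B ^+ 4 * w ^+ 2.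
  by rewrite ler_wpM2l ?exprn_ge0 ?(ltW B0)// [w ^+ 3]exprS ler_piMl.
have pow k : (k <= 5)%N -> B ^+ k * w ^+ 2 <= B ^+ 5 * w ^+ 2.
  by move=> k5; rewrite ler_wpM2r// ler_weXn2l.
have p1 := pow 1%N isT; have p3 := pow 3%N isT; have p4 := pow 4%N isT; rewrite expr1 in p1.
have diff : `|xs i.+1 - xs i| <= 15 * B ^+ 5 * w ^+ 2.
  move: h; rewrite !ler_norml => /andP[h1 h2].
  have /andP[a1 a2] := alxs; have /andP[t1 t2] := thb; have /andP[q1 q2] := qxx.
  apply/andP; split; lra.
have qd : `|Q * xs i * (xs i.+1 - xs i)| <= 30 * B ^+ 8 * w ^+ 3.
  rewrite normrM (ger0_norm (mulr_ge0 (ltW Q0) s0)).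
  have -> : 30 * B ^+ 8 * w ^+ 3 = B * (2 * B ^+ 2 * w) * (15 * B ^+ 5 * w ^+ 2) by ring.
  apply: ler_pM => //; first by rewrite mulr_ge0 ?(ltW Q0).
  by apply: ler_pM => //; exact: ltW.
have -> : xs i.+1 - ((1 - al * w) * xs i - Q * xs i ^+ 2 + th * w ^+ 2) =
  (xs i.+1 * (1 + Q * xs i) - (1 - al * w) * xs i - th * w ^+ 2) - Q * xs i * (xs i.+1 - xs i) by ring.
apply: le_trans (ler_normB _ _) _.
have : B ^+ 4 * w ^+ 3 <= B ^+ 8 * w ^+ 3.
  by rewrite ler_wpM2r ?exprn_ge0 ?(ltW w0)// ler_weXn2l.
lra.
Qed.

Let phi1 : ph n = phi 1.
Proof.
rewrite /ph /phi /x /z !mulr1 -!expRM_natl mulrN.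
have -> : n%:R * (p / n%:R) = p by field; rewrite gt_eqF.
have -> : n%:R * (q / n%:R) = q by field; rewrite gt_eqF.
by rewrite /Ac /Bc; ring.
Qed.

Let prod_xs m : \prod_(0 <= i < m) (1 + Q * xs i) = ph m.
Proof.
elim: m => [|m IH]; first by rewrite big_geq.
by rewrite big_nat_recr//= IH mulrC xs_def.
Qed.

(** Errors of the recursion add up to [E1] in each [y_i], and [n] factors turn this into [n E1]. The
    start [y 0] counts as one more error, since [xs 0] is nearly [0]. *)
Lemma riccati_product (y : nat -> R) (Y L E1 E2 : R) :
  (forall i, (i <= n)%N -> 0 <= y i <= Y) -> n%:R * Y <= B -> y 0%N <= E1 ->
  \sum_(0 <= i < n) `|y i.+1 - ((1 - al / n%:R) * y i - Q * y i ^+ 2 + th / n%:R ^+ 2)| <= E1 ->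
  (forall i, (i < n)%N -> 0 <= 1 - 2 * Q * y i / L <= 1) -> `|L^-1 - 1| <= E2 ->
  `|\prod_(0 <= i < n) (1 - 2 * Q * y i / L) - (phi 1) ^- 2| <=
     4 * B * (n%:R * E1) + 2 * B ^+ 2 * E2 + 100 * B ^+ 9 * n%:R^-1.
Proof.
move=> y0Y nY y0E yrec yL LE2.
set w := n%:R^-1.
have w0 : 0 < w := nV0; have w1 : w <= 1 := nV1.
have nw : n%:R * w = 1 by rewrite mulfV// gt_eqF.
have Y0 : 0 <= Y by have /andP[a1 a2] := y0Y 0%N (leq0n n); exact: le_trans a1 a2.
have YB : Y <= B * w by rewrite -ler_pdivrMr ?invr_gt0// invrK mulrC.
have E10 : 0 <= E1 by have /andP[a1 _] := y0Y 0%N (leq0n n); exact: le_trans a1 y0E.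
have E20 : 0 <= E2 by exact: le_trans (normr_ge0 _) LE2.
have b0 i : xs i <= 2 * B ^+ 2 * w by exact: xs_le.
have Bw : 4 * B ^+ 3 * w <= 1 by rewrite -ler_pdivlMr ?invr_gt0// invrK mul1r.
pose err i := `|y i.+1 - ((1 - al / n%:R) * y i - Q * y i ^+ 2 + th / n%:R ^+ 2)| + 38 * B ^+ 8 * w ^+ 3.
have step i : (i <= n)%N -> `|y i - xs i| <= 2 * E1 + 4 * B ^+ 3 * w ^+ 2 + i%:R * (38 * B ^+ 8 * w ^+ 3).
  move=> ni.
  suff H : `|y i - xs i| <= E1 + 4 * B ^+ 3 * w ^+ 2 + \sum_(0 <= j < i) err j.
    apply: le_trans H _; rewrite big_split /= sumr_const_nat subn0 -[_ *+ i]mulr_natl.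
    have : \sum_(0 <= j < i) `|y j.+1 - ((1 - al / n%:R) * y j - Q * y j ^+ 2 + th / n%:R ^+ 2)| <= E1.
      by apply: le_trans yrec; rewrite [leRHS](@big_cat_nat _ _ _ i)//= lerDl sumr_ge0.
    lra.
  elim: i ni => [_|i IH ni].
    rewrite big_geq// addr0; have /andP[a1 _] := y0Y 0%N (leq0n n).
    have := xs_ge0 0; have := xs0; rewrite -/w -exprVn -/w => k1 k2.
    rewrite ler_norml; apply/andP; split; lra.
  rewrite big_nat_recr//=.
  have IH' := IH (ltnW ni).
  have /andP[a1 a2] := y0Y i (ltnW ni).
  have g : y i.+1 - xs i.+1 = (y i.+1 - ((1 - al / n%:R) * y i - Q * y i ^+ 2 + th / n%:R ^+ 2))
     - (xs i.+1 - ((1 - al / n%:R) * xs i - Q * xs i ^+ 2 + th / n%:R ^+ 2))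
     + (1 - al / n%:R - Q * (y i + xs i)) * (y i - xs i) by ring.
  (* The hypothesis [nB] keeps the Lipschitz factor of the recursion in [[-1, 1]], so that
     differences are not amplified. *)
  have c1 : `|1 - al / n%:R - Q * (y i + xs i)| <= 1.
    have k1 : 0 <= al * w <= B * w by rewrite mulr_ge0 ?(ltW w0)//= ler_wpM2r// ltW.
    have k2 : 0 <= Q * (y i + xs i) <= B * (B * w + 2 * B ^+ 2 * w).
      have k3 : 0 <= y i + xs i by rewrite addr_ge0.
      rewrite mulr_ge0 ?(ltW Q0)//=; apply: ler_pM => //; first exact: ltW.
      by apply: lerD => //; exact: le_trans a2 YB.
    have k4 : B * w <= B ^+ 3 * w by rewrite ler_wpM2r// ltW.
    have k5 : B ^+ 2 * w <= B ^+ 3 * w by rewrite ler_wpM2r ?(ltW w0)// ler_weXn2l.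
    have k6 : B * (B * w + 2 * B ^+ 2 * w) = B ^+ 2 * w + 2 * (B ^+ 3 * w) by ring.
    case/andP: k1 => k11 k12; case/andP: k2 => k21 k22; rewrite -/w.
    rewrite ler_norml; apply/andP; split; lra.
  have c2 : `|(1 - al / n%:R - Q * (y i + xs i)) * (y i - xs i)| <= `|y i - xs i|.
    by rewrite normrM ler_piMl.
  have c3 := xs_rec i; rewrite -/w in c3.
  rewrite g; apply: le_trans (ler_normD _ _) _.
  apply: le_trans (lerD (ler_normB _ _) c2) _.
  apply: le_trans (lerD (lerD (lexx _) c3) IH') _.
  by rewrite /err [leLHS]addrC [leRHS]addrA.
have fin i : (i < n)%N -> `|y i - xs i| <= 2 * E1 + 42 * B ^+ 8 * w ^+ 2.
  move=> ni; apply: le_trans (step i (ltnW ni)) _.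
  have k1 : i%:R * (38 * B ^+ 8 * w ^+ 3) <= n%:R * (38 * B ^+ 8 * w ^+ 3).
    rewrite ler_wpM2r ?ler_nat ?(ltnW ni)// mulr_ge0 ?exprn_ge0 ?(ltW w0)//.
    by rewrite mulr_ge0// exprn_ge0// ltW.
  have k2 : n%:R * (38 * B ^+ 8 * w ^+ 3) = 38 * B ^+ 8 * w ^+ 2.
    by rewrite [w ^+ 3]exprS; have := nw; move: (w ^+ 2) => w2 e; rewrite (_ : _ * _ = 38 * B ^+ 8 * w2 * (n%:R * w)); [rewrite e mulr1|ring].
  have k3 : B ^+ 3 * w ^+ 2 <= B ^+ 8 * w ^+ 2.
    by rewrite ler_wpM2r ?exprn_ge0 ?(ltW w0)// ler_weXn2l.
  lra.
have pinv : \prod_(0 <= i < n) (1 + Q * xs i) ^- 2 = phi 1 ^- 2.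
  by rewrite -phi1 -prod_xs prod_expV2.
rewrite -pinv.
have hQ0 i : 0 <= Q * xs i by rewrite mulr_ge0// ltW.
(* The factors [1 - 2 t] and [(1 + t)^-2] agree to first order; with [t] of order [1/n] the
   discrepancies sum to order [1/n]. *)
have bnd i : 1 - 2 * (Q * xs i) <= (1 + Q * xs i) ^- 2 <= 1 - 2 * (Q * xs i) + 3 * (Q * xs i) ^+ 2.
  have t0 := hQ0 i; set t := Q * xs i in t0 *.
  have t2 : 0 < (1 + t) ^+ 2 by rewrite exprn_gt0// ltr_wpDr.
  rewrite -[X in _ <= X <= _]mul1r ler_pdivlMr// ler_pdivrMr//.
  by apply/andP; split; nra.
apply: le_trans (prod_diff yL _) _.
  move=> i ni; rewrite invr_ge0 exprn_ge0 ?addr_ge0//=.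
  by rewrite invf_le1 ?exprn_gt0 ?exprn_ege1 ?lerDl// ltr_wpDr.
apply: le_trans (_ : \sum_(0 <= i < n) (2 * B * (2 * E1 + 42 * B ^+ 8 * w ^+ 2) + 2 * B * (B * w) * E2
   + 3 * (B * (2 * B ^+ 2 * w)) ^+ 2) <= _).
  rewrite big_nat [leRHS]big_nat; apply: ler_sum => i /andP[_ ni].
  have /andP[a1 a2] := y0Y i (ltnW ni).
  have g : 1 - 2 * Q * y i / L - (1 + Q * xs i) ^- 2 =
     - (2 * Q * (y i - xs i)) - 2 * Q * y i * (L^-1 - 1) - ((1 + Q * xs i) ^- 2 - (1 - 2 * (Q * xs i))).
    by ring.
  rewrite g; apply: le_trans (ler_normB _ _) _; apply: lerD.
    apply: le_trans (ler_normB _ _) _; rewrite normrN; apply: lerD.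
      rewrite normrM ger0_norm ?mulr_ge0 ?(ltW Q0)//; apply: ler_pM => //.
      - by rewrite mulr_ge0// ltW.
      - by rewrite ler_wpM2l.
      - exact: fin.
    rewrite normrM ger0_norm ?mulr_ge0 ?(ltW Q0)//; apply: ler_pM => //.
    - by rewrite !mulr_ge0 ?(ltW Q0).
    - apply: ler_pM => //; first by rewrite mulr_ge0// ltW.
      + by rewrite ler_wpM2l.
      + exact: le_trans a2 YB.
  have /andP[k1 k2] := bnd i; rewrite ger0_norm ?subr_ge0//.
  have : (Q * xs i) ^+ 2 <= (B * (2 * B ^+ 2 * w)) ^+ 2.
    rewrite lerXn2r ?nnegrE//.
    - by rewrite !mulr_ge0 ?(ltW w0) ?exprn_ge0 ?(ltW B0).
    - by apply: ler_pM => //; exact: ltW.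
  lra.
rewrite sumr_const_nat subn0 -[_ *+ n]mulr_natl.
have k1 : n%:R * (2 * B * (2 * E1 + 42 * B ^+ 8 * w ^+ 2) + 2 * B * (B * w) * E2
   + 3 * (B * (2 * B ^+ 2 * w)) ^+ 2) = 4 * B * (n%:R * E1) + (n%:R * w) * (84 * B ^+ 9 * w + 2 * B ^+ 2 * E2 + 12 * B ^+ 6 * w) by ring.
rewrite k1 nw mul1r.
have : B ^+ 6 * w <= B ^+ 9 * w by rewrite ler_wpM2r ?(ltW w0)// ler_weXn2l.
have : 0 <= B ^+ 9 * w by rewrite mulr_ge0 ?(ltW w0)// exprn_ge0// ltW.
lra.
Qed.

End Riccati.

(** The product is close to the exponential of [- 2 Q S / lam] with [S] the sum of the [y_i].
    Summing the recursion telescopes and gives [(1 - lam) S = n tau] up to boundary terms, the sum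
    of squares and the errors. *)
Lemma strongly_subcritical_product (y : nat -> R) (n : nat) (lam Q tau Y E : R) :
  2^-1 <= lam -> lam < 1 -> 0 <= Q -> (forall i, (i <= n)%N -> 0 <= y i <= Y) ->
  \sum_(0 <= i < n) `|y i.+1 - (tau + lam * y i - Q * y i ^+ 2)| <= E ->
  (forall i, (i < n)%N -> 0 <= 1 - 2 * Q * y i / lam <= 1) -> 0 <= tau ->
  `|\prod_(0 <= i < n) (1 - 2 * Q * y i / lam) - expR (- (2 * Q * (n%:R * tau / (1 - lam))))| <=
    n%:R * (4 * Q * Y) ^+ 2 + 4 * Q * (1 - lam) * (n%:R * Y)
    + 2 * Q * ((2 * Y + Q * (n%:R * Y ^+ 2) + E) / (1 - lam)).
Proof.
move=> l1 l2 Q0 yY yrec yL tau0.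
have l0 : 0 < lam by lra.
have lV : lam^-1 <= 2 by rewrite -[leRHS]invrK lef_pV2 ?posrE// invr_gt0.
have lV1 : 1 <= lam^-1 by rewrite invf_ge1// ltW.
have Y0 : 0 <= Y by have /andP[a1 a2] := yY 0%N (leq0n n); exact: le_trans a1 a2.
pose hh i := 2 * Q * y i / lam.
have hh0 i : (i < n)%N -> 0 <= hh i <= 4 * Q * Y.
  move=> ni; have /andP[a1 a2] := yY i (ltnW ni).
  rewrite /hh divr_ge0 ?(ltW l0) ?mulr_ge0//=.
  have -> : 4 * Q * Y = 2 * Q * Y * 2 by ring.
  by apply: ler_pM => //; rewrite ?mulr_ge0 ?invr_ge0 ?(ltW l0)// ler_wpM2l// mulr_ge0.
set S := \sum_(0 <= i < n) y i.
have S0 : 0 <= S.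
  by rewrite /S big_nat sumr_ge0// => i /andP[_ ni]; case/andP: (yY i (ltnW ni)).
have SY : S <= n%:R * Y.
  rewrite /S big_nat; apply: le_trans (_ : \sum_(0 <= i < n | (0 <= i < n)%N) Y <= _).
    by apply: ler_sum => i /andP[_ ni]; case/andP: (yY i (ltnW ni)).
  by rewrite -big_nat sumr_const_nat subn0 -[X in X <= _]mulr_natl.
have pe : \prod_(0 <= i < n) expR (- hh i) = expR (- (2 * Q * S / lam)).
  rewrite /S; elim: (n) => [|m IH]; first by rewrite !big_geq// mulr0 mul0r oppr0 expR0.
  by rewrite !big_nat_recr//= IH -expRD /hh; congr expR; ring.
have p1 : `|\prod_(0 <= i < n) (1 - 2 * Q * y i / lam) - expR (- (2 * Q * S / lam))| <= n%:R * (4 * Q * Y) ^+ 2.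
  rewrite -pe; apply: le_trans (prod_diff yL _) _.
    move=> i ni; rewrite ltW ?expR_gt0//= -expR0 ler_expR oppr_le0.
    by case/andP: (hh0 i ni).
  rewrite big_nat; apply: le_trans (_ : \sum_(0 <= i < n | (0 <= i < n)%N) (4 * Q * Y) ^+ 2 <= _); last first.
    by rewrite -big_nat sumr_const_nat subn0 -[X in X <= _]mulr_natl.
  apply: ler_sum => i /andP[_ ni]; have /andP[a1 a2] := hh0 i ni.
  have /andP[b1 _] := yL i ni; rewrite -/(hh i) in b1 *.
  have e1 := expR_ge1Dx (- hh i); have e2 := expR_ge1Dx (hh i).
  have e3 : expR (hh i) * expR (- hh i) = 1 by rewrite -expRD subrr expR0.
  have e0 := expR_gt0 (- hh i).
  have e4 : (1 + hh i) * expR (- hh i) <= 1 by rewrite -[X in _ <= X]e3 ler_wpM2r ?(ltW e0).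
  rewrite ler0_norm; last lra.
  apply: le_trans (_ : hh i ^+ 2 <= _); last by rewrite lerXn2r ?nnegrE// (le_trans a1).
  have : hh i * (1 - hh i) <= hh i * expR (- hh i) by rewrite ler_wpM2l//; lra.
  rewrite expr2 mulrBr; lra.
have tel : y n - y 0%N = n%:R * tau - (1 - lam) * S - Q * \sum_(0 <= i < n) y i ^+ 2
   + \sum_(0 <= i < n) (y i.+1 - (tau + lam * y i - Q * y i ^+ 2)).
  rewrite /S; elim: (n) => [|m IH]; first by rewrite !big_geq//; ring.
  by rewrite !big_nat_recr//= -natr1; move: IH; lra.
have S2 : 0 <= \sum_(0 <= i < n) y i ^+ 2 <= n%:R * Y ^+ 2.
  rewrite sumr_ge0 => [|i _]; last exact: sqr_ge0.
  rewrite /= big_nat; apply: le_trans (_ : \sum_(0 <= i < n | (0 <= i < n)%N) Y ^+ 2 <= _).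
    apply: ler_sum => i /andP[_ ni]; have /andP[a1 a2] := yY i (ltnW ni).
    by rewrite lerXn2r ?nnegrE.
  by rewrite -big_nat sumr_const_nat subn0 -[X in X <= _]mulr_natl.
have eps0 : 0 < 1 - lam by rewrite subr_gt0.
have er : `|\sum_(0 <= i < n) (y i.+1 - (tau + lam * y i - Q * y i ^+ 2))| <= E.
  exact: le_trans (ler_norm_sum _ _ _) yrec.
have dS : `|S - n%:R * tau / (1 - lam)| <= (2 * Y + Q * (n%:R * Y ^+ 2) + E) / (1 - lam).
  rewrite ler_pdivlMr// -{2}(ger0_norm (ltW eps0)) -normrM mulrBl divfK ?gt_eqF//.
  have /andP[a1 a2] := yY 0%N (leq0n n); have /andP[b1 b2] := yY n (leqnn n).
  case/andP: S2 => c1 c2.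
  have := ler_wpM2l Q0 c2; have := mulr_ge0 Q0 c1.
  move: er; rewrite !ler_norml => /andP[r1 r2] ? ?; apply/andP; split; lra.
have -> : \prod_(0 <= i < n) (1 - 2 * Q * y i / lam) - expR (- (2 * Q * (n%:R * tau / (1 - lam)))) =
  (\prod_(0 <= i < n) (1 - 2 * Q * y i / lam) - expR (- (2 * Q * S / lam))) +
  (expR (- (2 * Q * S / lam)) - expR (- (2 * Q * (n%:R * tau / (1 - lam))))) by ring.
apply: le_trans (ler_normD _ _) _; rewrite -addrA; apply: lerD => //.
apply: le_trans (expRN_lipschitz _ _) _.
- by rewrite divr_ge0 ?(ltW l0)// !mulr_ge0.
- by apply: mulr_ge0; [exact: mulr_ge0|rewrite divr_ge0 ?(ltW eps0)// mulr_ge0].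
have -> : 2 * Q * S / lam - 2 * Q * (n%:R * tau / (1 - lam)) =
   2 * Q * S * (lam^-1 - 1) + 2 * Q * (S - n%:R * tau / (1 - lam)) by ring.
apply: le_trans (ler_normD _ _) _; apply: lerD; last first.
  by rewrite normrM ger0_norm ?mulr_ge0// ler_wpM2l// mulr_ge0.
rewrite ger0_norm; last by rewrite !mulr_ge0// subr_ge0.
have -> : 4 * Q * (1 - lam) * (n%:R * Y) = 2 * Q * (n%:R * Y) * (2 * (1 - lam)) by ring.
apply: ler_pM; rewrite ?mulr_ge0 ?subr_ge0//; first by rewrite ler_wpM2l// mulr_ge0.
have -> : lam^-1 - 1 = lam^-1 * (1 - lam) by rewrite mulrBr mulr1 mulVf// gt_eqF.
by rewrite ler_wpM2r// ltW.
Qed.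

End RealEstimates.

(** * The limit law as a product *)

Lemma coordH (R : realType) (d : nat) (s x : 'cV[R]_d) i : hmul s x i 0 = s i 0 * x i 0.
Proof. by rewrite mxE. Qed.

(** The condition [2 ep <= g] keeps the perturbed denominator above [g / 2]. *)
Lemma quotient_perturbation (R : realType) (b b1 A A0 g ep : R) :
  0 < g -> g <= A0 -> 0 <= A <= A0 -> 2 * ep <= g ->
  `|b - A| <= ep -> `|b1 - A0| <= ep -> `|b / b1 - A / A0| <= 4 * ep / g.
Proof.
move=> g0 gA0 /andP[A00 AA0] epg hb hb1.
have A0p : 0 < A0 by lra.
have b1g : g / 2 <= b1 by move: hb1; rewrite ler_norml => /andP[? ?]; lra.
have b1p : 0 < b1 by lra.
have -> : b / b1 - A / A0 = (b - A + A / A0 * (A0 - b1)) / b1.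
  by field; rewrite !gt_eqF.
have AA01 : 0 <= A / A0 <= 1.
  by rewrite divr_ge0 ?(ltW A0p)//= ler_pdivrMr// mul1r.
rewrite normrM normfV (gtr0_norm b1p) ler_pdivrMr//.
apply: le_trans (_ : 2 * ep <= _).
  apply: le_trans (ler_normD _ _) _.
  have -> : 2 * ep = ep + 1 * ep by ring.
  apply: lerD => //; rewrite normrM distrC; apply: ler_pM => //.
  by rewrite ger0_norm; case/andP: AA01.
have ep0 : 0 <= ep by exact: le_trans hb.
have -> : 2 * ep = 4 * ep / g * (g / 2) by field; rewrite gt_eqF.
by rewrite ler_wpM2l// divr_ge0 ?(ltW g0)// mulr_ge0.
Qed.

Section Core.
Variables (R : realType) (d : nat) (p : offspring R d) (c : R).
Hypothesis po : is_offspring p.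
Hypothesis pc : (\sum_(k < d) \sum_(l < d) \sum_(m < d) \sum_(j < d) cmom p k l m j
         <= c%:E)%E.
Variables (lam : R) (u v : 'cV[R]_d) (c0 V : R).
Hypothesis P : perron (Mmean p) lam u v.
Hypothesis c00 : 0 < c0.
Hypothesis vc0 : forall i, c0 <= v i 0.
Hypothesis vV : forall i, v i 0 <= V.
Hypothesis c_ge0 : 0 <= c.
Hypothesis V0 : 0 <= V.
Variables (s : 'cV[R]_d).
Hypothesis sC : inC s.

Let one := one_v R d.
Let tau := dotp v (one - s).
Let Dm i := one - Hit p s i (mu p).
Let y i := dotp v (Dm i).
Let Q := Qv p u v.
Let y0 := yext p v.
Let x i := y i - y0.

Let v0 i : 0 <= v i 0. Proof. exact: ltW (perron_v_gt0 P i). Qed.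
Let muC := mu_inC po.
Let oneC := @inC_one R d.
Let HC i : inC (Hit p s i (mu p)).
Proof. exact: inC_Hit. Qed.

Lemma survival_ge0 i k : 0 <= Dm i k 0.
Proof. by rewrite coordB coord1 subr_ge0; have /andP[] := HC i k. Qed.

Lemma survival_dstep i : Dm i.+1 = dstep p s (Dm i).
Proof. by rewrite /dstep /Dm subKr. Qed.

(** Multiplication by [s <= 1] pushes the orbit below the fixed point [mu]; hence the shifted
    variable [x] is nonnegative. *)
Lemma Hit_le_mu i : vle (Hit p s i (mu p)) (mu p).
Proof.
have hm (z : 'cV[R]_d) k : inC z -> hmul s z k 0 <= z k 0.
  move=> zC; rewrite coordH; have /andP[s0 s1] := sC k; have /andP[z0 z1] := zC k.
  by rewrite ler_piMl.
elim: i => [|i IH] k; first exact: hm.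
apply: le_trans (hm _ _ (inC_pgf po (HC i))) _.
rewrite -[in leRHS](mu_fix po pc); exact: (pgf_mono po pc (HC i) muC IH).
Qed.

Lemma yext_le_survival i : y0 <= y i.
Proof.
apply: ler_sum => k _; rewrite ler_wpM2l// qextE coordB coord1 lerD2l lerN2.
exact: Hit_le_mu.
Qed.

Lemma tau_ge0 : 0 <= tau.
Proof.
apply: sumr_ge0 => i _; rewrite mulr_ge0// coordB coord1.
by have /andP[? ?] := sC i; lra.
Qed.

Lemma survival_init : y 0%N <= tau + y0.
Proof.
rewrite -dotpD; apply: ler_sum => k _; rewrite ler_wpM2l//.
rewrite coordB coord1 coordH [leRHS]mxE coordB coord1 qextE.
have /andP[s0 s1] := sC k; have /andP[m0 m1] := muC k.
have : 0 <= (1 - s k 0) * (1 - mu p k 0) by rewrite mulr_ge0// subr_ge0.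
rewrite -/(mu p k 0); lra.
Qed.

Lemma survival_step_le i : y i.+1 <= tau + lam * y i.
Proof.
rewrite -(dotp_mulmx P) -dotpD; apply: ler_sum => k _; rewrite ler_wpM2l//.
rewrite coordB coord1 coordH [leRHS]mxE coordB coord1 mulmx_cE.
have H1 l : Hit p s i (mu p) l 0 <= one_v R d l 0 by rewrite coord1; case/andP: (HC i l).
have /andP[_ h] := pgf_slope po pc k (HC i) oneC H1.
move: h; rewrite (pgf_one po pc) => h.
have /andP[s0 s1] := sC k; have /andP[m0 m1] := inC_pgf po (HC i) k.
have h2 : \sum_l Mmean p k l * Dm i l 0 = \sum_l Mat p (one_v R d) k l * (one_v R d l 0 - Hit p s i (mu p) l 0).
  by apply: eq_bigr => l _; rewrite coordB.
rewrite h2; apply: le_trans (_ : 1 - s k 0 + (1 - pgf p (Hit p s i (mu p)) k 0) <= _).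
  have : 0 <= (1 - s k 0) * (1 - pgf p (Hit p s i (mu p)) k 0) by rewrite mulr_ge0// subr_ge0.
  rewrite /Hit; lra.
by rewrite lerD2l -(coord1 R k).
Qed.

(** Discrete Gronwall for the linear majorant, with [1 + |1 - lam|] as growth factor so that both
    signs of [1 - lam] are covered. *)
Lemma survival_le i n : (i <= n)%N ->
  y i <= expR (n%:R * `|1 - lam|) * (y0 + (n%:R + 1) * tau).
Proof.
move=> ni; set M := 1 + `|1 - lam|.
have M1 : 1 <= M by rewrite lerDl.
have lM : lam <= M by have := ler_norm (- (1 - lam)); rewrite normrN /M; lra.
have t0 := tau_ge0; have yy0 : 0 <= y0 := yext_ge0 po P.
have l0 := ltW (perron_lam_gt0 P).
have h : y i <= M ^+ i * (y0 + (i%:R + 1) * tau).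
  elim: i {ni} => [|i IH].
    by rewrite expr0 mul1r add0r mul1r addrC; exact: survival_init.
  apply: le_trans (survival_step_le i) _.
  have Mi : 1 <= M ^+ i.+1 by rewrite exprn_ege1.
  have s0 : 0 <= y0 + (i%:R + 1) * tau by rewrite addr_ge0// mulr_ge0// addr_ge0.
  have h1 : lam * y i <= M ^+ i.+1 * (y0 + (i%:R + 1) * tau).
    rewrite exprS -mulrA; apply: ler_pM => //.
    exact: le_trans yy0 (yext_le_survival i).
  have h2 : 1 * tau <= M ^+ i.+1 * tau by rewrite ler_wpM2r.
  rewrite -natr1; lra.
apply: le_trans h _; apply: ler_pM.
- by rewrite exprn_ge0// (le_trans ler01 M1).
- by rewrite addr_ge0// mulr_ge0// addr_ge0.
- apply: le_trans (_ : M ^+ n <= _); first exact: ler_weXn2l.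
  rewrite expRM_natl lerXn2r ?nnegrE ?expR_ge0 ?(le_trans ler01 M1)//.
  exact: expR_ge1Dx.
- by rewrite lerD2l ler_wpM2r// lerD2r ler_nat.
Qed.

(** [tau / (1 - lam)] is the fixed point of the linear majorant and lies above the initial value. *)
Lemma survival_le_subcritical i : lam < 1 -> y i <= tau / (1 - lam).
Proof.
move=> l1; have t0 := tau_ge0; have l0 := ltW (perron_lam_gt0 P).
have lp : 0 < 1 - lam by rewrite subr_gt0.
have yy0 : y0 = 0.
  rewrite /y0 /yext /dotp big1// => k _.
  by rewrite qextE (subcritical_mu po pc P l1) coord1 subrr mulr0.
elim: i => [|i IH].
  apply: le_trans survival_init _; rewrite yy0 addr0 ler_pdivlMr// ler_piMr//; lra.
apply: le_trans (survival_step_le i) _.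
apply: le_trans (_ : tau + lam * (tau / (1 - lam)) <= _).
  by rewrite lerD2l ler_wpM2l.
by rewrite [leLHS](_ : _ = tau / (1 - lam))//; field; rewrite gt_eqF.
Qed.

Variables (U : nat) (h K : R).
Hypothesis U0 : (0 < U)%N.
Hypothesis h01 : 0 < h <= 1.
Hypothesis K1 : 0 <= K.
Hypothesis lam_half : 2^-1 <= lam.
Hypothesis lam2 : lam <= 2.
Hypothesis ctr1 : forall x, dotp v x = 0 ->
  wnorm v (Mmean p ^+ U *m x) <= (1 - h) * wnorm v x.
Hypothesis ctr2 : forall x, dotp v x = 0 ->
  lam^-1 ^+ U * wnorm v (Mmean p ^+ U *m x) <= (1 - h) * wnorm v x.
Variables (n : nat) (Y : R).
Hypothesis n0 : (0 < n)%N.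
Hypothesis yY : forall i, (i <= n)%N -> y i <= Y.
Hypothesis Yc0 : Y / c0 <= 1.
Hypothesis nY : n%:R * Y <= K.

Let y0Y : y0 <= Y.
Proof. by apply: le_trans (yY (leq0n n)); exact: yext_le_survival. Qed.
Let Y0 : 0 <= Y. Proof. exact: le_trans (yext_ge0 po P) y0Y. Qed.
Let one_one : dotp v (one - one) = 0.
Proof. by rewrite subrr /dotp big1// => k _; rewrite mxE mulr0. Qed.

(** The constant orbit [y0] satisfies the recursion with [tau = 0] up to an error covered by the
    same summed bound. Subtracting, [y^2 - y0^2 = x^2 + 2 y0 x] turns [lam] into [lam - 2 Q y0]. *)
Lemma shifted_recursion : \sum_(0 <= i < n)
  `|x i.+1 - ((lam - 2 * Q * y0) * x i - Q * x i ^+ 2 + tau)| <=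
  2 * Cy d c c0 V U h K * (Y * (Y + n%:R * tau)).
Proof.
have h1 := dotp_recursion po pc P c00 vc0 vV c_ge0 V0 U0 h01 K1 lam2 ctr1 sC n0
  survival_ge0 (fun i _ => survival_dstep i) yY Yc0 nY.
have h2 := @dotp_recursion _ _ _ _ po pc _ _ _ _ _ P c00 vc0 vV c_ge0 V0 _ _ _ U0 h01 K1 lam2 ctr1
  one n Y (fun=> qext p) oneC n0 (fun _ => qext_ge0 po)
  (fun i _ => esym (dstep_qext po pc)) (fun _ _ => y0Y) Yc0 nY.
move: h1 h2; rewrite one_one mulr0 addr0 /=.
rewrite -/(yext p v) -/y0 -/Q -/tau => h1 h2.
have Cy0 : 0 <= Cy d c c0 V U h K * (Y * (n%:R * tau)).
  rewrite !mulr_ge0 ?tau_ge0//.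
  case/andP: h01 => h0 _.
  have a1 : 0 <= Cb d c c0 V.
    by rewrite /Cb -lock divr_ge0 ?exprn_ge0 ?(ltW c00)// !mulr_ge0// addr_ge0.
  have a2 : 0 <= KM d c c0 by rewrite /KM -lock divr_ge0 ?(ltW c00)// mulr_ge0// addr_ge0.
  have a3 : 0 <= C3 d c c0 V by rewrite /C3 -lock divr_ge0 ?exprn_ge0 ?(ltW c00)// !mulr_ge0.
  have a4 : 0 <= CU U h by rewrite /CU -lock divr_ge0 ?(ltW h0)// mulr_ge0// exprn_ge0.
  have a5 : 0 <= CR d c c0 V U h K by rewrite /CR mulr_ge0// addr_ge0// mulr_ge0.
  by rewrite /Cy addr_ge0// addr_ge0// mulr_ge0.
apply: le_trans (_ : \sum_(0 <= i < n) (`|y i.+1 - (tau + lam * y i - Q * y i ^+ 2)|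
   + `|y0 - (0 + lam * y0 - Q * y0 ^+ 2)|) <= _).
  apply: ler_sum => i _.
  have -> : x i.+1 - ((lam - 2 * Q * y0) * x i - Q * x i ^+ 2 + tau) =
     (y i.+1 - (tau + lam * y i - Q * y i ^+ 2)) - (y0 - (0 + lam * y0 - Q * y0 ^+ 2)).
    by rewrite /x; ring.
  exact: ler_normB.
rewrite big_split /=.
apply: le_trans (lerD h1 h2) _.
rewrite -/tau; lra.
Qed.

Hypothesis nt : n%:R * tau <= 1.
Hypothesis QY : 8 * Q * Y <= 1.
Variable Qb : R.
Hypothesis QQb : Q <= Qb.
Variables (lam' : R) (u' v' : 'cV[R]_d).
Hypothesis P' : perron (Mat p (mu p)) lam' u' v'.

Let Qge0 : 0 <= Q.
Proof.
apply: mulr_ge0 => //; apply: sumr_ge0 => k _; rewrite mulr_ge0//.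
apply: sumr_ge0 => l _; apply: sumr_ge0 => m _.
by rewrite !mulr_ge0 ?(bm_ge0 po pc)// ltW// (perron_u_gt0 P).
Qed.
Let lam0 : 0 < lam := perron_lam_gt0 P.
Let QY4 : 4 * Q * Y <= 1.
Proof. by have := mulr_ge0 Qge0 Y0; have := QY; lra. Qed.
Let L := lam - 2 * Q * y0.

Let ratio_small : 0 <= 2 * Q * y0 / lam <= 2^-1.
Proof.
have yy0 : 0 <= y0 := yext_ge0 po P.
apply/andP; split.
  by apply: divr_ge0; [apply: mulr_ge0 => //; apply: mulr_ge0|exact: ltW].
rewrite ler_pdivrMr//; have := ler_wpM2l Qge0 y0Y; have := QY; have := lam_half; lra.
Qed.
Let L_gt0 : 0 < L.
Proof.
have /andP[_] := ratio_small; rewrite ler_pdivrMr// /L => hh.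
have := lam0; lra.
Qed.

(** The quotient of the factors for [s] and for [s = 1] keeps the same shape, so that the ratio
    defining the law becomes a single product. *)
Lemma shifted_factor i : 1 - 2 * Q * x i / L = (1 - 2 * Q * y i / lam) / (1 - 2 * Q * y0 / lam).
Proof.
have L0 := L_gt0; have l0 := lam0; rewrite /x -/(y i); move: L0; rewrite /L => L0.
field; rewrite gt_eqF//= gt_eqF//.
Qed.

Lemma shifted_factor_bounds i : (i <= n)%N -> 0 <= 1 - 2 * Q * x i / L <= 1.
Proof.
move=> ni; rewrite shifted_factor.
have /andP[a0 a1] := factor_bounds po pc P lam_half survival_ge0 yY QY4 ni.
have /andP[b0 b1] := ratio_small.
have b : 0 < 1 - 2 * Q * y0 / lam by lra.
rewrite divr_ge0 ?(ltW b)//= ler_pdivrMr// mul1r lerD2l lerN2.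
apply: ler_wpM2r; first by rewrite invr_ge0 ltW.
by apply: ler_wpM2l; [exact: mulr_ge0|exact: yext_le_survival].
Qed.

Let eta := Y + n%:R * tau.
Definition core_error : R := Cp d c c0 V U h / c0 * ((1 - h) ^+ (n %/ U) + eta) +
  Cw d c c0 V U h K * eta + tau / c0.
(** Lower bound for the denominator: [u_j >= c0], and each factor [1 - 2 Q y0 / lam] is at least
    [exp (- 8 Qb y0)], with [n y0 <= K]. *)
Let g := c0 * expR (- (8 * Qb * K)).

(** Divided by [lam^n om], the numerator is close to [u_j A] and the denominator to [u_j B], since
    both differentials are aligned with [u] at time [n]; so [u_j] cancels. The term [tau / c0]
    accounts for the start [s u'] in place of [u']. *)
Lemma limit_law_product j : c0 <= u j 0 -> 2 * core_error <= g ->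
  `|Jit p s (mu p) u' n j 0 / (lam' ^+ n * u' j 0) - \prod_(0 <= i < n) (1 - 2 * Q * x i / L)|
     <= 4 * core_error / g.
Proof.
move=> cu eg.
have t0 := tau_ge0; have l0 := lam0.
have u'0 i : 0 <= u' i 0 by exact: ltW (perron_u_gt0 P' i).
pose W := Jit p s (mu p) u'.
have W0 k : 0 <= W 0%N k 0.
  by rewrite /W /= coordH mulr_ge0//; case/andP: (sC k).
have WS i : (i < n)%N -> W i.+1 = wstep p s (Dm i) (W i).
  by move=> _; rewrite /wstep /Dm subKr.
pose W1 i := lam' ^+ i *: u'.
have W10 k : 0 <= W1 0%N k 0 by rewrite /W1 expr0 scale1r.
have W1S i : (i < n)%N -> W1 i.+1 = wstep p one (qext p) (W1 i).
  move=> _; rewrite /wstep one_sub_qext hmul1 /W1 -scalemxAr (perron_eigen_r P').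
  by rewrite scalerA exprSr.
have y00 : forall i, (i <= n)%N -> dotp v ((fun=> qext p) i) <= Y by [].
have q00 : forall (i : nat) k, 0 <= (fun=> qext p) i k 0 by move=> i; exact: qext_ge0 po.
have h1 := @orth_W_end _ _ _ _ po pc _ _ _ _ _ P c00 vc0 vV c_ge0 V0 _ _ U0 h01 lam_half ctr2
  s n Y Dm sC n0 survival_ge0 yY Yc0 W W0 WS.
have h2 := @orth_W_end _ _ _ _ po pc _ _ _ _ _ P c00 vc0 vV c_ge0 V0 _ _ U0 h01 lam_half ctr2
  one n Y (fun=> qext p) oneC n0 q00 y00 Yc0 W1 W10 W1S.
have h3 := @omega_product _ _ _ _ po pc _ _ _ _ _ P c00 vc0 vV c_ge0 V0 _ _ _ U0 h01 K1 lam_half lam2 ctr1 ctr2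
  s n Y Dm sC n0 survival_ge0 (fun i _ => survival_dstep i) yY Yc0 nY nt W W0 WS QY4.
have nt1 : n%:R * dotp v (one - one) <= 1 by rewrite one_one mulr0.
have h4 := @omega_product _ _ _ _ po pc _ _ _ _ _ P c00 vc0 vV c_ge0 V0 _ _ _ U0 h01 K1 lam_half lam2 ctr1 ctr2
  one n Y (fun=> qext p) oneC n0 q00 (fun i _ => esym (dstep_qext po pc)) y00 Yc0 nY nt1 W1 W10 W1S QY4.
move: h1 h2 h3 h4; rewrite one_one mulr0 addr0 -/tau /= -/Q.
rewrite -/(yext p v) -/y0 -/eta.
set om := dotp v u'.
have -> : dotp v (W1 0%N) = om by rewrite /W1 expr0 scale1r.
have om0 : 0 < om.
  rewrite /om /dotp lt_neqAle eq_sym psumr_eq0; last by move=> i _; rewrite mulr_ge0.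
  apply/andP; split; last by apply: sumr_ge0 => i _; rewrite mulr_ge0.
  apply/allPn; exists j; first exact: mem_index_enum.
  by rewrite /= mulf_eq0 !gt_eqF ?(perron_u_gt0 P')// (perron_v_gt0 P).
set om_s := dotp v (W 0%N).
have hom : `|om_s - om| <= tau / c0 * om.
  rewrite distrC -dotpB ger0_norm.
    rewrite mulr_sumr; apply: ler_sum => k _.
    rewrite coordB /W /= coordH mulrCA ler_wpM2l//.
    have -> : u' k 0 - s k 0 * u' k 0 = (1 - s k 0) * u' k 0 by ring.
    rewrite ler_wpM2r// ler_pdivlMr//.
    apply: le_trans (_ : v k 0 * (one - s) k 0 <= _).
      rewrite coordB coord1 mulrC ler_wpM2r// subr_ge0; by case/andP: (sC k).
    rewrite /tau /dotp (bigD1 k)//= lerDl sumr_ge0// => i _.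
    rewrite mulr_ge0// coordB coord1 subr_ge0; by case/andP: (sC i).
  apply: sumr_ge0 => k _; rewrite mulr_ge0// coordB /W /= coordH subr_ge0.
  by rewrite ler_piMl//; case/andP: (sC k).
have oms : om_s <= om.
  apply: ler_sum => k _; rewrite ler_wpM2l// /W /= coordH.
  by rewrite ler_piMl//; case/andP: (sC k).
have oms0 : 0 <= om_s by apply: sumr_ge0 => k _; rewrite mulr_ge0.
set A := \prod_(0 <= i < n) (1 - 2 * Q * y i / lam).
set B := \prod_(0 <= i < n) (1 - 2 * Q * y0 / lam).
rewrite -/(W n).
move=> h1 h2 h3 h4.
have coord_dir (z : 'cV[R]_d) w : `|z j 0 - u j 0 * w| <= wnorm v (orth u v z) / c0 + `|dotp v z - w|.
  have e : z j 0 = dotp v z * u j 0 + orth u v z j 0.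
    by rewrite {1}(orthE u v z) [LHS]mxE coordZ.
  rewrite {1}e.
  have -> : dotp v z * u j 0 + orth u v z j 0 - u j 0 * w =
     orth u v z j 0 + u j 0 * (dotp v z - w) by ring.
  apply: le_trans (ler_normD _ _) _; apply: lerD; first exact: coord_le_wnorm P c00 vc0 _ _.
  rewrite normrM ger0_norm ?ler_piMl// ?(perron_u_le1 P)//.
  exact: ltW (perron_u_gt0 P j).
have /andP[h_0 h_1] := h01.
have k0 : 0 <= (1 - h) ^+ (n %/ U) by rewrite exprn_ge0// subr_ge0.
have Cb0 : 0 <= Cb d c c0 V.
  by rewrite /Cb -lock divr_ge0 ?exprn_ge0 ?(ltW c00)// !mulr_ge0// addr_ge0.
have KM0 : 0 <= KM d c c0 by rewrite /KM -lock divr_ge0 ?(ltW c00)// mulr_ge0// addr_ge0.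
have C30 : 0 <= C3 d c c0 V by rewrite /C3 -lock divr_ge0 ?exprn_ge0 ?(ltW c00)// !mulr_ge0.
have CU0 : 0 <= CU U h by rewrite /CU -lock divr_ge0 ?(ltW h_0)// mulr_ge0// exprn_ge0.
have CR0 : 0 <= CR d c c0 V U h K by rewrite /CR mulr_ge0// addr_ge0// mulr_ge0.
have CS0 : 0 <= CS d c c0 V U h K.
  by rewrite /CS mulr_ge0// addr_ge0// mulr_ge0// addr_ge0// mulr_ge0.
have Cw0 : 0 <= Cw d c c0 V U h K.
  by rewrite /Cw mulr_ge0// !addr_ge0// mulr_ge0.
have Cp0 : 0 <= Cp d c c0 V U h.
  by rewrite /Cp addr_ge0 ?exprn_ge0// mulr_ge0 ?divr_ge0 ?exprn_ge0 ?(ltW h_0)// mulr_ge0// addr_ge0.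
have n_0 : 0 <= n%:R * tau by rewrite mulr_ge0.
have Ye : Y <= eta by rewrite lerDl.
have tc0 : 0 <= tau / c0 by rewrite divr_ge0// ltW.
have A01 i : (i < n)%N -> 0 <= 1 - 2 * Q * y i / lam <= 1.
  by move=> ni; exact: (factor_bounds po pc P lam_half survival_ge0 yY QY4 (ltnW ni)).
have A1 : 0 <= A <= 1.
  rewrite /A big_nat; apply: (big_ind (fun z => 0 <= z <= 1)) => //.
  - by rewrite ler01 lexx.
  - by move=> z w /andP[? ?] /andP[? ?]; rewrite mulr_ge0//= mulr_ile1.
have X1 : `|(lam^-1 ^+ n *: W n) j 0 - u j 0 * (om * A)| <= core_error * om.
  apply: le_trans (coord_dir _ _) _; rewrite dotpZ.
  have h5 : `|lam^-1 ^+ n * dotp v (W n) - om * A| <= Cw d c c0 V U h K * eta * om_s + tau / c0 * om.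
    have -> : lam^-1 ^+ n * dotp v (W n) - om * A =
       lam^-1 ^+ n * dotp v (W n) - om_s * A + (om_s - om) * A by ring.
    apply: le_trans (ler_normD _ _) _; apply: lerD => //.
    rewrite normrM; have /andP[Aa Ab] := A1; rewrite (ger0_norm Aa).
    by apply: le_trans hom; rewrite ler_piMr.
  apply: le_trans (lerD (ler_wpM2r _ h1) h5) _; first by rewrite invr_ge0 ltW.
  have h6 : Cw d c c0 V U h K * eta * om_s <= Cw d c c0 V U h K * eta * om.
    by rewrite ler_wpM2l// mulr_ge0// (le_trans Y0).
  have h7 : Cp d c c0 V U h * ((1 - h) ^+ (n %/ U) + eta) * om_s / c0 <=
     Cp d c c0 V U h / c0 * ((1 - h) ^+ (n %/ U) + eta) * om.
    rewrite mulrAC.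
    have -> : Cp d c c0 V U h / c0 * ((1 - h) ^+ (n %/ U) + eta) * om =
      Cp d c c0 V U h * ((1 - h) ^+ (n %/ U) + eta) / c0 * om by ring.
    rewrite ler_wpM2l// divr_ge0 ?(ltW c00)// mulr_ge0// addr_ge0// (le_trans Y0)//.
  rewrite /core_error; lra.
have X2 : `|(lam^-1 ^+ n *: W1 n) j 0 - u j 0 * (om * B)| <= core_error * om.
  apply: le_trans (coord_dir _ _) _; rewrite dotpZ.
  apply: le_trans (lerD (ler_wpM2r _ h2) h4) _; first by rewrite invr_ge0 ltW.
  have h6 : Cw d c c0 V U h K * Y * om <= Cw d c c0 V U h K * eta * om.
    by rewrite ler_wpM2r ?(ltW om0)// ler_wpM2l.
  have h7 : Cp d c c0 V U h * ((1 - h) ^+ (n %/ U) + Y) * om / c0 <=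
     Cp d c c0 V U h / c0 * ((1 - h) ^+ (n %/ U) + eta) * om.
    have -> : Cp d c c0 V U h * ((1 - h) ^+ (n %/ U) + Y) * om / c0 =
      Cp d c c0 V U h / c0 * ((1 - h) ^+ (n %/ U) + Y) * om by ring.
    by rewrite ler_wpM2r ?(ltW om0)// ler_wpM2l ?divr_ge0 ?(ltW c00)// lerD2l.
  have h8 : 0 <= tau / c0 * om by rewrite mulr_ge0// ltW.
  rewrite /core_error; lra.
have B_ge : expR (- (8 * Qb * K)) <= B.
  have /andP[b0 b1] := ratio_small.
  rewrite /B prodr_const_nat subn0.
  apply: le_trans (_ : expR (- (2 * (2 * Q * y0 / lam))) ^+ n <= _); last first.
    rewrite lerXn2r ?nnegrE ?expR_ge0//; first lra.
    exact: expR_le_lin ratio_small.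
  rewrite -expRM_natl ler_expR mulrN lerN2.
  have y00' : 0 <= y0 := yext_ge0 po P.
  have r4 : 2 * Q * y0 / lam <= 4 * Q * y0.
    rewrite ler_pdivrMr//; have := ler_wpM2l (mulr_ge0 Qge0 y00') lam_half; lra.
  have nn0 : 0 <= n%:R :> R by [].
  have r5 : n%:R * y0 <= K by apply: le_trans nY; rewrite ler_wpM2l.
  have := ler_wpM2l Qge0 r5; have := ler_wpM2r K1 QQb; have := ler_wpM2l nn0 r4; lra.
have B0 : 0 < B by apply: lt_le_trans B_ge; exact: expR_gt0.
have AB : A <= B.
  rewrite /A /B big_nat [leRHS]big_nat; apply: ler_prod => i /andP[_ ni].
  have /andP[-> _] := A01 i ni; rewrite lerD2l lerN2; apply: ler_wpM2r; first by rewrite invr_ge0 ltW.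
  by apply: ler_wpM2l; [exact: mulr_ge0|exact: yext_le_survival].
have u0 := perron_u_gt0 P j.
have -> : \prod_(0 <= i < n) (1 - 2 * Q * x i / L) = (u j 0 * A) / (u j 0 * B).
  rewrite -mulf_div divff ?gt_eqF// mul1r /A /B.
  under eq_bigr do rewrite shifted_factor.
  by rewrite big_split /= prodfV.
have -> : W n j 0 / (lam' ^+ n * u' j 0) =
   ((lam^-1 ^+ n *: W n) j 0 / om) / ((lam^-1 ^+ n *: W1 n) j 0 / om).
  rewrite /W1 !coordZ.
  have ln : lam^-1 ^+ n != 0 by rewrite expf_neq0// invr_neq0// gt_eqF.
  have l'n : lam' ^+ n != 0 by rewrite expf_neq0// gt_eqF// (perron_lam_gt0 P').
  have u'j : u' j 0 != 0 by rewrite gt_eqF// (perron_u_gt0 P').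
  have key (z1 z2 z3 z4 z5 : R) : z1 != 0 -> z2 != 0 -> z3 != 0 -> z4 != 0 ->
      z5 / (z2 * z3) = (z1 * z5 / z4) / (z1 * (z2 * z3) / z4).
    by move=> z10 z20 z30 z40; field; rewrite z40 z30 z20 z10.
  by apply: key; rewrite // gt_eqF.
have scale (z w : R) : `|z - u j 0 * (om * w)| <= core_error * om -> `|z / om - u j 0 * w| <= core_error.
  move=> hz; rewrite -(ler_pM2r om0) -[X in _ * X <= _](gtr0_norm om0) -normrM.
  by apply: le_trans hz; rewrite [leLHS](_ : _ = `|z - u j 0 * (om * w)|)//; congr (`|_|); field; rewrite gt_eqF.
apply: quotient_perturbation => //.
- by rewrite mulr_gt0// expR_gt0.
- by apply: (ler_pM (ltW c00) (expR_ge0 _) cu B_ge).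
- have /andP[Aa _] := A1; by rewrite mulr_ge0 ?(ltW u0)//= ler_wpM2l// ltW.
- exact: scale.
- exact: scale.
Qed.
End Core.

(** * Uniform constants on the class K *)

(** Since [Q y] is [lam - 1] to second order, [lam - 2 Q y] is [2 - lam] to second order, and [lam']
    follows it. *)
Lemma near_expansion (R : realType) (Cb kap C3 Ke lam Q y lam' : R) :
  0 <= Cb -> 0 <= kap -> 0 <= C3 -> 0 <= Ke -> 1 <= lam -> 0 <= y -> y <= Ke * (lam - 1) ->
  `|Q * y - (lam - 1)| <= Cb * kap * (lam - 1) * y + C3 * y ^+ 2 ->
  `|lam' - (lam - 2 * Q * y)| <=
    Cb * (kap * (lam - 1 + 2 * Cb * y) * y + kap * ((lam - 1) * y)) + C3 * y ^+ 2 ->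
  let K1 := Cb * kap * Ke + C3 * Ke ^+ 2 in
  let K2 := Cb * (kap * (1 + 2 * Cb * Ke) * Ke + kap * Ke) + C3 * Ke ^+ 2 in
  `|lam - 2 * Q * y - (1 - (lam - 1))| <= 2 * K1 * (lam - 1) ^+ 2 /\
  `|lam' - (1 - (lam - 1))| <= (2 * K1 + K2) * (lam - 1) ^+ 2.
Proof.
move=> Cb0 kap0 C30 Ke0 lam1 y0 hy hr hm K1 K2.
have [dl dlE] : exists dl, dl = lam - 1 by exists (lam - 1).
have dl0 : 0 <= dl by rewrite dlE subr_ge0.
rewrite -!dlE in hy hr hm *.
have y2 : y ^+ 2 <= Ke ^+ 2 * dl ^+ 2 by rewrite -exprMn lerXn2r ?nnegrE// mulr_ge0.
have dy : dl * y <= Ke * dl ^+ 2 by have := ler_wpM2l dl0 hy; rewrite expr2; lra.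
have hr2 : `|Q * y - dl| <= K1 * dl ^+ 2.
  apply: le_trans hr _; rewrite /K1.
  have := ler_wpM2l (mulr_ge0 Cb0 kap0) dy; have := ler_wpM2l C30 y2; lra.
have hL : `|lam - 2 * Q * y - (1 - dl)| <= 2 * K1 * dl ^+ 2.
  have -> : lam - 2 * Q * y - (1 - dl) = - (2 * (Q * y - dl)) by have := dlE; lra.
  by rewrite normrN normrM ger0_norm// -mulrA ler_wpM2l.
have hM : `|lam' - (lam - 2 * Q * y)| <= K2 * dl ^+ 2.
  apply: le_trans hm _; rewrite /K2 [leRHS]mulrDl; apply: lerD; last by rewrite -mulrA ler_wpM2l.
  rewrite -[leRHS]mulrA ler_wpM2l// [leRHS]mulrDl; apply: lerD; last by rewrite -mulrA ler_wpM2l.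
  have -> : kap * (1 + 2 * Cb * Ke) * Ke * dl ^+ 2 = kap * ((1 + 2 * Cb * Ke) * (Ke * dl ^+ 2)) by ring.
  rewrite -[leLHS]mulrA ler_wpM2l//.
  have CK : 0 <= 1 + 2 * Cb * Ke by rewrite addr_ge0// !mulr_ge0.
  apply: le_trans (_ : (1 + 2 * Cb * Ke) * (dl * y) <= _); last by rewrite ler_wpM2l.
  have -> : (1 + 2 * Cb * Ke) * (dl * y) = (dl + 2 * Cb * (Ke * dl)) * y by ring.
  by rewrite ler_wpM2r// lerD2l ler_wpM2l// mulr_ge0.
split=> //.
have -> : lam' - (1 - dl) = (lam' - (lam - 2 * Q * y)) + (lam - 2 * Q * y - (1 - dl)) by ring.
apply: le_trans (ler_normD _ _) _; rewrite [leRHS]mulrDl [leRHS]addrC; exact: (lerD hM hL).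
Qed.

Section Class.
Variables (R : realType) (d : nat) (a b c : R) (U : nat).
Hypothesis d0 : (0 < d)%N.
Hypothesis a0 : 0 < a.
Hypothesis b0 : 0 < b.
Hypothesis c_gt0 : 0 < c.
Hypothesis U0 : (0 < U)%N.
Implicit Type p : offspring R d.

(** The bounds on [u] and [v] for [rho^U <= 2]. For the gap, the Doeblin constant [g = a^2 / rho^U]
    is at least [a^2 / 2], so [rho^U <= 1 + a^2 / 4] leaves [rho^U - g <= 1 - a^2 / 4]. [Qmin]
    replaces each Perron entry in [Q] by [lbound]. *)
Definition lbound : R := a / 2.
Definition ubound : R := 2 / a.
Definition gap : R := Num.min 1 (a ^+ 2 / 4).
Definition Qmin : R := 2^-1 * (lbound ^+ 3 * b).

Lemma lbound_gt0 : 0 < lbound. Proof. by rewrite divr_gt0. Qed.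
Lemma ubound_ge0 : 0 <= ubound. Proof. by rewrite divr_ge0// ltW. Qed.
Lemma gap01 : 0 < gap <= 1.
Proof. by rewrite lt_min ltr01 divr_gt0 ?exprn_gt0//= ge_min lexx. Qed.
Lemma Qmin_gt0 : 0 < Qmin.
Proof. by rewrite mulr_gt0// mulr_gt0// exprn_gt0// lbound_gt0. Qed.

Record nice p : Prop := Nice {
  nice_po : is_offspring p;
  nice_pc : (\sum_(k < d) \sum_(l < d) \sum_(m < d) \sum_(j < d) cmom p k l m j <= c%:E)%E;
  nice_P : perron (Mmean p) (rho p) (uvec p) (vvec p);
  nice_half : 2^-1 <= rho p;
  nice_2 : rho p <= 2;
  nice_u : forall i, lbound <= uvec p i 0;
  nice_v : forall i, lbound <= vvec p i 0;
  nice_V : forall i, vvec p i 0 <= ubound;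
  nice_prim : forall i j, 0 < (Mmean p ^+ U) i j;
  nice_ctr1 : forall x, dotp (vvec p) x = 0 ->
    wnorm (vvec p) (Mmean p ^+ U *m x) <= (1 - gap) * wnorm (vvec p) x;
  nice_ctr2 : forall x, dotp (vvec p) x = 0 ->
    (rho p)^-1 ^+ U * wnorm (vvec p) (Mmean p ^+ U *m x) <= (1 - gap) * wnorm (vvec p) x;
  nice_Qmin : Qmin <= Qc p;
  nice_Q : Qc p = Qv p (uvec p) (vvec p) }.

Lemma inK_nice p : inK a b c U p -> 2^-1 <= rho p <= 2 -> rho p ^+ U <= 2 ->
  rho p ^+ U <= 1 + a ^+ 2 / 4 -> nice p.
Proof.
move=> [po AU pb pc] /andP[l12 l2] lU2 lUa.
have AU0 i j : 0 < (Mmean p ^+ U) i j by exact: lt_le_trans (AU i j).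
have A0 := Mmean_ge0 po pc.
have [lam [u [v P]]] := perron_exists d0 U0 A0 AU0.
have rE : rho p = lam := perron_rootE P A0.
have uE : uvec p = u := perron_rightE P a0 AU A0.
have vE : vvec p = v := perron_leftE P a0 AU A0.
have P2 := P; rewrite -rE -uE -vE in P2.
have lU : 0 < rho p ^+ U by rewrite exprn_gt0// (perron_lam_gt0 P2).
have ug i : lbound <= uvec p i 0.
  rewrite /lbound ler_pdivrMr// mulrC; apply: le_trans (perron_u_ge P2 AU i) _.
  by rewrite ler_wpM2r// ltW// (perron_u_gt0 P2).
have vg i : lbound <= vvec p i 0.
  rewrite /lbound ler_pdivrMr// mulrC; apply: le_trans (perron_v_ge P2 a0 AU i) _.
  by rewrite ler_wpM2r// ltW// (perron_v_gt0 P2).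
have ga := contract_gap P2 a0 AU.
have gl : a ^+ 2 / 2 <= a ^+ 2 / rho p ^+ U.
  by rewrite ler_wpM2l ?exprn_ge0 ?(ltW a0)// lef_pV2 ?posrE.
have hg : gap <= a ^+ 2 / 4 by rewrite ge_min lexx orbT.
have QE : Qc p = Qv p (uvec p) (vvec p) by [].
split => //.
- by move=> i; rewrite /ubound ler_pdivlMr// mulrC (le_trans (perron_v_le P2 AU i)).
- move=> x vx; apply: le_trans (wnorm_contract P2 AU ga vx) _.
  rewrite ler_wpM2r ?(wnorm_ge0 P2)//; lra.
- move=> x vx; have w0 := wnorm_ge0 P2 x.
  have l0 : 0 < (rho p)^-1 ^+ U by rewrite exprVn invr_gt0.
  apply: le_trans (ler_wpM2l (ltW l0) (wnorm_contract P2 AU ga vx)) _.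
  rewrite mulrA ler_wpM2r// mulrBr exprVn mulVf ?gt_eqF// lerD2l lerN2 mulrC.
  apply: le_trans hg _; apply: le_trans (_ : a ^+ 2 / 2 / rho p ^+ U <= _).
    rewrite ler_pdivlMr//; have := ler_wpM2l (exprn_ge0 2 (ltW a0)) lU2; lra.
  by rewrite ler_wpM2r// invr_ge0 ltW.
- have lb := lbound_gt0.
  rewrite QE /Qmin /Qv ler_wpM2l//.
  have hb : b <= \sum_(k < d) \sum_(l < d) \sum_(m < d) bm p k l m.
    rewrite -lee_fin (le_trans pb)// -!sumEFin le_eqVlt; apply/orP; left; apply/eqP.
    apply: eq_bigr => k _; rewrite -sumEFin; apply: eq_bigr => l _; rewrite -sumEFin.
    by apply: eq_bigr => m _; exact: (bmomE po pc).
  apply: le_trans (ler_wpM2l (exprn_ge0 3 (ltW lb)) hb) _.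
  rewrite mulr_sumr; apply: ler_sum => k _.
  rewrite mulr_sumr mulr_sumr; apply: ler_sum => l _.
  rewrite mulr_sumr mulr_sumr; apply: ler_sum => m _.
  have -> : lbound ^+ 3 * bm p k l m = lbound * (bm p k l m * lbound * lbound) by ring.
  have bm0 := bm_ge0 po pc k l m.
  have lb0 := ltW lb.
  have h1 : bm p k l m * lbound <= bm p k l m * uvec p l 0 by rewrite ler_wpM2l.
  have h2 := ler_pM (mulr_ge0 bm0 lb0) lb0 h1 (ug m).
  exact: ler_pM lb0 (mulr_ge0 (mulr_ge0 bm0 lb0) lb0) (vg k) h2.
Qed.

Definition CbK : R := Cb d c lbound ubound.
Definition kapK : R := kap U gap.
Definition C3K : R := C3 d c lbound ubound.

Lemma CbK_ge0 : 0 <= CbK.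
Proof.
have V0 := ubound_ge0; have lb := ltW lbound_gt0; have c_0 := ltW c_gt0.
rewrite /CbK /Cb -lock; apply: divr_ge0; last exact: exprn_ge0.
by apply: mulr_ge0; [exact: mulr_ge0|exact: addr_ge0].
Qed.
Lemma C3K_ge0 : 0 <= C3K.
Proof.
have V0 := ubound_ge0; have lb := ltW lbound_gt0; have c_0 := ltW c_gt0.
rewrite /C3K /C3 -lock; apply: divr_ge0; last exact: exprn_ge0.
by apply: mulr_ge0 => //; exact: mulr_ge0.
Qed.
Lemma kapK_ge0 : 0 <= kapK.
Proof. by rewrite /kapK /kap -lock divr_ge0 ?exprn_ge0//; case/andP: gap01 => /ltW. Qed.

Lemma nice_Q_le p : nice p -> Qc p <= CbK.
Proof.
move=> N; have P := nice_P N; rewrite (nice_Q N) /Qv.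
have := bform_bound (nice_po N) (nice_pc N) P lbound_gt0 (nice_v N) (nice_V N) (ltW c_gt0) (uvec p) (uvec p).
rewrite (wnorm_u P) !mulr1 -/CbK => hb; have := ler_norm (bform p (vvec p) (uvec p) (uvec p)).
have := CbK_ge0; lra.
Qed.

Definition Kext : R := 4 / Qmin.
Definition K1ext : R := CbK * kapK * Kext + C3K * Kext ^+ 2.
Definition K2ext : R := CbK * (kapK * (1 + 2 * CbK * Kext) * Kext + kapK * Kext) + C3K * Kext ^+ 2.
Definition Knear : R := 2 * K1ext + K2ext.

(** A duality: conditioned on extinction, a supercritical process looks subcritical with the same
    distance to criticality. With [|1 - rho|] as parameter the two sides need no distinction below;
    on the subcritical side [mu = 1] and the expansions are exact. *)
Record near_critical p := NearCritical {
  near_mu : forall i, 0 < mu p i 0;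
  near_yext : yext p (vvec p) <= Kext * `|1 - rho p|;
  near_L : `|rho p - 2 * Qc p * yext p (vvec p) - (1 - `|1 - rho p|)| <= Knear * `|1 - rho p| ^+ 2;
  near_rho_mu : `|rho_mu p - (1 - `|1 - rho p|)| <= Knear * `|1 - rho p| ^+ 2;
  near_perron : exists u' v', perron (Mat p (mu p)) (rho_mu p) u' v' }.

Lemma nice_near_critical p : nice p -> rho p != 1 ->
  CbK * kapK * `|1 - rho p| <= Qmin / 2 ->
  `|1 - rho p| * (ubound * d%:R) < zst d c lbound ubound Qmin ^+ 2 * (Qmin / 4) ->
  near_critical p.
Proof.
move=> N l1 s1 s2.
have po := nice_po N; have pc := nice_pc N; have P := nice_P N.
have Cb0 := CbK_ge0; have C30 := C3K_ge0; have kap0 := kapK_ge0.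
have Qm0 := Qmin_gt0; have Ke0 : 0 <= Kext by rewrite divr_ge0// ltW.
have Ke2 : 0 <= Kext ^+ 2 := exprn_ge0 2 Ke0.
have K10 : 0 <= K1ext := addr_ge0 (mulr_ge0 (mulr_ge0 Cb0 kap0) Ke0) (mulr_ge0 C30 Ke2).
have CK : 0 <= 1 + 2 * CbK * Kext := addr_ge0 ler01 (mulr_ge0 (mulr_ge0 (ler0n _ 2) Cb0) Ke0).
have K20 : 0 <= K2ext := addr_ge0 (mulr_ge0 Cb0 (addr_ge0 (mulr_ge0 (mulr_ge0 kap0 CK) Ke0)
  (mulr_ge0 kap0 Ke0))) (mulr_ge0 C30 Ke2).
have Kn0 : 0 <= Knear := addr_ge0 (mulr_ge0 (ler0n _ 2) K10) K20.
have per : (forall i, 0 < mu p i 0) -> exists u' v', perron (Mat p (mu p)) (rho_mu p) u' v'.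
  move=> mu0; have MU := Mat_mu_primitive po pc mu0 (nice_prim N).
  have A0 k l := Mat_ge0 po pc k l (mu_inC po).
  have [lam' [u' [v' P']]] := perron_exists d0 U0 A0 MU.
  by exists u', v'; rewrite /rho_mu (perron_rootE P' A0).
have [lt1|gt1|e1] := ltgtP (rho p) 1; last by rewrite e1 eqxx in l1.
  have muE := subcritical_mu po pc P lt1.
  have mu0 i : 0 < mu p i 0 by rewrite muE coord1.
  have y0 : yext p (vvec p) = 0.
    by rewrite /yext /dotp big1// => i _; rewrite qextE muE coord1 subrr mulr0.
  have dlE : `|1 - rho p| = 1 - rho p by rewrite ger0_norm// subr_ge0 ltW.
  have dl0 : 0 <= `|1 - rho p| by [].
  split.
  - exact: mu0.
  - by rewrite y0 mulr_ge0.
  - rewrite y0 mulr0 subr0 dlE subKr subrr normr0 mulr_ge0// exprn_ge0// -dlE//.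
  - rewrite /rho_mu muE -/(rho p) dlE subKr subrr normr0 mulr_ge0// exprn_ge0// -dlE//.
  - exact: per.
have dlE : `|1 - rho p| = rho p - 1 by rewrite distrC ger0_norm// subr_ge0 ltW.
rewrite dlE in s1 s2.
have c_0 := ltW c_gt0; have V0 := ubound_ge0; have lam1 := ltW gt1.
have QmQ := nice_Qmin N; rewrite (nice_Q N) in QmQ.
have mu0 := mu_gt0 po pc P lbound_gt0 (nice_v N) (nice_V N) c_0 V0 gap01 (nice_2 N) (nice_ctr1 N) lam1 Qm0 QmQ s1 s2.
have hy := yext_le po pc P lbound_gt0 (nice_v N) (nice_V N) c_0 V0 gap01 (nice_2 N) (nice_ctr1 N) lam1 Qm0 QmQ s1 s2.
have ye := supercritical_yext po pc P lbound_gt0 (nice_v N) (nice_V N) c_0 V0 gap01 (nice_2 N) (nice_ctr1 N) lam1 Qm0 QmQ s1 s2 d0 (nice_prim N) gt1.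
have hr := yext_relation po pc P lbound_gt0 (nice_v N) (nice_V N) c_0 V0 gap01 (nice_2 N) (nice_ctr1 N) lam1 Qm0 QmQ s1 s2 ye.
have [u' [v' P']] := per mu0.
have hm := rho_mu_estimate po pc P lbound_gt0 (nice_v N) (nice_V N) c_0 V0 gap01 (nice_2 N) (nice_ctr1 N) lam1 Qm0 QmQ s1 s2 P'.
rewrite -/CbK -/kapK -/C3K in hr hm; rewrite -/Kext in hy.
have y0 : 0 <= yext p (vvec p) := yext_ge0 po P.
rewrite -(nice_Q N) in hr hm.
have [hL hM] := near_expansion Cb0 kap0 C30 Ke0 lam1 y0 hy hr hm.
split; rewrite ?dlE//; last exact: per.
apply: le_trans hL _; rewrite ler_wpM2r ?exprn_ge0 ?subr_ge0//.
by rewrite lerDl.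
Qed.
End Class.

(** * The three regimes *)

Section SequenceLimits.
Variables (R : realType) (u w : nat -> R) (l m : R).
Hypothesis ul : u k @[k --> \oo] --> l.
Hypothesis wm : w k @[k --> \oo] --> m.

Lemma seq_cvgD : u k + w k @[k --> \oo] --> l + m. Proof. exact: cvgD. Qed.
Lemma seq_cvgB : u k - w k @[k --> \oo] --> l - m. Proof. exact: cvgB. Qed.
Lemma seq_cvgM : u k * w k @[k --> \oo] --> l * m. Proof. exact: cvgM. Qed.
Lemma seq_cvgZ r : r * u k @[k --> \oo] --> r * l.
Proof. by apply: cvgM => //; exact: cvg_cst. Qed.
Lemma seq_cvgZr r : u k * r @[k --> \oo] --> l * r.
Proof. by apply: cvgM => //; exact: cvg_cst. Qed.
Lemma seq_cvg_norm : `|u k| @[k --> \oo] --> `|l|. Proof. exact: cvg_norm. Qed.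
Lemma seq_cvgV (l0 : l != 0) : (u k)^-1 @[k --> \oo] --> l^-1. Proof. exact: cvgV. Qed.
Lemma seq_le z : l < z -> \forall k \near \oo, u k <= z. Proof. exact: cvgr_le. Qed.
Lemma seq_lt z : l < z -> \forall k \near \oo, u k < z. Proof. exact: cvgr_lt. Qed.
Lemma seq_gt z : z < l -> \forall k \near \oo, z < u k. Proof. exact: cvgr_gt. Qed.
Lemma seq_dist : `|u k - l| @[k --> \oo] --> (0 : R).
Proof. by rewrite -(normr0 R) -(subrr l); apply: cvg_norm; apply: cvgB => //; exact: cvg_cst. Qed.
End SequenceLimits.
Arguments seq_cvgD {R u w l m} ul wm.
Arguments seq_cvgB {R u w l m} ul wm.
Arguments seq_cvgM {R u w l m} ul wm.
Arguments seq_cvgZ {R u l} ul r.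
Arguments seq_cvgZr {R u l} ul r.
Arguments seq_cvg_norm {R u l} ul.
Arguments seq_cvgV {R u l} ul l0.
Arguments seq_dist {R u l} ul.

(** [Qc (f k)] is bounded but need not converge, so its products with null sequences require this
    form. *)
Lemma null_bounded_mul (R : realType) (u w : nat -> R) B :
  (\forall k \near \oo, `|u k| <= B) -> w k @[k --> \oo] --> (0 : R) -> u k * w k @[k --> \oo] --> (0 : R).
Proof.
move=> uB w0.
have B1 : 0 < `|B| + 1 by rewrite ltr_wpDl.
apply/cvgr0Pnorm_le => e e0.
have /cvgr0Pnorm_le/(_ (e / (`|B| + 1))) := w0; rewrite divr_gt0// => /(_ isT) wn.
near=> k; rewrite normrM.
have h1 : `|u k| <= `|B| + 1.
  by apply: le_trans (_ : B <= _); [near: k|rewrite (le_trans (ler_norm B))// lerDl].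
have h2 : `|w k| <= e / (`|B| + 1) by near: k.
have -> : e = (`|B| + 1) * (e / (`|B| + 1)) by field; rewrite gt_eqF.
exact: ler_pM.
Unshelve. all: by end_near. Qed.

Lemma null_le (R : realType) (u w : nat -> R) :
  (\forall k \near \oo, `|u k| <= w k) -> w k @[k --> \oo] --> (0 : R) -> u k @[k --> \oo] --> (0 : R).
Proof.
move=> uw w0; apply/cvgr0Pnorm_le => e e0.
have /cvgr0Pnorm_le/(_ e e0) wn := w0.
near=> k; apply: le_trans (_ : w k <= _); first by near: k.
by apply: le_trans (ler_norm _) _; near: k.
Unshelve. all: by end_near. Qed.

Lemma expR_remainder (R : realType) (x : R) : 0 <= x -> 0 <= expR (- x) - 1 + x <= x ^+ 2.
Proof.
move=> x0; have h := expR_ge1Dx (- x).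
apply/andP; split; first lra.
have h2 : expR (- x) <= (1 + x)^-1.
  by rewrite expRN lef_pV2 ?posrE ?expR_gt0 ?expR_ge1Dx// ltr_pwDl.
have x1 : 0 < 1 + x by lra.
have h3 : (1 + x)^-1 <= 1 - x + x ^+ 2.
  rewrite -div1r ler_pdivrMr//.
  have := exprn_ge0 3 x0; rewrite !exprS expr0; lra.
lra.
Qed.

(** The witness is [limn], which has a value for every [k], including those for which convergence in
    [m] is not known; it is the true limit eventually. *)
Lemma limit_claim_of_bound (R : realType) (d : nat) (t : 'cV[R]_d) nk f j mvec Psi (e : nat -> R) :
  (\forall k \near \oo, exists X, Lnj (f k) (s_of t (mvec k)) j (nk k) m @[m --> \oo] --> X /\
     `|X - Psi k| <= e k) ->
  e k @[k --> \oo] --> (0 : R) -> limit_claim t nk f j mvec Psi.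
Proof.
move=> H e0; exists (fun k => limn (Lnj (f k) (s_of t (mvec k)) j (nk k))); split.
  near=> k.
  have [X [LX _]] : exists X, Lnj (f k) (s_of t (mvec k)) j (nk k) m @[m --> \oo] --> X /\
     `|X - Psi k| <= e k by near: k.
  have -> : limn (Lnj (f k) (s_of t (mvec k)) j (nk k)) = X by apply: cvg_lim.
  exact: LX.
apply: (@null_le _ _ e _ e0).
near=> k.
have [X [LX Xe]] : exists X, Lnj (f k) (s_of t (mvec k)) j (nk k) m @[m --> \oo] --> X /\
     `|X - Psi k| <= e k by near: k.
have -> : limn (Lnj (f k) (s_of t (mvec k)) j (nk k)) = X by apply: cvg_lim.
by rewrite normr_id.
Unshelve. all: by end_near. Qed.

Lemma seq_near_eq (R : realType) (u w : nat -> R) (l : R) :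
  (\forall k \near \oo, u k = w k) -> u k @[k --> \oo] --> l -> w k @[k --> \oo] --> l.
Proof. by move=> uw ul; apply: cvg_trans ul; exact: near_eq_cvg. Qed.

Lemma recursion_perturb (R : realType) (x : nat -> R) n (L Q tau al th Y C : R) : (0 < n)%N ->
  (forall i, (i <= n)%N -> 0 <= x i <= Y) ->
  \sum_(0 <= i < n) `|x i.+1 - (L * x i - Q * x i ^+ 2 + tau)| <= C ->
  \sum_(0 <= i < n) `|x i.+1 - ((1 - al / n%:R) * x i - Q * x i ^+ 2 + th / n%:R ^+ 2)| <=
    C + `|n%:R * (L - 1) + al| * Y + `|n%:R ^+ 2 * tau - th| / n%:R.
Proof.
move=> n0 xY h; have nn : 0 < n%:R :> R by rewrite ltr0n.
pose D := `|n%:R * (L - 1) + al| * Y / n%:R + `|n%:R ^+ 2 * tau - th| / n%:R ^+ 2.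
apply: le_trans (_ : \sum_(0 <= i < n) (`|x i.+1 - (L * x i - Q * x i ^+ 2 + tau)| + D) <= _).
  rewrite big_nat [leRHS]big_nat; apply: ler_sum => i /andP[_ ni].
  have /andP[xi0 xiY] := xY i (ltnW ni).
  have -> : x i.+1 - ((1 - al / n%:R) * x i - Q * x i ^+ 2 + th / n%:R ^+ 2) =
    (x i.+1 - (L * x i - Q * x i ^+ 2 + tau)) +
    ((n%:R * (L - 1) + al) * x i / n%:R + (n%:R ^+ 2 * tau - th) / n%:R ^+ 2).
    by field; rewrite gt_eqF.
  apply: le_trans (ler_normD _ _) _; rewrite lerD2l.
  apply: le_trans (ler_normD _ _) _; apply: lerD.
    rewrite !normrM normfV (gtr0_norm nn) ler_wpM2r ?invr_ge0 ?(ltW nn)//.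
    by rewrite ler_wpM2l// ger0_norm.
  by rewrite normrM normfV (gtr0_norm (exprn_gt0 2 nn)).
rewrite big_split /= sumr_const_nat subn0 -[D *+ n]mulr_natl -addrA; apply: lerD => //.
rewrite [leLHS](_ : _ = `|n%:R * (L - 1) + al| * Y + `|n%:R ^+ 2 * tau - th| / n%:R)//.
by rewrite /D; field; rewrite gt_eqF.
Qed.

Lemma sum_bounds (R : realType) (C q th K al g : R) :
  0 <= C -> 0 <= q -> 0 <= th -> 0 <= K -> 0 <= al -> 0 <= g ->
  let B := 1 + C + q + th + K + al + g in
  [/\ 1 <= B, al + 1 + g <= B, C <= B, th <= B & K <= B /\ q <= B].
Proof. by move=> C0 q0 t0 K0 a0 g0 B; rewrite /B; split; [lra|lra|lra|lra|split; lra]. Qed.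

(** [p] and [-(p + al)] are the roots of [X^2 + al X - Q th]. The square root is at most
    [al + 1 + Q th], since the squares differ by [(1 - Q th)^2 + 2 al (1 + Q th)]. *)
Lemma riccati_roots (R : realType) (al Q th C : R) : 0 <= al -> 0 < Q -> 0 < th -> Q <= C ->
  let p := (Num.sqrt (al ^+ 2 + 4 * Q * th) - al) / 2 in
  [/\ 0 < p, p + al <= al + 1 + C * th & p * (p + al) = Q * th].
Proof.
move=> al0 Q0 th0 QC p; set D := al ^+ 2 + 4 * Q * th in p *.
have Qth : 0 < Q * th by rewrite mulr_gt0.
have D0 : 0 <= D by rewrite /D; have := exprn_ge0 2 al0; lra.
have sD : Num.sqrt D ^+ 2 = D by exact: sqr_sqrtr.
have sD0 : 0 <= Num.sqrt D by exact: sqrtr_ge0.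
have alsD : al < Num.sqrt D.
  rewrite -(ltr_pXn2r (n := 2)) ?nnegrE// sD /D; lra.
have sDle : Num.sqrt D <= al + 1 + Q * th.
  rewrite -(ler_pXn2r (n := 2)) ?nnegrE ?addr_ge0 ?(ltW Qth)// sD /D.
  have := mulr_ge0 al0 (ltW Qth); have := sqr_ge0 (1 - Q * th); rewrite !expr2; lra.
have QthC : Q * th <= C * th by rewrite ler_wpM2r// ltW.
split; rewrite /p; [lra|lra|].
have -> : (Num.sqrt D - al) / 2 * ((Num.sqrt D - al) / 2 + al) = (Num.sqrt D ^+ 2 - al ^+ 2) / 4 by field.
by rewrite sD /D; field.
Qed.

(** * Passage to the limit along the sequence of laws *)

Section Sequences.
Variables (R : realType) (d : nat) (a b c : R) (U : nat).
Hypothesis d0 : (0 < d)%N.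
Hypothesis a0 : 0 < a.
Hypothesis b0 : 0 < b.
Hypothesis c_gt0 : 0 < c.
Hypothesis U0 : (0 < U)%N.

Definition surv (p : offspring R d) s i : R := dotp (vvec p) (one_v R d - Hit p s i (mu p)).
Definition tauv (p : offspring R d) s : R := dotp (vvec p) (one_v R d - s).
Local Notation lb := (lbound a).
Local Notation ub := (ubound a).
Local Notation Cbk := (CbK d a c).
Definition gK (K : R) : R := lb * expR (- (8 * Cbk * K)).

Lemma limit_law_exists (p : offspring R d) s n (Y K : R) j :
  nice a b c U p -> near_critical a b c U p -> inC s -> (0 < n)%N -> 0 <= K ->
  (forall i, (i <= n)%N -> surv p s i <= Y) -> Y / lb <= 1 -> n%:R * Y <= K ->
  n%:R * tauv p s <= 1 -> 8 * Cbk * Y <= 1 ->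
  let err := core_error c (vvec p) lb ub s U (gap a) K n Y in
  2 * err <= gK K ->
  exists X, Lnj p s j n m @[m --> \oo] --> X /\
   `|X - \prod_(0 <= i < n) (1 - 2 * Qc p * (surv p s i - yext p (vvec p)) /
       (rho p - 2 * Qc p * yext p (vvec p)))| <= 4 * err / gK K.
Proof.
move=> N NC sC n0 K0 SY Yl nY nt QY err eg.
have po := nice_po N; have pc := nice_pc N; have P := nice_P N; have lb0 := lbound_gt0 a0.
have [u' [v' P']] := near_perron NC.
have MU := Mat_mu_primitive po pc (near_mu NC) (nice_prim N).
have cv := @Lnj_cvg _ _ _ _ po pc (near_mu NC) _ _ _ _ U0 P' MU s j n sC.
eexists; split; first exact: cv.
have Y0 : 0 <= Y.
  apply: le_trans (SY 0%N (leq0n n)); apply: le_trans (yext_ge0 po P) _.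
  exact: (yext_le_survival po pc P sC).
have QQ : Qv p (uvec p) (vvec p) <= Cbk by have := nice_Q_le a0 c_gt0 N; rewrite (nice_Q N).
have QY' : 8 * Qv p (uvec p) (vvec p) * Y <= 1.
  by apply: le_trans QY; rewrite ler_wpM2r// ler_wpM2l.
rewrite (nice_Q N).
exact: (limit_law_product po pc P lb0 (nice_v N) (nice_V N) (ltW c_gt0) (ubound_ge0 a0)
  sC U0 (gap01 a0) K0 (nice_half N) (nice_2 N) (nice_ctr1 N) (nice_ctr2 N) n0 SY Yl nY nt QY' QQ P'
  (nice_u N j) eg).
Qed.

Variables (t : 'cV[R]_d) (f : nat -> offspring R d) (nk : nat -> nat) (j : 'I_d).
Hypothesis t0 : forall i, 0 <= t i 0.
Hypothesis fK : forall k, inK a b c U (f k).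
Hypothesis nk_oo : forall N, \forall k \near \oo, (N <= nk k)%N.
Hypothesis rho1 : rho (f k) @[k --> \oo] --> (1 : R).
Hypothesis rho_neq1 : forall k, rho (f k) != 1.

Let n k : R := (nk k)%:R.
Let dl k : R := `|1 - rho (f k)|.

Lemma dl_null : dl k @[k --> \oo] --> (0 : R).
Proof.
by have := seq_dist rho1; rewrite /dl; under eq_fun do rewrite distrC.
Qed.

Lemma near_n_ge (B : R) : \forall k \near \oo, B <= n k.
Proof.
near=> k; apply: le_trans (_ : (Num.truncn `|B|).+1%:R <= _).
  apply: le_trans (ler_norm B) _; rewrite ltW//; exact: truncnS_gt.
rewrite /n ler_nat; near: k; exact: nk_oo.
Unshelve. all: by end_near. Qed.

Lemma n_inv_null : (n k)^-1 @[k --> \oo] --> (0 : R).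
Proof.
apply/cvgr0Pnorm_le => e e0; near=> k.
have h : e^-1 <= n k by near: k; exact: near_n_ge.
have n0 : 0 < n k by apply: lt_le_trans h; rewrite invr_gt0.
by rewrite normfV gtr0_norm// -[leRHS]invrK lef_pV2 ?posrE ?invr_gt0.
Unshelve. all: by end_near. Qed.

Lemma near_nice : \forall k \near \oo, nice a b c U (f k).
Proof.
have rU : rho (f k) ^+ U @[k --> \oo] --> (1 : R).
  elim: U => [|m IH]; first by under eq_fun do rewrite expr0; exact: cvg_cst.
  by under eq_fun do rewrite exprS; have := seq_cvgM rho1 IH; rewrite mulr1.
have a2 : 0 < a ^+ 2 / 4 by rewrite divr_gt0// exprn_gt0.
near=> k; apply: inK_nice => //.
- have : dl k <= 2^-1 by near: k; apply: (seq_le dl_null); rewrite invr_gt0.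
  by rewrite /dl ler_norml => /andP[h1 h2]; apply/andP; split; lra.
- by near: k; apply: (seq_le rU); rewrite ltr1n.
- by near: k; apply: (seq_le rU); rewrite ltrDl.
Unshelve. all: by end_near. Qed.

Lemma near_near_critical : \forall k \near \oo, near_critical a b c U (f k).
Proof.
have Qm0 := Qmin_gt0 a0 b0.
have z0 : 0 < zst d c lb ub (Qmin a b) := zst_gt0 d (lbound_gt0 a0) (ltW c_gt0) (ubound_ge0 a0) Qm0.
near=> k; apply: nice_near_critical => //; first by near: k; exact: near_nice.
- near: k.
  have := seq_cvgZ dl_null (CbK d a c * kapK a U); rewrite mulr0 => h.
  by apply: (seq_le h); rewrite divr_gt0.
- rewrite mulrC; near: k.
  have := seq_cvgZ dl_null (ub * d%:R); rewrite mulr0 => h.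
  by apply: (seq_lt h); rewrite mulr_gt0 ?exprn_gt0// divr_gt0.
Unshelve. all: by end_near. Qed.

Let T : R := \sum_i t i 0.

Lemma s_of_inC (p : offspring R d) m : nice a b c U p -> 0 < m -> inC (s_of t (m *: vvec p)).
Proof.
move=> N m0 i; rewrite [s_of _ _ i 0]mxE coordZ expR_ge0/=.
rewrite -[leRHS](expR0 R) ler_expR oppr_le0 divr_ge0// mulr_ge0 ?(ltW m0)//.
exact: le_trans (ltW (lbound_gt0 a0)) (nice_v N i).
Qed.

(** The weight [v_i] in [tau] cancels the [v_i] in the scale: each term is
    [m v_i (1 - exp (- t_i / (m v_i)))], which is [t_i] up to [t_i^2 / (m v_i)]. *)
Lemma tauv_scaled (p : offspring R d) m : nice a b c U p -> 0 < m ->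
  `|m * tauv p (s_of t (m *: vvec p)) - T| <= m^-1 * \sum_i (t i 0 ^+ 2 / lb).
Proof.
move=> N m0; have lb0 := lbound_gt0 a0.
rewrite /tauv /dotp mulr_sumr /T -sumrB mulr_sumr.
apply: le_trans (ler_norm_sum _ _ _) _; apply: ler_sum => i _.
have vl := nice_v N i; have v0 := lt_le_trans lb0 vl.
rewrite coordB coord1 [s_of _ _ i 0]mxE coordZ.
set w := m * vvec p i 0; have w0 : 0 < w by rewrite mulr_gt0.
have x0 : 0 <= t i 0 / w by rewrite divr_ge0// ltW.
have /andP[r0 r1] := expR_remainder x0.
have -> : m * (vvec p i 0 * (1 - expR (- (t i 0 / w)))) - t i 0 =
   - (w * (expR (- (t i 0 / w)) - 1 + t i 0 / w)).
  rewrite mulrA -/w; field; rewrite gt_eqF//.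
rewrite normrN ger0_norm; last by rewrite mulr_ge0// ltW.
apply: le_trans (ler_wpM2l (ltW w0) r1) _.
have -> : w * (t i 0 / w) ^+ 2 = t i 0 ^+ 2 * w^-1 by field; rewrite gt_eqF.
rewrite mulrCA ler_wpM2l ?exprn_ge0// /w invfM ler_wpM2l ?invr_ge0 ?(ltW m0)//.
by rewrite lef_pV2 ?posrE.
Qed.

Variable M : nat -> R.
Let s k := s_of t (M k *: vvec (f k)).
Let tau k : R := tauv (f k) (s k).

Lemma scaled_tau_cvg : (\forall k \near \oo, 0 < M k) -> (M k)^-1 @[k --> \oo] --> (0 : R) ->
  M k * tau k @[k --> \oo] --> T.
Proof.
move=> M0 MV.
have h : M k * tau k - T @[k --> \oo] --> (0 : R).
  apply: (@null_le _ _ (fun k => (M k)^-1 * \sum_i (t i 0 ^+ 2 / lb))).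
    by near=> k; apply: tauv_scaled; near: k => //; exact: near_nice.
  by have := seq_cvgZr MV (\sum_i (t i 0 ^+ 2 / lb)); rewrite mul0r.
have hT : T @[k --> \oo] --> T by exact: cvg_cst.
have := seq_cvgD h hT; rewrite add0r.
by under eq_fun do rewrite subrK.
Unshelve. all: by end_near. Qed.

Lemma contraction_null : (1 - gap a) ^+ (nk k %/ U) @[k --> \oo] --> (0 : R).
Proof.
have /andP[h0 h1] := gap01 a0.
have z1 : `|1 - gap a| < 1 by rewrite ger0_norm ?subr_ge0// gtrBl.
apply/cvgr0Pnorm_le => e e0.
have /cvgr0Pnorm_le/(_ e e0)[N _ HN] := @cvg_expr R _ z1.
near=> k; apply: HN => /=.
rewrite leq_divRL//; near: k; exact: nk_oo.
Unshelve. all: by end_near. Qed.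

(** All that a regime has to supply is a null majorant [Y] of the orbit with [n Y] bounded, together
    with [n tau -> 0]. *)
Lemma limit_law_approx (Y : nat -> R) (K : R) : 0 <= K ->
  (\forall k \near \oo, 0 < M k) ->
  (\forall k \near \oo, forall i, (i <= nk k)%N -> surv (f k) (s k) i <= Y k) ->
  Y k @[k --> \oo] --> (0 : R) -> (\forall k \near \oo, n k * Y k <= K) ->
  n k * tau k @[k --> \oo] --> (0 : R) ->
  exists2 e : nat -> R, e k @[k --> \oo] --> (0 : R) &
  \forall k \near \oo, exists X, Lnj (f k) (s k) j (nk k) m @[m --> \oo] --> X /\
   `|X - \prod_(0 <= i < nk k) (1 - 2 * Qc (f k) * (surv (f k) (s k) i - yext (f k) (vvec (f k))) /
       (rho (f k) - 2 * Qc (f k) * yext (f k) (vvec (f k))))| <= e k.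
Proof.
move=> K0 M0 SY Y0 nY nt; have lb0 := lbound_gt0 a0.
have gK0 : 0 < gK K by rewrite mulr_gt0// expR_gt0.
pose E k := core_error c (vvec (f k)) lb ub (s k) U (gap a) K (nk k) (Y k).
have E0 : E k @[k --> \oo] --> (0 : R).
  rewrite /E /core_error; under eq_fun do rewrite -/(tauv _ _) -/(tau _) -/(n _).
  have tau0 : tau k @[k --> \oo] --> (0 : R).
    have h := seq_cvgM nt n_inv_null; rewrite mul0r in h; apply: seq_near_eq h.
    near=> k; have n1 : 1 <= n k by near: k; exact: near_n_ge.
    by field; rewrite gt_eqF// (lt_le_trans ltr01).
  have eta0 := seq_cvgD Y0 nt; rewrite addr0 in eta0.
  have := seq_cvgD (seq_cvgD (seq_cvgZ (seq_cvgD contraction_null eta0) (Cp d c lb ub U (gap a) / lb))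
    (seq_cvgZ eta0 (Cw d c lb ub U (gap a) K))) (seq_cvgZr tau0 lb^-1).
  by rewrite mul0r !addr0 !mulr0 !addr0.
exists (fun k => 4 * E k / gK K).
  by have := seq_cvgZr (seq_cvgZ E0 4) (gK K)^-1; rewrite mulr0 mul0r.
near=> k.
apply: limit_law_exists => //.
- by near: k; exact: near_nice.
- by near: k; exact: near_near_critical.
- by apply: s_of_inC; near: k => //; exact: near_nice.
- by rewrite -(ltr0n R); apply: lt_le_trans ltr01 _; near: k; exact: near_n_ge.
- by near: k.
- rewrite ler_pdivrMr// mul1r; near: k; exact: (seq_le Y0).
- by near: k.
- by near: k; exact: (seq_le nt).
- near: k; have h := seq_cvgZ Y0 (8 * Cbk); rewrite mulr0 in h; exact: (seq_le h).
- near: k; have h := seq_cvgZ E0 2; rewrite mulr0 in h; exact: (seq_le h).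
Unshelve. all: by end_near. Qed.

Lemma tau_null : n k * tau k @[k --> \oo] --> (0 : R) -> tau k @[k --> \oo] --> (0 : R).
Proof.
move=> nt; have h := seq_cvgM nt n_inv_null; rewrite mul0r in h; apply: seq_near_eq h.
near=> k; have n1 : 1 <= n k by near: k; exact: near_n_ge.
by field; rewrite gt_eqF// (lt_le_trans ltr01).
Unshelve. all: by end_near. Qed.

(** Cases (1) and (2) together: [al] is the limit of [n |1 - rho|] and [psi] that of the scale
    divided by [n^2]. Then [n^2 tau] tends to [T / psi], and [T > 0] makes the root [pk]
    positive. *)
Lemma moderate_case (al psi : R) : 0 <= al -> 0 < psi -> 0 < T ->
  n k * dl k @[k --> \oo] --> al -> M k / n k ^+ 2 @[k --> \oo] --> psi ->
  let th := T / psi in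
  let pk k := (Num.sqrt (al ^+ 2 + 4 * Qc (f k) * th) - al) / 2 in
  limit_claim t nk f j (fun k => M k *: vvec (f k)) (fun k => phi (pk k) (pk k + al) 1 ^- 2).
Proof.
move=> al0 psi0 T0 ndl Mpsi th pk.
have lb0 := lbound_gt0 a0; have Qm0 := Qmin_gt0 a0 b0.
have Cb0 := CbK_ge0 d a0 c_gt0.
have th0 : 0 < th by rewrite divr_gt0.
have n_gt0 : \forall k \near \oo, 0 < n k.
  by near=> k; apply: lt_le_trans ltr01 _; near: k; exact: near_n_ge.
have M0 : \forall k \near \oo, 0 < M k.
  near=> k; have nn : 0 < n k by near: k.
  have : 0 < M k / n k ^+ 2 by near: k; exact: (seq_gt Mpsi).
  by rewrite pmulr_lgt0// invr_gt0 exprn_gt0.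
have psiV := seq_cvgV Mpsi (lt0r_neq0 psi0).
have MV : (M k)^-1 @[k --> \oo] --> (0 : R).
  have h := seq_cvgM psiV (seq_cvgM n_inv_null n_inv_null); rewrite !mulr0 in h.
  apply: seq_near_eq h; near=> k; have nn : 0 < n k by near: k.
  have MM : 0 < M k by near: k.
  by field; rewrite !gt_eqF.
have n2t : n k ^+ 2 * tau k @[k --> \oo] --> th.
  have h := seq_cvgM (scaled_tau_cvg M0 MV) psiV; apply: seq_near_eq h.
  near=> k; have nn : 0 < n k by near: k.
  have MM : 0 < M k by near: k.
  by field; rewrite !gt_eqF.
have nt : n k * tau k @[k --> \oo] --> (0 : R).
  have h := seq_cvgM n2t n_inv_null; rewrite mulr0 in h; apply: seq_near_eq h.
  near=> k; have nn : 0 < n k by near: k.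
  by field; rewrite gt_eqF.
have t_0 := tau_null nt.
have Ke0 : 0 <= Kext a b by rewrite /Kext divr_ge0// ltW.
have endl : expR (n k * dl k) @[k --> \oo] --> expR al.
  exact: (continuous_cvg _ (@continuous_expR R al) ndl).
(* The Gronwall majorant with [y_ext] replaced by its bound; [n Y] stays bounded because [n dl] and
   [n^2 tau] converge. *)
pose Y k := expR (n k * dl k) * (Kext a b * dl k + (n k + 1) * tau k).
pose K := expR al * (Kext a b * al + th) + 1.
have K0 : 0 <= K by rewrite addr_ge0// mulr_ge0 ?expR_ge0// addr_ge0 ?(ltW th0)// mulr_ge0.
have nY : n k * Y k @[k --> \oo] --> expR al * (Kext a b * al + th).
  have h := seq_cvgM endl (seq_cvgD (seq_cvgD (seq_cvgZ ndl (Kext a b)) n2t) nt).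
  rewrite addr0 in h; apply: seq_near_eq h; near=> k; rewrite /Y; ring.
have Y0 : Y k @[k --> \oo] --> (0 : R).
  have h := seq_cvgM endl (seq_cvgD (seq_cvgD (seq_cvgZ dl_null (Kext a b)) nt) t_0).
  rewrite mulr0 !addr0 mulr0 in h; apply: seq_near_eq h; near=> k; rewrite /Y; ring.
have nYK : \forall k \near \oo, n k * Y k <= K by apply: (seq_le nY); rewrite ltrDl.
have SY : \forall k \near \oo, forall i, (i <= nk k)%N -> surv (f k) (s k) i <= Y k.
  near=> k => i ik.
  have N : nice a b c U (f k) by near: k; exact: near_nice.
  have NC : near_critical a b c U (f k) by near: k; exact: near_near_critical.
  have sC : inC (s k) by apply: s_of_inC => //; near: k.
  apply: le_trans (survival_le (nice_po N) (nice_pc N) (nice_P N) sC ik) _.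
  rewrite /Y ler_wpM2l ?expR_ge0// lerD2r; exact: near_yext NC.
have [e e0 He] := limit_law_approx K0 M0 SY Y0 nYK nt.
(* A sum of nonnegative terms, hence one number, independent of [k], above every parameter of the
   Riccati comparison. *)
pose B := 1 + CbK d a c + (Qmin a b)^-1 + th + K + al + CbK d a c * th.
have Qi0 : 0 < (Qmin a b)^-1 by rewrite invr_gt0.
have Cth : 0 <= CbK d a c * th by rewrite mulr_ge0// ltW.
have [B1 Bq QB thB [KB QmB]] := sum_bounds Cb0 (ltW Qi0) (ltW th0) K0 al0 Cth.
rewrite -/B in B1 Bq QB thB KB QmB.
pose Cyk := Cy d c lb ub U (gap a) K.
pose dL k := Knear d a b c U * (n k * dl k * dl k) + `|n k * dl k - al|.
pose E1 k := 2 * Cyk * (Y k * (Y k + n k * tau k)) + dL k * Y k + `|n k ^+ 2 * tau k - th| / n k + tau k.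
(* The Riccati comparison multiplies [E1] by [n]; distributed in this way, every term of [n E1] has
   a null factor beside convergent ones. *)
pose nE1 k := 2 * Cyk * (n k * Y k * (Y k + n k * tau k)) + dL k * (n k * Y k) + `|n k ^+ 2 * tau k - th| + n k * tau k.
pose E2 k := 2 * (dl k + Knear d a b c U * (dl k * dl k)).
have dL0 : dL k @[k --> \oo] --> (0 : R).
  have h := seq_cvgD (seq_cvgZ (seq_cvgM ndl dl_null) (Knear d a b c U)) (seq_dist ndl).
  by rewrite !mulr0 addr0 in h.
have nE10 : nE1 k @[k --> \oo] --> (0 : R).
  have h := seq_cvgD (seq_cvgD (seq_cvgD (seq_cvgZ (seq_cvgM nY (seq_cvgD Y0 nt)) (2 * Cyk))
    (seq_cvgM dL0 nY)) (seq_dist n2t)) nt.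
  by rewrite !addr0 !mulr0 mul0r !addr0 in h.
have dL1 : dl k + Knear d a b c U * (dl k * dl k) @[k --> \oo] --> (0 : R).
  have h := seq_cvgD dl_null (seq_cvgZ (seq_cvgM dl_null dl_null) (Knear d a b c U)).
  by rewrite !mulr0 addr0 in h.
apply: (@limit_claim_of_bound _ _ _ _ _ _ _ _
  (fun k => e k + (4 * B * nE1 k + 2 * B ^+ 2 * E2 k + 100 * B ^+ 9 * (n k)^-1))); last first.
  have h := seq_cvgD e0 (seq_cvgD (seq_cvgD (seq_cvgZ nE10 (4 * B))
    (seq_cvgZ (seq_cvgZ dL1 2) (2 * B ^+ 2))) (seq_cvgZ n_inv_null (100 * B ^+ 9))).
  by rewrite !mulr0 !addr0 in h.
near=> k.
have [X [LX hX]] : exists X, Lnj (f k) (s k) j (nk k) m @[m --> \oo] --> X /\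
   `|X - \prod_(0 <= i < nk k) (1 - 2 * Qc (f k) * (surv (f k) (s k) i - yext (f k) (vvec (f k))) /
       (rho (f k) - 2 * Qc (f k) * yext (f k) (vvec (f k))))| <= e k by near: k.
exists X; split => //.
have N : nice a b c U (f k) by near: k; exact: near_nice.
have NC : near_critical a b c U (f k) by near: k; exact: near_near_critical.
have sC : inC (s k) by apply: s_of_inC => //; near: k.
have nn : 0 < n k by near: k.
have SYk : forall i, (i <= nk k)%N -> surv (f k) (s k) i <= Y k by near: k.
have YB : n k * Y k <= K by near: k.
have Ylb : Y k / lb <= 1.
  by rewrite ler_pdivrMr// mul1r; near: k; exact: (seq_le Y0).
have QY : 8 * CbK d a c * Y k <= 1.
  by near: k; have h := seq_cvgZ Y0 (8 * CbK d a c); rewrite mulr0 in h; exact: (seq_le h).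
have dLh : dl k + Knear d a b c U * (dl k * dl k) <= 2^-1 by near: k; exact: (seq_le dL1).
have nB : 4 * B ^+ 3 <= n k by near: k; exact: near_n_ge.
have Qle : Qc (f k) <= CbK d a c by have := nice_Q_le a0 c_gt0 N.
have Qge := nice_Qmin N; have Q0 : 0 < Qc (f k) by exact: lt_le_trans Qge.
have po := nice_po N; have pc := nice_pc N; have P := nice_P N.
have nk0 : (0 < nk k)%N by rewrite -(ltr0n R).
have yl i := yext_le_survival po pc P sC i.
pose x i := surv (f k) (s k) i - yext (f k) (vvec (f k)).
pose L := rho (f k) - 2 * Qc (f k) * yext (f k) (vvec (f k)).
have ye0 : 0 <= yext (f k) (vvec (f k)) := yext_ge0 po P.
have xY i : (i <= nk k)%N -> 0 <= x i <= Y k.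
  by move=> ni; rewrite subr_ge0 yl/=; apply: le_trans (SYk i ni); rewrite gerBl.
have Y_0 : 0 <= Y k by have /andP[h1 h2] := xY 0%N (leq0n _); exact: le_trans h1 h2.
have rec := shifted_recursion po pc P lb0 (nice_v N) (nice_V N) (ltW c_gt0) (ubound_ge0 a0) sC U0
  (gap01 a0) K0 (nice_2 N) (nice_ctr1 N) nk0 SYk Ylb YB.
rewrite -(nice_Q N) in rec.
have rec2 := recursion_perturb al th nk0 xY rec.
have tau0 : 0 <= tau k := tau_ge0 P sC.
have nL := near_L NC; rewrite -/L -/(dl k) in nL.
have dlk0 : 0 <= dl k by exact: normr_ge0.
have LdL : `|n k * (L - 1) + al| <= dL k.
  have -> : n k * (L - 1) + al = n k * (L - (1 - dl k)) - (n k * dl k - al) by ring.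
  apply: le_trans (ler_normB _ _) _; rewrite lerD2r normrM (gtr0_norm nn).
  have -> : Knear d a b c U * (n k * dl k * dl k) = n k * (Knear d a b c U * dl k ^+ 2) by ring.
  by rewrite ler_wpM2l// ltW.
have rec3 : \sum_(0 <= i < nk k)
  `|x i.+1 - ((1 - al / (nk k)%:R) * x i - Qc (f k) * x i ^+ 2 + th / (nk k)%:R ^+ 2)| <= E1 k.
  apply: le_trans rec2 _; rewrite -/(n k) /E1 -[X in X <= _]addr0; apply: lerD => //.
  rewrite lerD2r; apply: lerD; last by rewrite ler_wpM2r.
  exact: lexx.
have x0E : x 0%N <= E1 k.
  apply: le_trans (_ : tau k <= _).
    by have h := survival_init po P sC; rewrite lerBlDr; exact: h.
  rewrite /E1 lerDr; apply: addr_ge0; last by rewrite divr_ge0// ltW.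
  apply: addr_ge0; last by rewrite mulr_ge0// (le_trans _ LdL).
  by apply: le_trans rec; apply: sumr_ge0 => i _; exact: normr_ge0.
have factor i : (i < nk k)%N -> 0 <= 1 - 2 * Qc (f k) * x i / L <= 1.
  move=> ni; have := @shifted_factor_bounds _ _ _ _ po pc _ _ _ P _ sC (nice_half N) _ _ SYk _ i (ltnW ni).
  rewrite -(nice_Q N); apply.
  by apply: le_trans QY; rewrite ler_wpM2r// ler_wpM2l.
have L1 : `|L - 1| <= dl k + Knear d a b c U * (dl k * dl k).
  have -> : L - 1 = L - (1 - dl k) - dl k by ring.
  apply: le_trans (ler_normB _ _) _; rewrite (ger0_norm dlk0) addrC lerD2l.
  by rewrite -expr2.
have hL : 2^-1 <= L by move: (le_trans L1 dLh); rewrite ler_norml => /andP[h1 h2]; lra.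
have LE : `|L^-1 - 1| <= E2 k.
  have L0 : 0 < L by lra.
  have -> : L^-1 - 1 = (1 - L) / L by field; rewrite gt_eqF.
  rewrite normrM distrC normfV (gtr0_norm L0) ler_pdivrMr//.
  have A0 : 0 <= dl k + Knear d a b c U * (dl k * dl k) := le_trans (normr_ge0 _) L1.
  apply: le_trans L1 _; rewrite /E2.
  have := ler_wpM2l A0 hL; lra.
have [p0 q_C pq] := riccati_roots al0 Q0 th0 Qle; rewrite -/(pk k) in p0 q_C pq.
have q_B := le_trans q_C Bq.
have p_B : pk k <= B by apply: le_trans q_B; rewrite lerDl.
have QB' := le_trans Qle QB.
have QVB : (Qc (f k))^-1 <= B by apply: le_trans QmB; rewrite lef_pV2 ?posrE.
have YB' := le_trans YB KB.
have fin := riccati_product B1 p0 p_B erefl q_B al0 Q0 QB' QVB (ltW th0) thB pq nB xY YB' x0E rec3 factor LE.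
rewrite -/(n k) in fin.
have nE : n k * E1 k = nE1 k by rewrite /E1 /nE1; field; rewrite gt_eqF.
rewrite nE in fin.
apply: le_trans (ler_distD (\prod_(0 <= i < nk k) (1 - 2 * Qc (f k) * x i / L)) _ _) _.
exact: lerD hX fin.
Unshelve. all: by end_near. Qed.

(** If [T = 0] then every [t_i] is [0] and [s = 1], so numerator and denominator of the limit law
    coincide. *)
Lemma trivial_case mvec Psi : T = 0 -> (forall k, Psi k = 1) -> limit_claim t nk f j mvec Psi.
Proof.
move=> T0 Psi1.
have ti i : t i 0 = 0.
  by apply/eqP; move/eqP: T0; rewrite /T psumr_eq0// => /allP/(_ i (mem_index_enum _)).
apply: (@limit_claim_of_bound _ _ _ _ _ _ _ _ (fun=> 0)); last exact: cvg_cst.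
near=> k; exists 1.
have N : nice a b c U (f k) by near: k; exact: near_nice.
have NC : near_critical a b c U (f k) by near: k; exact: near_near_critical.
have s1 : s_of t (mvec k) = one_v R d.
  by apply/matrixP => i i0; rewrite ord1 [LHS]mxE coord1 ti mul0r oppr0 expR0.
have [u' [v' P']] := near_perron NC.
have po := nice_po N; have pc := nice_pc N.
have MU := Mat_mu_primitive po pc (near_mu NC) (nice_prim N).
have cv := @Lnj_cvg _ _ _ _ po pc (near_mu NC) _ _ _ _ U0 P' MU (one_v R d) j (nk k) (@inC_one R d).
split; last by rewrite Psi1 subrr normr0.
have nz : rho_mu (f k) ^+ nk k * u' j 0 != 0.
  apply: mulf_neq0; last by apply: lt0r_neq0; exact: perron_u_gt0 P' j.
  by apply: expf_neq0; apply: lt0r_neq0; exact: perron_lam_gt0 P'.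
by rewrite s1; move: cv; rewrite (Jit_one_mu po pc P') coordZ (divff nz).
Unshelve. all: by end_near. Qed.

(** With [Y = tau / (1 - rho)] one has [n Y -> T], while the quadratic contribution
    [n Y^2 / (1 - rho)] equals [(n Y)^2 / (n (1 - rho))] and vanishes in the limit. *)
Lemma strong_case : (forall k, rho (f k) < 1) -> n k * (1 - rho (f k)) @[k --> \oo] --> +oo ->
  (forall k, M k = n k / (1 - rho (f k))) ->
  limit_claim t nk f j (fun k => M k *: vvec (f k)) (fun k => expR (- (2 * Qc (f k) * T))).
Proof.
move=> lt1 noo ME.
have lb0 := lbound_gt0 a0; have Cb0 := CbK_ge0 d a0 c_gt0.
have T0 : 0 <= T by apply: sumr_ge0 => i _; exact: t0.
pose de k := 1 - rho (f k).
have de_gt0 k : 0 < de k by rewrite subr_gt0; exact: lt1.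
have dlE k : dl k = de k := gtr0_norm (de_gt0 k).
have de0 : de k @[k --> \oo] --> (0 : R).
  by have := dl_null; under eq_fun do rewrite dlE.
have n_gt0 : \forall k \near \oo, 0 < n k.
  by near=> k; apply: lt_le_trans ltr01 _; near: k; exact: near_n_ge.
have v0 : (n k * de k)^-1 @[k --> \oo] --> (0 : R).
  apply/cvgr0Pnorm_le => e e0.
  have /cvgryPge/(_ e^-1) H := noo.
  near=> k; have h : e^-1 <= n k * de k by near: k.
  have p0 : 0 < n k * de k by apply: lt_le_trans h; rewrite invr_gt0.
  by rewrite normfV gtr0_norm// -[leRHS]invrK lef_pV2 ?posrE ?invr_gt0.
have M0 : \forall k \near \oo, 0 < M k.
  near=> k; rewrite ME divr_gt0//; first by near: k.
  exact: de_gt0.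
have MV : (M k)^-1 @[k --> \oo] --> (0 : R).
  have h := seq_cvgM de0 n_inv_null; rewrite mulr0 in h.
  by under eq_fun do rewrite ME invf_div.
have W : M k * tau k @[k --> \oo] --> T by exact: scaled_tau_cvg.
have nt : n k * tau k @[k --> \oo] --> (0 : R).
  have h := seq_cvgM W de0; rewrite mulr0 in h; apply: seq_near_eq h.
  near=> k; rewrite ME /de; have := de_gt0 k; rewrite /de => dk.
  by field; rewrite gt_eqF.
pose Y k := tau k / de k.
have nYE k : n k * Y k = M k * tau k by rewrite ME /Y /de; ring.
have nY : n k * Y k @[k --> \oo] --> T by under eq_fun do rewrite nYE.
have Y0 : Y k @[k --> \oo] --> (0 : R).
  have h := seq_cvgM nY n_inv_null; rewrite mulr0 in h; apply: seq_near_eq h.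
  near=> k; have nn : 0 < n k by near: k.
  by rewrite mulrAC mulfV ?mul1r// gt_eqF.
pose K := T + 1.
have K0 : 0 <= K by rewrite addr_ge0.
have nYK : \forall k \near \oo, n k * Y k <= K by apply: (seq_le nY); rewrite ltrDl.
have SY : \forall k \near \oo, forall i, (i <= nk k)%N -> surv (f k) (s k) i <= Y k.
  near=> k => i ik.
  have N : nice a b c U (f k) by near: k; exact: near_nice.
  have sC : inC (s k) by apply: s_of_inC => //; near: k.
  by have h := survival_le_subcritical (nice_po N) (nice_pc N) (nice_P N) sC i (lt1 k).
have [e e0 He] := limit_law_approx K0 M0 SY Y0 nYK nt.
pose Cyk := Cy d c lb ub U (gap a) K.
pose Q k := Qc (f k).
have QB : \forall k \near \oo, `|Q k| <= CbK d a c.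
  near=> k; have N : nice a b c U (f k) by near: k; exact: near_nice.
  have Qge := nice_Qmin N; have Q0 : 0 <= Q k by exact: le_trans (ltW (Qmin_gt0 a0 b0)) Qge.
  by rewrite ger0_norm//; have := nice_Q_le a0 c_gt0 N.
(* The final error, rewritten so that each term is a bounded power of [Q] times a product containing
   one of the null factors [Y], [de], [(n de)^-1] or [|n Y - T|]. *)
pose g k := Q k * (Q k * (16 * (n k * Y k * Y k) + 2 * (n k * Y k * (n k * Y k) * (n k * de k)^-1))) +
  Q k * (4 * (de k * (n k * Y k)) + 4 * (n k * Y k * (n k * de k)^-1) +
    4 * Cyk * (n k * Y k * (n k * de k)^-1 * Y k + Y k * (n k * Y k)) + 2 * `|n k * Y k - T|).
have g0 : g k @[k --> \oo] --> (0 : R).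
  have WY := seq_cvgM nY Y0; have Wv := seq_cvgM nY v0.
  have h1 := seq_cvgD (seq_cvgZ WY 16) (seq_cvgZ (seq_cvgM (seq_cvgM nY nY) v0) 2).
  rewrite !mulr0 addr0 in h1.
  have h2 := seq_cvgD (seq_cvgD (seq_cvgD (seq_cvgZ (seq_cvgM de0 nY) 4) (seq_cvgZ Wv 4))
    (seq_cvgZ (seq_cvgD (seq_cvgM Wv Y0) (seq_cvgM Y0 nY)) (4 * Cyk))) (seq_cvgZ (seq_dist nY) 2).
  rewrite !mulr0 !mul0r !addr0 !mulr0 !addr0 in h2.
  have h := seq_cvgD (null_bounded_mul QB (null_bounded_mul QB h1)) (null_bounded_mul QB h2).
  by rewrite addr0 in h.
apply: (@limit_claim_of_bound _ _ _ _ _ _ _ _ (fun k => e k + g k)); last first.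
  by have h := seq_cvgD e0 g0; rewrite addr0 in h.
near=> k.
have [X [LX hX]] : exists X, Lnj (f k) (s k) j (nk k) m @[m --> \oo] --> X /\
   `|X - \prod_(0 <= i < nk k) (1 - 2 * Qc (f k) * (surv (f k) (s k) i - yext (f k) (vvec (f k))) /
       (rho (f k) - 2 * Qc (f k) * yext (f k) (vvec (f k))))| <= e k by near: k.
exists X; split => //.
have N : nice a b c U (f k) by near: k; exact: near_nice.
have sC : inC (s k) by apply: s_of_inC => //; near: k.
have nn : 0 < n k by near: k.
have SYk : forall i, (i <= nk k)%N -> surv (f k) (s k) i <= Y k by near: k.
have YB : n k * Y k <= K by near: k.
have Ylb : Y k / lb <= 1.
  by rewrite ler_pdivrMr// mul1r; near: k; exact: (seq_le Y0).
have QY : 8 * CbK d a c * Y k <= 1.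
  by near: k; have h := seq_cvgZ Y0 (8 * CbK d a c); rewrite mulr0 in h; exact: (seq_le h).
have Qle : Qc (f k) <= CbK d a c by have := nice_Q_le a0 c_gt0 N.
have Qge := nice_Qmin N; have Q0 : 0 < Qc (f k) by exact: lt_le_trans (Qmin_gt0 a0 b0) Qge.
have po := nice_po N; have pc := nice_pc N; have P := nice_P N.
have nk0 : (0 < nk k)%N by rewrite -(ltr0n R).
have ye0 : yext (f k) (vvec (f k)) = 0.
  rewrite /yext /dotp big1// => i _.
  by rewrite qextE (subcritical_mu po pc P (lt1 k)) coord1 subrr mulr0.
have yl i := yext_le_survival po pc P sC i.
have rec := shifted_recursion po pc P lb0 (nice_v N) (nice_V N) (ltW c_gt0) (ubound_ge0 a0) sC U0
  (gap01 a0) K0 (nice_2 N) (nice_ctr1 N) nk0 SYk Ylb YB.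
have QY8 : 8 * Qv (f k) (uvec (f k)) (vvec (f k)) * Y k <= 1.
  rewrite -(nice_Q N); apply: le_trans QY; rewrite ler_wpM2r ?ler_wpM2l//.
  by apply: le_trans (SYk 0%N (leq0n _)); rewrite -ye0; exact: yl.
have factor := @shifted_factor_bounds _ _ _ _ po pc _ _ _ P _ sC (nice_half N) _ _ SYk QY8.
rewrite -(nice_Q N) ye0 mulr0 subr0 in rec factor hX *.
have tau0 : 0 <= tau k := tau_ge0 P sC.
pose x i := surv (f k) (s k) i - 0.
have xY i : (i <= nk k)%N -> 0 <= x i <= Y k.
  by move=> ni; rewrite /x subr0 SYk// andbT -ye0; exact: yl.
have rec2 : \sum_(0 <= i < nk k) `|x i.+1 - (tau k + rho (f k) * x i - Qc (f k) * x i ^+ 2)| <=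
   2 * Cyk * (Y k * (Y k + n k * tau k)).
  apply: le_trans rec; apply: ler_sum => i _.
  rewrite [X in `|X| <= _](_ : _ = x i.+1 - (rho (f k) * x i - Qc (f k) * x i ^+ 2 + tau k))//; ring.
have fin := strongly_subcritical_product (nice_half N) (lt1 k) (ltW Q0) xY rec2
  (fun i ni => factor i (ltnW ni)) tau0.
have dk := de_gt0 k.
have nYd : n k * tau k / (1 - rho (f k)) = n k * Y k by rewrite /Y /de mulrA.
have Y_0 : 0 <= Y k by rewrite divr_ge0// ltW.
have lip : `|expR (- (2 * Qc (f k) * (n k * Y k))) - expR (- (2 * Qc (f k) * T))| <=
    Q k * (2 * `|n k * Y k - T|).
  have Q2 : 0 <= 2 * Qc (f k) by rewrite mulr_ge0// ltW.
  apply: le_trans (expRN_lipschitz _ _) _.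
  - by apply: mulr_ge0 => //; apply: mulr_ge0 => //; exact: ltW.
  - exact: mulr_ge0.
  - rewrite -mulrBr normrM (ger0_norm Q2) /Q.
    by rewrite [leRHS](_ : _ = 2 * Qc (f k) * `|n k * Y k - T|)//; ring.
rewrite -/(n k) nYd -/(de k) in fin.
apply: le_trans (ler_distD (\prod_(0 <= i < nk k) (1 - 2 * Qc (f k) * x i / rho (f k))) _ _) _.
apply: lerD; first exact: hX.
apply: le_trans (ler_distD (expR (- (2 * Qc (f k) * (n k * Y k)))) _ _) _.
apply: le_trans (lerD fin lip) _.
rewrite [leLHS](_ : _ = g k)//.
have tE : tau k = Y k * de k by rewrite /Y divfK// gt_eqF.
have key (n1 d1 Y1 Q1 C1 A1 : R) : 0 < n1 -> 0 < d1 ->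
  n1 * (4 * Q1 * Y1) ^+ 2 + 4 * Q1 * d1 * (n1 * Y1) +
    2 * Q1 * ((2 * Y1 + Q1 * (n1 * Y1 ^+ 2) + 2 * C1 * (Y1 * (Y1 + n1 * (Y1 * d1)))) / d1) +
    Q1 * (2 * A1) =
  Q1 * (Q1 * (16 * (n1 * Y1 * Y1) + 2 * (n1 * Y1 * (n1 * Y1) * (n1 * d1)^-1))) +
    Q1 * (4 * (d1 * (n1 * Y1)) + 4 * (n1 * Y1 * (n1 * d1)^-1) +
      4 * C1 * (n1 * Y1 * (n1 * d1)^-1 * Y1 + Y1 * (n1 * Y1)) + 2 * A1).
  by move=> n10 d10; field; rewrite !gt_eqF.
by rewrite /g /Q tE; exact: key.
Unshelve. all: by end_near. Qed.
End Sequences.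

(** * Matching with the limiting expressions of the theorem *)

Lemma limit_claim_near_eq (R : realType) (d : nat) (t : 'cV[R]_d) nk f j mvec Psi Psi' :
  (\forall k \near \oo, Psi k = Psi' k) ->
  limit_claim t nk f j mvec Psi -> limit_claim t nk f j mvec Psi'.
Proof.
move=> PP [ell [cv e0]]; exists ell; split => //.
apply: seq_near_eq e0; near=> k.
by have -> : Psi k = Psi' k by near: k.
Unshelve. all: by end_near. Qed.

Lemma pow_expR_dist (R : realType) (be : R) n : (0 < n)%N -> 0 <= be <= n%:R ->
  `|(1 - be / n%:R) ^+ n - expR (- be)| <= be * be / n%:R.
Proof.
move=> n0 /andP[be0 bn]; have nn : 0 < n%:R :> R by rewrite ltr0n.
set x := be / n%:R.
have x0 : 0 <= x by rewrite divr_ge0// ltW.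
have x1 : x <= 1 by rewrite ler_pdivrMr// mul1r.
have bE : - be = n%:R * (- x) by rewrite /x; field; rewrite gt_eqF.
have E (z : R) : z ^+ n = \prod_(0 <= i < n) z by rewrite prodr_const_nat subn0.
rewrite bE expRM_natl !E.
apply: le_trans (prod_diff _ _) _.
- by move=> i _; apply/andP; split; lra.
- by move=> i _; rewrite expR_ge0 -[leRHS](expR0 R) ler_expR oppr_le0.
rewrite sumr_const_nat subn0 -[leLHS]mulr_natl.
have /andP[e1 e2] := expR_remainder x0.
have h : `|1 - x - expR (- x)| <= x ^+ 2.
  by rewrite ler_norml; apply/andP; split; lra.
apply: le_trans (ler_wpM2l (ltW nn) h) _.
by rewrite [leLHS](_ : _ = be * be / n%:R)// /x; field; rewrite gt_eqF.
Qed.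

(** In terms of [z] the roots are [p = al (z - 1) / 2] and [q = al (z + 1) / 2]. Hence [w = q / p],
    and [r^(1/2)] combines with the two powers of [r] into [exp (-q)] and [exp p]. *)
Lemma phi_power_form (R : realType) (r Q T : R) : 0 < r < 1 -> 0 < Q -> 0 < T ->
  let al := - ln r in
  let th := T / ((r - 1 + al) / al ^+ 2) in
  let p := (Num.sqrt (al ^+ 2 + 4 * Q * th) - al) / 2 in
  let z := Num.sqrt (1 + 4 * Q * T / (r - 1 - ln r)) in
  let w := (z + 1) / (z - 1) in
  z != 1 /\ r `^ 2^-1 * ((r `^ (z / 2) + w * r `^ (- (z / 2))) / (1 + w)) = phi p (p + al) 1.
Proof.
move=> /andP[r0 r1] Q0 T0 al th p z w.
have al0 : 0 < al by rewrite oppr_gt0 ln_lt0// r0 r1.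
have den : 0 < r - 1 + al.
  have := @expR_gt1Dx R (ln r); rewrite lnK ?posrE// => /(_ _) h.
  have : 1 + ln r < r by apply: h; rewrite lt_eqF// -oppr_gt0.
  by rewrite /al; lra.
pose D := 4 * Q * T / (r - 1 - ln r).
have D0 : 0 < D by rewrite divr_gt0// !mulr_gt0.
have z1 : 1 < z.
  by rewrite /z -/D -[ltLHS](sqrtr1 R) ltr_sqrt; lra.
have sE : Num.sqrt (al ^+ 2 + 4 * Q * th) = al * z.
  have -> : al ^+ 2 + 4 * Q * th = al ^+ 2 * (1 + D).
    by rewrite /th /D -/al; field; rewrite !gt_eqF.
  by rewrite sqrtrM ?sqr_ge0// sqrtr_sqr gtr0_norm.
have pE : p = al * (z - 1) / 2 by rewrite /p sE; field.
have qE : p + al = al * (z + 1) / 2 by rewrite pE; field.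
split; first by rewrite gt_eqF.
rewrite /powR (gt_eqF r0) mulrA mulrDr.
have -> : expR (2^-1 * ln r) * expR (z / 2 * ln r) = expR (- (p + al)).
  by rewrite -expRD qE /al; congr expR; field.
have -> : expR (2^-1 * ln r) * (w * expR (- (z / 2) * ln r)) = w * expR p.
  by rewrite mulrCA -expRD pE /al; congr (_ * expR _); field.
have key (y be e1 e2 : R) : 1 < y -> 0 < be ->
    (e1 + (y + 1) / (y - 1) * e2) / (1 + (y + 1) / (y - 1)) =
    (be * (y + 1) / 2 * e2 + be * (y - 1) / 2 * e1) / (be * (y - 1) / 2 + be * (y + 1) / 2).
  move=> y1 be0; have y0 : y != 0 by rewrite gt_eqF//; lra.
  have y10 : y - 1 != 0 by rewrite gt_eqF//; lra.
  have be00 : be != 0 by rewrite gt_eqF.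
  have s1 : 1 + (y + 1) / (y - 1) = 2 * y / (y - 1) by field.
  have s2 : be * (y - 1) / 2 + be * (y + 1) / 2 = be * y by field.
  by rewrite s1 s2; field; rewrite y0 y10 be00.
rewrite /phi !mulr1 qE pE /w; exact: key.
Qed.

(** For [al = 0] the roots are opposite, with [p = q = sqrt (2 Q T)]. *)
Lemma phi_cosh (R : realType) (Q T : R) : 0 < Q -> 0 < T ->
  let p := (Num.sqrt (0 ^+ 2 + 4 * Q * (T / 2^-1)) - 0) / 2 in
  phi p (p + 0) 1 = cosh_ (Num.sqrt (2 * Q * T)).
Proof.
move=> Q0 T0 p; set z := Num.sqrt (2 * Q * T).
have z0 : 0 < z by rewrite sqrtr_gt0 !mulr_gt0.
have pE : p = z.
  rewrite /p subr0 expr0n /= add0r invrK.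
  have -> : 4 * Q * (T * 2) = 2 ^+ 2 * (2 * Q * T) by ring.
  by rewrite sqrtrM// sqrtr_sqr ger0_norm// /z; field.
rewrite /phi pE addr0 !mulr1 /cosh_.
have zz : z + z = z * 2 by ring.
have zn : z != 0 by rewrite gt_eqF.
by rewrite zz -mulrDr -mulf_div divff// mul1r.
Qed.

Section ExpansionOfScale.
Variables (R : realType) (d : nat) (a b c : R) (U : nat).
Hypothesis d0 : (0 < d)%N.
Hypothesis a0 : 0 < a.
Hypothesis b0 : 0 < b.
Hypothesis c_gt0 : 0 < c.
Hypothesis U0 : (0 < U)%N.
Variables (f : nat -> offspring R d) (nk : nat -> nat).
Hypothesis fK : forall k, inK a b c U (f k).
Hypothesis nk_oo : forall N, \forall k \near \oo, (N <= nk k)%N.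
Hypothesis rho1 : rho (f k) @[k --> \oo] --> (1 : R).
Hypothesis rho_neq1 : forall k, rho (f k) != 1.

(** By [near_rho_mu], [n (1 - rho_mu)] has the same limit as [n |1 - rho|], and [rho_mu^n] differs
    from [exp (- n (1 - rho_mu))] by order [1/n]. *)
Lemma scale_cvg (r : R) : 0 < r < 1 ->
  (nk k)%:R * `|1 - rho (f k)| @[k --> \oo] --> - ln r ->
  (let rm := rho_mu (f k) in
   (rm ^+ nk k - 1 + (nk k)%:R * (1 - rm)) / (1 - rm) ^+ 2) / (nk k)%:R ^+ 2 @[k --> \oo] -->
  (r - 1 + - ln r) / (- ln r) ^+ 2.
Proof.
move=> /andP[r0 r1] ndl; set al := - ln r in ndl *.
have al0 : 0 < al by rewrite oppr_gt0 ln_lt0// r0 r1.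
pose be k := (nk k)%:R * (1 - rho_mu (f k)).
have NC := near_near_critical d0 a0 b0 c_gt0 U0 fK rho1 rho_neq1.
have dl0 := @dl_null _ _ _ rho1.
have n_gt0 : \forall k \near \oo, 0 < (nk k)%:R :> R.
  by near=> k; apply: lt_le_trans ltr01 _; near: k; exact: near_n_ge.
have be_al : be k @[k --> \oo] --> al.
  have h1 : be k - (nk k)%:R * `|1 - rho (f k)| @[k --> \oo] --> (0 : R).
    apply: (@null_le _ _ (fun k => Knear d a b c U * ((nk k)%:R * `|1 - rho (f k)| * `|1 - rho (f k)|))); last first.
      by have h := seq_cvgZ (seq_cvgM ndl dl0) (Knear d a b c U); rewrite !mulr0 in h.
    near=> k; have N : near_critical a b c U (f k) by near: k.
    have h := near_rho_mu N; have nn : 0 < (nk k)%:R :> R by near: k.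
    have -> : be k - (nk k)%:R * `|1 - rho (f k)| =
      - ((nk k)%:R * (rho_mu (f k) - (1 - `|1 - rho (f k)|))) by rewrite /be; ring.
    rewrite normrN normrM (gtr0_norm nn).
    apply: le_trans (ler_wpM2l (ltW nn) h) _.
    by rewrite [leLHS](_ : _ = Knear d a b c U * ((nk k)%:R * `|1 - rho (f k)| * `|1 - rho (f k)|))//; ring.
  have h := seq_cvgD h1 ndl; rewrite add0r in h.
  by move: h; under eq_fun do rewrite subrK.
have eb : expR (- be k) @[k --> \oo] --> r.
  have hN : - be k @[k --> \oo] --> - al by exact: cvgN.
  have h : expR (- be k) @[k --> \oo] --> expR (- al).
    exact: (continuous_cvg _ (@continuous_expR R (- al)) hN).
  by rewrite opprK lnK ?posrE// in h.
have pw : rho_mu (f k) ^+ nk k - expR (- be k) @[k --> \oo] --> (0 : R).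
  apply: (@null_le _ _ (fun k => be k * be k * (nk k)%:R^-1)); last first.
    by have h := seq_cvgM (seq_cvgM be_al be_al) (@n_inv_null R _ nk_oo); rewrite mulr0 in h.
  near=> k; have nn : 0 < (nk k)%:R :> R by near: k.
  have b_0 : 0 < be k by near: k; exact: (seq_gt be_al).
  have b_n : be k <= (nk k)%:R.
    apply: le_trans (_ : al + 1 <= _).
      by near: k; apply: (seq_le be_al); rewrite ltrDl.
    by near: k; exact: near_n_ge.
  have rE : rho_mu (f k) = 1 - be k / (nk k)%:R by rewrite /be; field; rewrite gt_eqF.
  by rewrite rE; apply: pow_expR_dist; rewrite ?(ltW b_0)// -(ltr0n R).
have al2 : al * al != 0 by rewrite gt_eqF// mulr_gt0.
have h0 : 1 @[k --> \oo] --> (1 : R) by exact: cvg_cst.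
have h := seq_cvgM (seq_cvgD (seq_cvgB (seq_cvgD pw eb) h0) be_al) (seq_cvgV (seq_cvgM be_al be_al) al2).
rewrite add0r -expr2 in h; apply: seq_near_eq h.
near=> k; rewrite subrK /be /=.
have nn : 0 < (nk k)%:R :> R by near: k.
by rewrite -expr2 exprMn invfM mulrCA mulrC.
Unshelve. all: by end_near. Qed.
End ExpansionOfScale.

Theorem theorem6 (R : realType) (d : nat) (a b c : R) (U : nat)
    (t : 'cV[R]_d) (nk : nat -> nat) (f : nat -> offspring R d) :
  (0 < d)%N -> 0 < a -> 0 < b -> 0 < c -> (0 < U)%N ->
  @HypH R d a b c U ->
  (forall i, 0 <= t i 0) ->
  (forall N, \forall k \near \oo, (N <= nk k)%N) ->
  (forall k, inK a b c U (f k)) ->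
  (rho (f k) @[k --> \oo] --> (1 : R)) ->
  let T := \sum_(i < d) t i 0 in
  forall j : 'I_d,
  [/\
   (* case (1) *)
   (forall r : R, 0 < r < 1 ->
     (forall k, rho (f k) != 1) ->
     ((nk k)%:R * `|1 - rho (f k)| @[k --> \oo] --> - ln r) ->
     limit_claim t nk f j
       (fun k => let n := nk k in let rm := rho_mu (f k) in
          ((rm ^+ n - 1 + n%:R * (1 - rm)) / (1 - rm) ^+ 2) *: vvec (f k))
       (fun k => let z := Num.sqrt (1 + 4 * Qc (f k) * T / (r - 1 - ln r)) in
          let w := (z + 1) / (z - 1) in
          if z == 1 then 1 (* degenerate case T = 0 (w = +oo): limit value *)
          else (r `^ 2^-1 * ((r `^ (z / 2) + w * r `^ (- (z / 2))) / (1 + w)))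
                 ^- 2)),
   (* case (2) *)
   ((forall k, rho (f k) != 1) ->
     ((nk k)%:R * `|1 - rho (f k)| @[k --> \oo] --> (0 : R)) ->
     limit_claim t nk f j
       (fun k => ((nk k)%:R ^+ 2 / 2) *: vvec (f k))
       (fun k => (cosh_ (Num.sqrt (2 * Qc (f k) * T))) ^- 2)) &
   (* case (3) *)
   ((forall k, rho (f k) < 1) ->
     ((nk k)%:R * (1 - rho (f k)) @[k --> \oo] --> +oo) ->
     limit_claim t nk f j
       (fun k => ((nk k)%:R / (1 - rho (f k))) *: vvec (f k))
       (fun k => expR (- (2 * Qc (f k) * T))))].
Proof.
move=> d0 a0 b0 c0 U0 _ t0 nk_oo fK rho1 T j.
have T0 : 0 <= T by apply: sumr_ge0 => i _; exact: t0.
have Qpos : \forall k \near \oo, 0 < Qc (f k).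
  near=> k; have N : nice a b c U (f k) by near: k; exact: near_nice.
  exact: lt_le_trans (Qmin_gt0 a0 b0) (nice_Qmin N).
(* At [T = 0] one has [z = 1], so [w] is degenerate and the comparison with [phi] loses its positive
   root; the law is then identically [1]. *)
have [TE|Tn] := eqVneq T 0.
  split.
  - move=> r r01 ne1 _; apply: (trivial_case d0 a0 b0 c0 U0 nk j t0 fK rho1 ne1 _ TE) => k.
    by rewrite /= TE mulr0 mul0r addr0 sqrtr1 eqxx.
  - move=> ne1 _; apply: (trivial_case d0 a0 b0 c0 U0 nk j t0 fK rho1 ne1 _ TE) => k.
    by rewrite TE mulr0 sqrtr0 /cosh_ oppr0 expR0 divff ?expr1n ?invr1// pnatr_eq0.
  - move=> lt1 noo; have ne1 k : rho (f k) != 1 by rewrite lt_eqF.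
    apply: (trivial_case d0 a0 b0 c0 U0 nk j t0 fK rho1 ne1 _ TE) => k.
    by rewrite TE mulr0 oppr0 expR0.
have Tp : 0 < T by rewrite lt_neqAle eq_sym Tn.
split.
- move=> r r01 ne1 ndl.
  have /andP[r0 r1] := r01.
  have al0 : 0 < - ln r by rewrite oppr_gt0 ln_lt0// r0 r1.
  have psi0 : 0 < (r - 1 + - ln r) / (- ln r) ^+ 2.
    rewrite divr_gt0 ?exprn_gt0//.
    have := @expR_gt1Dx R (ln r); rewrite lnK ?posrE// => h.
    have : 1 + ln r < r by apply: h; rewrite lt_eqF// -oppr_gt0.
    by rewrite -subr_gt0; congr (_ < _); ring.
  have Mpsi := scale_cvg d0 a0 b0 c0 U0 fK nk_oo rho1 ne1 r01 ndl.
  have H := moderate_case d0 a0 b0 c0 U0 j t0 fK nk_oo rho1 ne1 (ltW al0) psi0 Tp ndl Mpsi.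
  apply: limit_claim_near_eq H; near=> k.
  have Q0 : 0 < Qc (f k) by near: k.
  have [z1 zE] := phi_power_form r01 Q0 Tp.
  by rewrite /= (negbTE z1) zE.
- move=> ne1 ndl.
  have Mpsi : (nk k)%:R ^+ 2 / 2 / (nk k)%:R ^+ 2 @[k --> \oo] --> (2^-1 : R).
    have h : 2^-1 @[k --> \oo] --> (2^-1 : R) by exact: cvg_cst.
    apply: seq_near_eq h; near=> k.
    have nn : 1 <= (nk k)%:R :> R by near: k; exact: near_n_ge.
    by field; rewrite gt_eqF// (lt_le_trans ltr01).
  have psi0 : 0 < 2^-1 :> R by rewrite invr_gt0.
  have H := moderate_case d0 a0 b0 c0 U0 j t0 fK nk_oo rho1 ne1 (lexx 0) psi0 Tp ndl Mpsi.
  apply: limit_claim_near_eq H; near=> k.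
  have Q0 : 0 < Qc (f k) by near: k.
  by rewrite (phi_cosh Q0 Tp).
- move=> lt1 noo; have ne1 k : rho (f k) != 1 by rewrite lt_eqF.
  exact: (strong_case d0 a0 b0 c0 U0 j t0 fK nk_oo rho1 ne1 lt1 noo (fun=> erefl)).
Unshelve. all: by end_near. Qed.
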